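(* Let $P_{2k}$ be a real-valued polynomial in $z_1,\bar z_1$ such that for some integer $k>1$, $P_{2k}(rz)=r^{2k}P_{2k}(z)$ for all $r\in\mathbb R,z\in\mathbb C$, and $\frac{\partial^2P_{2k}}{\partial z_1\partial\bar z_1}(z_1)>0$ for all $z_1\neq0$. Let $\Omega=\{(z_1,z_2)\in\mathbb C^2:\mathrm{Re}\, z_2+P_{2k}(z_1)<0\}$. Then $\Omega$ equipped with its Carath\'eodory distance $\rho^C_\Omega$ is a complete metric space.
   Context: The Carath\'eodory pseudo-metric is $F^C_\Omega(p,v)=\sup\{|df_p(v)| : f:\Omega\to\Delta \text{ holomorphic}, f(p)=0\}$ ($\Delta$ the unit disc), and the Carath\'eodory distance is $\rho^C_\Omega(p,q)=\inf\int_0^1F^C_\Omega(\gamma(t),\gamma'(t))\,dt$, the infimum over piecewise $C^1$ curves $\gamma:[0,1]\to\Omega$ with $\gamma(0)=p,\gamma(1)=q$. *)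

(* Defs.v *)
From Stdlib Require Import Reals Lra.
From Coquelicot Require Import Coquelicot.
Open Scope R_scope.

Definition C2 := (C * C)%type.

Fixpoint Csum (f : nat -> C) (n : nat) : C :=
  match n with
  | O => f O
  | S m => Cplus (Csum f m) (f (S m))
  end.

Definition polyzzb (c : nat -> nat -> C) (N : nat) (z : C) : C :=
  Csum (fun j => Csum (fun l => Cmult (c j l) (Cmult (Cpow z j) (Cpow (Cconj z) l))) N) N.

Definition polyzzb_ddbar (c : nat -> nat -> C) (N : nat) (z : C) : C :=
  Csum (fun j => Csum (fun l =>
     Cmult (RtoC (INR j * INR l))
       (Cmult (c j l) (Cmult (Cpow z (j - 1)) (Cpow (Cconj z) (l - 1))))) N) N.

Definition Omega (P : C -> C) (p : C2) : Prop :=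
  Re (snd p) + Re (P (fst p)) < 0.

Definition cdiff_at (f : C2 -> C) (p : C2) (a : C2) : Prop :=
  forall eps : R, 0 < eps -> exists delta : R, 0 < delta /\
    forall h1 h2 : C, Cmod h1 < delta -> Cmod h2 < delta ->
      Cmod (Cminus (f (Cplus (fst p) h1, Cplus (snd p) h2))
                   (Cplus (f p) (Cplus (Cmult (fst a) h1) (Cmult (snd a) h2))))
        <= eps * (Cmod h1 + Cmod h2).

Definition holo_to_disc (U : C2 -> Prop) (f : C2 -> C) : Prop :=
  forall q, U q -> Cmod (f q) < 1 /\ exists a, cdiff_at f q a.

Definition caratheodory_metric (U : C2 -> Prop) (p v : C2) : Rbar :=
  Lub_Rbar (fun x => exists f a, holo_to_disc U f /\ f p = RtoC 0 /\
     cdiff_at f p a /\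
     x = Cmod (Cplus (Cmult (fst a) (fst v)) (Cmult (snd a) (snd v)))).

Definition vel (g : R -> C2) (s : R) : C2 :=
  ((Derive (fun u => fst (fst (g u))) s, Derive (fun u => snd (fst (g u))) s),
   (Derive (fun u => fst (snd (g u))) s, Derive (fun u => snd (snd (g u))) s)).

(* g is C^1 on [a,b] (realised as restriction of a function differentiable
   on R whose derivative is continuous on [a,b]) *)
Definition C1_on (g : R -> C2) (a b : R) : Prop :=
  forall comp : C2 -> R,
    (comp = (fun q => fst (fst q)) \/ comp = (fun q => snd (fst q)) \/
     comp = (fun q => fst (snd q)) \/ comp = (fun q => snd (snd q))) ->
    (forall s, ex_derive (fun u => comp (g u)) s) /\
    (forall s, a <= s <= b -> continuous (Derive (fun u => comp (g u))) s).

Definition carath_length (U : C2 -> Prop) (p q : C2) (L : R) : Prop :=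
  exists (gamma : R -> C2) (n : nat) (t : nat -> R) (g : nat -> R -> C2)
         (l : nat -> R),
    (0 < n)%nat /\ t O = 0 /\ t n = 1 /\
    (forall i, (i < n)%nat -> t i < t (S i)) /\
    gamma 0 = p /\ gamma 1 = q /\
    (forall s, 0 <= s <= 1 -> U (gamma s)) /\
    (forall i, (i < n)%nat ->
       C1_on (g i) (t i) (t (S i)) /\
       (forall s, t i <= s <= t (S i) -> g i s = gamma s) /\
       (forall s, t i <= s <= t (S i) ->
          is_finite (caratheodory_metric U (g i s) (vel (g i) s))) /\
       is_RInt (fun s => real (caratheodory_metric U (g i s) (vel (g i) s)))
               (t i) (t (S i)) (l i)) /\
    L = sum_f_R0 l (n - 1).

(* Caratheodory distance rho^C_U(p,q) = inf of lengths (+oo if none) *)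
Definition carath_dist (U : C2 -> Prop) (p q : C2) : Rbar :=
  Glb_Rbar (carath_length U p q).

Definition complete_metric_space (U : C2 -> Prop) (d : C2 -> C2 -> Rbar) : Prop :=
  (forall p q, U p -> U q -> is_finite (d p q)) /\
  (forall p q, U p -> U q -> (d p q = Finite 0 <-> p = q)) /\
  (forall p q, U p -> U q -> d p q = d q p) /\
  (forall p q r, U p -> U q -> U r -> real (d p r) <= real (d p q) + real (d q r)) /\
  (forall u : nat -> C2, (forall m, U (u m)) ->
     (forall eps, 0 < eps -> exists N, forall m k, (N <= m)%nat -> (N <= k)%nat ->
        real (d (u m) (u k)) < eps) ->
     exists x, U x /\
       forall eps, 0 < eps -> exists N, forall m, (N <= m)%nat -> real (d (u m) x) < eps).

(* Main.v *)
Require Import Defs.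
From Stdlib Require Import Reals Lra Psatz Classical IndefiniteDescription.
From Coquelicot Require Import Coquelicot.
Open Scope R_scope.

(* A holomorphic [f : Omega -> Delta] satisfies [|f p - f q| <= 4 rho (p, q)], so completeness only needs enough
   holomorphic functions. They have the form [exp (t z2) F (z1)] with [F] entire, and are bounded by [1] on [Omega]
   as soon as [|F| <= exp (t P)]. Lossless peak functions, i.e. [F] with [|F b| >= c exp (t P b)] at a prescribed [b]
   and [c] independent of [t] and [b], exist because [P] is strictly subharmonic away from the origin. To build
   one, cut off the exponential of the holomorphic part of the second-order expansion of [t P] at [b] and correct
   the result by solving a d-bar equation in the norm weighted by [exp (- t P)]; the solution operator is a
   Cauchy kernel twisted by the same expansions, and its error is summed by a Neumann series. Homogeneity of [P]
   reduces all [t] to a single large one, and a small bounded correction of [P] handles the degenerate point [0].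

   Comparing [|f|] at two [rho]-close points then shows that along a [rho]-Cauchy sequence [- Re z2 - P z1] stays
   bounded and bounded away from [0], that [z1] stays bounded (peak functions for [P - e |z1|^2k]), and that the
   sequence is Cauchy for the Euclidean distance. Its limit lies in [Omega], where [rho] is Euclidean-continuous. *)

(** The difficulty is uniformity in [t] and [b]. For [k > 1] the mixed derivative of [P] vanishes at
    [0], so no dilation makes [t P] uniformly strictly subharmonic. The correction
    [- eps / (1 + |y|^2)] repairs the origin, and what matters is that it is bounded: multiplied by
    one fixed [T] it changes the weight by a factor at most [exp (T eps)], and dilations carry this
    single [T] to every [t].

    Twisting bounds the Cauchy kernel by [exp (phi z - phi zeta - K |z - zeta|^2)] times its own
    modulus. The weight at [zeta] then cancels, so a plain weighted supremum norm suffices, and the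
    error of the solution operator is of order [1 / K]; zooming in makes [K] large. In polar
    coordinates the area element absorbs the singularity of the kernel, so only iterated Riemann
    integrals of bounded functions occur. The limit of the series is known to be continuous only;
    Goursat for small [zbar]-derivative and Morera make it holomorphic.

    [Omega] is invariant under imaginary translations of [z2], and no modulus of a peak function
    sees [Im z2]. It is recovered from [f exp (s z2)] for a whole interval of [s], which excludes
    the periods of the exponential. *)

(** * Moduli of complex numbers and the complex exponential *)

Definition cexp (z : C) : C := (exp (fst z) * cos (snd z), exp (fst z) * sin (snd z)).

Lemma C_ext (z w : C) : fst z = fst w -> snd z = snd w -> z = w.
Proof. destruct z, w; simpl; congruence. Qed.

Lemma Cmod_sqr (z : C) : Cmod z * Cmod z = fst z * fst z + snd z * snd z.
Proof.
  unfold Cmod. rewrite sqrt_sqrt; [ring|]. nra.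
Qed.

Lemma Cmod_le_sqr (z : C) (M : R) :
  0 <= M -> fst z * fst z + snd z * snd z <= M * M -> Cmod z <= M.
Proof.
  intros HM H. apply Rsqr_incr_0_var; [|exact HM]. unfold Rsqr. now rewrite Cmod_sqr.
Qed.

Lemma Cmod_le_abs (z : C) : Cmod z <= Rabs (fst z) + Rabs (snd z).
Proof.
  apply Cmod_le_sqr.
  - pose proof (Rabs_pos (fst z)); pose proof (Rabs_pos (snd z)); lra.
  - unfold Rabs; destruct (Rcase_abs (fst z)), (Rcase_abs (snd z)); nra.
Qed.

Lemma abs_fst_le (z : C) : Rabs (fst z) <= Cmod z.
Proof. pose proof (Cmod_sqr z). pose proof (Cmod_ge_0 z). apply Rabs_le. split; nra. Qed.

Lemma abs_snd_le (z : C) : Rabs (snd z) <= Cmod z.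
Proof. pose proof (Cmod_sqr z). pose proof (Cmod_ge_0 z). apply Rabs_le. split; nra. Qed.

Lemma Cmod_minus_sym (a b : C) : Cmod (Cminus a b) = Cmod (Cminus b a).
Proof. rewrite <- Cmod_opp. f_equal. ring. Qed.

Lemma Cmod_tri3 (a b c : C) :
  Cmod (Cminus a c) <= Cmod (Cminus a b) + Cmod (Cminus b c).
Proof.
  replace (Cminus a c) with (Cplus (Cminus a b) (Cminus b c)) by ring. apply Cmod_triangle.
Qed.

Lemma Cmod_sub_le (a b : C) : Cmod (Cminus a b) <= Cmod a + Cmod b.
Proof. unfold Cminus. rewrite <- (Cmod_opp b). apply Cmod_triangle. Qed.

Lemma Cmod_rev_tri (a b : C) : Cmod a - Cmod b <= Cmod (Cminus a b).
Proof.
  pose proof (Cmod_triangle (Cminus a b) b). replace (Cplus (Cminus a b) b) with a in H by ring. lra.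
Qed.

Lemma Cmod_RtoC (x : R) : Cmod (RtoC x) = Rabs x.
Proof. apply Cmod_R. Qed.

Lemma Cmod_conj (z : C) : Cmod (Cconj z) = Cmod z.
Proof. unfold Cmod, Cconj; simpl. f_equal. ring. Qed.

Lemma Cmod_Ci : Cmod Ci = 1.
Proof. unfold Cmod, Ci; simpl. replace (0 * (0 * 1) + 1 * (1 * 1)) with 1 by ring. apply sqrt_1. Qed.

Lemma fst_le_Cmod (z : C) : fst z <= Cmod z.
Proof. pose proof (abs_fst_le z). pose proof (Rle_abs (fst z)). lra. Qed.

Lemma cexp_plus (z w : C) : cexp (Cplus z w) = Cmult (cexp z) (cexp w).
Proof.
  unfold cexp. apply C_ext; simpl; rewrite exp_plus, ?cos_plus, ?sin_plus; ring.
Qed.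

Lemma cexp_0 : cexp (RtoC 0) = RtoC 1.
Proof. unfold cexp; apply C_ext; simpl; rewrite exp_0, ?cos_0, ?sin_0; ring. Qed.

Lemma Cmod_cexp (z : C) : Cmod (cexp z) = exp (fst z).
Proof.
  pose proof (exp_pos (fst z)). pose proof (sin2_cos2 (snd z)). unfold Rsqr in H0.
  pose proof (Cmod_sqr (cexp z)). pose proof (Cmod_ge_0 (cexp z)).
  unfold cexp in H1 at 3 4 5 6; simpl in H1.
  assert (Cmod (cexp z) * Cmod (cexp z) = exp (fst z) * exp (fst z)).
  { rewrite H1.
    replace (exp (fst z) * exp (fst z)) with (exp (fst z) * exp (fst z) * (sin (snd z) * sin (snd z) + cos (snd z) * cos (snd z))) by (rewrite H0; ring). ring. }
  nra.
Qed.

Lemma exp_rem (x : R) : Rabs x <= 1 -> Rabs (exp x - 1 - x) <= 6 * (x * x).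
Proof.
  intros H. apply Rabs_le_between in H.
  pose proof (exp_ineq1_le x). rewrite Rabs_pos_eq by lra.
  (* Up to [1/2] the inequality [exp x (1 - x) <= 1] gives [2 x^2]. Beyond it [exp x <= 3], and the
     value [3/2 = 6 / 4] at [x = 1/2] fixes the constant [6]. *)
  destruct (Rle_dec x (1/2)).
  - pose proof (exp_ineq1_le (- x)). pose proof (exp_pos x).
    assert (exp x * exp (- x) = 1) by (rewrite <- exp_plus, Rplus_opp_r; apply exp_0).
    assert (exp x * (1 - x) <= 1) by nra.
    nra.
  - pose proof exp_le_3.
    assert (exp x <= exp 1) by (destruct (Req_dec x 1); [subst; lra | left; apply exp_increasing; lra]).
    nra.
Qed.

Lemma cos_rem (y : R) : Rabs (cos y - 1) <= y * y / 2.
Proof.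
  replace y with (2 * (y / 2)) at 1 by field. rewrite cos_2a_sin.
  pose proof (Rabs_pos (sin (y/2))).
  assert (Rabs (sin (y/2)) <= Rabs (y/2)).
  { destruct (Rle_dec 0 (y/2)).
    - rewrite (Rabs_pos_eq (y/2)) by lra. destruct (Req_dec (y/2) 0) as [->|].
      + rewrite sin_0, Rabs_R0; lra.
      + assert (0 < y/2) by lra. pose proof (sin_lt_x _ H1).
        pose proof (sin_lt_x (y/2)). apply Rabs_le. split; [|lra].
        destruct (Rle_dec (y/2) 1).
        * assert (0 < sin (y/2)) by (apply sin_gt_0; [lra|pose proof PI2_1; unfold PI2 in *; lra]). lra.
        * pose proof (SIN_bound (y/2)). lra.
    - rewrite (Rabs_left (y/2)) by lra. rewrite <- (Rabs_Ropp (sin _)), <- sin_neg.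
      assert (0 < - (y/2)) by lra. pose proof (sin_lt_x _ H0). apply Rabs_le. split; [|lra].
      destruct (Rle_dec (-(y/2)) 1).
      + assert (0 < sin (-(y/2))) by (apply sin_gt_0; [lra|pose proof PI2_1; unfold PI2 in *; lra]). lra.
      + pose proof (SIN_bound (-(y/2))). lra. }
  replace (1 - 2 * sin (y/2) * sin (y/2) - 1) with (- (2 * (sin (y/2) * sin (y/2)))) by ring.
  rewrite Rabs_Ropp, !Rabs_mult, (Rabs_pos_eq 2) by lra.
  assert (Rabs (y/2) * Rabs (y/2) = y * y / 4).
  { rewrite <- Rabs_mult, Rabs_pos_eq; [field|nra]. }
  nra.
Qed.

Lemma sin_rem (y : R) : Rabs (sin y - y) <= Rabs y * (y * y).
Proof.
  assert (forall y, 0 <= y -> Rabs (sin y - y) <= y * (y * y)) as H.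
  { clear y. intros y Hy. destruct (Req_dec y 0) as [->|Hn].
    { rewrite sin_0. replace (0 - 0) with 0 by ring. rewrite Rabs_R0. lra. }
    destruct (MVT_gen (fun y => sin y - y) 0 y (fun y => cos y - 1)) as (c & Hc & E).
    - intros. apply (is_derive_minus sin (fun y => y) x (cos x) 1); [apply is_derive_Reals, derivable_pt_lim_sin|apply (is_derive_id x)].
    - intros. apply derivable_continuous_pt. apply derivable_pt_minus; [apply derivable_pt_sin|apply derivable_pt_id].
    - rewrite Rmin_left, Rmax_right in Hc by lra. rewrite sin_0 in E.
      replace (sin y - y) with ((cos c - 1) * y) by lra.
      rewrite Rabs_mult, (Rabs_pos_eq y) by lra. pose proof (cos_rem c).
      pose proof (Rabs_pos (cos c - 1)). assert (c * c <= y * y) by nra. nra. }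
  destruct (Rle_dec 0 y).
  - rewrite (Rabs_pos_eq y) by lra. auto.
  - rewrite (Rabs_left y) by lra. rewrite <- Rabs_Ropp.
    replace (- (sin y - y)) with (sin (-y) - - y) by (rewrite sin_neg; ring).
    replace (y*y) with (-y * -y) by ring. apply H. lra.
Qed.

Lemma cexp_rem (w : C) : Cmod w <= 1 ->
  Cmod (Cminus (cexp w) (Cplus (RtoC 1) w)) <= 20 * (Cmod w * Cmod w).
Proof.
  intros H. pose proof (abs_fst_le w). pose proof (abs_snd_le w). rewrite Cmod_sqr.
  destruct w as [x y]; simpl in *.
  assert (Rabs x <= 1) by lra. assert (Hy: Rabs y <= 1) by lra.
  eapply Rle_trans; [apply Cmod_le_abs|]. simpl.
  pose proof (exp_rem x H2). pose proof (cos_rem y). pose proof (sin_rem y).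
  apply Rabs_le_between in H3, H4. apply Rabs_le_between in H2.
  assert (exp x <= 3). { apply Rle_trans with (exp 1); [|apply exp_le_3].
     destruct (Req_dec x 1); [subst; lra | left; apply exp_increasing; lra]. }
  pose proof (exp_pos x).
  assert (Rabs y * (y * y) <= y * y) by (pose proof (Rabs_pos y); nra).
  assert (HS := Rle_trans _ _ _ H5 H8). apply Rabs_le_between in HS.
  apply Rabs_le_between in Hy.
  assert (Rabs (exp x * cos y + - (1 + x)) <= 6*(x*x) + 3 * (y*y)).
  { replace (exp x * cos y + - (1 + x)) with (exp x * (cos y - 1) + (exp x - 1 - x)) by ring.
    apply Rabs_le. split; nra. }
  assert (Rabs (exp x * sin y + - (0 + y)) <= 7*(x*x) + 10 * (y*y)).
  { replace (exp x * sin y + - (0 + y)) with (exp x * (sin y - y) + (exp x - 1 - x) * y + x * y) by ring.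
    set (s := sin y - y) in *. set (u := exp x - 1 - x) in *.
    assert (Rabs (exp x * s) <= 3 * (y * y)) by (apply Rabs_le; split; nra).
    assert (Rabs (u * y) <= 6 * (x * x)).
    { rewrite Rabs_mult. apply Rle_trans with (6 * (x*x) * 1); [|lra].
      apply Rmult_le_compat; try apply Rabs_pos; apply Rabs_le; lra. }
    apply Rabs_le_between in H10, H11. apply Rabs_le. split; nra. }
  nra.
Qed.

(** * Complex-valued integrals of a real variable *)

(** An epsilon-delta form rather than a filter, because continuity will mostly come from explicit
    Lipschitz bounds through [ccont_lip]. *)
Definition ccont (f : R -> C) (t : R) : Prop :=
  forall eps, 0 < eps -> exists d, 0 < d /\ forall s, Rabs (s - t) < d -> Cmod (Cminus (f s) (f t)) < eps.

Definition CInt (f : R -> C) (a b : R) : C :=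
  (RInt (fun t => fst (f t)) a b, RInt (fun t => snd (f t)) a b).

Definition exCInt (f : R -> C) (a b : R) : Prop :=
  ex_RInt (fun t => fst (f t)) a b /\ ex_RInt (fun t => snd (f t)) a b.

Lemma ccont_re_im (f : R -> C) (t : R) : ccont f t ->
  continuous (fun t => fst (f t)) t /\ continuous (fun t => snd (f t)) t.
Proof.
  intros H. split; apply continuity_pt_filterlim; intros eps He; destruct (H eps He) as (d & Hd & K);
   exists d; split; auto; intros s [_ Hs]; apply K in Hs; eapply Rle_lt_trans; [|exact Hs| |exact Hs].
  - apply (abs_fst_le (Cminus (f s) (f t))).
  - apply (abs_snd_le (Cminus (f s) (f t))).
Qed.

Lemma ex_CInt_cont (f : R -> C) (a b : R) : a <= b ->
  (forall t, a <= t <= b -> ccont f t) -> exCInt f a b.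
Proof.
  intros Hab H. split; apply (@ex_RInt_continuous R_CompleteNormedModule); rewrite Rmin_left, Rmax_right by lra;
   intros t Ht; apply ccont_re_im; auto.
Qed.

Lemma CInt_plus (f g : R -> C) (a b : R) : exCInt f a b -> exCInt g a b ->
  CInt (fun t => Cplus (f t) (g t)) a b = Cplus (CInt f a b) (CInt g a b).
Proof.
  intros [H1 H2] [H3 H4]. apply C_ext; simpl.
  - now apply (RInt_plus (fun t => fst (f t)) (fun t => fst (g t)) a b).
  - now apply (RInt_plus (fun t => snd (f t)) (fun t => snd (g t)) a b).
Qed.

Lemma exCInt_plus (f g : R -> C) (a b : R) : exCInt f a b -> exCInt g a b ->
  exCInt (fun t => Cplus (f t) (g t)) a b.
Proof.
  intros [H1 H2] [H3 H4]. split; simpl.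
  - now apply (ex_RInt_plus (fun t => fst (f t)) (fun t => fst (g t)) a b).
  - now apply (ex_RInt_plus (fun t => snd (f t)) (fun t => snd (g t)) a b).
Qed.

Lemma ex_RInt_lin (f g : R -> R) (a b x y : R) : ex_RInt f a b -> ex_RInt g a b ->
  ex_RInt (fun t => x * f t + y * g t) a b.
Proof.
  intros. apply (ex_RInt_plus (fun t => x * f t) (fun t => y * g t));
  apply (@ex_RInt_scal R_NormedModule); auto.
Qed.

Lemma RInt_lin (f g : R -> R) (a b x y : R) : ex_RInt f a b -> ex_RInt g a b ->
  RInt (fun t => x * f t + y * g t) a b = x * RInt f a b + y * RInt g a b.
Proof.
  intros. rewrite (RInt_plus (fun t => x * f t) (fun t => y * g t)).
  - now rewrite (RInt_scal (V:=R_CompleteNormedModule) f), (RInt_scal (V:=R_CompleteNormedModule) g).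
  - now apply (@ex_RInt_scal R_NormedModule).
  - now apply (@ex_RInt_scal R_NormedModule).
Qed.

Lemma exCInt_scal (c : C) (f : R -> C) (a b : R) : exCInt f a b ->
  exCInt (fun t => Cmult c (f t)) a b.
Proof.
  intros [H1 H2]. split; simpl.
  - apply ex_RInt_ext with (fun t => fst c * fst (f t) + (- snd c) * snd (f t)); [intros; simpl; ring|].
    now apply ex_RInt_lin.
  - apply ex_RInt_lin; auto.
Qed.

Lemma CInt_scal (c : C) (f : R -> C) (a b : R) : exCInt f a b ->
  CInt (fun t => Cmult c (f t)) a b = Cmult c (CInt f a b).
Proof.
  intros [H1 H2]. apply C_ext; simpl.
  - transitivity (RInt (fun t => fst c * fst (f t) + (- snd c) * snd (f t)) a b).
    + apply RInt_ext; intros; simpl; ring.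
    + rewrite RInt_lin by auto. ring.
  - rewrite RInt_lin by auto. ring.
Qed.

Lemma CInt_ext (f g : R -> C) (a b : R) : a <= b -> (forall t, a <= t <= b -> f t = g t) ->
  CInt f a b = CInt g a b.
Proof.
  intros Hab H. apply C_ext; simpl; apply RInt_ext; rewrite Rmin_left, Rmax_right by lra;
   intros t Ht; rewrite H; auto; lra.
Qed.

Lemma exCInt_ext (f g : R -> C) (a b : R) : a <= b -> (forall t, a <= t <= b -> f t = g t) ->
  exCInt f a b -> exCInt g a b.
Proof.
  intros Hab H [H1 H2]. split; [eapply ex_RInt_ext; [|exact H1]|eapply ex_RInt_ext; [|exact H2]];
   rewrite Rmin_left, Rmax_right by lra; intros t Ht; simpl; rewrite H; auto; lra.
Qed.

Lemma CInt_opp (f : R -> C) (a b : R) : exCInt f a b ->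
  CInt (fun t => Copp (f t)) a b = Copp (CInt f a b).
Proof.
  intros H. replace (Copp (CInt f a b)) with (Cmult (Copp (RtoC 1)) (CInt f a b)) by ring.
  rewrite <- CInt_scal by auto. unfold CInt. f_equal; apply RInt_ext; intros; simpl; ring.
Qed.

Lemma exCInt_opp (f : R -> C) (a b : R) : exCInt f a b -> exCInt (fun t => Copp (f t)) a b.
Proof.
  intros [H1 H2]. split; simpl; now apply (@ex_RInt_opp R_NormedModule).
Qed.

Lemma CInt_minus (f g : R -> C) (a b : R) : exCInt f a b -> exCInt g a b ->
  CInt (fun t => Cminus (f t) (g t)) a b = Cminus (CInt f a b) (CInt g a b).
Proof.
  intros. unfold Cminus. rewrite (CInt_plus f (fun t => Copp (g t))), CInt_opp; auto. now apply exCInt_opp.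
Qed.

Lemma exCInt_minus (f g : R -> C) (a b : R) : exCInt f a b -> exCInt g a b ->
  exCInt (fun t => Cminus (f t) (g t)) a b.
Proof.
  intros. apply (exCInt_plus f (fun t => Copp (g t))); auto. now apply exCInt_opp.
Qed.

Lemma CInt_const (c : C) (a b : R) : CInt (fun _ => c) a b = Cmult (RtoC (b - a)) c.
Proof.
  apply C_ext; simpl; rewrite RInt_const; unfold scal; simpl; unfold mult; simpl; ring.
Qed.

Lemma exCInt_const (c : C) (a b : R) : exCInt (fun _ => c) a b.
Proof. split; simpl; apply ex_RInt_const. Qed.

Lemma RInt_abs_le (f : R -> R) (a b M : R) : a <= b -> ex_RInt f a b ->
  (forall t, a <= t <= b -> Rabs (f t) <= M) -> Rabs (RInt f a b) <= (b - a) * M.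
Proof.
  intros Hab He H. apply (norm_RInt_le_const f a b (RInt f a b) M Hab).
  - exact H.
  - apply (@RInt_correct R_CompleteNormedModule); exact He.
Qed.

(** The real and imaginary parts are estimated separately, which costs the factor [2]. It reappears
    in all Cauchy estimates below; no constant there has to be sharp. *)
Lemma CInt_le (f : R -> C) (a b M : R) : a <= b -> exCInt f a b ->
  (forall t, a <= t <= b -> Cmod (f t) <= M) -> Cmod (CInt f a b) <= 2 * ((b - a) * M).
Proof.
  intros Hab [H1 H2] H. eapply Rle_trans; [apply Cmod_le_abs|].
  assert (Rabs (fst (CInt f a b)) <= (b-a)*M).
  { apply RInt_abs_le; auto. intros. eapply Rle_trans; [apply abs_fst_le|auto]. }
  assert (Rabs (snd (CInt f a b)) <= (b-a)*M).
  { apply RInt_abs_le; auto. intros. eapply Rle_trans; [apply abs_snd_le|auto]. }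
  lra.
Qed.

Lemma CInt_Chasles (f : R -> C) (a b c : R) : exCInt f a b -> exCInt f b c ->
  Cplus (CInt f a b) (CInt f b c) = CInt f a c.
Proof.
  intros [H1 H2] [H3 H4]. apply C_ext; simpl.
  - apply (RInt_Chasles (V:=R_CompleteNormedModule) (fun t => fst (f t))); auto.
  - apply (RInt_Chasles (V:=R_CompleteNormedModule) (fun t => snd (f t))); auto.
Qed.

Lemma ccont_lip (f : R -> C) (t d L : R) : 0 < d ->
  (forall s, Rabs (s - t) <= d -> Cmod (Cminus (f s) (f t)) <= L * Rabs (s - t)) -> ccont f t.
Proof.
  intros Hd H eps He. set (L' := Rabs L + 1).
  assert (0 < L') by (unfold L'; pose proof (Rabs_pos L); lra).
  exists (Rmin d (eps / L')). split.
  - apply Rmin_pos; auto. apply Rdiv_lt_0_compat; auto.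
  - intros s Hs. assert (Rabs (s-t) < d) by (eapply Rlt_le_trans; [exact Hs|apply Rmin_l]).
    assert (Rabs (s-t) < eps / L') by (eapply Rlt_le_trans; [exact Hs|apply Rmin_r]).
    eapply Rle_lt_trans; [apply H; lra|].
    assert (L <= L') by (unfold L'; pose proof (Rle_abs L); lra).
    assert (Rabs (s-t) * L' < eps). { apply Rlt_div_r in H2; auto. }
    pose proof (Rabs_pos (s-t)). nra.
Qed.

(** * Functions of one complex variable *)

Definition cdiff1 (f : C -> C) (z a : C) : Prop :=
  forall eps, 0 < eps -> exists d, 0 < d /\ forall h, Cmod h < d ->
    Cmod (Cminus (f (Cplus z h)) (Cplus (f z) (Cmult a h))) <= eps * Cmod h.

(** Real differentiability in Wirtinger form: [p] and [q] are the derivatives in [z] and [zbar], and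
    [q = 0] is complex differentiability. *)
Definition rdiff (f : C -> C) (z p q : C) : Prop :=
  forall eps, 0 < eps -> exists d, 0 < d /\ forall h, Cmod h < d ->
    Cmod (Cminus (f (Cplus z h)) (Cplus (f z) (Cplus (Cmult p h) (Cmult q (Cconj h))))) <= eps * Cmod h.

Definition ccontC (f : C -> C) (z : C) : Prop :=
  forall eps, 0 < eps -> exists d, 0 < d /\ forall w, Cmod (Cminus w z) < d ->
    Cmod (Cminus (f w) (f z)) < eps.

Lemma cdiff1_rdiff (f : C -> C) (z a : C) : cdiff1 f z a -> rdiff f z a (RtoC 0).
Proof.
  intros H eps He. destruct (H eps He) as (d & Hd & K). exists d; split; auto.
  intros h Hh. replace (Cplus (Cmult a h) (Cmult (RtoC 0) (Cconj h))) with (Cmult a h) by ring. auto.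
Qed.

Lemma rdiff_cont (f : C -> C) (z p q : C) : rdiff f z p q -> ccontC f z.
Proof.
  intros H eps He. destruct (H 1 Rlt_0_1) as (d & Hd & K).
  set (L := 1 + Cmod p + Cmod q).
  assert (HL : 0 < L) by (unfold L; pose proof (Cmod_ge_0 p); pose proof (Cmod_ge_0 q); lra).
  exists (Rmin d (eps / L)). split; [apply Rmin_pos; auto; apply Rdiv_lt_0_compat; auto|].
  intros w Hw. set (h := Cminus w z) in *.
  assert (w = Cplus z h) by (unfold h; ring).
  assert (Cmod h < d) by (eapply Rlt_le_trans; [exact Hw|apply Rmin_l]).
  assert (Cmod h < eps / L) by (eapply Rlt_le_trans; [exact Hw|apply Rmin_r]).
  apply Rlt_div_r in H2; auto. specialize (K h H1). rewrite <- H0 in K.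
  replace (Cminus (f w) (f z)) with (Cplus (Cminus (f w) (Cplus (f z) (Cplus (Cmult p h) (Cmult q (Cconj h)))))
     (Cplus (Cmult p h) (Cmult q (Cconj h)))) by ring.
  eapply Rle_lt_trans; [apply Cmod_triangle|].
  pose proof (Cmod_triangle (Cmult p h) (Cmult q (Cconj h))). rewrite !Cmod_mult, Cmod_conj in H3.
  unfold L in *. nra.
Qed.

Lemma cdiff1_cont (f : C -> C) (z a : C) : cdiff1 f z a -> ccontC f z.
Proof. intros H. eapply rdiff_cont, cdiff1_rdiff; eauto. Qed.

Lemma cdiff1_ext (f g : C -> C) (z a : C) : (forall w, f w = g w) -> cdiff1 f z a -> cdiff1 g z a.
Proof.
  intros E H eps He. destruct (H eps He) as (d & Hd & K). exists d; split; auto.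
  intros h Hh. rewrite <- !E. auto.
Qed.

Lemma cdiff1_const (c z : C) : cdiff1 (fun _ => c) z (RtoC 0).
Proof.
  intros eps He. exists 1; split; [lra|]. intros h _.
  replace (Cminus c (Cplus c (Cmult (RtoC 0) h))) with (RtoC 0) by ring. rewrite Cmod_0.
  pose proof (Cmod_ge_0 h). nra.
Qed.

Lemma cdiff1_affine (b c z : C) : cdiff1 (fun w => Cplus (Cmult b w) c) z b.
Proof.
  intros eps He. exists 1; split; [lra|]. intros h _.
  match goal with |- Cmod ?x <= _ => replace x with (RtoC 0) by ring end. rewrite Cmod_0.
  pose proof (Cmod_ge_0 h). nra.
Qed.

Lemma cdiff1_plus (f g : C -> C) (z a b : C) : cdiff1 f z a -> cdiff1 g z b ->
  cdiff1 (fun w => Cplus (f w) (g w)) z (Cplus a b).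
Proof.
  intros Hf Hg eps He.
  destruct (Hf (eps/2)) as (d1 & Hd1 & K1); [lra|]. destruct (Hg (eps/2)) as (d2 & Hd2 & K2); [lra|].
  exists (Rmin d1 d2); split; [apply Rmin_pos; auto|]. intros h Hh.
  assert (Cmod h < d1) by (eapply Rlt_le_trans; [exact Hh|apply Rmin_l]).
  assert (Cmod h < d2) by (eapply Rlt_le_trans; [exact Hh|apply Rmin_r]).
  specialize (K1 h H). specialize (K2 h H0).
  match goal with |- Cmod ?x <= _ => replace x with
   (Cplus (Cminus (f (Cplus z h)) (Cplus (f z) (Cmult a h))) (Cminus (g (Cplus z h)) (Cplus (g z) (Cmult b h)))) by ring end.
  eapply Rle_trans; [apply Cmod_triangle|]. lra.
Qed.

Lemma cdiff1_mult (f g : C -> C) (z a b : C) : cdiff1 f z a -> cdiff1 g z b ->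
  cdiff1 (fun w => Cmult (f w) (g w)) z (Cplus (Cmult a (g z)) (Cmult (f z) b)).
Proof.
  intros Hf Hg eps He.
  set (M := 1 + Cmod (f z) + Cmod (g z) + Cmod a).
  pose proof (Cmod_ge_0 (f z)). pose proof (Cmod_ge_0 (g z)). pose proof (Cmod_ge_0 a).
  assert (0 < M) by (unfold M; lra).
  assert (He' : 0 < eps / (4 * M)) by (apply Rdiv_lt_0_compat; lra).
  set (e := eps / (4 * M)) in *. assert (e * M = eps / 4) by (unfold e; field; lra).
  destruct (Hf e He') as (d1 & Hd1 & K1). destruct (Hg e He') as (d2 & Hd2 & K2).
  destruct (cdiff1_cont g z b Hg (Rmin 1 e)) as (d3 & Hd3 & K3); [apply Rmin_pos; lra|].
  exists (Rmin d1 (Rmin d2 d3)); split; [repeat apply Rmin_pos; auto|]. intros h Hh.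
  assert (Cmod h < d1) by (eapply Rlt_le_trans; [exact Hh|apply Rmin_l]).
  assert (Cmod h < d2) by (eapply Rlt_le_trans; [exact Hh|]; eapply Rle_trans; [apply Rmin_r|apply Rmin_l]).
  assert (Cmod h < d3) by (eapply Rlt_le_trans; [exact Hh|]; eapply Rle_trans; [apply Rmin_r|apply Rmin_r]).
  specialize (K1 h H4). specialize (K2 h H5). specialize (K3 (Cplus z h)).
  replace (Cminus (Cplus z h) z) with h in K3 by ring. specialize (K3 H6).
  assert (K3a : Cmod (Cminus (g (Cplus z h)) (g z)) < 1) by (eapply Rlt_le_trans; [exact K3|apply Rmin_l]).
  assert (K3b : Cmod (Cminus (g (Cplus z h)) (g z)) < e) by (eapply Rlt_le_trans; [exact K3|apply Rmin_r]).
  set (F := f (Cplus z h)) in *. set (G := g (Cplus z h)) in *.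
  replace (Cminus (Cmult F G) (Cplus (Cmult (f z) (g z)) (Cmult (Cplus (Cmult a (g z)) (Cmult (f z) b)) h)))
   with (Cplus (Cmult (Cminus F (Cplus (f z) (Cmult a h))) G)
     (Cplus (Cmult (Cmult a h) (Cminus G (g z))) (Cmult (f z) (Cminus G (Cplus (g z) (Cmult b h)))))) by ring.
  assert (Cmod G <= M).
  { pose proof (Cmod_rev_tri G (g z)). unfold M. lra. }
  eapply Rle_trans; [apply Cmod_triangle|].
  eapply Rle_trans; [apply Rplus_le_compat_l, Cmod_triangle|].
  rewrite !Cmod_mult. pose proof (Cmod_ge_0 h).
  pose proof (Cmod_ge_0 (Cminus F (Cplus (f z) (Cmult a h)))).
  pose proof (Cmod_ge_0 (Cminus G (Cplus (g z) (Cmult b h)))). pose proof (Cmod_ge_0 G).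
  pose proof (Cmod_ge_0 (Cminus G (g z))).
  assert (Cmod (Cminus F (Cplus (f z) (Cmult a h))) * Cmod G <= e * Cmod h * M) by (apply Rmult_le_compat; lra).
  assert (Cmod a * Cmod h * Cmod (Cminus G (g z)) <= M * Cmod h * e).
  { apply Rmult_le_compat; try lra; [nra|]. apply Rmult_le_compat_r; unfold M; lra. }
  assert (Cmod (f z) * Cmod (Cminus G (Cplus (g z) (Cmult b h))) <= M * (e * Cmod h)).
  { apply Rmult_le_compat; try lra. unfold M; lra. }
  assert (e * M * Cmod h = eps / 4 * Cmod h) by (rewrite H3; ring).
  nra.
Qed.

Lemma cdiff1_comp (f g : C -> C) (z a b : C) : cdiff1 f z a -> cdiff1 g (f z) b ->
  cdiff1 (fun w => g (f w)) z (Cmult b a).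
Proof.
  intros Hf Hg eps He.
  set (M := 2 + Cmod a + Cmod b).
  pose proof (Cmod_ge_0 a). pose proof (Cmod_ge_0 b).
  assert (HM : 0 < M) by (unfold M; lra).
  assert (He' : 0 < eps / (4 * M)) by (apply Rdiv_lt_0_compat; lra).
  set (e := Rmin 1 (eps / (4 * M))).
  assert (0 < e) by (apply Rmin_pos; lra). assert (e <= 1) by apply Rmin_l.
  assert (e * M <= eps / 4).
  { apply Rle_trans with (eps / (4 * M) * M); [apply Rmult_le_compat_r; [lra|apply Rmin_r]|]. right; field; lra. }
  destruct (Hf e H1) as (d1 & Hd1 & K1). destruct (Hg e H1) as (d2 & Hd2 & K2).
  exists (Rmin d1 (d2 / M)); split; [apply Rmin_pos; auto; apply Rdiv_lt_0_compat; auto|]. intros h Hh.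
  assert (Cmod h < d1) by (eapply Rlt_le_trans; [exact Hh|apply Rmin_l]).
  assert (H5 : Cmod h < d2 / M) by (eapply Rlt_le_trans; [exact Hh|apply Rmin_r]).
  apply Rlt_div_r in H5; auto. specialize (K1 h H4). pose proof (Cmod_ge_0 h).
  set (k := Cminus (f (Cplus z h)) (f z)).
  assert (Hk : Cmod k <= (M - 1) * Cmod h).
  { replace k with (Cplus (Cminus (f (Cplus z h)) (Cplus (f z) (Cmult a h))) (Cmult a h)) by (unfold k; ring).
    eapply Rle_trans; [apply Cmod_triangle|]. rewrite Cmod_mult. unfold M. nra. }
  specialize (K2 k). replace (Cplus (f z) k) with (f (Cplus z h)) in K2 by (unfold k; ring).
  assert (Cmod k < d2) by nra. specialize (K2 H7).
  match goal with |- Cmod ?x <= _ => replace x with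
    (Cplus (Cminus (g (f (Cplus z h))) (Cplus (g (f z)) (Cmult b k)))
      (Cmult b (Cminus (f (Cplus z h)) (Cplus (f z) (Cmult a h))))) by (unfold k; ring) end.
  eapply Rle_trans; [apply Cmod_triangle|]. rewrite Cmod_mult.
  assert (Cmod b * Cmod (Cminus (f (Cplus z h)) (Cplus (f z) (Cmult a h))) <= M * (e * Cmod h)).
  { apply Rmult_le_compat; auto using Cmod_ge_0. unfold M; lra. }
  assert (e * Cmod k <= e * (M * Cmod h)) by (apply Rmult_le_compat_l; nra).
  nra.
Qed.

Lemma cdiff1_cexp (z : C) : cdiff1 cexp z (cexp z).
Proof.
  intros eps He. set (L := 20 * exp (fst z)). pose proof (exp_pos (fst z)).
  assert (0 < L) by (unfold L; lra).
  exists (Rmin 1 (eps / L)). split; [apply Rmin_pos; [lra|apply Rdiv_lt_0_compat; auto]|].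
  intros h Hh.
  assert (Cmod h < 1) by (eapply Rlt_le_trans; [exact Hh|apply Rmin_l]).
  assert (H2 : Cmod h < eps / L) by (eapply Rlt_le_trans; [exact Hh|apply Rmin_r]).
  apply Rlt_div_r in H2; auto. rewrite cexp_plus.
  replace (Cminus (Cmult (cexp z) (cexp h)) (Cplus (cexp z) (Cmult (cexp z) h)))
    with (Cmult (cexp z) (Cminus (cexp h) (Cplus (RtoC 1) h))) by ring.
  rewrite Cmod_mult, Cmod_cexp. pose proof (cexp_rem h (Rlt_le _ _ H1)). pose proof (Cmod_ge_0 h).
  apply Rle_trans with (exp (fst z) * (20 * (Cmod h * Cmod h))); [apply Rmult_le_compat_l; lra|].
  unfold L in *. nra.
Qed.

(** * Rectangle integrals and Goursat's theorem *)

(** Counterclockwise boundary integral of [[a, b] x [c, d]]: bottom minus top, plus [Ci] times right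
    minus left. *)
Definition rectint (f : C -> C) (a b c d : R) : C :=
  Cplus (Cminus (CInt (fun x => f (x, c)) a b) (CInt (fun x => f (x, d)) a b))
        (Cmult Ci (Cminus (CInt (fun y => f (b, y)) c d) (CInt (fun y => f (a, y)) c d))).

Lemma ccont_hor (f : C -> C) (x y : R) : ccontC f (x, y) -> ccont (fun s => f (s, y)) x.
Proof.
  intros H eps He. destruct (H eps He) as (d & Hd & K). exists d; split; auto.
  intros s Hs. apply K. replace (Cminus (s, y) (x, y)) with (RtoC (s - x)) by (apply C_ext; simpl; ring).
  now rewrite Cmod_RtoC.
Qed.

Lemma Cmod_Ci_mult (x : R) : Cmod (0, x) = Rabs x.
Proof. replace ((0, x) : C) with (Cmult Ci (RtoC x)) by (apply C_ext; simpl; ring). rewrite Cmod_mult, Cmod_Ci, Cmod_RtoC. ring. Qed.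

Lemma ccont_ver (f : C -> C) (x y : R) : ccontC f (x, y) -> ccont (fun s => f (x, s)) y.
Proof.
  intros H eps He. destruct (H eps He) as (d & Hd & K). exists d; split; auto.
  intros s Hs. apply K. replace (Cminus (x, s) (x, y)) with ((0, s - y) : C) by (apply C_ext; simpl; ring).
  now rewrite Cmod_Ci_mult.
Qed.

Definition contrect (f : C -> C) (a b c d : R) : Prop :=
  forall x y, a <= x <= b -> c <= y <= d -> ccontC f (x, y).

Lemma ex_hor (f : C -> C) (a b c d a' b' y : R) : contrect f a b c d -> a <= a' -> a' <= b' -> b' <= b -> c <= y <= d ->
  exCInt (fun x => f (x, y)) a' b'.
Proof. intros H ? ? ? ?. apply ex_CInt_cont; [lra|]. intros. apply ccont_hor, H; lra. Qed.

Lemma ex_ver (f : C -> C) (a b c d c' d' x : R) : contrect f a b c d -> c <= c' -> c' <= d' -> d' <= d -> a <= x <= b ->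
  exCInt (fun y => f (x, y)) c' d'.
Proof. intros H ? ? ? ?. apply ex_CInt_cont; [lra|]. intros. apply ccont_ver, H; lra. Qed.

Lemma rectint_split (f : C -> C) (a m b c n d : R) : contrect f a b c d ->
  a <= m -> m <= b -> c <= n -> n <= d ->
  rectint f a b c d = Cplus (Cplus (rectint f a m c n) (rectint f m b c n))
                            (Cplus (rectint f a m n d) (rectint f m b n d)).
Proof.
  intros H ? ? ? ?. unfold rectint.
  rewrite <- (CInt_Chasles (fun x => f (x, c)) a m b) by (eapply ex_hor; try exact H; lra).
  rewrite <- (CInt_Chasles (fun x => f (x, d)) a m b) by (eapply ex_hor; try exact H; lra).
  rewrite <- (CInt_Chasles (fun y => f (a, y)) c n d) by (eapply ex_ver; try exact H; lra).
  rewrite <- (CInt_Chasles (fun y => f (b, y)) c n d) by (eapply ex_ver; try exact H; lra).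
  ring.
Qed.

Lemma rectint_le (f : C -> C) (a b c d M : R) : contrect f a b c d -> a <= b -> c <= d ->
  (forall x y, a <= x <= b -> c <= y <= d -> Cmod (f (x, y)) <= M) ->
  Cmod (rectint f a b c d) <= 4 * M * ((b - a) + (d - c)).
Proof.
  intros H ? ? HM. unfold rectint. eapply Rle_trans; [apply Cmod_triangle|].
  rewrite Cmod_mult, Cmod_Ci, Rmult_1_l.
  eapply Rle_trans; [apply Rplus_le_compat; apply Cmod_sub_le|].
  assert (forall y, c <= y <= d -> Cmod (CInt (fun x => f (x, y)) a b) <= 2 * ((b-a) * M)).
  { intros y Hy. apply CInt_le; auto. eapply ex_hor; try exact H; lra. }
  assert (forall x, a <= x <= b -> Cmod (CInt (fun y => f (x, y)) c d) <= 2 * ((d-c) * M)).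
  { intros y Hy. apply CInt_le; auto. eapply ex_ver; try exact H; lra. }
  pose proof (H2 c). pose proof (H2 d). pose proof (H3 a). pose proof (H3 b).
  lra.
Qed.

Lemma rectint_plus (f g : C -> C) (a b c d : R) : contrect f a b c d -> contrect g a b c d -> a <= b -> c <= d ->
  rectint (fun z => Cplus (f z) (g z)) a b c d = Cplus (rectint f a b c d) (rectint g a b c d).
Proof.
  intros Hf Hg ? ?. unfold rectint.
  rewrite (CInt_plus (fun x => f (x, c)) (fun x => g (x, c))); try (eapply ex_hor; eauto; lra).
  rewrite (CInt_plus (fun x => f (x, d)) (fun x => g (x, d))); try (eapply ex_hor; eauto; lra).
  rewrite (CInt_plus (fun x => f (a, x)) (fun x => g (a, x))); try (eapply ex_ver; eauto; lra).
  rewrite (CInt_plus (fun x => f (b, x)) (fun x => g (b, x))); try (eapply ex_ver; eauto; lra).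
  ring.
Qed.

Lemma RInt_id (a b : R) : RInt (fun x => x) a b = (b * b - a * a) / 2.
Proof.
  apply is_RInt_unique. replace ((b * b - a * a) / 2) with (minus (b*b/2) (a*a/2)) by (unfold minus, plus, opp; simpl; field).
  apply (is_RInt_derive (fun x => x * x / 2) (fun x => x)).
  - intros. auto_derive; auto. field.
  - intros. apply continuous_id.
Qed.

Lemma CInt_affine (u v : C) (a b : R) :
  CInt (fun x => Cplus u (Cmult (RtoC x) v)) a b =
  Cplus (Cmult (RtoC (b - a)) u) (Cmult (RtoC ((b * b - a * a) / 2)) v).
Proof.
  assert (forall p q, RInt (fun x => p + x * q) a b = (b - a) * p + (b*b-a*a)/2 * q).
  { intros. transitivity (RInt (fun x => p * 1 + q * x) a b).
    - apply RInt_ext. intros. simpl. ring.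
    - rewrite (RInt_lin (fun _ => 1) (fun x => x)), RInt_const, RInt_id.
      + unfold scal; simpl; unfold mult; simpl. ring.
      + apply ex_RInt_const.
      + apply (@ex_RInt_continuous R_CompleteNormedModule). intros. apply continuous_id. }
  apply C_ext; simpl.
  - replace ((b - a) * fst u - 0 * snd u + ((b * b - a * a) / 2 * fst v - 0 * snd v)) with
     ((b - a) * fst u + ((b * b - a * a) / 2 * fst v)) by ring. rewrite <- H. apply RInt_ext. intros; simpl; ring.
  - replace ((b - a) * snd u + 0 * fst u + ((b * b - a * a) / 2 * snd v + 0 * fst v)) with
     ((b - a) * snd u + ((b * b - a * a) / 2 * snd v)) by ring. rewrite <- H. apply RInt_ext. intros; simpl; ring.
Qed.

(** Green's formula in the one case needed: the complex affine part has a primitive and contributes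
    nothing, while the [zbar]-coefficient [q] contributes [2 i q] per unit of area. *)
Lemma rectint_affine (f0 p q z : C) (a b c d : R) : a <= b -> c <= d ->
  rectint (fun w => Cplus f0 (Cplus (Cmult p (Cminus w z)) (Cmult q (Cconj (Cminus w z))))) a b c d
  = Cmult (Cmult (RtoC 2) (Cmult Ci q)) (RtoC ((b - a) * (d - c))).
Proof.
  intros ? ?. unfold rectint.
  set (f := fun w => Cplus f0 (Cplus (Cmult p (Cminus w z)) (Cmult q (Cconj (Cminus w z))))).
  assert (Hh : forall y, CInt (fun x => f (x, y)) a b = Cplus (Cmult (RtoC (b - a)) (f (0, y))) (Cmult (RtoC ((b * b - a * a) / 2)) (Cplus p q))).
  { intros y. rewrite <- CInt_affine. apply CInt_ext; auto. intros. unfold f. apply C_ext; simpl; ring. }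
  assert (Hv : forall x, CInt (fun y => f (x, y)) c d = Cplus (Cmult (RtoC (d - c)) (f (x, 0))) (Cmult (RtoC ((d * d - c * c) / 2)) (Cmult Ci (Cminus p q)))).
  { intros x. rewrite <- CInt_affine. apply CInt_ext; auto. intros. unfold f. apply C_ext; simpl; ring. }
  change (Cplus (Cminus (CInt (fun x => f (x, c)) a b) (CInt (fun x => f (x, d)) a b))
        (Cmult Ci (Cminus (CInt (fun y => f (b, y)) c d) (CInt (fun y => f (a, y)) c d))) = Cmult (Cmult (RtoC 2) (Cmult Ci q)) (RtoC ((b - a) * (d - c)))).
  rewrite !Hh, !Hv. unfold f. apply C_ext; simpl; field.
Qed.

Lemma contrect_sub (f : C -> C) (a b c d a' b' c' d' : R) : contrect f a b c d ->
  a <= a' -> b' <= b -> c <= c' -> d' <= d -> contrect f a' b' c' d'.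
Proof. intros H ? ? ? ? x y ? ?. apply H; lra. Qed.

(** The hypothesis says that the intervals [[a n, a n + w / 2^n]] are nested; the supremum of the
    left endpoints lies in all of them. It serves both the bisection and the limits of geometrically
    convergent sequences. *)
Lemma nested_sup (a : nat -> R) (w : R) : 0 < w ->
  (forall n, a n <= a (S n) <= a n + w / 2 ^ n - w / 2 ^ S n) ->
  exists x, forall n, a n <= x <= a n + w / 2 ^ n.
Proof.
  intros Hw H.
  assert (Hp : forall n, 0 < w / 2 ^ n) by (intros; apply Rdiv_lt_0_compat; auto; apply pow_lt; lra).
  assert (M1 : forall n m, a n <= a (n + m)%nat /\ a (n + m)%nat + w / 2 ^ (n + m) <= a n + w / 2 ^ n).
  { intros n m. induction m as [|m IH].
    - rewrite Nat.add_0_r. lra.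
    - rewrite Nat.add_succ_r. pose proof (H (n + m)%nat). lra. }
  destruct (completeness (fun x => exists n, x = a n)) as (x & Hx1 & Hx2).
  - exists (a O + w / 2 ^ 0). intros y (n & ->). pose proof (M1 O n). simpl Nat.add in H0. pose proof (Hp n). lra.
  - exists (a O), O; auto.
  - exists x. intros n. split; [apply Hx1; exists n; auto|].
    apply Hx2. intros y (m & ->). destruct (Nat.le_ge_cases n m).
    + replace m with (n + (m - n))%nat by lia. pose proof (M1 n (m - n)%nat). pose proof (Hp (n + (m-n))%nat). lra.
    + pose proof (M1 m (n - m)%nat). replace (m + (n - m))%nat with n in H1 by lia. pose proof (Hp n). lra.
Qed.

Lemma pow2_small (w d : R) : 0 < w -> 0 < d -> exists n, w / 2 ^ n < d.
Proof.
  intros Hw Hd. destruct (pow_lt_1_zero (1/2)) with (y := d / w) as (N & HN).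
  - rewrite Rabs_pos_eq; lra.
  - apply Rdiv_lt_0_compat; auto.
  - exists N. specialize (HN N (le_n N)). rewrite Rabs_pos_eq in HN by (apply pow_le; lra).
    apply Rlt_div_r in HN; auto. unfold Rdiv in HN. rewrite Rmult_1_l in HN. rewrite pow_inv in HN by lra.
    unfold Rdiv. lra.
Qed.

(* Repeated bisection as in Goursat's theorem, carried out for functions whose [zbar]-derivative is only small. *)
Lemma goursat (f : C -> C) (a b c d eps : R) : a < b -> c < d ->
  (forall x y, a <= x <= b -> c <= y <= d -> exists p q, rdiff f (x, y) p q /\ Cmod q <= eps) ->
  Cmod (rectint f a b c d) <= 2 * eps * ((b - a) * (d - c)).
Proof.
  intros Hab Hcd Hf.
  assert (Hcont : contrect f a b c d).
  { intros x y Hx Hy. destruct (Hf x y Hx Hy) as (p & q & K & _). eapply rdiff_cont; eauto. }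
  apply Rnot_lt_le; intros Hlt.
  set (w := b - a) in *. set (h := d - c) in *. assert (Hw : 0 < w) by (unfold w; lra). assert (Hh : 0 < h) by (unfold h; lra).
  assert (Hwh : 0 < w * h) by nra.
  (* [kap] is the size of the integral per unit of area. Bisection preserves a lower bound [kap] for
     this density, whereas at the limit point it is at most [2 |q|] up to an error that tends to
     [0]. *)
  set (kap := Cmod (rectint f a b c d) / (w * h)).
  assert (Hk : 2 * eps < kap) by (unfold kap; apply (proj1 (Rlt_div_r (2*eps) (Cmod (rectint f a b c d)) (w*h) Hwh)); lra).
  set (good := fun n (p : R * R) => a <= fst p /\ fst p + w / 2 ^ n <= b /\ c <= snd p /\ snd p + h / 2 ^ n <= d /\
     kap * ((w / 2 ^ n) * (h / 2 ^ n)) <= Cmod (rectint f (fst p) (fst p + w / 2 ^ n) (snd p) (snd p + h / 2 ^ n))).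
  (* If all four quarters had density below [kap], their sum would contradict [G5]. The implication
     stands under the existential quantifier, so that the choice principle applies to all pairs,
     good or not. *)
  assert (step : forall n p, exists p', good n p -> good (S n) p' /\
     fst p <= fst p' <= fst p + w / 2 ^ n - w / 2 ^ S n /\ snd p <= snd p' <= snd p + h / 2 ^ n - h / 2 ^ S n).
  { intros n p. apply NNPP. intros HN.
    assert (Hg : good n p) by (apply NNPP; intros ?; apply HN; exists p; tauto).
    assert (HN' : forall p', fst p <= fst p' <= fst p + w / 2 ^ n - w / 2 ^ S n /\ snd p <= snd p' <= snd p + h / 2 ^ n - h / 2 ^ S n -> ~ good (S n) p').
    { intros p' Hp' Hg'. apply HN. exists p'. tauto. }
    clear HN. destruct p as [x y]. destruct Hg as (G1 & G2 & G3 & G4 & G5). simpl in G1, G2, G3, G4, G5, HN'.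
    set (w1 := w / (2 * 2 ^ n)) in *. set (h1 := h / (2 * 2 ^ n)) in *.
    assert (P : 0 < 2 ^ n) by (apply pow_lt; lra).
    assert (Ew : w / 2 ^ n = w1 + w1) by (unfold w1; field; lra).
    assert (Eh : h / 2 ^ n = h1 + h1) by (unfold h1; field; lra).
    assert (0 < w1) by (apply Rdiv_lt_0_compat; lra). assert (0 < h1) by (apply Rdiv_lt_0_compat; lra).
    rewrite Ew, Eh in *.
    assert (Q : forall x' y', (x' = x \/ x' = x + w1) -> (y' = y \/ y' = y + h1) ->
       Cmod (rectint f x' (x' + w1) y' (y' + h1)) < kap * (w1 * h1)).
    { intros x' y' Hx Hy. apply Rnot_le_lt. intros Hle. apply (HN' (x', y')); simpl.
      - destruct Hx, Hy; subst; lra.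
      - unfold good; simpl. fold w1 h1. destruct Hx, Hy; subst; repeat split; try lra. }
    rewrite (rectint_split f x (x + w1) (x + (w1 + w1)) y (y + h1) (y + (h1 + h1))) in G5; try lra.
    2:{ eapply contrect_sub; eauto; lra. }
    pose proof (Q x y (or_introl eq_refl) (or_introl eq_refl)).
    pose proof (Q (x + w1) y (or_intror eq_refl) (or_introl eq_refl)).
    pose proof (Q x (y + h1) (or_introl eq_refl) (or_intror eq_refl)).
    pose proof (Q (x + w1) (y + h1) (or_intror eq_refl) (or_intror eq_refl)).
    rewrite (Rplus_assoc x) in H2, H4. rewrite (Rplus_assoc y) in H3, H4.
    pose proof (Cmod_triangle (Cplus (rectint f x (x + w1) y (y + h1)) (rectint f (x + w1) (x + (w1 + w1)) y (y + h1)))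
      (Cplus (rectint f x (x + w1) (y + h1) (y + (h1 + h1))) (rectint f (x + w1) (x + (w1 + w1)) (y + h1) (y + (h1 + h1))))).
    pose proof (Cmod_triangle (rectint f x (x + w1) y (y + h1)) (rectint f (x + w1) (x + (w1 + w1)) y (y + h1))).
    pose proof (Cmod_triangle (rectint f x (x + w1) (y + h1) (y + (h1 + h1))) (rectint f (x + w1) (x + (w1 + w1)) (y + h1) (y + (h1 + h1)))).
    replace (kap * ((w1 + w1) * (h1 + h1))) with (4 * (kap * (w1 * h1))) in G5 by ring. lra. }
  destruct (functional_choice (fun (np : nat * (R * R)) p' => good (fst np) (snd np) -> good (S (fst np)) p' /\
     fst (snd np) <= fst p' <= fst (snd np) + w / 2 ^ fst np - w / 2 ^ S (fst np) /\ snd (snd np) <= snd p' <= snd (snd np) + h / 2 ^ fst np - h / 2 ^ S (fst np))) as (nx & Hnx).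
  { intros [n p]. apply step. }
  set (P := fix P n := match n with O => (a, c) | S m => nx (m, P m) end).
  assert (HP : forall n, good n (P n)).
  { induction n as [|n IH].
    - simpl. unfold good; simpl. unfold Rdiv. rewrite Rinv_1, !Rmult_1_r.
      replace (a + w) with b by (unfold w; ring). replace (c + h) with d by (unfold h; ring).
      repeat split; try lra. unfold kap. right; field; lra.
    - apply (Hnx (n, P n)). exact IH. }
  destruct (nested_sup (fun n => fst (P n)) w Hw) as (x & Hx).
  { intros n. apply (Hnx (n, P n)). apply HP. }
  destruct (nested_sup (fun n => snd (P n)) h Hh) as (y & Hy).
  { intros n. apply (Hnx (n, P n)). apply HP. }
  assert (Hxy : a <= x <= b /\ c <= y <= d).
  { pose proof (Hx O); pose proof (Hy O). simpl in H, H0. unfold Rdiv in *. rewrite Rinv_1, Rmult_1_r in *. unfold w, h in *; lra. }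
  destruct (Hf x y (proj1 Hxy) (proj2 Hxy)) as (p & q & Hpq & Hq).
  (* Bisection does not change the shape, so the ratio [rho] of the squared half perimeter to the
     area is the same at every stage. With this [eta] the remainder costs
     [4 eta rho = (kap - 2 eps) / 2] per unit of area, half of the available gap. *)
  set (rho := (w + h) * (w + h) / (w * h)).
  assert (Hrho : 0 < rho) by (apply Rdiv_lt_0_compat; nra).
  set (eta := (kap - 2 * eps) / (8 * rho)). assert (Heta : 0 < eta) by (apply Rdiv_lt_0_compat; lra).
  destruct (Hpq eta Heta) as (dl & Hdl & K).
  destruct (pow2_small (w + h) dl) as (n & Hn); [lra|auto|].
  destruct (HP n) as (G1 & G2 & G3 & G4 & G5). specialize (Hx n). specialize (Hy n).
  destruct (P n) as [x0 y0]. simpl in *.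
  set (t := / 2 ^ n). assert (Ht : 0 < t) by (apply Rinv_0_lt_compat, pow_lt; lra).
  unfold Rdiv in G2, G4, G5, Hx, Hy, Hn. fold t in G2, G4, G5, Hx, Hy, Hn.
  set (lin := fun w0 => Cplus (f (x, y)) (Cplus (Cmult p (Cminus w0 (x, y))) (Cmult q (Cconj (Cminus w0 (x, y)))))).
  set (e := fun w0 => Cminus (f w0) (lin w0)).
  assert (Hclin : forall z, ccontC lin z).
  { intros z. apply rdiff_cont with p q. intros ep Hep. exists 1; split; [lra|]. intros k _.
    unfold lin. match goal with |- Cmod ?X <= _ => replace X with (RtoC 0) end.
    - rewrite Cmod_0. pose proof (Cmod_ge_0 k). nra.
    - apply C_ext; simpl; ring. }
  assert (Hce : contrect e x0 (x0 + w * t) y0 (y0 + h * t)).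
  { intros x' y' Hx' Hy'.
    intros ep Hep. destruct (Hcont x' y' ltac:(lra) ltac:(lra) (ep/2)) as (d1 & Hd1 & K1); [lra|].
    destruct (Hclin (x', y') (ep/2)) as (d2 & Hd2 & K2); [lra|].
    exists (Rmin d1 d2). split; [apply Rmin_pos; auto|]. intros w0 Hw0.
    specialize (K1 w0 (Rlt_le_trans _ _ _ Hw0 (Rmin_l _ _))). specialize (K2 w0 (Rlt_le_trans _ _ _ Hw0 (Rmin_r _ _))).
    unfold e. replace (Cminus (Cminus (f w0) (lin w0)) (Cminus (f (x', y')) (lin (x', y')))) with
      (Cminus (Cminus (f w0) (f (x', y'))) (Cminus (lin w0) (lin (x', y')))) by ring.
    pose proof (Cmod_sub_le (Cminus (f w0) (f (x', y'))) (Cminus (lin w0) (lin (x', y')))). lra. }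
  assert (E : rectint f x0 (x0 + w * t) y0 (y0 + h * t) = Cplus (rectint lin x0 (x0 + w * t) y0 (y0 + h * t)) (rectint e x0 (x0 + w * t) y0 (y0 + h * t))).
  { rewrite <- rectint_plus; [|intros ? ? ? ?; apply Hclin|exact Hce|nra|nra].
    unfold rectint. f_equal; [|f_equal]; f_equal; apply CInt_ext; try nra; intros; unfold e; ring. }
  rewrite E in G5. unfold lin in G5 at 1. rewrite rectint_affine in G5 by nra.
  assert (Be : Cmod (rectint e x0 (x0 + w * t) y0 (y0 + h * t)) <= 4 * (eta * ((w + h) * t)) * ((x0 + w * t - x0) + (y0 + h * t - y0))).
  { apply rectint_le; auto; try nra. intros x' y' Hx' Hy'. unfold e, lin.
    specialize (K (Cminus (x', y') (x, y))). replace (Cplus (x, y) (Cminus (x', y') (x, y))) with ((x', y') : C) in K by (apply C_ext; simpl; ring).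
    assert (Cmod (Cminus (x', y') (x, y)) <= (w + h) * t).
    { eapply Rle_trans; [apply Cmod_le_abs|]. simpl.
      assert (Rabs (x' + - x) <= w * t) by (apply Rabs_le; lra). assert (Rabs (y' + - y) <= h * t) by (apply Rabs_le; lra). lra. }
    eapply Rle_trans; [apply K; lra|]. apply Rmult_le_compat_l; lra. }
  pose proof (Cmod_triangle (Cmult (Cmult (RtoC 2) (Cmult Ci q)) (RtoC ((x0 + w * t - x0) * (y0 + h * t - y0)))) (rectint e x0 (x0 + w * t) y0 (y0 + h * t))).
  rewrite !Cmod_mult, Cmod_Ci, !Cmod_RtoC, (Rabs_pos_eq 2) in H by lra.
  replace (x0 + w * t - x0) with (w * t) in * by ring. replace (y0 + h * t - y0) with (h * t) in * by ring.
  rewrite (Rabs_pos_eq (w * t * (h * t))) in H by (apply Rmult_le_pos; nra).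
  set (ar := w * t * (h * t)) in *. assert (Har : 0 < ar) by (unfold ar; apply Rmult_lt_0_compat; nra).
  assert (EQ : 4 * (eta * ((w + h) * t)) * (w * t + h * t) = (kap - 2 * eps) / 2 * ar).
  { unfold eta, rho, ar. field. lra. }
  rewrite EQ in Be. unfold lin in *. nra.
Qed.

(** * Circle integrals and Cauchy's formula for the derivative *)

Definition cis (y : R) : C := (cos y, sin y).

Lemma Cmod_cis (y : R) : Cmod (cis y) = 1.
Proof.
  replace (cis y) with (cexp (0, y)) by (unfold cis, cexp; apply C_ext; simpl; rewrite exp_0; ring).
  rewrite Cmod_cexp. simpl. apply exp_0.
Qed.

Lemma cis_inv (y : R) : Cmult (cis y) (cis (- y)) = RtoC 1.
Proof.
  unfold cis. rewrite cos_neg, sin_neg. pose proof (sin2_cos2 y). unfold Rsqr in H.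
  apply C_ext; simpl; [|ring]. rewrite <- H. ring.
Qed.

Lemma cis_lip (x y : R) : Cmod (Cminus (cis x) (cis y)) <= 2 * Rabs (x - y).
Proof.
  assert (forall f df, (forall t, is_derive f t (df t)) -> (forall t, Rabs (df t) <= 1) -> Rabs (f x - f y) <= Rabs (x - y)) as H.
  { intros f df Hd Hb. destruct (MVT_gen f y x df) as (c & _ & E).
    - intros; apply Hd.
    - intros. apply continuity_pt_filterlim, (ex_derive_continuous f). eexists; apply Hd.
    - rewrite E, Rabs_mult. specialize (Hb c). pose proof (Rabs_pos (x - y)). nra. }
  eapply Rle_trans; [apply Cmod_le_abs|]. simpl.
  pose proof (H cos (fun t => - sin t)). pose proof (H sin cos).
  assert (Rabs (cos x - cos y) <= Rabs (x - y)).
  { apply H0; intros; [apply is_derive_Reals, derivable_pt_lim_cos|]. rewrite Rabs_Ropp. apply Rabs_le, SIN_bound. }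
  assert (Rabs (sin x - sin y) <= Rabs (x - y)).
  { apply H1; intros; [apply is_derive_Reals, derivable_pt_lim_sin|]. apply Rabs_le, COS_bound. }
  unfold Rminus in *. lra.
Qed.

Lemma ccont_cis (t : R) : ccont cis t.
Proof. apply ccont_lip with 1 2; [lra|]. intros. apply cis_lip. Qed.

Lemma CInt_cis : CInt cis 0 (2 * PI) = RtoC 0.
Proof.
  apply C_ext; simpl; apply is_RInt_unique.
  - replace 0 with (minus (sin (2 * PI)) (sin 0)) at 2 by (rewrite sin_2PI, sin_0; unfold minus, plus, opp; simpl; ring).
    apply (is_RInt_derive sin cos).
    + intros. apply is_derive_Reals, derivable_pt_lim_sin.
    + intros. apply continuity_pt_filterlim, continuity_cos.
  - replace 0 with (minus (- cos (2 * PI)) (- cos 0)) at 2 by (rewrite cos_2PI, cos_0; unfold minus, plus, opp; simpl; ring).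
    apply (is_RInt_derive (fun x => - cos x) sin).
    + intros. auto_derive; auto. ring.
    + intros. apply continuity_pt_filterlim, continuity_sin.
Qed.

Lemma CInt_cis_neg : CInt (fun y => cis (- y)) 0 (2 * PI) = RtoC 0.
Proof.
  pose proof CInt_cis as H. unfold CInt in *.
  assert (H1 : RInt (fun t => fst (cis t)) 0 (2*PI) = 0) by exact (f_equal fst H).
  assert (H2 : RInt (fun t => snd (cis t)) 0 (2*PI) = 0) by exact (f_equal snd H).
  apply C_ext; simpl.
  - transitivity (RInt (fun t => fst (cis t)) 0 (2*PI)); [|exact H1]. apply RInt_ext. intros; simpl; apply cos_neg.
  - transitivity (RInt (fun t => opp (snd (cis t))) 0 (2*PI)).
    + apply RInt_ext. intros; simpl; apply sin_neg.
    + rewrite (RInt_opp (V:=R_CompleteNormedModule) (fun t => snd (cis t))), H2; [unfold opp; simpl; ring|].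
      apply (@ex_RInt_continuous R_CompleteNormedModule). intros. simpl. apply continuity_pt_filterlim, continuity_sin.
Qed.

Lemma ccont_cis_neg (t : R) : ccont (fun y => cis (- y)) t.
Proof.
  apply ccont_lip with 1 2; [lra|]. intros. eapply Rle_trans; [apply cis_lip|].
  replace (- s - - t) with (- (s - t)) by ring. rewrite Rabs_Ropp. lra.
Qed.

Lemma ccont_comp (f : C -> C) (g : R -> C) (t : R) : ccontC f (g t) -> ccont g t -> ccont (fun s => f (g s)) t.
Proof.
  intros Hf Hg eps He. destruct (Hf eps He) as (d & Hd & K). destruct (Hg d Hd) as (d' & Hd' & K').
  exists d'; split; auto.
Qed.

Lemma ccont_mult (f g : R -> C) (t : R) : ccont f t -> ccont g t -> ccont (fun s => Cmult (f s) (g s)) t.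
Proof.
  intros Hf Hg eps He.
  set (M := 1 + Cmod (f t) + Cmod (g t)).
  pose proof (Cmod_ge_0 (f t)). pose proof (Cmod_ge_0 (g t)).
  assert (HM : 0 < M) by (unfold M; lra).
  set (e := Rmin 1 (eps / (4 * M))).
  assert (0 < e) by (apply Rmin_pos; [lra|apply Rdiv_lt_0_compat; lra]). assert (e <= 1) by apply Rmin_l.
  assert (e * M <= eps / 4).
  { apply Rle_trans with (eps / (4 * M) * M); [apply Rmult_le_compat_r; [lra|apply Rmin_r]|]. right; field; lra. }
  destruct (Hf e H1) as (d1 & Hd1 & K1). destruct (Hg e H1) as (d2 & Hd2 & K2).
  exists (Rmin d1 d2); split; [apply Rmin_pos; auto|]. intros s Hs.
  specialize (K1 s (Rlt_le_trans _ _ _ Hs (Rmin_l _ _))). specialize (K2 s (Rlt_le_trans _ _ _ Hs (Rmin_r _ _))).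
  replace (Cminus (Cmult (f s) (g s)) (Cmult (f t) (g t))) with
    (Cplus (Cmult (Cminus (f s) (f t)) (g s)) (Cmult (f t) (Cminus (g s) (g t)))) by ring.
  eapply Rle_lt_trans; [apply Cmod_triangle|]. rewrite !Cmod_mult.
  pose proof (Cmod_rev_tri (g s) (g t)). assert (Cmod (g s) <= M) by (unfold M; lra).
  assert (Cmod (Cminus (f s) (f t)) * Cmod (g s) <= e * M) by (apply Rmult_le_compat; auto using Cmod_ge_0; lra).
  assert (Cmod (f t) * Cmod (Cminus (g s) (g t)) <= M * e) by (apply Rmult_le_compat; auto using Cmod_ge_0; unfold M; lra).
  lra.
Qed.

Lemma ccont_const (c : C) (t : R) : ccont (fun _ => c) t.
Proof. intros eps He. exists 1; split; [lra|]. intros. replace (Cminus c c) with (RtoC 0) by ring. now rewrite Cmod_0. Qed.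

Lemma ccont_plus (f g : R -> C) (t : R) : ccont f t -> ccont g t -> ccont (fun s => Cplus (f s) (g s)) t.
Proof.
  intros Hf Hg eps He. destruct (Hf (eps/2)) as (d1 & Hd1 & K1); [lra|]. destruct (Hg (eps/2)) as (d2 & Hd2 & K2); [lra|].
  exists (Rmin d1 d2); split; [apply Rmin_pos; auto|]. intros s Hs.
  specialize (K1 s (Rlt_le_trans _ _ _ Hs (Rmin_l _ _))). specialize (K2 s (Rlt_le_trans _ _ _ Hs (Rmin_r _ _))).
  replace (Cminus (Cplus (f s) (g s)) (Cplus (f t) (g t))) with
    (Cplus (Cminus (f s) (f t)) (Cminus (g s) (g t))) by ring.
  eapply Rle_lt_trans; [apply Cmod_triangle|]. lra.
Qed.

Lemma ccont_circle (f : C -> C) (z : C) (r t : R) :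
  ccontC f (Cplus z (Cmult (RtoC r) (cis t))) ->
  ccont (fun y => f (Cplus z (Cmult (RtoC r) (cis y)))) t.
Proof.
  intros H. apply (ccont_comp f (fun y => Cplus z (Cmult (RtoC r) (cis y)))); auto.
  apply ccont_plus; [apply ccont_const|]. apply ccont_mult; [apply ccont_const|apply ccont_cis].
Qed.

Lemma two_PI_pos : 0 < 2 * PI. Proof. pose proof PI_RGT_0. lra. Qed.

Lemma Cmod_rcis (r y : R) : 0 <= r -> Cmod (Cmult (RtoC r) (cis y)) = r.
Proof. intros. rewrite Cmod_mult, Cmod_cis, Cmod_RtoC, Rabs_pos_eq; lra. Qed.

(* Goursat's theorem in the logarithmic coordinate [w], for [f (z + e^w) e^(-w)]: the horizontal sides of a
   rectangle of height [2 PI] cancel, so the circle integral does not depend on the radius. *)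
Lemma cauchy_deriv (f : C -> C) (z a : C) (r : R) : 0 < r ->
  (forall w, Cmod (Cminus w z) <= r -> exists p, cdiff1 f w p) -> cdiff1 f z a ->
  CInt (fun y => Cmult (f (Cplus z (Cmult (RtoC r) (cis y)))) (cis (- y))) 0 (2 * PI) = Cmult (RtoC (2 * PI * r)) a.
Proof.
  intros Hr Hf Ha. pose proof two_PI_pos as HPI.
  (* [J s] is, up to the factor [i], the integral of [f w / (w - z)^2] over the circle of radius
     [s]. It is constant in [s] by Goursat, and its limit at [0] is [2 PI a]. *)
  set (J := fun s => CInt (fun y => Cmult (Cmult (f (Cplus z (Cmult (RtoC s) (cis y)))) (cis (- y))) (RtoC (/ s))) 0 (2 * PI)).
  assert (Hc : forall s, 0 < s <= r -> forall t, ccont (fun y => f (Cplus z (Cmult (RtoC s) (cis y)))) t).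
  { intros s Hs t. apply ccont_circle. destruct (Hf (Cplus z (Cmult (RtoC s) (cis t)))) as (p & Hp).
    - replace (Cminus (Cplus z (Cmult (RtoC s) (cis t))) z) with (Cmult (RtoC s) (cis t)) by ring. rewrite Cmod_rcis; lra.
    - eapply cdiff1_cont; eauto. }
  assert (EJ : forall s, 0 < s -> s < r -> J s = J r).
  { intros s Hs Hsr.
    set (g := fun w => Cmult (f (Cplus z (cexp w))) (cexp (Copp w))).
    assert (Hg : Cmod (rectint g (ln s) (ln r) 0 (2 * PI)) <= 2 * 0 * ((ln r - ln s) * (2 * PI - 0))).
    { apply goursat; [apply ln_increasing; lra|lra|].
      intros x y Hx Hy. destruct (Hf (Cplus z (cexp (x, y)))) as (p & Hp).
      - replace (Cminus (Cplus z (cexp (x, y))) z) with (cexp (x, y)) by ring. rewrite Cmod_cexp. simpl.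
        rewrite <- (exp_ln r) by auto. destruct (Req_dec x (ln r)); [subst; lra|left; apply exp_increasing; lra].
      - eexists; exists (RtoC 0); split; [|rewrite Cmod_0; lra]. apply cdiff1_rdiff. unfold g.
        apply cdiff1_mult.
        + apply (cdiff1_comp (fun w => Cplus z (cexp w)) f).
          * apply cdiff1_plus; [apply cdiff1_const|apply cdiff1_cexp].
          * exact Hp.
        + apply (cdiff1_comp (fun w => Copp w) cexp); [|apply cdiff1_cexp].
          apply cdiff1_ext with (fun w => Cplus (Cmult (Copp (RtoC 1)) w) (RtoC 0)); [intros; ring|apply cdiff1_affine]. }
    rewrite Rmult_0_r, Rmult_0_l in Hg.
    assert (Hg0 : rectint g (ln s) (ln r) 0 (2 * PI) = RtoC 0).
    { apply Cmod_eq_0. pose proof (Cmod_ge_0 (rectint g (ln s) (ln r) 0 (2 * PI))). lra. }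
    unfold rectint in Hg0.
    assert (E1 : CInt (fun x => g (x, 0)) (ln s) (ln r) = CInt (fun x => g (x, 2 * PI)) (ln s) (ln r)).
    { apply CInt_ext; [left; apply ln_increasing; lra|]. intros. unfold g, cexp; simpl.
      rewrite Ropp_0, !sin_neg, !cos_neg, sin_2PI, cos_2PI, sin_0, cos_0. f_equal; apply C_ext; simpl; ring. }
    assert (E2 : forall s', 0 < s' -> CInt (fun y => g (ln s', y)) 0 (2 * PI) = J s').
    { intros s' Hs'. apply CInt_ext; [lra|]. intros y Hy. unfold g.
      replace (cexp (ln s', y)) with (Cmult (RtoC s') (cis y)) by (unfold cexp, cis; apply C_ext; simpl; rewrite exp_ln by auto; ring).
      replace (cexp (Copp (ln s', y))) with (Cmult (cis (- y)) (RtoC (/ s'))). 1: ring.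
      unfold cexp, cis; apply C_ext; simpl; rewrite exp_Ropp, exp_ln by auto; ring. }
    rewrite E1, !E2 in Hg0 by lra.
    assert (Cmult (Copp Ci) (Cmult Ci (Cminus (J r) (J s))) = RtoC 0).
    { match type of Hg0 with Cplus ?x ?y = _ => replace (Cmult Ci (Cminus (J r) (J s))) with (Cplus x y) by ring end. rewrite Hg0; ring. }
    replace (Cmult (Copp Ci) (Cmult Ci (Cminus (J r) (J s)))) with (Cminus (J r) (J s)) in H by (apply C_ext; simpl; ring).
    replace (J r) with (Cplus (Cminus (J r) (J s)) (J s)) by ring. rewrite H. ring. }
  (* On a small circle [f] is [f z + a (w - z)] up to [eps |w - z|]. The constant term is harmless
     although it is divided by [s], because [cis (- y)] has mean zero. *)
  assert (EL : forall eps, 0 < eps -> Cmod (Cminus (J r) (Cmult (RtoC (2 * PI)) a)) <= 2 * (2 * PI * eps)).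
  { intros eps He. destruct (Ha eps He) as (d & Hd & K).
    set (s := Rmin (d / 2) (r / 2)).
    assert (Hs : 0 < s) by (apply Rmin_pos; lra). assert (s <= d/2) by apply Rmin_l. assert (s <= r/2) by apply Rmin_r.
    rewrite <- (EJ s) by lra.
    assert (X1 : exCInt (fun y => Cmult (Cmult (f (Cplus z (Cmult (RtoC s) (cis y)))) (cis (- y))) (RtoC (/ s))) 0 (2 * PI)).
    { apply ex_CInt_cont; [lra|]. intros. apply ccont_mult; [|apply ccont_const]. apply ccont_mult; [apply Hc; lra|apply ccont_cis_neg]. }
    assert (X2 : exCInt (fun y => cis (- y)) 0 (2 * PI)).
    { apply ex_CInt_cont; [lra|]. intros. apply ccont_cis_neg. }
    assert (E : Cminus (J s) (Cmult (RtoC (2 * PI)) a) =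
      CInt (fun y => Cminus (Cminus (Cmult (Cmult (f (Cplus z (Cmult (RtoC s) (cis y)))) (cis (- y))) (RtoC (/ s))) a) (Cmult (Cmult (f z) (RtoC (/ s))) (cis (- y)))) 0 (2 * PI)).
    { rewrite CInt_minus; [|apply exCInt_minus; [exact X1|apply exCInt_const]|now apply exCInt_scal].
      rewrite CInt_minus; [|exact X1|apply exCInt_const].
      rewrite CInt_scal by auto. rewrite CInt_cis_neg, CInt_const, Rminus_0_r. unfold J. ring. }
    rewrite E. replace (2 * (2 * PI * eps)) with (2 * ((2 * PI - 0) * eps)) by ring. apply CInt_le; [lra| |].
    { apply exCInt_minus; [apply exCInt_minus; [exact X1|apply exCInt_const]|now apply exCInt_scal]. }
    intros y Hy. specialize (K (Cmult (RtoC s) (cis y))). rewrite Cmod_rcis in K by lra.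
    specialize (K ltac:(lra)).
    match goal with |- Cmod ?X <= _ => replace X with (Cmult (Cminus (f (Cplus z (Cmult (RtoC s) (cis y)))) (Cplus (f z) (Cmult a (Cmult (RtoC s) (cis y))))) (Cmult (cis (- y)) (RtoC (/ s)))) end.
    - rewrite !Cmod_mult, Cmod_cis, Cmod_RtoC, Rabs_pos_eq by (left; now apply Rinv_0_lt_compat).
      apply Rle_trans with (eps * s * (1 * / s)); [|right; field; lra].
      apply Rmult_le_compat_r; [|exact K]. rewrite Rmult_1_l. left. now apply Rinv_0_lt_compat.
    - assert (Hi : Cmult (Cmult (RtoC s) (cis y)) (Cmult (cis (- y)) (RtoC (/ s))) = RtoC 1).
      { replace (Cmult (Cmult (RtoC s) (cis y)) (Cmult (cis (- y)) (RtoC (/ s)))) with (Cmult (Cmult (cis y) (cis (-y))) (Cmult (RtoC s) (RtoC (/ s)))) by ring.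
        rewrite cis_inv, <- RtoC_mult, Rinv_r by lra. ring. }
      transitivity (Cminus (Cminus (Cmult (Cmult (f (Cplus z (Cmult (RtoC s) (cis y)))) (cis (- y))) (RtoC (/ s))) (Cmult a (Cmult (Cmult (RtoC s) (cis y)) (Cmult (cis (- y)) (RtoC (/ s))))))
         (Cmult (Cmult (f z) (RtoC (/ s))) (cis (- y)))); [ring|rewrite Hi; ring]. }
  assert (Efin : J r = Cmult (RtoC (2 * PI)) a).
  { assert (Cmod (Cminus (J r) (Cmult (RtoC (2 * PI)) a)) = 0).
    { apply Rle_antisym; [|apply Cmod_ge_0]. apply Rnot_lt_le. intros Hlt.
      set (m := Cmod (Cminus (J r) (Cmult (RtoC (2 * PI)) a))) in *.
      specialize (EL (m / (8 * PI)) ltac:(apply Rdiv_lt_0_compat; lra)). fold m in EL.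
      replace (2 * (2 * PI * (m / (8 * PI)))) with (m / 2) in EL by (field; lra). lra. }
    apply Cmod_eq_0 in H. replace (J r) with (Cplus (Cminus (J r) (Cmult (RtoC (2 * PI)) a)) (Cmult (RtoC (2 * PI)) a)) by ring. rewrite H; ring. }
  assert (X : exCInt (fun y => Cmult (f (Cplus z (Cmult (RtoC r) (cis y)))) (cis (- y))) 0 (2 * PI)).
  { apply ex_CInt_cont; [lra|]. intros. apply ccont_mult; [apply Hc; lra|apply ccont_cis_neg]. }
  replace (Cmult (RtoC (2 * PI * r)) a) with (Cmult (RtoC r) (J r)) by (rewrite Efin, !RtoC_mult; ring).
  unfold J. rewrite <- CInt_scal.
  - apply CInt_ext; [lra|]. intros y Hy.
    replace (Cmult (RtoC r) (Cmult (Cmult (f (Cplus z (Cmult (RtoC r) (cis y)))) (cis (- y))) (RtoC (/ r)))) with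
     (Cmult (Cmult (f (Cplus z (Cmult (RtoC r) (cis y)))) (cis (- y))) (Cmult (RtoC r) (RtoC (/ r)))) by ring.
    rewrite <- RtoC_mult, Rinv_r by lra. ring.
  - eapply exCInt_ext; [lra| |apply (exCInt_scal (RtoC (/ r))), X]. intros; simpl. ring.
Qed.

Lemma ex_cauchy (f : C -> C) (z : C) (r : R) : 0 < r ->
  (forall w, Cmod (Cminus w z) <= r -> exists p, cdiff1 f w p) ->
  exCInt (fun y => Cmult (f (Cplus z (Cmult (RtoC r) (cis y)))) (cis (- y))) 0 (2 * PI).
Proof.
  intros Hr Hf. pose proof two_PI_pos. apply ex_CInt_cont; [lra|]. intros t _.
  apply ccont_mult; [|apply ccont_cis_neg]. apply ccont_circle.
  destruct (Hf (Cplus z (Cmult (RtoC r) (cis t)))) as (p & Hp).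
  - replace (Cminus (Cplus z (Cmult (RtoC r) (cis t))) z) with (Cmult (RtoC r) (cis t)) by ring. rewrite Cmod_rcis; lra.
  - eapply cdiff1_cont; eauto.
Qed.

Lemma cauchy_est (f : C -> C) (z a : C) (r M : R) : 0 < r ->
  (forall w, Cmod (Cminus w z) <= r -> exists p, cdiff1 f w p) -> cdiff1 f z a ->
  (forall w, Cmod (Cminus w z) <= r -> Cmod (f w) <= M) -> Cmod a <= 2 * M / r.
Proof.
  intros Hr Hf Ha HM. pose proof two_PI_pos.
  pose proof (cauchy_deriv f z a r Hr Hf Ha) as E.
  assert (Cmod (Cmult (RtoC (2 * PI * r)) a) <= 2 * ((2 * PI - 0) * M)).
  { rewrite <- E. apply CInt_le; [lra|now apply ex_cauchy|]. intros. rewrite Cmod_mult, Cmod_cis, Rmult_1_r.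
    apply HM. replace (Cminus (Cplus z (Cmult (RtoC r) (cis t))) z) with (Cmult (RtoC r) (cis t)) by ring. rewrite Cmod_rcis; lra. }
  rewrite Cmod_mult, Cmod_RtoC, Rabs_pos_eq in H0 by nra.
  apply Rle_div_r; auto. apply Rmult_le_reg_l with (2 * PI); [lra|]. nra.
Qed.

(** The real mean value theorem is applied to each component, at two different intermediate points;
    hence the factor [2]. *)
Lemma curve_mvt (u : R -> C) (M : R) :
  (forall t, 0 <= t <= 1 -> exists D : C, is_derive (fun t => fst (u t)) t (fst D) /\ is_derive (fun t => snd (u t)) t (snd D) /\ Cmod D <= M) ->
  Cmod (Cminus (u 1) (u 0)) <= 2 * M.
Proof.
  intros H.
  assert (forall (g : R -> R), (forall t, 0 <= t <= 1 -> exists l, is_derive g t l /\ Rabs l <= M) -> Rabs (g 1 - g 0) <= M) as K.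
  { intros g Hg. destruct (MVT_gen g 0 1 (Derive g)) as (c & Hc & E).
    - rewrite Rmin_left, Rmax_right by lra. intros. destruct (Hg x) as (l & Hl & _); [lra|].
      apply Derive_correct. eexists; eauto.
    - rewrite Rmin_left, Rmax_right by lra. intros. destruct (Hg x) as (l & Hl & _); [lra|].
      apply continuity_pt_filterlim, (ex_derive_continuous g). eexists; eauto.
    - rewrite Rmin_left, Rmax_right in Hc by lra. rewrite E. destruct (Hg c Hc) as (l & Hl & Hb).
      rewrite (is_derive_unique _ _ _ Hl). rewrite Rminus_0_r, Rmult_1_r. auto. }
  eapply Rle_trans; [apply Cmod_le_abs|].
  pose proof (K (fun t => fst (u t))) as K1. pose proof (K (fun t => snd (u t))) as K2.
  assert (Rabs (fst (u 1) - fst (u 0)) <= M).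
  { apply K1. intros t Ht. destruct (H t Ht) as (D & D1 & D2 & D3). exists (fst D); split; auto.
    eapply Rle_trans; [apply abs_fst_le|auto]. }
  assert (Rabs (snd (u 1) - snd (u 0)) <= M).
  { apply K2. intros t Ht. destruct (H t Ht) as (D & D1 & D2 & D3). exists (snd D); split; auto.
    eapply Rle_trans; [apply abs_snd_le|auto]. }
  simpl. unfold Rminus in *. lra.
Qed.

Lemma curve_derive (u : R -> C) (t : R) (D : C) :
  (forall eps, 0 < eps -> exists d, 0 < d /\ forall s, Rabs s < d ->
     Cmod (Cminus (u (t + s)) (Cplus (u t) (Cmult (RtoC s) D))) <= eps * Rabs s) ->
  is_derive (fun t => fst (u t)) t (fst D) /\ is_derive (fun t => snd (u t)) t (snd D).
Proof.
  intros H.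
  assert (forall g l, (forall eps, 0 < eps -> exists d, 0 < d /\ forall s, Rabs s < d ->
     Rabs (g (t + s) - (g t + s * l)) <= eps * Rabs s) -> is_derive g t l) as K.
  { intros g l Hg. apply is_derive_Reals. intros eps He. destruct (Hg (eps/2)) as (d & Hd & Kd); [lra|].
    exists (mkposreal d Hd). intros s Hs0 Hs. simpl in Hs. specialize (Kd s Hs).
    replace ((g (t + s) - g t) / s - l) with ((g (t + s) - (g t + s * l)) / s) by (field; auto).
    assert (0 < Rabs s) by (now apply Rabs_pos_lt).
    unfold Rdiv. rewrite Rabs_mult, Rabs_inv.
    apply Rle_lt_trans with (eps / 2 * Rabs s * / Rabs s).
    - apply Rmult_le_compat_r; auto. left. now apply Rinv_0_lt_compat.
    - rewrite Rmult_assoc, Rinv_r by lra. lra. }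
  split; apply K; intros eps He; destruct (H eps He) as (d & Hd & Kd); exists d; split; auto; intros s Hs; specialize (Kd s Hs);
   (eapply Rle_trans; [|exact Kd]); [eapply Rle_trans; [|apply abs_fst_le]|eapply Rle_trans; [|apply abs_snd_le]]; right; f_equal; simpl; ring.
Qed.

Lemma cdiff1_line (f : C -> C) (z h a : C) (t : R) : cdiff1 f (Cplus z (Cmult (RtoC t) h)) a ->
  is_derive (fun t => fst (f (Cplus z (Cmult (RtoC t) h)))) t (fst (Cmult a h)) /\
  is_derive (fun t => snd (f (Cplus z (Cmult (RtoC t) h)))) t (snd (Cmult a h)).
Proof.
  intros H. apply (curve_derive (fun t => f (Cplus z (Cmult (RtoC t) h)))). intros eps He.
  set (m := 1 + Cmod h). pose proof (Cmod_ge_0 h). assert (0 < m) by (unfold m; lra).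
  destruct (H (eps / m)) as (d & Hd & K); [apply Rdiv_lt_0_compat; auto|].
  exists (d / m); split; [apply Rdiv_lt_0_compat; auto|]. intros s Hs.
  apply Rlt_div_r in Hs; auto. specialize (K (Cmult (RtoC s) h)). rewrite Cmod_mult, Cmod_RtoC in K.
  pose proof (Rabs_pos s).
  replace (Cplus z (Cmult (RtoC (t + s)) h)) with (Cplus (Cplus z (Cmult (RtoC t) h)) (Cmult (RtoC s) h)) by (rewrite RtoC_plus; ring).
  replace (Cmult (RtoC s) (Cmult a h)) with (Cmult a (Cmult (RtoC s) h)) by ring.
  eapply Rle_trans; [apply K; unfold m in *; nra|].
  assert (eps / m * m = eps) by (field; lra). assert (0 < eps / m) by (apply Rdiv_lt_0_compat; auto).
  rewrite <- H3 at 2. rewrite Rmult_assoc. apply Rmult_le_compat_l; [lra|]. unfold m. nra.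
Qed.

Lemma cdiff1_mvt (f : C -> C) (z h : C) (M : R) :
  (forall t, 0 <= t <= 1 -> exists a, cdiff1 f (Cplus z (Cmult (RtoC t) h)) a /\ Cmod a <= M) ->
  Cmod (Cminus (f (Cplus z h)) (f z)) <= 2 * M * Cmod h.
Proof.
  intros H.
  pose proof (curve_mvt (fun t => f (Cplus z (Cmult (RtoC t) h))) (M * Cmod h)) as K. cbv beta in K.
  replace (Cplus z (Cmult (RtoC 1) h)) with (Cplus z h) in K by ring.
  replace (Cplus z (Cmult (RtoC 0) h)) with z in K by ring.
  rewrite Rmult_assoc. apply K. intros t Ht. destruct (H t Ht) as (a & Ha & Hb).
  exists (Cmult a h). destruct (cdiff1_line f z h a t Ha). split; [assumption|split; [assumption|]].
  rewrite Cmod_mult. apply Rmult_le_compat_r; auto using Cmod_ge_0.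
Qed.

(** * Morera's theorem *)

Lemma CInt_swap (f : R -> C) (a b : R) : exCInt f b a -> CInt f a b = Copp (CInt f b a).
Proof.
  intros [H1 H2]. apply C_ext; simpl.
  - rewrite <- (opp_RInt_swap (V:=R_CompleteNormedModule) (fun t => fst (f t))); auto.
  - rewrite <- (opp_RInt_swap (V:=R_CompleteNormedModule) (fun t => snd (f t))); auto.
Qed.

Lemma ex_CInt_all (f : R -> C) (a b : R) : (forall t, ccont f t) -> exCInt f a b.
Proof.
  intros H. split; apply (@ex_RInt_continuous R_CompleteNormedModule); intros; apply ccont_re_im; auto.
Qed.

Lemma CInt_le_abs (f : R -> C) (a b M : R) : (forall t, ccont f t) ->
  (forall t, Rabs (t - a) <= Rabs (b - a) -> Cmod (f t) <= M) -> Cmod (CInt f a b) <= 2 * (Rabs (b - a) * M).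
Proof.
  intros Hc H. destruct (Rle_dec a b).
  - rewrite (Rabs_pos_eq (b - a)) in * by lra. apply CInt_le; auto using ex_CInt_all.
    intros. apply H. rewrite Rabs_pos_eq; lra.
  - rewrite CInt_swap by (apply ex_CInt_all; auto). rewrite Cmod_opp.
    rewrite (Rabs_left (b - a)) in * by lra. replace (- (b - a)) with (a - b) in * by ring.
    apply CInt_le; auto using ex_CInt_all; [lra|].
    intros. apply H. rewrite Rabs_left1; lra.
Qed.

(** Allows reversed and degenerate rectangles, so that the increment of the primitive can be
    computed at any point and in any direction without distinguishing signs. *)
Lemma rectint0_all (F : C -> C) : (forall z, ccontC F z) ->
  (forall a b c d, a < b -> c < d -> rectint F a b c d = RtoC 0) -> forall a b c d, rectint F a b c d = RtoC 0.
Proof.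
  intros Hc H.
  assert (Hh : forall y t, ccont (fun x => F (x, y)) t) by (intros; apply ccont_hor, Hc).
  assert (Hv : forall y t, ccont (fun x => F (y, x)) t) by (intros; apply ccont_ver, Hc).
  assert (Hp : forall f a, (forall t, ccont f t) -> CInt f a a = RtoC 0).
  { intros f a Hf. apply C_ext; simpl; apply (RInt_point (V:=R_CompleteNormedModule)). }
  assert (S1 : forall a b c d, rectint F b a c d = Copp (rectint F a b c d)).
  { intros. unfold rectint. rewrite (CInt_swap _ b a), (CInt_swap _ b a) by (apply ex_CInt_all; auto). ring. }
  assert (S2 : forall a b c d, rectint F a b d c = Copp (rectint F a b c d)).
  { intros. unfold rectint. rewrite (CInt_swap _ d c), (CInt_swap _ d c) by (apply ex_CInt_all; auto). ring. }
  assert (Z1 : forall a c d, rectint F a a c d = RtoC 0).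
  { intros. unfold rectint. rewrite !Hp by auto. ring. }
  assert (Z2 : forall a b c, rectint F a b c c = RtoC 0).
  { intros. unfold rectint. rewrite !Hp by auto. ring. }
  intros a b c d. destruct (Rtotal_order a b) as [Hab|[->|Hab]]; auto; destruct (Rtotal_order c d) as [Hcd|[->|Hcd]]; auto.
  - rewrite S2, H by lra. ring.
  - rewrite S1, H by lra. ring.
  - rewrite S1, S2, H by lra. ring.
Qed.

Lemma morera_primitive (F : C -> C) : (forall z, ccontC F z) ->
  (forall a b c d, a < b -> c < d -> rectint F a b c d = RtoC 0) -> exists G, forall z, cdiff1 G z (F z).
Proof.
  intros Hc H. pose proof (rectint0_all F Hc H) as H0.
  assert (Hh : forall y t, ccont (fun x => F (x, y)) t) by (intros; apply ccont_hor, Hc).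
  assert (Hv : forall y t, ccont (fun x => F (y, x)) t) by (intros; apply ccont_ver, Hc).
  assert (Eh : forall y a b, exCInt (fun x => F (x, y)) a b) by (intros; apply ex_CInt_all; auto).
  assert (Ev : forall y a b, exCInt (fun x => F (y, x)) a b) by (intros; apply ex_CInt_all; auto).
  (* The primitive integrates from [0] along the real axis and then vertically. *)
  exists (fun z => Cplus (CInt (fun t => F (t, 0)) 0 (fst z)) (Cmult Ci (CInt (fun s => F (fst z, s)) 0 (snd z)))).
  intros [x y] eps He. destruct (Hc (x, y) (eps/4)) as (d & Hd & K); [lra|].
  exists (d/2); split; [lra|]. intros [p q] Hpq. simpl.
  pose proof (abs_fst_le (p, q)). pose proof (abs_snd_le (p, q)). simpl in H1, H2.
  (* The vanishing integral over the rectangle between the real axis and height [y] moves the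
     horizontal increment from height [0] to height [y]. After that only values of [F] near [(x, y)]
     are left. *)
  pose proof (H0 x (x + p) 0 y) as R. unfold rectint in R.
  assert (E : Cminus (Cplus (CInt (fun t => F (t, 0)) 0 (x + p)) (Cmult Ci (CInt (fun s => F (x + p, s)) 0 (y + q))))
     (Cplus (Cplus (CInt (fun t => F (t, 0)) 0 x) (Cmult Ci (CInt (fun s => F (x, s)) 0 y))) (Cmult (F (x, y)) (p, q)))
    = Cplus (CInt (fun t => Cminus (F (t, y)) (F (x, y))) x (x + p)) (Cmult Ci (CInt (fun s => Cminus (F (x + p, s)) (F (x, y))) y (y + q)))).
  { rewrite <- (CInt_Chasles (fun t => F (t, 0)) 0 x (x + p)) by auto.
    rewrite <- (CInt_Chasles (fun t => F (x + p, t)) 0 y (y + q)) by auto.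
    rewrite !CInt_minus, !CInt_const by (auto; apply exCInt_const).
    set (A := CInt (fun t => F (t, 0)) x (x + p)) in *. set (B := CInt (fun t => F (t, y)) x (x + p)) in *.
    set (D := CInt (fun t => F (x + p, t)) 0 y) in *. set (E' := CInt (fun t => F (x, t)) 0 y) in *.
    replace ((p, q) : C) with (Cplus (RtoC p) (Cmult Ci (RtoC q))) by (apply C_ext; simpl; ring).
    replace (x + p - x) with p by ring. replace (y + q - y) with q by ring.
    assert (R' : A = Cminus B (Cmult Ci (Cminus D E'))).
    { transitivity (Cplus (Cplus (Cminus A B) (Cmult Ci (Cminus D E'))) (Cminus B (Cmult Ci (Cminus D E')))); [ring|]. rewrite R. ring. }
    rewrite R'. ring. }
  rewrite E. eapply Rle_trans; [apply Cmod_triangle|]. rewrite Cmod_mult, Cmod_Ci, Rmult_1_l.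
  assert (B1 : Cmod (CInt (fun t => Cminus (F (t, y)) (F (x, y))) x (x + p)) <= 2 * (Rabs (x + p - x) * (eps / 4))).
  { apply CInt_le_abs.
    - intros. apply ccont_plus; auto. apply ccont_const.
    - intros t Ht. left. apply K. replace (x + p - x) with p in Ht by ring.
      replace (Cminus (t, y) (x, y)) with (RtoC (t - x)) by (apply C_ext; simpl; ring). rewrite Cmod_RtoC. lra. }
  assert (B2 : Cmod (CInt (fun s => Cminus (F (x + p, s)) (F (x, y))) y (y + q)) <= 2 * (Rabs (y + q - y) * (eps / 4))).
  { apply CInt_le_abs.
    - intros. apply ccont_plus; [apply (Hv (x + p))|]. apply ccont_const.
    - intros t Ht. left. apply K. replace (y + q - y) with q in Ht by ring.
      eapply Rle_lt_trans; [apply Cmod_le_abs|]. simpl. replace (x + p + - x) with p by ring. unfold Rminus in Ht. lra. }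
  replace (x + p - x) with p in B1 by ring. replace (y + q - y) with q in B2 by ring.
  pose proof (Rmult_le_compat_r (eps/4) _ _ ltac:(lra) H1). pose proof (Rmult_le_compat_r (eps/4) _ _ ltac:(lra) H2). lra.
Qed.

(** The derivative of an entire function is holomorphic because Cauchy's formula on unit circles can
    be differentiated under the integral. That needs a quadratic remainder for [G], uniform on the
    circle. It is bootstrapped: [F] bounded makes [G] Lipschitz, Cauchy's formula then makes [F]
    Lipschitz, and this bounds the remainder of [G]. *)
Lemma primitive_holo (G F : C -> C) : (forall z, cdiff1 G z (F z)) ->
  (forall M, exists B, forall z, Cmod z <= M -> Cmod (F z) <= B) -> forall z, exists a, cdiff1 F z a.
Proof.
  intros HG HB z0. pose proof two_PI_pos as HPI.
  assert (HG' : forall z w, Cmod (Cminus w z) <= 1 -> exists p, cdiff1 G w p) by (intros; eexists; apply HG).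
  set (T := fun f z => CInt (fun y => Cmult (f (Cplus z (Cmult (RtoC 1) (cis y)))) (cis (- y))) 0 (2 * PI)).
  assert (EF : forall z, T G z = Cmult (RtoC (2 * PI)) (F z)).
  { intros z. unfold T. rewrite (cauchy_deriv G z (F z) 1 Rlt_0_1 (HG' z) (HG z)). now rewrite Rmult_1_r. }
  assert (Tc : forall f, (forall z, ccontC f z) -> forall z, exCInt (fun y => Cmult (f (Cplus z (Cmult (RtoC 1) (cis y)))) (cis (- y))) 0 (2 * PI)).
  { intros f Hf z. apply ex_CInt_all. intros. apply ccont_mult; [apply ccont_circle; auto|apply ccont_cis_neg]. }
  assert (GC : forall z, ccontC G z) by (intros; eapply cdiff1_cont, HG).
  destruct (HB (Cmod z0 + 4)) as (B & HBb).
  assert (0 <= B). { eapply Rle_trans; [apply (Cmod_ge_0 (F z0))|apply HBb; lra]. }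
  assert (Glip : forall w h, Cmod w <= Cmod z0 + 3 -> Cmod h <= 1 -> Cmod (Cminus (G (Cplus w h)) (G w)) <= 2 * B * Cmod h).
  { intros w h Hw Hh. apply cdiff1_mvt. intros t Ht. eexists; split; [apply HG|]. apply HBb.
    eapply Rle_trans; [apply Cmod_triangle|]. rewrite Cmod_mult, Cmod_RtoC, Rabs_pos_eq by lra. pose proof (Cmod_ge_0 h). nra. }
  assert (Flip : forall z h, Cmod z <= Cmod z0 + 2 -> Cmod h <= 1 -> Cmod (Cminus (F (Cplus z h)) (F z)) <= 4 * B * Cmod h).
  { intros z h Hz Hh.
    assert (Cmod (Cminus (T G (Cplus z h)) (T G z)) <= 2 * ((2 * PI - 0) * (2 * B * Cmod h))).
    { unfold T. rewrite <- CInt_minus by auto. apply CInt_le; [lra|apply exCInt_minus; auto|].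
      intros y _.
      replace (Cminus (Cmult (G (Cplus (Cplus z h) (Cmult (RtoC 1) (cis y)))) (cis (- y))) (Cmult (G (Cplus z (Cmult (RtoC 1) (cis y)))) (cis (- y))))
       with (Cmult (Cminus (G (Cplus (Cplus z (Cmult (RtoC 1) (cis y))) h)) (G (Cplus z (Cmult (RtoC 1) (cis y))))) (cis (- y))).
      - rewrite Cmod_mult, Cmod_cis, Rmult_1_r. apply Glip; auto.
        eapply Rle_trans; [apply Cmod_triangle|]. rewrite Cmod_rcis; lra.
      - replace (Cplus (Cplus z h) (Cmult (RtoC 1) (cis y))) with (Cplus (Cplus z (Cmult (RtoC 1) (cis y))) h) by ring. ring. }
    rewrite !EF in H0. replace (Cminus (Cmult (RtoC (2 * PI)) (F (Cplus z h))) (Cmult (RtoC (2 * PI)) (F z))) with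
     (Cmult (RtoC (2 * PI)) (Cminus (F (Cplus z h)) (F z))) in H0 by ring.
    rewrite Cmod_mult, Cmod_RtoC, Rabs_pos_eq in H0 by lra. apply Rmult_le_reg_l with (2 * PI); lra. }
  (* The mean value bound for [v |-> G v - F w * v], whose derivative [F v - F w] is small by
     [Flip]. *)
  assert (Grem : forall w h, Cmod w <= Cmod z0 + 2 -> Cmod h <= 1 -> Cmod (Cminus (G (Cplus w h)) (Cplus (G w) (Cmult (F w) h))) <= 8 * B * (Cmod h * Cmod h)).
  { intros w h Hw Hh.
    set (g := fun v => Cplus (G v) (Cplus (Cmult (Copp (F w)) v) (RtoC 0))).
    assert (Cmod (Cminus (g (Cplus w h)) (g w)) <= 2 * (4 * B * Cmod h) * Cmod h).
    { apply cdiff1_mvt. intros t Ht. exists (Cplus (F (Cplus w (Cmult (RtoC t) h))) (Copp (F w))). split.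
      - unfold g. apply cdiff1_plus; [apply HG|apply cdiff1_affine].
      - change (Cmod (Cminus (F (Cplus w (Cmult (RtoC t) h))) (F w)) <= 4 * B * Cmod h).
        assert (Cmod (Cmult (RtoC t) h) <= Cmod h).
        { rewrite Cmod_mult, Cmod_RtoC, Rabs_pos_eq by lra. pose proof (Cmod_ge_0 h). nra. }
        eapply Rle_trans; [apply Flip; lra|]. apply Rmult_le_compat_l; lra. }
    unfold g in H0.
    match type of H0 with Cmod ?X <= _ => replace X with (Cminus (G (Cplus w h)) (Cplus (G w) (Cmult (F w) h))) in H0 by ring end. lra. }
  assert (FC : forall z, Cmod z <= Cmod z0 + 1 -> ccontC F z).
  { intros z Hz eps He. exists (Rmin 1 (eps / (4 * B + 1))). split; [apply Rmin_pos; [lra|apply Rdiv_lt_0_compat; lra]|].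
    intros w Hw. pose proof (Rlt_le_trans _ _ _ Hw (Rmin_l _ _)). pose proof (Rlt_le_trans _ _ _ Hw (Rmin_r _ _)).
    apply Rlt_div_r in H1; [|lra]. pose proof (Flip z (Cminus w z) ltac:(lra) ltac:(lra)).
    replace (Cplus z (Cminus w z)) with w in H2 by ring. pose proof (Cmod_ge_0 (Cminus w z)). nra. }
  exists (Cmult (RtoC (/ (2 * PI))) (T F z0)). intros eps He.
  exists (Rmin 1 (eps / (16 * B + 1))). split; [apply Rmin_pos; [lra|apply Rdiv_lt_0_compat; lra]|].
  intros h Hh. pose proof (Rlt_le_trans _ _ _ Hh (Rmin_l _ _)). pose proof (Rlt_le_trans _ _ _ Hh (Rmin_r _ _)).
  apply Rlt_div_r in H1; [|lra]. pose proof (Cmod_ge_0 h).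
  apply Rmult_le_reg_l with (2 * PI); [lra|].
  rewrite <- (Rabs_pos_eq (2 * PI)) at 1 by lra. rewrite <- Cmod_RtoC, <- Cmod_mult.
  assert (XF : exCInt (fun y => Cmult (F (Cplus z0 (Cmult (RtoC 1) (cis y)))) (cis (- y))) 0 (2 * PI)).
  { apply ex_CInt_all. intros. apply ccont_mult; [apply ccont_circle, FC|apply ccont_cis_neg].
    eapply Rle_trans; [apply Cmod_triangle|]. rewrite Cmod_rcis; lra. }
  assert (E : Cmult (RtoC (2 * PI)) (Cminus (F (Cplus z0 h)) (Cplus (F z0) (Cmult (Cmult (RtoC (/ (2 * PI))) (T F z0)) h)))
    = CInt (fun y => Cminus (Cminus (Cmult (G (Cplus (Cplus z0 h) (Cmult (RtoC 1) (cis y)))) (cis (- y))) (Cmult (G (Cplus z0 (Cmult (RtoC 1) (cis y)))) (cis (- y))))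
       (Cmult h (Cmult (F (Cplus z0 (Cmult (RtoC 1) (cis y)))) (cis (- y))))) 0 (2 * PI)).
  { rewrite CInt_minus; [|apply exCInt_minus; auto|now apply exCInt_scal]. rewrite CInt_minus by auto. rewrite CInt_scal by auto.
    fold (T G (Cplus z0 h)) (T G z0) (T F z0). rewrite !EF.
    transitivity (Cminus (Cminus (Cmult (RtoC (2 * PI)) (F (Cplus z0 h))) (Cmult (RtoC (2 * PI)) (F z0))) (Cmult (Cmult (RtoC (2 * PI)) (RtoC (/ (2 * PI)))) (Cmult h (T F z0)))); [ring|].
    rewrite <- RtoC_mult, Rinv_r by lra. ring. }
  rewrite E. apply Rle_trans with (2 * ((2 * PI - 0) * (8 * B * (Cmod h * Cmod h)))).
  - apply CInt_le; [lra| |].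
    { apply exCInt_minus; [apply exCInt_minus; auto|now apply exCInt_scal]. }
    intros y _. set (w := Cplus z0 (Cmult (RtoC 1) (cis y))).
    replace (Cplus (Cplus z0 h) (Cmult (RtoC 1) (cis y))) with (Cplus w h) by (unfold w; ring).
    replace (Cminus (Cminus (Cmult (G (Cplus w h)) (cis (- y))) (Cmult (G w) (cis (- y)))) (Cmult h (Cmult (F w) (cis (- y)))))
      with (Cmult (Cminus (G (Cplus w h)) (Cplus (G w) (Cmult (F w) h))) (cis (- y))) by ring.
    rewrite Cmod_mult, Cmod_cis, Rmult_1_r. apply Grem; [|lra]. unfold w.
    eapply Rle_trans; [apply Cmod_triangle|]. rewrite Cmod_rcis; lra.
  - replace (2 * ((2 * PI - 0) * (8 * B * (Cmod h * Cmod h)))) with (2 * PI * (Cmod h * (16 * B * Cmod h))) by ring.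
    apply Rmult_le_compat_l; [lra|]. rewrite (Rmult_comm eps). apply Rmult_le_compat_l; [lra|]. nra.
Qed.

Lemma morera (F : C -> C) : (forall z, ccontC F z) ->
  (forall M, exists B, forall z, Cmod z <= M -> Cmod (F z) <= B) ->
  (forall a b c d, a < b -> c < d -> rectint F a b c d = RtoC 0) -> forall z, exists a, cdiff1 F z a.
Proof.
  intros Hc HB H. destruct (morera_primitive F Hc H) as (G & HG). eapply primitive_holo; eauto.
Qed.

(** * Functions with locally Lipschitz real differential *)

(* [d z u] is the real differential of [f] at [(z, u)]; remainder, size and Lipschitz bounds are all quantitative,
   so that the class is stable under integration with respect to parameters. *)
Definition C11 (f : C -> C -> C) (d : C -> C -> C -> C -> C) : Prop :=
  (forall z u h k h' k', d z u (Cplus h h') (Cplus k k') = Cplus (d z u h k) (d z u h' k')) /\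
  (forall z u (c : R) h k, d z u (Cmult (RtoC c) h) (Cmult (RtoC c) k) = Cmult (RtoC c) (d z u h k)) /\
  forall M, exists L, 0 <= L /\ forall z u h k, Cmod z <= M -> Cmod u <= M -> Cmod h <= M -> Cmod k <= M ->
    Cmod (f z u) <= L /\
    Cmod (Cminus (f (Cplus z h) (Cplus u k)) (Cplus (f z u) (d z u h k))) <= L * ((Cmod h + Cmod k) * (Cmod h + Cmod k)) /\
    forall a b, Cmod (d z u a b) <= L * (Cmod a + Cmod b) /\
      Cmod (Cminus (d (Cplus z h) (Cplus u k) a b) (d z u a b)) <= L * (Cmod h + Cmod k) * (Cmod a + Cmod b).

Lemma C11_intro (f : C -> C -> C) (d : C -> C -> C -> C -> C) :
  (forall z u h k h' k', d z u (Cplus h h') (Cplus k k') = Cplus (d z u h k) (d z u h' k')) ->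
  (forall z u (c : R) h k, d z u (Cmult (RtoC c) h) (Cmult (RtoC c) k) = Cmult (RtoC c) (d z u h k)) ->
  (forall M, 0 <= M -> exists L, 0 <= L /\ forall z u h k, Cmod z <= M -> Cmod u <= M -> Cmod h <= M -> Cmod k <= M ->
    Cmod (f z u) <= L /\
    Cmod (Cminus (f (Cplus z h) (Cplus u k)) (Cplus (f z u) (d z u h k))) <= L * ((Cmod h + Cmod k) * (Cmod h + Cmod k)) /\
    forall a b, Cmod (d z u a b) <= L * (Cmod a + Cmod b) /\
      Cmod (Cminus (d (Cplus z h) (Cplus u k) a b) (d z u a b)) <= L * (Cmod h + Cmod k) * (Cmod a + Cmod b)) ->
  C11 f d.
Proof.
  intros H1 H2 H3. split; [exact H1|split; [exact H2|]]. intros M. destruct (Rle_dec 0 M); auto.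
  exists 0; split; [lra|]. intros z u h k Hz. pose proof (Cmod_ge_0 z). lra.
Qed.

Lemma C11_ext (f f' : C -> C -> C) (d d' : C -> C -> C -> C -> C) :
  (forall z u, f z u = f' z u) -> (forall z u h k, d z u h k = d' z u h k) -> C11 f d -> C11 f' d'.
Proof.
  intros Ef Ed (H1 & H2 & H3). split; [|split].
  - intros. rewrite <- !Ed. apply H1.
  - intros. rewrite <- !Ed. apply H2.
  - intros M. destruct (H3 M) as (L & HL & K). exists L; split; auto. intros z u h k Hz Hu Hh Hk.
    destruct (K z u h k Hz Hu Hh Hk) as (K1 & K2 & K3). rewrite <- !Ef, <- !Ed. split; auto. split; auto.
    intros a b. rewrite <- !Ed. auto.
Qed.

Lemma C11_const (c : C) : C11 (fun _ _ => c) (fun _ _ _ _ => RtoC 0).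
Proof.
  apply C11_intro; intros; try ring. exists (Cmod c); split; [apply Cmod_ge_0|].
  intros z u h k _ _ _ _. pose proof (Cmod_ge_0 c). pose proof (Cmod_ge_0 h). pose proof (Cmod_ge_0 k).
  split; [lra|]. split.
  - replace (Cminus c (Cplus c (RtoC 0))) with (RtoC 0) by ring. rewrite Cmod_0.
    apply Rmult_le_pos; [lra|]. nra.
  - intros a b. pose proof (Cmod_ge_0 a). pose proof (Cmod_ge_0 b).
    replace (Cminus (RtoC 0) (RtoC 0)) with (RtoC 0) by ring. rewrite Cmod_0.
    split; repeat apply Rmult_le_pos; lra.
Qed.

Lemma C11_linear (l : C -> C -> C) (B : R) :
  (forall h k h' k', l (Cplus h h') (Cplus k k') = Cplus (l h k) (l h' k')) ->
  (forall (c : R) h k, l (Cmult (RtoC c) h) (Cmult (RtoC c) k) = Cmult (RtoC c) (l h k)) ->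
  0 <= B -> (forall h k, Cmod (l h k) <= B * (Cmod h + Cmod k)) -> C11 l (fun _ _ => l).
Proof.
  intros Ha Hs HB Hb. apply C11_intro; auto. intros M HM. exists (B * (2 * M) + B); split; [nra|].
  intros z u h k Hz Hu Hh Hk. pose proof (Cmod_ge_0 h). pose proof (Cmod_ge_0 k).
  assert (0 <= B * (2 * M)) by nra.
  split; [|split].
  - eapply Rle_trans; [apply Hb|]. nra.
  - rewrite Ha. replace (Cminus (Cplus (l z u) (l h k)) (Cplus (l z u) (l h k))) with (RtoC 0) by ring. rewrite Cmod_0.
    apply Rmult_le_pos; nra.
  - intros a b. pose proof (Cmod_ge_0 a). pose proof (Cmod_ge_0 b). split.
    + eapply Rle_trans; [apply Hb|]. apply Rmult_le_compat_r; lra.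
    + replace (Cminus (l a b) (l a b)) with (RtoC 0) by ring. rewrite Cmod_0.
      repeat apply Rmult_le_pos; lra.
Qed.

Lemma C11_fst : C11 (fun z _ => z) (fun _ _ h _ => h).
Proof.
  apply (C11_linear (fun h _ => h) 1); auto; [lra|]. intros. pose proof (Cmod_ge_0 k). lra.
Qed.

Lemma C11_snd : C11 (fun _ u => u) (fun _ _ _ k => k).
Proof.
  apply (C11_linear (fun _ k => k) 1); auto; [lra|]. intros. pose proof (Cmod_ge_0 h). lra.
Qed.

(** An outer function of two variables makes this single chain rule cover sums, products, conjugates
    and exponentials. The remainder of the composite is that of [g] at the true increments [p1],
    [p2], plus the differential of [g] applied to the remainders [e1], [e2]. *)
Lemma C11_comp (g f1 f2 : C -> C -> C) (dg d1 d2 : C -> C -> C -> C -> C) :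
  C11 g dg -> C11 f1 d1 -> C11 f2 d2 ->
  C11 (fun z u => g (f1 z u) (f2 z u)) (fun z u h k => dg (f1 z u) (f2 z u) (d1 z u h k) (d2 z u h k)).
Proof.
  intros (A0 & S0 & E0) (A1 & S1 & E1) (A2 & S2 & E2). apply C11_intro.
  - intros. now rewrite A1, A2, A0.
  - intros. now rewrite S1, S2, S0.
  - intros M HM. destruct (E1 M) as (L1 & HL1 & B1). destruct (E2 M) as (L2 & HL2 & B2).
    (* Lipschitz constants of [f1] and [f2]: the increments satisfy [s <= 2 M], so a quadratic
       remainder [L s^2] is at most [2 M L s]. [M'] then dominates both the values and the
       increments fed to [g]. *)
    set (K1 := L1 * (1 + 2 * M)). set (K2 := L2 * (1 + 2 * M)).
    assert (HK1 : L1 <= K1) by (unfold K1; nra). assert (HK2 : L2 <= K2) by (unfold K2; nra).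
    set (M' := L1 + L2 + (K1 + K2) * (2 * M)).
    destruct (E0 M') as (G & HG & B0).
    assert (HGK : 0 <= G * ((K1 + K2) * (K1 + K2))) by (apply Rmult_le_pos; nra).
    assert (HGL : 0 <= G * (L1 + L2)) by (apply Rmult_le_pos; lra).
    exists (G + G * ((K1 + K2) * (K1 + K2)) + G * (L1 + L2)). split; [lra|].
    intros z u h k Hz Hu Hh Hk.
    destruct (B1 z u h k Hz Hu Hh Hk) as (F1 & R1 & D1). destruct (B2 z u h k Hz Hu Hh Hk) as (F2 & R2 & D2).
    pose proof (Cmod_ge_0 h). pose proof (Cmod_ge_0 k).
    set (s := Cmod h + Cmod k) in *. assert (Hs : 0 <= s <= 2 * M) by (unfold s; lra).
    set (x1 := f1 z u) in *. set (x2 := f2 z u) in *. set (y1 := f1 (Cplus z h) (Cplus u k)) in *. set (y2 := f2 (Cplus z h) (Cplus u k)) in *.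
    set (e1 := Cminus y1 (Cplus x1 (d1 z u h k))) in *. set (e2 := Cminus y2 (Cplus x2 (d2 z u h k))) in *.
    destruct (D1 h k) as (D1a & _). destruct (D2 h k) as (D2a & _). fold s in D1a, D2a.
    set (p1 := Cplus (d1 z u h k) e1). set (p2 := Cplus (d2 z u h k) e2).
    assert (Ey1 : y1 = Cplus x1 p1) by (unfold p1, e1; ring). assert (Ey2 : y2 = Cplus x2 p2) by (unfold p2, e2; ring).
    assert (P1 : Cmod p1 <= K1 * s).
    { unfold p1. eapply Rle_trans; [apply Cmod_triangle|]. unfold K1.
      assert (L1 * (s * s) <= L1 * (s * (2 * M))) by (apply Rmult_le_compat_l; nra). lra. }
    assert (P2 : Cmod p2 <= K2 * s).
    { unfold p2. eapply Rle_trans; [apply Cmod_triangle|]. unfold K2.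
      assert (L2 * (s * s) <= L2 * (s * (2 * M))) by (apply Rmult_le_compat_l; nra). lra. }
    assert (Q1 : K1 * s <= K1 * (2 * M)) by (apply Rmult_le_compat_l; lra).
    assert (Q2 : K2 * s <= K2 * (2 * M)) by (apply Rmult_le_compat_l; lra).
    assert (Q3 : 0 <= K1 * (2 * M)) by (apply Rmult_le_pos; lra).
    assert (Q4 : 0 <= K2 * (2 * M)) by (apply Rmult_le_pos; lra).
    destruct (B0 x1 x2 p1 p2) as (G1 & G2 & G3); try (unfold M'; lra).
    rewrite <- Ey1, <- Ey2 in G2, G3.
    assert (Q5 : Cmod p1 + Cmod p2 <= (K1 + K2) * s) by lra.
    assert (Q5' : 0 <= Cmod p1 + Cmod p2) by (pose proof (Cmod_ge_0 p1); pose proof (Cmod_ge_0 p2); lra).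
    split; [lra|]. split.
    + destruct (G3 e1 e2) as (G3a & _).
      replace (Cminus (g y1 y2) (Cplus (g x1 x2) (dg x1 x2 (d1 z u h k) (d2 z u h k)))) with
        (Cplus (Cminus (g y1 y2) (Cplus (g x1 x2) (dg x1 x2 p1 p2))) (dg x1 x2 e1 e2)) by (unfold p1, p2; rewrite A0; ring).
      eapply Rle_trans; [apply Cmod_triangle|].
      assert (G * ((Cmod p1 + Cmod p2) * (Cmod p1 + Cmod p2)) <= G * ((K1 + K2) * s * ((K1 + K2) * s))).
      { apply Rmult_le_compat_l; auto. apply Rmult_le_compat; auto. }
      assert (G * (Cmod e1 + Cmod e2) <= G * ((L1 + L2) * (s * s))) by (apply Rmult_le_compat_l; lra).
      assert (0 <= G * (s * s)) by (apply Rmult_le_pos; nra). nra.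
    + intros a b. pose proof (Cmod_ge_0 a). pose proof (Cmod_ge_0 b). set (al := Cmod a + Cmod b) in *.
      assert (Hal : 0 <= al) by (unfold al; lra).
      destruct (D1 a b) as (U1 & V1). destruct (D2 a b) as (U2 & V2). fold al in U1, V1, U2, V2.
      split.
      * destruct (G3 (d1 z u a b) (d2 z u a b)) as (G3a & _). eapply Rle_trans; [exact G3a|].
        assert (G * (Cmod (d1 z u a b) + Cmod (d2 z u a b)) <= G * ((L1 + L2) * al)) by (apply Rmult_le_compat_l; lra).
        assert (0 <= (G + G * ((K1 + K2) * (K1 + K2))) * al) by (apply Rmult_le_pos; lra). lra.
      * set (a1 := d1 (Cplus z h) (Cplus u k) a b) in *. set (a2 := d2 (Cplus z h) (Cplus u k) a b) in *.
        set (b1 := d1 z u a b) in *. set (b2 := d2 z u a b) in *.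
        assert (W1 : Cmod a1 <= K1 * al).
        { replace a1 with (Cplus (Cminus a1 b1) b1) by ring. eapply Rle_trans; [apply Cmod_triangle|].
          unfold K1. assert (L1 * s * al <= L1 * (2 * M) * al) by (apply Rmult_le_compat_r; [lra|]; apply Rmult_le_compat_l; lra). lra. }
        assert (W2 : Cmod a2 <= K2 * al).
        { replace a2 with (Cplus (Cminus a2 b2) b2) by ring. eapply Rle_trans; [apply Cmod_triangle|].
          unfold K2. assert (L2 * s * al <= L2 * (2 * M) * al) by (apply Rmult_le_compat_r; [lra|]; apply Rmult_le_compat_l; lra). lra. }
        destruct (G3 a1 a2) as (_ & G3a). destruct (G3 (Cminus a1 b1) (Cminus a2 b2)) as (G3b & _).
        assert (E : dg x1 x2 a1 a2 = Cplus (dg x1 x2 (Cminus a1 b1) (Cminus a2 b2)) (dg x1 x2 b1 b2)).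
        { rewrite <- A0. f_equal; ring. }
        replace (Cminus (dg y1 y2 a1 a2) (dg x1 x2 b1 b2)) with (Cplus (Cminus (dg y1 y2 a1 a2) (dg x1 x2 a1 a2)) (dg x1 x2 (Cminus a1 b1) (Cminus a2 b2))) by (rewrite E; ring).
        eapply Rle_trans; [apply Cmod_triangle|].
        assert (G * (Cmod p1 + Cmod p2) * (Cmod a1 + Cmod a2) <= G * ((K1 + K2) * s) * ((K1 + K2) * al)).
        { apply Rmult_le_compat; try lra.
          - apply Rmult_le_pos; lra.
          - pose proof (Cmod_ge_0 a1); pose proof (Cmod_ge_0 a2); lra.
          - apply Rmult_le_compat_l; lra. }
        assert (G * (Cmod (Cminus a1 b1) + Cmod (Cminus a2 b2)) <= G * ((L1 + L2) * s * al)) by (apply Rmult_le_compat_l; lra).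
        assert (0 <= G * (s * al)) by (apply Rmult_le_pos; nra). nra.
Qed.

Lemma C11_plus (f1 f2 : C -> C -> C) (d1 d2 : C -> C -> C -> C -> C) : C11 f1 d1 -> C11 f2 d2 ->
  C11 (fun z u => Cplus (f1 z u) (f2 z u)) (fun z u h k => Cplus (d1 z u h k) (d2 z u h k)).
Proof.
  intros H1 H2. apply (C11_comp Cplus f1 f2 (fun _ _ => Cplus) d1 d2); auto.
  apply (C11_linear Cplus 1); intros; try ring; [lra|]. rewrite Rmult_1_l. apply Cmod_triangle.
Qed.

Lemma C11_mult (f1 f2 : C -> C -> C) (d1 d2 : C -> C -> C -> C -> C) : C11 f1 d1 -> C11 f2 d2 ->
  C11 (fun z u => Cmult (f1 z u) (f2 z u)) (fun z u h k => Cplus (Cmult (d1 z u h k) (f2 z u)) (Cmult (f1 z u) (d2 z u h k))).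
Proof.
  intros H1 H2. apply (C11_comp Cmult f1 f2 (fun z u h k => Cplus (Cmult h u) (Cmult z k)) d1 d2); auto.
  apply C11_intro; intros; try ring. exists (M * M + M + 1). split; [nra|].
  intros z u h k Hz Hu Hh Hk.
  pose proof (Cmod_ge_0 h). pose proof (Cmod_ge_0 k). pose proof (Cmod_ge_0 z). pose proof (Cmod_ge_0 u).
  split; [|split].
  - rewrite Cmod_mult. nra.
  - replace (Cminus (Cmult (Cplus z h) (Cplus u k)) (Cplus (Cmult z u) (Cplus (Cmult h u) (Cmult z k)))) with (Cmult h k) by ring.
    rewrite Cmod_mult. apply Rle_trans with (1 * ((Cmod h + Cmod k) * (Cmod h + Cmod k))); [nra|].
    apply Rmult_le_compat_r; nra.
  - intros a b. pose proof (Cmod_ge_0 a). pose proof (Cmod_ge_0 b). split.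
    + eapply Rle_trans; [apply Cmod_triangle|]. rewrite !Cmod_mult.
      assert (Cmod a * Cmod u <= Cmod a * M) by (apply Rmult_le_compat_l; lra).
      assert (Cmod z * Cmod b <= M * Cmod b) by (apply Rmult_le_compat_r; lra).
      assert (0 <= (M * M + 1) * (Cmod a + Cmod b)) by (apply Rmult_le_pos; nra). nra.
    + match goal with |- Cmod ?X <= _ => replace X with (Cplus (Cmult a k) (Cmult h b)) by ring end.
      eapply Rle_trans; [apply Cmod_triangle|]. rewrite !Cmod_mult.
      assert (0 <= (M * M + M) * ((Cmod h + Cmod k) * (Cmod a + Cmod b))) by (apply Rmult_le_pos; nra). nra.
Qed.

Lemma C11_lin1 (l : C -> C) (B : R) : (forall h h', l (Cplus h h') = Cplus (l h) (l h')) ->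
  (forall (c : R) h, l (Cmult (RtoC c) h) = Cmult (RtoC c) (l h)) -> 0 <= B -> (forall h, Cmod (l h) <= B * Cmod h) ->
  C11 (fun z _ => l z) (fun _ _ h _ => l h).
Proof.
  intros. apply (C11_linear (fun h _ => l h) B); auto. intros.
  eapply Rle_trans; [apply H2|]. apply Rmult_le_compat_l; auto. pose proof (Cmod_ge_0 k). lra.
Qed.

Lemma C11_comp1 (g : C -> C) (f : C -> C -> C) (dg : C -> C -> C) (d : C -> C -> C -> C -> C) :
  C11 (fun z _ => g z) (fun z _ h _ => dg z h) -> C11 f d ->
  C11 (fun z u => g (f z u)) (fun z u h k => dg (f z u) (d z u h k)).
Proof.
  intros Hg Hf. apply (C11_comp (fun z _ => g z) f (fun _ _ => RtoC 0) (fun z _ h _ => dg z h) d (fun _ _ _ _ => RtoC 0)); auto.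
  apply C11_const.
Qed.

Lemma C11_opp (f : C -> C -> C) (d : C -> C -> C -> C -> C) : C11 f d ->
  C11 (fun z u => Copp (f z u)) (fun z u h k => Copp (d z u h k)).
Proof.
  intros. apply (C11_comp1 Copp f (fun _ h => Copp h) d); auto.
  apply (C11_lin1 Copp 1); intros; try ring; [lra|]. rewrite Cmod_opp. lra.
Qed.

Lemma C11_conj (f : C -> C -> C) (d : C -> C -> C -> C -> C) : C11 f d ->
  C11 (fun z u => Cconj (f z u)) (fun z u h k => Cconj (d z u h k)).
Proof.
  intros. apply (C11_comp1 Cconj f (fun _ h => Cconj h) d); auto.
  apply (C11_lin1 Cconj 1); intros; [apply C_ext; simpl; ring|apply C_ext; simpl; ring|lra|]. rewrite Cmod_conj. lra.
Qed.

Lemma C11_re (f : C -> C -> C) (d : C -> C -> C -> C -> C) : C11 f d ->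
  C11 (fun z u => RtoC (fst (f z u))) (fun z u h k => RtoC (fst (d z u h k))).
Proof.
  intros. apply (C11_comp1 (fun z => RtoC (fst z)) f (fun _ h => RtoC (fst h)) d); auto.
  apply (C11_lin1 (fun z => RtoC (fst z)) 1); intros; [apply C_ext; simpl; ring|apply C_ext; simpl; ring|lra|].
  rewrite Cmod_RtoC, Rmult_1_l. apply abs_fst_le.
Qed.

Lemma C11_im (f : C -> C -> C) (d : C -> C -> C -> C -> C) : C11 f d ->
  C11 (fun z u => RtoC (snd (f z u))) (fun z u h k => RtoC (snd (d z u h k))).
Proof.
  intros. apply (C11_comp1 (fun z => RtoC (snd z)) f (fun _ h => RtoC (snd h)) d); auto.
  apply (C11_lin1 (fun z => RtoC (snd z)) 1); intros; [apply C_ext; simpl; ring|apply C_ext; simpl; ring|lra|].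
  rewrite Cmod_RtoC, Rmult_1_l. apply abs_snd_le.
Qed.

Lemma exp_mono (x y : R) : x <= y -> exp x <= exp y.
Proof. intros [H| ->]; [left; now apply exp_increasing|lra]. Qed.

Lemma cexp_rem_M (M : R) : 0 <= M -> exists L, 0 <= L /\ forall w, Cmod w <= M ->
  Cmod (Cminus (cexp w) (Cplus (RtoC 1) w)) <= L * (Cmod w * Cmod w).
Proof.
  intros HM. exists (20 + exp M + 1 + M). pose proof (exp_pos M). split; [lra|]. intros w Hw.
  pose proof (Cmod_ge_0 w).
  destruct (Rle_dec (Cmod w) 1).
  - eapply Rle_trans; [apply cexp_rem; auto|]. nra.
  - eapply Rle_trans; [apply Cmod_sub_le|]. rewrite Cmod_cexp.
    pose proof (Cmod_triangle (RtoC 1) w). rewrite Cmod_1 in H1.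
    assert (exp (fst w) <= exp M) by (apply exp_mono; pose proof (fst_le_Cmod w); lra).
    assert (1 <= Cmod w * Cmod w) by nra. nra.
Qed.

Lemma C11_cexp (f : C -> C -> C) (d : C -> C -> C -> C -> C) : C11 f d ->
  C11 (fun z u => cexp (f z u)) (fun z u h k => Cmult (cexp (f z u)) (d z u h k)).
Proof.
  intros. apply (C11_comp1 cexp f (fun z h => Cmult (cexp z) h) d); auto.
  apply C11_intro; intros; try ring. destruct (cexp_rem_M M H0) as (B & HB & HBw).
  pose proof (exp_pos M).
  exists (exp M * (1 + B + B * M)). split; [apply Rmult_le_pos; nra|].
  intros z _ h k Hz _ Hh _. pose proof (Cmod_ge_0 h). pose proof (Cmod_ge_0 k).
  assert (HE : Cmod (cexp z) <= exp M) by (rewrite Cmod_cexp; apply exp_mono; pose proof (fst_le_Cmod z); lra).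
  pose proof (Cmod_ge_0 (cexp z)). pose proof (HBw h Hh).
  assert (0 <= B * M) by nra.
  assert (Hhh : Cmod h * Cmod h <= (Cmod h + Cmod k) * (Cmod h + Cmod k)) by nra.
  assert (Hhh0 : 0 <= Cmod h * Cmod h) by nra.
  split; [nra|]. split.
  - rewrite cexp_plus. replace (Cminus (Cmult (cexp z) (cexp h)) (Cplus (cexp z) (Cmult (cexp z) h))) with (Cmult (cexp z) (Cminus (cexp h) (Cplus (RtoC 1) h))) by ring.
    rewrite Cmod_mult, Rmult_assoc. apply Rmult_le_compat; auto using Cmod_ge_0.
    eapply Rle_trans; [exact H5|]. apply Rmult_le_compat; nra.
  - intros a b. pose proof (Cmod_ge_0 a). pose proof (Cmod_ge_0 b). split.
    + rewrite Cmod_mult, Rmult_assoc. apply Rmult_le_compat; auto. nra.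
    + rewrite cexp_plus. replace (Cminus (Cmult (Cmult (cexp z) (cexp h)) a) (Cmult (cexp z) a)) with
        (Cmult (cexp z) (Cmult (Cplus (Cminus (cexp h) (Cplus (RtoC 1) h)) h) a)) by ring.
      rewrite !Cmod_mult, !Rmult_assoc. apply Rmult_le_compat; auto.
      { apply Rmult_le_pos; auto using Cmod_ge_0. }
      apply Rle_trans with (((1 + B * M) * Cmod h) * Cmod a).
      * apply Rmult_le_compat_r; auto. eapply Rle_trans; [apply Cmod_triangle|].
        assert (B * (Cmod h * Cmod h) <= B * (Cmod h * M)) by (apply Rmult_le_compat_l; nra). lra.
      * rewrite Rmult_assoc. apply Rmult_le_compat; try nra.
Qed.

Lemma C11_lip_z (f : C -> C -> C) (d : C -> C -> C -> C -> C) : C11 f d ->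
  forall M, exists L, 0 <= L /\ forall z u h k, Cmod z <= M -> Cmod u <= M -> Cmod h <= M -> Cmod k <= M ->
   Cmod (Cminus (f (Cplus z h) (Cplus u k)) (f z u)) <= L * (Cmod h + Cmod k).
Proof.
  intros (_ & _ & H) M. destruct (H M) as (L & HL & K). exists (Rabs (L * (1 + 2 * M))). split; [apply Rabs_pos|].
  intros z u h k Hz Hu Hh Hk. destruct (K z u h k Hz Hu Hh Hk) as (_ & K1 & K2). destruct (K2 h k) as (K3 & _).
  pose proof (Cmod_ge_0 h). pose proof (Cmod_ge_0 k).
  replace (Cminus (f (Cplus z h) (Cplus u k)) (f z u)) with
   (Cplus (Cminus (f (Cplus z h) (Cplus u k)) (Cplus (f z u) (d z u h k))) (d z u h k)) by ring.
  eapply Rle_trans; [apply Cmod_triangle|].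
  apply Rle_trans with (L * (1 + 2 * M) * (Cmod h + Cmod k)).
  - assert (L * ((Cmod h + Cmod k) * (Cmod h + Cmod k)) <= L * ((2 * M) * (Cmod h + Cmod k))) by (apply Rmult_le_compat_l; nra). nra.
  - apply Rmult_le_compat_r; [lra|apply Rle_abs].
Qed.

(** Differentiation under the integral sign: the bounds of the class are uniform on balls, so they
    integrate pointwise. The argument [l u + t e] covers both uses, over the angle with [l] the real
    part and [e = Ci], and over the radius with [l = 0] and [e = 1]. *)
Lemma C11_int (f : C -> C -> C) (d : C -> C -> C -> C -> C) (l : C -> C) (e : C) (a b : R) : a <= b ->
  C11 f d -> (forall h h', l (Cplus h h') = Cplus (l h) (l h')) ->
  (forall (c : R) h, l (Cmult (RtoC c) h) = Cmult (RtoC c) (l h)) -> (forall h, Cmod (l h) <= Cmod h) ->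
  Cmod e <= 1 ->
  C11 (fun z u => CInt (fun t => f z (Cplus (l u) (Cmult (RtoC t) e))) a b)
      (fun z u h k => CInt (fun t => d z (Cplus (l u) (Cmult (RtoC t) e)) h (l k)) a b).
Proof.
  intros Hab Hf la ls lb He.
  assert (Hf' := Hf). destruct Hf' as (A0 & S0 & E0).
  set (R0 := Rabs a + Rabs b). assert (0 <= R0) by (unfold R0; pose proof (Rabs_pos a); pose proof (Rabs_pos b); lra).
  assert (Hpt : forall u t, a <= t <= b -> Cmod (Cplus (l u) (Cmult (RtoC t) e)) <= Cmod u + R0).
  { intros u t Ht. eapply Rle_trans; [apply Cmod_triangle|]. rewrite Cmod_mult, Cmod_RtoC.
    assert (Rabs t <= R0). { unfold R0, Rabs in *. destruct (Rcase_abs t), (Rcase_abs a), (Rcase_abs b); lra. }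
    pose proof (lb u). pose proof (Rabs_pos t). pose proof (Cmod_ge_0 e). nra. }
  assert (Xf : forall z u, exCInt (fun t => f z (Cplus (l u) (Cmult (RtoC t) e))) a b).
  { intros z u. apply ex_CInt_cont; auto. intros t Ht.
    destruct (C11_lip_z f d Hf (Cmod z + Cmod u + R0 + 1)) as (L & HL & K).
    apply ccont_lip with 1 L; [lra|]. intros s Hs.
    specialize (K z (Cplus (l u) (Cmult (RtoC t) e)) (RtoC 0) (Cmult (RtoC (s - t)) e)).
    replace (Cplus (Cplus (l u) (Cmult (RtoC t) e)) (Cmult (RtoC (s - t)) e)) with (Cplus (l u) (Cmult (RtoC s) e)) in K by (rewrite RtoC_minus; ring).
    replace (Cplus z (RtoC 0)) with z in K by ring. rewrite Cmod_0, Cmod_mult, Cmod_RtoC, Rplus_0_l in K.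
    pose proof (Hpt u t Ht). pose proof (Cmod_ge_0 z). pose proof (Cmod_ge_0 u). pose proof (Cmod_ge_0 e). pose proof (Rabs_pos (s - t)).
    eapply Rle_trans; [apply K; nra|]. apply Rmult_le_compat_l; auto. nra. }
  assert (Xd : forall z u h k, exCInt (fun t => d z (Cplus (l u) (Cmult (RtoC t) e)) h (l k)) a b).
  { intros z u h k. apply ex_CInt_cont; auto. intros t Ht.
    destruct (E0 (Cmod z + Cmod u + R0 + 1)) as (L & HL & K).
    apply ccont_lip with 1 (L * (Cmod h + Cmod (l k))); [lra|]. intros s Hs.
    specialize (K z (Cplus (l u) (Cmult (RtoC t) e)) (RtoC 0) (Cmult (RtoC (s - t)) e)).
    replace (Cplus (Cplus (l u) (Cmult (RtoC t) e)) (Cmult (RtoC (s - t)) e)) with (Cplus (l u) (Cmult (RtoC s) e)) in K by (rewrite RtoC_minus; ring).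
    replace (Cplus z (RtoC 0)) with z in K by ring. rewrite Cmod_0, Cmod_mult, Cmod_RtoC, Rplus_0_l in K.
    pose proof (Hpt u t Ht). pose proof (Cmod_ge_0 z). pose proof (Cmod_ge_0 u). pose proof (Cmod_ge_0 e). pose proof (Rabs_pos (s - t)).
    destruct K as (_ & _ & K); try nra. destruct (K h (l k)) as (_ & K').
    eapply Rle_trans; [apply K'|]. pose proof (Cmod_ge_0 h). pose proof (Cmod_ge_0 (l k)).
    replace (L * (Cmod h + Cmod (l k)) * Rabs (s - t)) with (L * Rabs (s - t) * (Cmod h + Cmod (l k))) by ring.
    apply Rmult_le_compat_r; [lra|]. apply Rmult_le_compat_l; auto. nra. }
  apply C11_intro.
  - intros. rewrite <- CInt_plus by auto. apply CInt_ext; auto. intros. rewrite la, A0. auto.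
  - intros. rewrite <- CInt_scal by auto. apply CInt_ext; auto. intros. rewrite ls, S0. auto.
  - intros M HM. destruct (E0 (M + R0)) as (L & HL & K). exists (2 * ((b - a) * L)). split; [nra|].
    intros z u h k Hz Hu Hh Hk. pose proof (Cmod_ge_0 h). pose proof (Cmod_ge_0 k).
    assert (KK : forall t, a <= t <= b -> let w := Cplus (l u) (Cmult (RtoC t) e) in
      Cmod (f z w) <= L /\
      Cmod (Cminus (f (Cplus z h) (Cplus (l (Cplus u k)) (Cmult (RtoC t) e))) (Cplus (f z w) (d z w h (l k)))) <= L * ((Cmod h + Cmod k) * (Cmod h + Cmod k)) /\
      forall p q, Cmod (d z w p (l q)) <= L * (Cmod p + Cmod q) /\
       Cmod (Cminus (d (Cplus z h) (Cplus (l (Cplus u k)) (Cmult (RtoC t) e)) p (l q)) (d z w p (l q))) <= L * (Cmod h + Cmod k) * (Cmod p + Cmod q)).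
    { intros t Ht w. pose proof (Hpt u t Ht). fold w in H2. pose proof (lb k). pose proof (Cmod_ge_0 (l k)).
      destruct (K z w h (l k)) as (K1 & K2 & K3); try lra.
      replace (Cplus (l (Cplus u k)) (Cmult (RtoC t) e)) with (Cplus w (l k)) by (rewrite la; unfold w; ring).
      split; auto. split.
      - eapply Rle_trans; [exact K2|]. apply Rmult_le_compat_l; auto. nra.
      - intros p q. destruct (K3 p (l q)) as (K4 & K5). pose proof (lb q). pose proof (Cmod_ge_0 p). pose proof (Cmod_ge_0 (l q)).
        split; [eapply Rle_trans; [exact K4|]; apply Rmult_le_compat_l; lra|].
        eapply Rle_trans; [exact K5|]. apply Rmult_le_compat; try nra. }
    split; [|split].
    + apply Rle_trans with (2 * ((b - a) * L)); [|lra]. apply CInt_le; auto. intros t Ht. apply (KK t Ht).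
    + rewrite <- CInt_plus, <- CInt_minus by auto using exCInt_plus.
      replace (2 * ((b - a) * L) * ((Cmod h + Cmod k) * (Cmod h + Cmod k))) with (2 * ((b - a) * (L * ((Cmod h + Cmod k) * (Cmod h + Cmod k))))) by ring.
      apply CInt_le; auto using exCInt_plus, exCInt_minus. intros t Ht. apply (KK t Ht).
    + intros p q. split.
      * replace (2 * ((b - a) * L) * (Cmod p + Cmod q)) with (2 * ((b - a) * (L * (Cmod p + Cmod q)))) by ring.
        apply CInt_le; auto. intros t Ht. apply (KK t Ht).
      * rewrite <- CInt_minus by auto.
        replace (2 * ((b - a) * L) * (Cmod h + Cmod k) * (Cmod p + Cmod q)) with (2 * ((b - a) * (L * (Cmod h + Cmod k) * (Cmod p + Cmod q)))) by ring.
        apply CInt_le; auto using exCInt_minus. intros t Ht. apply (KK t Ht).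
Qed.

(** * The parametrix *)

(** One-variable functions are kept as two-variable ones with an idle second argument, so that every
    closure rule applies to them unchanged. *)
Definition C11s (v : C -> C) (dv : C -> C -> C) : Prop := C11 (fun z _ => v z) (fun z _ h _ => dv z h).

Lemma CInt_ext_open (f g : R -> C) (a b : R) : a <= b -> (forall t, a < t < b -> f t = g t) ->
  CInt f a b = CInt g a b.
Proof.
  intros Hab H. apply C_ext; simpl; apply RInt_ext; rewrite Rmin_left, Rmax_right by lra;
   intros t Ht; rewrite H; auto; lra.
Qed.

Lemma lin_decomp (l : C -> C) : (forall h h', l (Cplus h h') = Cplus (l h) (l h')) ->
  (forall (c : R) h, l (Cmult (RtoC c) h) = Cmult (RtoC c) (l h)) ->
  forall h, l h = Cplus (Cmult (RtoC (fst h)) (l (RtoC 1))) (Cmult (RtoC (snd h)) (l Ci)).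
Proof.
  intros la ls h. rewrite <- !ls, <- la. f_equal. apply C_ext; simpl; ring.
Qed.

(** Wirtinger's formulas: a real linear map is determined by its values at [1] and [Ci]. *)
Lemma C11s_rdiff (v : C -> C) (dv : C -> C -> C) (z : C) : C11s v dv ->
  rdiff v z (Cmult (RtoC (/2)) (Cminus (dv z (RtoC 1)) (Cmult Ci (dv z Ci))))
            (Cmult (RtoC (/2)) (Cplus (dv z (RtoC 1)) (Cmult Ci (dv z Ci)))).
Proof.
  intros (Ha & Hs & He) eps Hep. destruct (He (Cmod z + 1)) as (L & HL & K).
  exists (Rmin 1 (eps / (L + 1))). split; [apply Rmin_pos; [lra|apply Rdiv_lt_0_compat; lra]|].
  intros h Hh. pose proof (Rlt_le_trans _ _ _ Hh (Rmin_l _ _)). pose proof (Rlt_le_trans _ _ _ Hh (Rmin_r _ _)).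
  apply Rlt_div_r in H0; [|lra]. pose proof (Cmod_ge_0 z). pose proof (Cmod_ge_0 h).
  destruct (K z (RtoC 0) h (RtoC 0)) as (_ & K2 & _); rewrite ?Cmod_0; try lra.
  assert (E : dv z h = Cplus (Cmult (Cmult (RtoC (/ 2)) (Cminus (dv z (RtoC 1)) (Cmult Ci (dv z Ci)))) h)
            (Cmult (Cmult (RtoC (/ 2)) (Cplus (dv z (RtoC 1)) (Cmult Ci (dv z Ci)))) (Cconj h))).
  { rewrite (lin_decomp (dv z)) with (h := h).
    - apply C_ext; simpl; field.
    - intros. apply (Ha z (RtoC 0) h0 (RtoC 0) h' (RtoC 0)).
    - intros. apply (Hs z (RtoC 0) c h0 (RtoC 0)). }
  rewrite <- E. rewrite Cmod_0, Rplus_0_r in K2. eapply Rle_trans; [exact K2|]. nra.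
Qed.

Lemma C11_ccont (f : C -> C -> C) (d : C -> C -> C -> C -> C) (z a e : C) (t : R) : C11 f d -> Cmod e <= 1 ->
  ccont (fun t => f z (Cplus a (Cmult (RtoC t) e))) t.
Proof.
  intros Hf He. set (p := Cplus a (Cmult (RtoC t) e)).
  destruct (C11_lip_z f d Hf (Cmod z + Cmod p + 1)) as (L & HL & K).
  apply ccont_lip with 1 L; [lra|]. intros s Hs.
  specialize (K z p (RtoC 0) (Cmult (RtoC (s - t)) e)).
  replace (Cplus p (Cmult (RtoC (s - t)) e)) with (Cplus a (Cmult (RtoC s) e)) in K by (unfold p; rewrite RtoC_minus; ring).
  replace (Cplus z (RtoC 0)) with z in K by ring. rewrite Cmod_0, Cmod_mult, Cmod_RtoC, Rplus_0_l in K.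
  pose proof (Cmod_ge_0 z). pose proof (Cmod_ge_0 p). pose proof (Cmod_ge_0 e). pose proof (Rabs_pos (s - t)).
  fold p. eapply Rle_trans; [apply K; nra|]. apply Rmult_le_compat_l; auto. nra.
Qed.

Lemma C11_ccont_d (f : C -> C -> C) (d : C -> C -> C -> C -> C) (z a e h k : C) (t : R) : C11 f d -> Cmod e <= 1 ->
  ccont (fun t => d z (Cplus a (Cmult (RtoC t) e)) h k) t.
Proof.
  intros (_ & _ & Hf) He. set (p := Cplus a (Cmult (RtoC t) e)).
  destruct (Hf (Cmod z + Cmod p + 1)) as (L & HL & K).
  apply ccont_lip with 1 (L * (Cmod h + Cmod k)); [lra|]. intros s Hs.
  specialize (K z p (RtoC 0) (Cmult (RtoC (s - t)) e)).
  replace (Cplus p (Cmult (RtoC (s - t)) e)) with (Cplus a (Cmult (RtoC s) e)) in K by (unfold p; rewrite RtoC_minus; ring).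
  replace (Cplus z (RtoC 0)) with z in K by ring. rewrite Cmod_0, Cmod_mult, Cmod_RtoC, Rplus_0_l in K.
  pose proof (Cmod_ge_0 z). pose proof (Cmod_ge_0 p). pose proof (Cmod_ge_0 e). pose proof (Rabs_pos (s - t)).
  fold p. destruct K as (_ & _ & K); try nra. destruct (K h k) as (_ & K').
  eapply Rle_trans; [exact K'|]. pose proof (Cmod_ge_0 h). pose proof (Cmod_ge_0 k).
  replace (L * (Cmod h + Cmod k) * Rabs (s - t)) with (L * Rabs (s - t) * (Cmod h + Cmod k)) by ring.
  apply Rmult_le_compat_r; [lra|]. apply Rmult_le_compat_l; auto. nra.
Qed.

(** The fundamental theorem of calculus along a line in the second variable. It will evaluate the
    radial and the angular derivatives in the proof of the Cauchy-Pompeiu formula. *)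
Lemma C11_curve (f : C -> C -> C) (d : C -> C -> C -> C -> C) (z a e : C) (s t : R) : C11 f d -> Cmod e <= 1 ->
  CInt (fun t => d z (Cplus a (Cmult (RtoC t) e)) (RtoC 0) e) s t =
  Cminus (f z (Cplus a (Cmult (RtoC t) e))) (f z (Cplus a (Cmult (RtoC s) e))).
Proof.
  intros Hf He.
  assert (D : forall t, is_derive (fun t => fst (f z (Cplus a (Cmult (RtoC t) e)))) t (fst (d z (Cplus a (Cmult (RtoC t) e)) (RtoC 0) e)) /\
     is_derive (fun t => snd (f z (Cplus a (Cmult (RtoC t) e)))) t (snd (d z (Cplus a (Cmult (RtoC t) e)) (RtoC 0) e))).
  { intros x. apply (curve_derive (fun t => f z (Cplus a (Cmult (RtoC t) e)))). intros eps Hep.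
    destruct Hf as (_ & Hs & Hf). set (p := Cplus a (Cmult (RtoC x) e)).
    destruct (Hf (Cmod z + Cmod p + 1)) as (L & HL & K).
    exists (Rmin 1 (eps / (L + 1))). split; [apply Rmin_pos; [lra|apply Rdiv_lt_0_compat; lra]|].
    intros y Hy. pose proof (Rlt_le_trans _ _ _ Hy (Rmin_l _ _)). pose proof (Rlt_le_trans _ _ _ Hy (Rmin_r _ _)).
    apply Rlt_div_r in H0; [|lra].
    specialize (K z p (RtoC 0) (Cmult (RtoC y) e)).
    replace (Cplus p (Cmult (RtoC y) e)) with (Cplus a (Cmult (RtoC (x + y)) e)) in K by (unfold p; rewrite RtoC_plus; ring).
    replace (Cplus z (RtoC 0)) with z in K by ring. rewrite Cmod_0, Cmod_mult, Cmod_RtoC, Rplus_0_l in K.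
    pose proof (Cmod_ge_0 z). pose proof (Cmod_ge_0 p). pose proof (Cmod_ge_0 e). pose proof (Rabs_pos y).
    destruct K as (_ & K & _); try nra. fold p.
    pose proof (Hs z p y (RtoC 0) e) as Hs'. replace (Cmult (RtoC y) (RtoC 0)) with (RtoC 0) in Hs' by ring.
    rewrite <- Hs'. eapply Rle_trans; [exact K|].
    assert (Rabs y * Cmod e * (Rabs y * Cmod e) <= Rabs y * Rabs y) by (apply Rmult_le_compat; nra).
    apply Rle_trans with (L * (Rabs y * Rabs y)); [apply Rmult_le_compat_l; auto|].
    assert (Rabs y * (Rabs y * (L + 1)) <= Rabs y * eps) by (apply Rmult_le_compat_l; lra). nra. }
  assert (Cn := fun x => ccont_re_im _ x (C11_ccont_d f d z a e (RtoC 0) e x Hf He)).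
  apply C_ext; simpl; apply is_RInt_unique.
  - apply (is_RInt_derive (fun t => fst (f z (Cplus a (Cmult (RtoC t) e))))); intros; [apply D|apply Cn].
  - apply (is_RInt_derive (fun t => snd (f z (Cplus a (Cmult (RtoC t) e))))); intros; [apply D|apply Cn].
Qed.

Lemma polar_pt (r t : R) : Cplus (RtoC r) (Cmult (RtoC t) Ci) = (r, t).
Proof. apply C_ext; simpl; ring. Qed.

(** From here on the second variable is not a point of the plane: it encodes polar coordinates,
    radius as real part and angle as imaginary part. *)
Definition aint (f : C -> C -> C) (z : C) (r : R) : C := CInt (fun t => f z (r, t)) 0 (2 * PI).

(** The measure is [dr dt], without the Jacobian [r]. Against the kernel [1 / w] with [w = r e^(it)]
    the area element becomes [e^(-it) dr dt], and the singularity is gone; the factor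
    [cis (- snd u)] in [gS] is what remains of it. *)
Definition dint (f : C -> C -> C) (z : C) : C := CInt (aint f z) 0 1.

Lemma C11_aint (f : C -> C -> C) (d : C -> C -> C -> C -> C) : C11 f d ->
  C11 (fun z u => aint f z (fst u)) (fun z u h k => CInt (fun t => d z (fst u, t) h (RtoC (fst k))) 0 (2 * PI)).
Proof.
  intros Hf. pose proof two_PI_pos.
  eapply C11_ext; [| |apply (C11_int f d (fun u => RtoC (fst u)) Ci 0 (2 * PI))]; auto; try lra.
  - intros. apply CInt_ext; [lra|]. intros. cbv beta. now rewrite polar_pt.
  - intros. apply CInt_ext; [lra|]. intros. cbv beta. now rewrite polar_pt.
  - intros. apply C_ext; simpl; ring.
  - intros. apply C_ext; simpl; ring.
  - intros. rewrite Cmod_RtoC. apply abs_fst_le.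
  - rewrite Cmod_Ci. lra.
Qed.

Lemma C11_dint (f : C -> C -> C) (d : C -> C -> C -> C -> C) : C11 f d ->
  C11s (dint f) (fun z h => CInt (fun r => CInt (fun t => d z (r, t) h (RtoC 0)) 0 (2 * PI)) 0 1).
Proof.
  intros Hf. eapply C11_ext; [| |apply (C11_int _ _ (fun _ => RtoC 0) (RtoC 1) 0 1 Rle_0_1 (C11_aint f d Hf))]; cbv beta.
  - intros. unfold dint. apply CInt_ext; [lra|]. intros. f_equal. simpl. ring.
  - intros. apply CInt_ext; [lra|]. intros. simpl.
    replace (0 + (t * 1 - 0 * 0)) with t by ring. reflexivity.
  - intros. ring.
  - intros. ring.
  - intros. rewrite Cmod_0. apply Cmod_ge_0.
  - rewrite Cmod_1. lra.
Qed.

Lemma aint_ex (f : C -> C -> C) (d : C -> C -> C -> C -> C) (z : C) (r : R) : C11 f d -> exCInt (fun t => f z (r, t)) 0 (2 * PI).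
Proof.
  intros Hf. pose proof two_PI_pos. apply exCInt_ext with (fun t => f z (Cplus (RtoC r) (Cmult (RtoC t) Ci))); [lra| |].
  - intros. now rewrite polar_pt.
  - apply ex_CInt_all. intros. apply C11_ccont with d; auto. rewrite Cmod_Ci; lra.
Qed.

Lemma aint_ex_d (f : C -> C -> C) (d : C -> C -> C -> C -> C) (z h k : C) (r : R) : C11 f d -> exCInt (fun t => d z (r, t) h k) 0 (2 * PI).
Proof.
  intros Hf. pose proof two_PI_pos. apply exCInt_ext with (fun t => d z (Cplus (RtoC r) (Cmult (RtoC t) Ci)) h k); [lra| |].
  - intros. now rewrite polar_pt.
  - apply ex_CInt_all. intros. apply C11_ccont_d with f; auto. rewrite Cmod_Ci; lra.
Qed.

Lemma dint_ex (f : C -> C -> C) (d : C -> C -> C -> C -> C) (z : C) : C11 f d -> exCInt (aint f z) 0 1.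
Proof.
  intros Hf. apply exCInt_ext with (fun r => aint f z (fst (Cplus (RtoC 0) (Cmult (RtoC r) (RtoC 1))))); [lra| |].
  - intros. f_equal. simpl. ring.
  - apply ex_CInt_all. intros.
    apply (C11_ccont (fun z u => aint f z (fst u)) _ z (RtoC 0) (RtoC 1) t (C11_aint f d Hf)). rewrite Cmod_1; lra.
Qed.

Lemma dint_ex_d (f : C -> C -> C) (d : C -> C -> C -> C -> C) (z h : C) (k : R) : C11 f d ->
  exCInt (fun r => CInt (fun t => d z (r, t) h (RtoC k)) 0 (2 * PI)) 0 1.
Proof.
  intros Hf. pose proof (C11_aint f d Hf) as Ha.
  eapply exCInt_ext; [lra| |apply ex_CInt_all; intros; apply (C11_ccont_d _ _ z (RtoC 0) (RtoC 1) h (RtoC k) t Ha)].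
  - intros. cbv beta. simpl. replace (0 + (t * 1 - 0 * 0)) with t by ring. reflexivity.
  - rewrite Cmod_1; lra.
Qed.

Lemma dint_le (f : C -> C -> C) (d : C -> C -> C -> C -> C) (z : C) (M : R) : C11 f d ->
  (forall r t, 0 <= r <= 1 -> Cmod (f z (r, t)) <= M) -> Cmod (dint f z) <= 8 * PI * M.
Proof.
  intros Hf HM. pose proof two_PI_pos. replace (8 * PI * M) with (2 * ((1 - 0) * (2 * ((2 * PI - 0) * M)))) by ring.
  apply CInt_le; [lra|eapply dint_ex; eauto|]. intros r Hr. apply CInt_le; [lra|eapply aint_ex; eauto|]. auto.
Qed.

Definition pol (u : C) : C := Cmult (RtoC (fst u)) (cis (snd u)).

Definition dpol (u k : C) : C :=
  Cplus (Cmult (RtoC (fst k)) (cis (snd u))) (Cmult (RtoC (fst u)) (Cmult (Cmult Ci (RtoC (snd k))) (cis (snd u)))).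

Lemma cexp_Ci (y : R) : cexp (Cmult Ci (RtoC y)) = cis y.
Proof. unfold cexp, cis. apply C_ext; simpl; replace (0 * y - 1 * 0) with 0 by ring; rewrite exp_0; replace (0 * 0 + 1 * y) with y by ring; ring. Qed.

Lemma C11_cis : C11 (fun _ u => cis (snd u)) (fun _ u _ k => Cmult (Cmult Ci (RtoC (snd k))) (cis (snd u))).
Proof.
  eapply C11_ext; [| |apply (C11_cexp _ _ (C11_mult _ _ _ _ (C11_const Ci) (C11_im _ _ C11_snd)))]; cbv beta.
  - intros. apply cexp_Ci.
  - intros. rewrite cexp_Ci. ring.
Qed.

Lemma C11_cis_neg : C11 (fun _ u => cis (- snd u)) (fun _ u _ k => Cmult (Cmult (Copp Ci) (RtoC (snd k))) (cis (- snd u))).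
Proof.
  assert (E : forall y, cexp (Cmult (Copp Ci) (RtoC y)) = cis (- y)).
  { intros. rewrite <- cexp_Ci. f_equal. rewrite RtoC_opp. ring. }
  eapply C11_ext; [| |apply (C11_cexp _ _ (C11_mult _ _ _ _ (C11_const (Copp Ci)) (C11_im _ _ C11_snd)))]; cbv beta.
  - intros. apply E.
  - intros. rewrite E. ring.
Qed.

Lemma C11_pol : C11 (fun _ u => pol u) (fun _ u _ k => dpol u k).
Proof.
  eapply C11_ext; [| |apply (C11_mult _ _ _ _ (C11_re _ _ C11_snd) C11_cis)]; cbv beta; reflexivity.
Qed.

Lemma Cmod_pol (u : C) : Cmod (pol u) = Rabs (fst u).
Proof. unfold pol. rewrite Cmod_mult, Cmod_cis, Cmod_RtoC. ring. Qed.

(* Holomorphic in [w] and equal to [1] at [w = 0]: multiplying the Cauchy kernel [1 / w] by it keeps the residue. *)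
Definition ker (A B : C -> C) (z w : C) : C := cexp (Cplus (Cmult (A z) w) (Cmult (B z) (Cmult w w))).

Definition Nf (A B v : C -> C) (z u : C) : C := Cmult (v (Cminus z (pol u))) (ker A B (Cminus z (pol u)) (pol u)).

(** Differential of [v zeta * ker zeta w] in [zeta], with [w] fixed; it is only real linear in [h].
    The dependence on [w] is holomorphic, so its derivative is the multiplier [N2]. In [dN] the
    point [zeta = z - w] moves with both arguments. *)
Definition M1 (A B v : C -> C) (dA dB dv : C -> C -> C) (z w h : C) : C :=
  Cplus (Cmult (dv z h) (ker A B z w))
    (Cmult (Cmult (v z) (ker A B z w)) (Cplus (Cmult (dA z h) w) (Cmult (dB z h) (Cmult w w)))).

Definition N2 (A B v : C -> C) (z w : C) : C :=
  Cmult (Cmult (v z) (ker A B z w)) (Cplus (A z) (Cmult (RtoC 2) (Cmult (B z) w))).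

Definition dN (A B v : C -> C) (dA dB dv : C -> C -> C) (z u h k : C) : C :=
  Cplus (M1 A B v dA dB dv (Cminus z (pol u)) (pol u) (Cminus h (dpol u k)))
        (Cmult (N2 A B v (Cminus z (pol u)) (pol u)) (dpol u k)).

Lemma C11_Nf (A B v : C -> C) (dA dB dv : C -> C -> C) : C11s A dA -> C11s B dB -> C11s v dv ->
  C11 (Nf A B v) (dN A B v dA dB dv).
Proof.
  intros HA HB Hv.
  pose proof (C11_plus _ _ _ _ C11_fst (C11_opp _ _ C11_pol)) as HZ.
  pose proof (C11_comp1 _ _ _ _ HA HZ) as HAZ. pose proof (C11_comp1 _ _ _ _ HB HZ) as HBZ. pose proof (C11_comp1 _ _ _ _ Hv HZ) as HvZ.
  pose proof (C11_mult _ _ _ _ HvZ (C11_cexp _ _ (C11_plus _ _ _ _ (C11_mult _ _ _ _ HAZ C11_pol) (C11_mult _ _ _ _ HBZ (C11_mult _ _ _ _ C11_pol C11_pol))))) as H.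
  eapply C11_ext; [| |exact H]; cbv beta.
  - intros. reflexivity.
  - intros. unfold dN, M1, N2, ker. fold (Cminus z (pol u)). fold (Cminus h (dpol u k)).
    replace (RtoC 2) with (Cplus (RtoC 1) (RtoC 1)) by (rewrite <- RtoC_plus; f_equal; ring). ring.
Qed.

(** The cutoff [1 - |w|^4]: it vanishes on the unit circle, which removes the boundary term, and it
    is so flat at [w = 0] that its derivative beats [exp (- K r^2)] pointwise by a factor
    [1 / K]. *)
Definition chi (u : C) : C := Cminus (RtoC 1) (Cmult (Cmult (RtoC (fst u)) (RtoC (fst u))) (Cmult (RtoC (fst u)) (RtoC (fst u)))).

Definition dchi (u k : C) : C := Cmult (Cmult (RtoC (-4)) (Cmult (RtoC (fst u)) (Cmult (RtoC (fst u)) (RtoC (fst u))))) (RtoC (fst k)).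

Lemma C11_chi : C11 (fun _ u => chi u) (fun _ u _ k => dchi u k).
Proof.
  pose proof (C11_mult _ _ _ _ (C11_re _ _ C11_snd) (C11_re _ _ C11_snd)) as H.
  pose proof (C11_plus _ _ _ _ (C11_const (RtoC 1)) (C11_opp _ _ (C11_mult _ _ _ _ H H))) as H'.
  eapply C11_ext; [| |exact H']; cbv beta.
  - reflexivity.
  - intros. unfold dchi. apply C_ext; simpl; ring.
Qed.

Definition gf (A B v : C -> C) (z u : C) : C := Cmult (chi u) (Nf A B v z u).

Definition gS (A B v : C -> C) (z u : C) : C := Cmult (gf A B v z u) (cis (- snd u)).

(** The [wbar]-derivative of [1 - |w|^4] is [-2 |w|^2 w]. Divided by [w] and multiplied by the
    Jacobian [r] it gives [-2 r^3]. *)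
Definition gR (A B v : C -> C) (z u : C) : C :=
  Cmult (Cmult (RtoC (-2)) (Cmult (RtoC (fst u)) (Cmult (RtoC (fst u)) (RtoC (fst u))))) (Nf A B v z u).

Definition Sop (A B v : C -> C) (z : C) : C := Cmult (RtoC (/ PI)) (dint (gS A B v) z).

Definition Rop (A B v : C -> C) (z : C) : C := Cmult (RtoC (/ PI)) (dint (gR A B v) z).

Lemma C11_gf (A B v : C -> C) (dA dB dv : C -> C -> C) : C11s A dA -> C11s B dB -> C11s v dv ->
  C11 (gf A B v) (fun z u h k => Cplus (Cmult (dchi u k) (Nf A B v z u)) (Cmult (chi u) (dN A B v dA dB dv z u h k))).
Proof. intros. apply (C11_mult _ _ _ _ C11_chi (C11_Nf A B v dA dB dv H H0 H1)). Qed.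

Lemma C11_gS (A B v : C -> C) (dA dB dv : C -> C -> C) : C11s A dA -> C11s B dB -> C11s v dv ->
  exists d, C11 (gS A B v) d /\ forall z u h, d z u h (RtoC 0) = Cmult (Cmult (chi u) (dN A B v dA dB dv z u h (RtoC 0))) (cis (- snd u)).
Proof.
  intros. eexists; split; [apply (C11_mult _ _ _ _ (C11_gf A B v dA dB dv H H0 H1) C11_cis_neg)|].
  intros. cbv beta. unfold dchi. simpl. change (0, 0) with (RtoC 0). ring.
Qed.

Lemma C11_gR (A B v : C -> C) (dA dB dv : C -> C -> C) : C11s A dA -> C11s B dB -> C11s v dv ->
  exists d, C11 (gR A B v) d.
Proof.
  intros. eexists.
  apply (C11_mult _ _ _ _ (C11_mult _ _ _ _ (C11_const (RtoC (-2))) (C11_mult _ _ _ _ (C11_re _ _ C11_snd) (C11_mult _ _ _ _ (C11_re _ _ C11_snd) (C11_re _ _ C11_snd)))) (C11_Nf A B v dA dB dv H H0 H1)).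
Qed.

(** In polar coordinates the [wbar]-derivative is [e^(it) / 2] times [d/dr + (i / r) d/dt]. On the
    left stands the [zbar]-derivative of the integrand; on the right the part coming from the
    cutoff, minus half of this operator applied to cutoff times integrand. The terms with [n2]
    cancel because the twist is holomorphic in [w]. *)
Lemma pompeiu_algebra (c s r x : R) (m1 mi n2 n : C) : r <> 0 ->
  Cmult (RtoC (/ 2)) (Cplus (Cmult (Cmult (RtoC x) m1) (c, - s)) (Cmult Ci (Cmult (Cmult (RtoC x) mi) (c, - s)))) =
  Cminus (Cmult (RtoC (- 2 * (r * (r * r)))) n)
   (Cmult (RtoC (/ 2)) (Cplus
     (Cplus (Cmult (RtoC (- 4 * (r * (r * r)))) n) (Cmult (RtoC x) (Cplus (Cplus (Cmult (RtoC (- c)) m1) (Cmult (RtoC (- s)) mi)) (Cmult n2 (c, s)))))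
     (Cmult (Cmult Ci (RtoC (/ r))) (Cmult (RtoC x) (Cplus (Cplus (Cmult (RtoC (r * s)) m1) (Cmult (RtoC (- (r * c))) mi)) (Cmult n2 (Cmult (Cmult Ci (RtoC r)) (c, s)))))))).
Proof.
  intros Hr. apply C_ext; simpl; field; auto.
Qed.

(* The Cauchy-Pompeiu formula for [zeta |-> v zeta * (1 - |z - zeta|^4) * ker zeta (z - zeta)]. *)
Lemma dbar_Sop (A B v : C -> C) (dA dB dv : C -> C -> C) : C11s A dA -> C11s B dB -> C11s v dv ->
  exists dS, C11s (Sop A B v) dS /\ forall z,
    Cmult (RtoC (/ 2)) (Cplus (dS z (RtoC 1)) (Cmult Ci (dS z Ci))) = Cplus (v z) (Rop A B v z).
Proof.
  intros HA HB Hv. pose proof two_PI_pos as HPI.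
  destruct (C11_gS A B v dA dB dv HA HB Hv) as (d & Hd & Ed).
  destruct (C11_gR A B v dA dB dv HA HB Hv) as (dR & HdR).
  pose proof (C11_gf A B v dA dB dv HA HB Hv) as Hg.
  set (dg := fun z u h k => Cplus (Cmult (dchi u k) (Nf A B v z u)) (Cmult (chi u) (dN A B v dA dB dv z u h k))) in *.
  pose proof (C11_mult _ _ _ _ (C11_const (RtoC (/ PI))) (C11_dint _ _ Hd)) as HS.
  eexists. split.
  { eapply C11_ext; [intros; reflexivity| |exact HS]. intros z u h k. cbv beta.
    instantiate (1 := fun z h => Cmult (RtoC (/ PI)) (CInt (fun r => CInt (fun t => d z (r, t) h (RtoC 0)) 0 (2 * PI)) 0 1)). cbv beta. ring. }
  intros z. cbv beta.
  set (I := fun h => CInt (fun r => CInt (fun t => d z (r, t) h (RtoC 0)) 0 (2 * PI)) 0 1).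
  change (Cmult (RtoC (/ 2)) (Cplus (Cmult (RtoC (/ PI)) (I (RtoC 1))) (Cmult Ci (Cmult (RtoC (/ PI)) (I Ci)))) = Cplus (v z) (Rop A B v z)).
  (* [J r] is the radial derivative of the angular mean of [gf], so its integral reduces to the two
     ends: at [r = 1] the cutoff vanishes, and at [r = 0] the integrand is [v z] for every angle.
     This produces the term [v z] of the formula. *)
  set (J := fun r => CInt (fun t => dg z (r, t) (RtoC 0) (RtoC 1)) 0 (2 * PI)).
  assert (HJ : exCInt J 0 1) by apply (dint_ex_d _ _ z (RtoC 0) 1 Hg).
  assert (XI : forall h, exCInt (fun r => CInt (fun t => d z (r, t) h (RtoC 0)) 0 (2 * PI)) 0 1) by (intros; apply (dint_ex_d _ _ z h 0 Hd)).
  assert (XR : exCInt (aint (gR A B v) z) 0 1) by (eapply dint_ex; eauto).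
  assert (EJ : CInt J 0 1 = Cmult (RtoC (- (2 * PI))) (v z)).
  { pose proof (C11_curve (fun z u => aint (gf A B v) z (fst u)) _ z (RtoC 0) (RtoC 1) 0 1 (C11_aint _ _ Hg)) as E.
    rewrite Cmod_1 in E. specialize (E (Rle_refl 1)).
    transitivity (Cminus (aint (gf A B v) z (fst (Cplus (RtoC 0) (Cmult (RtoC 1) (RtoC 1))))) (aint (gf A B v) z (fst (Cplus (RtoC 0) (Cmult (RtoC 0) (RtoC 1)))))).
    - rewrite <- E. apply CInt_ext; [lra|]. intros. cbv beta. simpl. replace (0 + (t * 1 - 0 * 0)) with t by ring. reflexivity.
    - simpl. replace (0 + (1 * 1 - 0 * 0)) with 1 by ring. replace (0 + (0 * 1 - 0 * 0)) with 0 by ring.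
      assert (aint (gf A B v) z 1 = RtoC 0).
      { transitivity (CInt (fun _ => RtoC 0) 0 (2 * PI)).
        - apply CInt_ext; [lra|]. intros. unfold gf, chi; simpl. replace (Cminus (RtoC 1) (Cmult (Cmult (RtoC 1) (RtoC 1)) (Cmult (RtoC 1) (RtoC 1)))) with (RtoC 0) by ring. ring.
        - rewrite CInt_const. ring. }
      assert (aint (gf A B v) z 0 = Cmult (RtoC (2 * PI)) (v z)).
      { transitivity (CInt (fun _ => v z) 0 (2 * PI)).
        - apply CInt_ext; [lra|]. intros. unfold gf, chi, Nf, ker, pol; simpl.
          replace (Cmult (RtoC 0) (cis t)) with (RtoC 0) by ring. replace (Cminus z (RtoC 0)) with z by ring.
          replace (Cplus (Cmult (A z) (RtoC 0)) (Cmult (B z) (Cmult (RtoC 0) (RtoC 0)))) with (RtoC 0) by ring. rewrite cexp_0. ring.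
        - rewrite CInt_const, Rminus_0_r. reflexivity. }
      rewrite H, H0, RtoC_opp. ring. }
  assert (EI : Cmult (RtoC (/ 2)) (Cplus (I (RtoC 1)) (Cmult Ci (I Ci))) = Cminus (dint (gR A B v) z) (Cmult (RtoC (/ 2)) (CInt J 0 1))).
  { unfold I, dint. rewrite <- (CInt_scal Ci) by auto. rewrite <- CInt_plus by auto using exCInt_scal.
    rewrite <- CInt_scal by auto using exCInt_plus, exCInt_scal. rewrite <- (CInt_scal (RtoC (/ 2)) J) by auto.
    rewrite <- CInt_minus by auto using exCInt_scal.
    (* The endpoints are left out since the pointwise identity divides by [r]. *)
    apply CInt_ext_open; [lra|]. intros r Hr.
    assert (X1 : forall h, exCInt (fun t => d z (r, t) h (RtoC 0)) 0 (2 * PI)) by (intros; eapply aint_ex_d; eauto).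
    assert (X2 : exCInt (fun t => dg z (r, t) (RtoC 0) (RtoC 1)) 0 (2 * PI)) by (eapply aint_ex_d; eauto).
    assert (X3 : exCInt (fun t => gR A B v z (r, t)) 0 (2 * PI)) by (eapply aint_ex; eauto).
    assert (X4 : exCInt (fun t => dg z (r, t) (RtoC 0) Ci) 0 (2 * PI)) by (eapply aint_ex_d; eauto).
    (* The angular derivative integrates to [0] over a full turn, so it may be added freely, with
       the factor [i / r] that completes the [wbar]-derivative. *)
    assert (E0 : CInt (fun t => dg z (r, t) (RtoC 0) Ci) 0 (2 * PI) = RtoC 0).
    { transitivity (CInt (fun t => dg z (Cplus (RtoC r) (Cmult (RtoC t) Ci)) (RtoC 0) Ci) 0 (2 * PI)).
      - apply CInt_ext; [lra|]. intros. now rewrite polar_pt.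
      - rewrite (C11_curve _ _ z (RtoC r) Ci 0 (2 * PI) Hg) by (rewrite Cmod_Ci; lra). rewrite !polar_pt.
        unfold gf, Nf, pol, chi; simpl. unfold cis. rewrite sin_2PI, cos_2PI, sin_0, cos_0. ring. }
    transitivity (Cminus (aint (gR A B v) z r) (Cmult (RtoC (/ 2)) (Cplus (J r) (Cmult (Cmult Ci (RtoC (/ r))) (CInt (fun t => dg z (r, t) (RtoC 0) Ci) 0 (2 * PI)))))).
    2:{ rewrite E0. ring. }
    unfold aint, J. rewrite <- (CInt_scal Ci) by auto. rewrite <- CInt_plus by auto using exCInt_scal.
    rewrite <- CInt_scal by auto using exCInt_plus, exCInt_scal.
    rewrite <- (CInt_scal (Cmult Ci (RtoC (/ r)))) by auto.
    rewrite <- CInt_plus by auto using exCInt_scal. rewrite <- CInt_scal by auto using exCInt_plus, exCInt_scal.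
    rewrite <- CInt_minus by auto using exCInt_plus, exCInt_scal.
    apply CInt_ext; [lra|]. intros t Ht. rewrite !Ed. unfold dg, dN.
    set (zeta := Cminus z (pol (r, t))). set (w := pol (r, t)).
    set (l := M1 A B v dA dB dv zeta w).
    assert (Hl : forall h, l h = Cplus (Cmult (RtoC (fst h)) (l (RtoC 1))) (Cmult (RtoC (snd h)) (l Ci))).
    { destruct HA as (HA1 & HA2 & _), HB as (HB1 & HB2 & _), Hv as (Hv1 & Hv2 & _).
      apply lin_decomp; intros; unfold l, M1.
      - rewrite (HA1 zeta (RtoC 0) h (RtoC 0) h' (RtoC 0)), (HB1 zeta (RtoC 0) h (RtoC 0) h' (RtoC 0)), (Hv1 zeta (RtoC 0) h (RtoC 0) h' (RtoC 0)). ring.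
      - rewrite (HA2 zeta (RtoC 0) c h (RtoC 0)), (HB2 zeta (RtoC 0) c h (RtoC 0)), (Hv2 zeta (RtoC 0) c h (RtoC 0)). ring. }
    set (m1 := l (RtoC 1)) in *. set (mi := l Ci) in *. set (n2 := N2 A B v zeta w).
    assert (D0 : dpol (r, t) (RtoC 0) = RtoC 0) by (unfold dpol; apply C_ext; simpl; ring).
    assert (D1 : dpol (r, t) (RtoC 1) = (cos t, sin t)) by (unfold dpol, cis; apply C_ext; simpl; ring).
    assert (D2 : dpol (r, t) Ci = Cmult (Cmult Ci (RtoC r)) (cos t, sin t)) by (unfold dpol, cis; apply C_ext; simpl; ring).
    rewrite D0, D1, D2.
    replace (Cminus (RtoC 1) (RtoC 0)) with (RtoC 1) by ring. replace (Cminus Ci (RtoC 0)) with Ci by ring.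
    fold m1 mi. rewrite (Hl (Cminus (RtoC 0) (cos t, sin t))), (Hl (Cminus (RtoC 0) (Cmult (Cmult Ci (RtoC r)) (cos t, sin t)))).
    set (n := Nf A B v z (r, t)) in *.
    set (x := 1 - r * r * (r * r)).
    replace (chi (r, t)) with (RtoC x) by (unfold chi, x; apply C_ext; simpl; ring).
    replace (gR A B v z (r, t)) with (Cmult (RtoC (- 2 * (r * (r * r)))) n) by (unfold gR, n; apply C_ext; simpl; ring).
    pose proof (pompeiu_algebra (cos t) (sin t) r x m1 mi n2 n ltac:(lra)) as PA.
    replace (cis (- snd (r, t))) with ((cos t, - sin t) : C) by (unfold cis; simpl; now rewrite cos_neg, sin_neg).
    replace (Cplus m1 (Cmult n2 (RtoC 0))) with m1 by ring. replace (Cplus mi (Cmult n2 (RtoC 0))) with mi by ring.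
    rewrite PA. f_equal. f_equal. f_equal. f_equal. f_equal.
    - unfold dchi. f_equal. apply C_ext; simpl; ring.
    - f_equal. f_equal. f_equal; f_equal; f_equal; simpl; ring.
    - unfold dchi. f_equal. simpl fst.
      replace (Cmult (Cmult (RtoC (-4)) (Cmult (RtoC r) (Cmult (RtoC r) (RtoC r)))) (RtoC 0)) with (RtoC 0) by ring.
      replace (Cmult (RtoC 0) n) with (RtoC 0) by ring. rewrite Cplus_0_l. f_equal. f_equal. f_equal; f_equal; f_equal; simpl; ring. }
  transitivity (Cmult (RtoC (/ PI)) (Cmult (RtoC (/ 2)) (Cplus (I (RtoC 1)) (Cmult Ci (I Ci))))); [ring|].
  rewrite EI, EJ. unfold Rop.
  assert (E2 : Cmult (RtoC (/ PI)) (Cmult (RtoC (/ 2)) (RtoC (- (2 * PI)))) = RtoC (-1)).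
  { rewrite <- !RtoC_mult. f_equal. field. apply PI_neq0. }
  transitivity (Cminus (Cmult (RtoC (/ PI)) (dint (gR A B v) z)) (Cmult (Cmult (RtoC (/ PI)) (Cmult (RtoC (/ 2)) (RtoC (- (2 * PI))))) (v z))); [ring|].
  rewrite E2. replace (RtoC (-1)) with (Copp (RtoC 1)) by (rewrite <- RtoC_opp; reflexivity). ring.
Qed.

(** * The initial cutoff of the local peak function *)

(** The squared positive part is of class [C^{1,1}]. The cutoff is its cube analogue [x * posq x]
    because the derivative of that cube is [3 posq x], which is still in the class; the
    [zbar]-derivative of the bump must be an admissible input for [Sop]. *)
Definition posq (z : C) : C := RtoC (Rmax 0 (fst z) * Rmax 0 (fst z)).

Lemma C11s_posq : C11s posq (fun z h => RtoC (2 * Rmax 0 (fst z) * fst h)).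
Proof.
  unfold C11s. apply C11_intro.
  - intros. apply C_ext; simpl; ring.
  - intros. apply C_ext; simpl; ring.
  - intros M HM. exists (M * M + 2 * M + 2). split; [nra|]. intros z _ h k Hz _ Hh _.
    pose proof (abs_fst_le z). pose proof (abs_fst_le h). pose proof (Cmod_ge_0 h). pose proof (Cmod_ge_0 k).
    assert (X : 0 <= Rmax 0 (fst z) <= M).
    { split; [apply Rmax_l|]. apply Rmax_lub; auto. pose proof (Rle_abs (fst z)). lra. }
    unfold posq. split; [|split].
    + rewrite Cmod_RtoC, Rabs_pos_eq by nra. nra.
    + apply Rle_trans with (Cmod h * Cmod h).
      2:{ apply Rle_trans with (1 * ((Cmod h + Cmod k) * (Cmod h + Cmod k))); [nra|]. apply Rmult_le_compat_r; nra. }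
      rewrite <- RtoC_plus, <- RtoC_minus, Cmod_RtoC. simpl.
      apply Rle_trans with (fst h * fst h).
      2:{ pose proof (Cmod_sqr h). nra. }
      set (x := fst z). set (y := fst h).
      unfold Rmax; destruct (Rle_dec 0 (x + y)), (Rle_dec 0 x); apply Rabs_le; split; nra.
    + intros a b. pose proof (abs_fst_le a). pose proof (Cmod_ge_0 a). pose proof (Cmod_ge_0 b). split.
      * rewrite Cmod_RtoC, !Rabs_mult, (Rabs_pos_eq 2), (Rabs_pos_eq (Rmax 0 (fst z))) by lra.
        pose proof (Rabs_pos (fst a)).
        assert (2 * Rmax 0 (fst z) * Rabs (fst a) <= 2 * M * Cmod a) by (apply Rmult_le_compat; lra).
        assert (0 <= (M * M + 2) * (Cmod a + Cmod b)) by (apply Rmult_le_pos; nra). nra.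
      * rewrite <- RtoC_minus, Cmod_RtoC. simpl.
        assert (Rabs (Rmax 0 (fst z + fst h) - Rmax 0 (fst z)) <= Cmod h).
        { apply Rle_trans with (Rabs (fst h)); [|lra].
          unfold Rmax; destruct (Rle_dec 0 (fst z + fst h)), (Rle_dec 0 (fst z)); unfold Rabs; destruct (Rcase_abs _), (Rcase_abs (fst h)); lra. }
        replace (2 * Rmax 0 (fst z + fst h) * fst a - 2 * Rmax 0 (fst z) * fst a) with
          (2 * ((Rmax 0 (fst z + fst h) - Rmax 0 (fst z)) * fst a)) by ring.
        rewrite !Rabs_mult, (Rabs_pos_eq 2) by lra.
        assert (Rabs (Rmax 0 (fst z + fst h) - Rmax 0 (fst z)) * Rabs (fst a) <= (Cmod h + Cmod k) * (Cmod a + Cmod b)).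
        { apply Rmult_le_compat; try apply Rabs_pos; lra. }
        assert (0 <= (M * M + 2 * M) * ((Cmod h + Cmod k) * (Cmod a + Cmod b))) by (apply Rmult_le_pos; nra). nra.
Qed.

(* [bump a] is the cutoff [max (0, 1 - |z - a|^4) ^ 3] times [ker]; its [zbar]-derivative is [dbump]. *)
Definition sq (a z : C) : C := Cmult (Cminus z a) (Cconj (Cminus z a)).

Definition cut (a z : C) : C := Cminus (RtoC 1) (Cmult (sq a z) (sq a z)).

Definition bump (A B : C -> C) (a z : C) : C :=
  Cmult (Cmult (cut a z) (posq (cut a z))) (ker (fun _ => A a) (fun _ => B a) a (Cminus z a)).

Definition dbump (A B : C -> C) (a z : C) : C :=
  Cmult (Cmult (Cmult (RtoC (-6)) (Cmult (sq a z) (posq (cut a z)))) (Cminus z a)) (ker (fun _ => A a) (fun _ => B a) a (Cminus z a)).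

Lemma C11s_dbump (A B : C -> C) (a : C) : exists d, C11s (dbump A B a) d.
Proof.
  pose proof (C11_plus _ _ _ _ C11_fst (C11_const (Copp a))) as Hw.
  pose proof (C11_mult _ _ _ _ Hw (C11_conj _ _ Hw)) as Hs.
  pose proof (C11_plus _ _ _ _ (C11_const (RtoC 1)) (C11_opp _ _ (C11_mult _ _ _ _ Hs Hs))) as Hc.
  pose proof (C11_comp1 _ _ _ _ C11s_posq Hc) as Hp.
  pose proof (C11_cexp _ _ (C11_plus _ _ _ _ (C11_mult _ _ _ _ (C11_const (A a)) Hw) (C11_mult _ _ _ _ (C11_const (B a)) (C11_mult _ _ _ _ Hw Hw)))) as Hk.
  pose proof (C11_mult _ _ _ _ (C11_mult _ _ _ _ (C11_mult _ _ _ _ (C11_const (RtoC (-6))) (C11_mult _ _ _ _ Hs Hp)) Hw) Hk) as H.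
  match type of H with C11 _ ?d => exists (fun z h => d z (RtoC 0) h (RtoC 0)) end.
  eapply C11_ext; [| |exact H]; reflexivity.
Qed.

Lemma C11s_bump (A B : C -> C) (a : C) :
  exists d, C11s (bump A B a) d /\ forall z, Cmult (RtoC (/ 2)) (Cplus (d z (RtoC 1)) (Cmult Ci (d z Ci))) = dbump A B a z.
Proof.
  pose proof (C11_plus _ _ _ _ C11_fst (C11_const (Copp a))) as Hw.
  pose proof (C11_mult _ _ _ _ Hw (C11_conj _ _ Hw)) as Hs.
  pose proof (C11_plus _ _ _ _ (C11_const (RtoC 1)) (C11_opp _ _ (C11_mult _ _ _ _ Hs Hs))) as Hc.
  pose proof (C11_comp1 _ _ _ _ C11s_posq Hc) as Hp.
  pose proof (C11_cexp _ _ (C11_plus _ _ _ _ (C11_mult _ _ _ _ (C11_const (A a)) Hw) (C11_mult _ _ _ _ (C11_const (B a)) (C11_mult _ _ _ _ Hw Hw)))) as Hk.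
  pose proof (C11_mult _ _ _ _ (C11_mult _ _ _ _ Hc Hp) Hk) as H.
  set (s := fun z => fst (sq a z)). set (x := fun z => fst (cut a z)). set (p := fun z => Rmax 0 (x z)).
  set (k := fun z => ker (fun _ => A a) (fun _ => B a) a (Cminus z a)).
  assert (Es : forall z, sq a z = RtoC (s z)) by (intros; unfold s, sq; apply C_ext; simpl; ring).
  assert (Ec : forall z, cut a z = RtoC (x z)) by (intros; unfold x, cut; rewrite Es; apply C_ext; simpl; ring).
  (* Since [p] is the positive part of [x], the product rule for [x p^2] collapses to [3 p^2]. With
     [-2 s] from [1 - s^2] this is the constant [-6]. *)
  assert (Exp : forall z, x z * p z = p z * p z) by (intros; unfold p, Rmax; destruct (Rle_dec 0 (x z)); ring).
  set (t := fun (z h : C) => 2 * (fst (Cminus z a) * fst h + snd (Cminus z a) * snd h)).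
  set (q := fun z => Cmult (RtoC (x z * (p z * p z))) (Cmult (k z) (Cplus (A a) (Cmult (RtoC 2) (Cmult (B a) (Cminus z a)))))).
  (* The differential is split into a multiple of [t z h], the differential of [|z - a|^2], and a
     complex linear part [q z * h]. The second one drops out of the [zbar]-derivative. *)
  exists (fun z h => Cplus (Cmult (RtoC (- 6 * (s z * (p z * p z)) * t z h)) (k z)) (Cmult (q z) h)). split.
  - eapply C11_ext; [| |exact H]; cbv beta; [reflexivity|]. intros z u h _.
    change (Cplus z (Copp a)) with (Cminus z a). fold (sq a z). change (Cplus (RtoC 1) (Copp (Cmult (sq a z) (sq a z)))) with (cut a z).
    change (cexp (Cplus (Cmult (A a) (Cminus z a)) (Cmult (B a) (Cmult (Cminus z a) (Cminus z a))))) with (k z).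
    replace (Cplus h (RtoC 0)) with h by ring.
    assert (Et : Cplus (Cmult h (Cconj (Cminus z a))) (Cmult (Cminus z a) (Cconj h)) = RtoC (t z h)) by (unfold t; apply C_ext; simpl; ring).
    rewrite Et. unfold posq. rewrite Ec, Es. simpl fst. fold (p z).
    replace (0 + - (t z h * s z - 0 * 0 + (s z * t z h - 0 * 0))) with (- 2 * (s z * t z h)) by ring.
    replace (Cplus (RtoC 0) (Copp (Cplus (Cmult (RtoC (t z h)) (RtoC (s z))) (Cmult (RtoC (s z)) (RtoC (t z h)))))) with (RtoC (-2 * (s z * t z h))) by (apply C_ext; simpl; ring).
    replace (Cplus (Cmult (RtoC (-2 * (s z * t z h))) (RtoC (p z * p z))) (Cmult (RtoC (x z)) (RtoC (2 * p z * (-2 * (s z * t z h)))))) with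
      (RtoC (- 6 * (s z * (p z * p z)) * t z h)).
    2:{ rewrite <- !RtoC_mult, <- RtoC_plus. f_equal.
        replace (-2 * (s z * t z h) * (p z * p z) + x z * (2 * p z * (-2 * (s z * t z h)))) with (-2 * (s z * t z h) * (p z * p z) + (-4 * (s z * t z h)) * (x z * p z)) by ring.
        rewrite Exp. ring. }
    unfold q. rewrite (RtoC_mult (x z) (p z * p z)). replace (RtoC 2) with (Cplus (RtoC 1) (RtoC 1)) by (rewrite <- RtoC_plus; f_equal; ring). ring.
  - intros z. cbv beta. unfold dbump. fold (k z). unfold posq. rewrite Ec, Es. simpl fst. fold (p z). unfold t.
    generalize (q z) (k z) (s z) (p z). intros [q1 q2] [k1 k2] s' p'. apply C_ext; simpl; field.
Qed.

(** * Weighted bounds for the solution operator and its error *)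

Lemma ker_bound (A B : C -> C) (phi : C -> R) (K : R) (z w : C) :
  (forall z w, Cmod w <= 1 -> fst (Cplus (Cmult (A z) w) (Cmult (B z) (Cmult w w))) <= phi (Cplus z w) - phi z - K * (Cmod w * Cmod w)) ->
  Cmod w <= 1 -> Cmod (ker A B z w) <= exp (phi (Cplus z w) - phi z - K * (Cmod w * Cmod w)).
Proof. intros H Hw. unfold ker. rewrite Cmod_cexp. apply exp_mono. auto. Qed.

(** The factor [exp (phi zeta)] allowed to [v] cancels against [exp (- phi zeta)] in the kernel
    bound. What is left is the weight at [z] and a Gaussian in the distance. *)
Lemma Nf_bound (A B v : C -> C) (phi : C -> R) (K V : R) (z : C) (r t : R) :
  (forall z w, Cmod w <= 1 -> fst (Cplus (Cmult (A z) w) (Cmult (B z) (Cmult w w))) <= phi (Cplus z w) - phi z - K * (Cmod w * Cmod w)) ->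
  0 <= V -> (forall z, Cmod (v z) <= V * exp (phi z)) -> 0 <= r <= 1 ->
  Cmod (Nf A B v z (r, t)) <= V * exp (phi z) * exp (- (K * (r * r))).
Proof.
  intros H HV Hv Hr. unfold Nf. rewrite Cmod_mult. set (w := pol (r, t)). set (zeta := Cminus z w).
  assert (Hw : Cmod w = r) by (unfold w; rewrite Cmod_pol; simpl; apply Rabs_pos_eq; lra).
  pose proof (ker_bound A B phi K zeta w H ltac:(lra)) as Hk. rewrite Hw in Hk.
  replace (Cplus zeta w) with z in Hk by (unfold zeta; ring).
  apply Rle_trans with (V * exp (phi zeta) * exp (phi z - phi zeta - K * (r * r))).
  - apply Rmult_le_compat; auto using Cmod_ge_0.
  - right. rewrite !Rmult_assoc, <- !exp_plus. f_equal. f_equal. ring.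
Qed.

Lemma xexp_le (K y : R) : 0 < K -> y * exp (- (K * y)) <= / K.
Proof.
  intros HK. pose proof (exp_ineq1_le (K * y)). pose proof (exp_pos (- (K * y))).
  assert (E : exp (K * y) * exp (- (K * y)) = 1) by (rewrite <- exp_plus, Rplus_opp_r; apply exp_0).
  apply Rmult_le_reg_l with K; auto. rewrite Rinv_r by lra.
  assert (K * y * exp (- (K * y)) <= exp (K * y) * exp (- (K * y))) by (apply Rmult_le_compat_r; lra). lra.
Qed.

(** Cutoff and Gaussian are both at most [1], so this is the constant [8 PI] of [dint_le] divided by
    [PI]; no gain in [K] is sought here. *)
Lemma Sop_bound (A B v : C -> C) (dA dB dv : C -> C -> C) (phi : C -> R) (K V : R) (z : C) :
  C11s A dA -> C11s B dB -> C11s v dv -> 0 <= K ->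
  (forall z w, Cmod w <= 1 -> fst (Cplus (Cmult (A z) w) (Cmult (B z) (Cmult w w))) <= phi (Cplus z w) - phi z - K * (Cmod w * Cmod w)) ->
  0 <= V -> (forall z, Cmod (v z) <= V * exp (phi z)) -> Cmod (Sop A B v z) <= 8 * V * exp (phi z).
Proof.
  intros HA HB Hv HK H HV Hb. destruct (C11_gS A B v dA dB dv HA HB Hv) as (d & Hd & _).
  pose proof PI_RGT_0. unfold Sop. rewrite Cmod_mult, Cmod_RtoC, Rabs_pos_eq by (left; now apply Rinv_0_lt_compat).
  apply Rle_trans with (/ PI * (8 * PI * (V * exp (phi z)))); [|right; field; lra].
  apply Rmult_le_compat_l; [left; now apply Rinv_0_lt_compat|].
  apply (dint_le _ _ _ _ Hd). intros r t Hr. unfold gS, gf. rewrite !Cmod_mult, Cmod_cis, Rmult_1_r.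
  pose proof (Nf_bound A B v phi K V z r t H HV Hb Hr) as HN.
  assert (Cmod (chi (r, t)) <= 1).
  { unfold chi; simpl. rewrite <- !RtoC_mult, <- RtoC_minus, Cmod_RtoC.
    assert (0 <= r * r <= 1) by nra. assert (0 <= (r * r) * (r * r) <= 1) by nra. apply Rabs_le; lra. }
  pose proof (exp_pos (phi z)). assert (exp (- (K * (r * r))) <= 1) by (rewrite <- exp_0; apply exp_mono; nra).
  assert (0 <= V * exp (phi z)) by nra.
  assert (V * exp (phi z) * exp (- (K * (r * r))) <= V * exp (phi z) * 1) by (apply Rmult_le_compat_l; lra).
  apply Rle_trans with (1 * (V * exp (phi z) * exp (- (K * (r * r))))); [|lra].
  apply Rmult_le_compat; auto using Cmod_ge_0.
Qed.

(** The gain is [r^2 exp (- K r^2) <= 1 / K], with the remaining [r] of [r^3] bounded by [1]. For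
    large [K] this makes [Rop] a contraction in the weighted norm. *)
Lemma Rop_bound (A B v : C -> C) (dA dB dv : C -> C -> C) (phi : C -> R) (K V : R) (z : C) :
  C11s A dA -> C11s B dB -> C11s v dv -> 0 < K ->
  (forall z w, Cmod w <= 1 -> fst (Cplus (Cmult (A z) w) (Cmult (B z) (Cmult w w))) <= phi (Cplus z w) - phi z - K * (Cmod w * Cmod w)) ->
  0 <= V -> (forall z, Cmod (v z) <= V * exp (phi z)) -> Cmod (Rop A B v z) <= 16 / K * V * exp (phi z).
Proof.
  intros HA HB Hv HK H HV Hb. destruct (C11_gR A B v dA dB dv HA HB Hv) as (d & Hd).
  pose proof PI_RGT_0. unfold Rop. rewrite Cmod_mult, Cmod_RtoC, Rabs_pos_eq by (left; now apply Rinv_0_lt_compat).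
  apply Rle_trans with (/ PI * (8 * PI * (2 / K * (V * exp (phi z))))); [|right; field; lra].
  apply Rmult_le_compat_l; [left; now apply Rinv_0_lt_compat|].
  apply (dint_le _ _ _ _ Hd). intros r t Hr. unfold gR; simpl fst. rewrite !Cmod_mult, !Cmod_RtoC.
  rewrite (Rabs_pos_eq r) by lra. replace (Rabs (-2)) with 2 by (unfold Rabs; destruct (Rcase_abs (-2)); lra).
  pose proof (Nf_bound A B v phi K V z r t H HV Hb Hr) as HN.
  pose proof (exp_pos (phi z)). pose proof (exp_pos (- (K * (r * r)))). pose proof (xexp_le K (r * r) HK).
  assert (0 <= V * exp (phi z)) by nra.
  apply Rle_trans with (2 * (r * (r * r)) * (V * exp (phi z) * exp (- (K * (r * r))))).
  - apply Rmult_le_compat_l; auto. assert (0 <= r * r) by nra. nra.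
  - replace (2 * (r * (r * r)) * (V * exp (phi z) * exp (- (K * (r * r))))) with (2 * (r * (r * r * exp (- (K * (r * r))))) * (V * exp (phi z))) by ring.
    apply Rmult_le_compat_r; auto. unfold Rdiv. apply Rmult_le_compat_l; [lra|].
    assert (0 <= r * r * exp (- (K * (r * r)))) by (apply Rmult_le_pos; nra).
    apply Rle_trans with (1 * (r * r * exp (- (K * (r * r))))); [|lra]. apply Rmult_le_compat_r; lra.
Qed.

(** In each coordinate the intervals of radius [2 D / 2^n] around the [n]-th term are nested. The
    explicit rate is kept because it must be combined with the bounds on [vseq]. *)
Lemma geom_limit (u : nat -> C) (D : R) : 0 < D -> (forall n, Cmod (Cminus (u (S n)) (u n)) <= D / 2 ^ n) ->
  exists l, forall n, Cmod (Cminus l (u n)) <= 4 * D / 2 ^ n.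
Proof.
  intros HD H.
  assert (K : forall x : nat -> R, (forall n, Rabs (x (S n) - x n) <= D / 2 ^ n) -> exists l, forall n, Rabs (l - x n) <= 2 * D / 2 ^ n).
  { intros x Hx. destruct (nested_sup (fun n => x n - 2 * D / 2 ^ n) (4 * D)) as (l & Hl); [lra| |].
    - intros n. specialize (Hx n). apply Rabs_le_between in Hx. simpl pow.
      assert (P : 0 < 2 ^ n) by (apply pow_lt; lra).
      replace (2 * D / (2 * 2 ^ n)) with (D / 2 ^ n) by (field; lra).
      replace (4 * D / (2 * 2 ^ n)) with (2 * (D / 2 ^ n)) by (field; lra).
      replace (4 * D / 2 ^ n) with (4 * (D / 2 ^ n)) by (field; lra).
      replace (2 * D / 2 ^ n) with (2 * (D / 2 ^ n)) by (field; lra). lra.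
    - exists l. intros n. specialize (Hl n). replace (4 * D / 2 ^ n) with (2 * D / 2 ^ n + 2 * D / 2 ^ n) in Hl by (field; apply pow_nonzero; lra).
      apply Rabs_le. lra. }
  destruct (K (fun n => fst (u n))) as (l1 & H1).
  { intros n. eapply Rle_trans; [|apply H]. apply (abs_fst_le (Cminus (u (S n)) (u n))). }
  destruct (K (fun n => snd (u n))) as (l2 & H2).
  { intros n. eapply Rle_trans; [|apply H]. apply (abs_snd_le (Cminus (u (S n)) (u n))). }
  exists (l1, l2). intros n. eapply Rle_trans; [apply Cmod_le_abs|]. specialize (H1 n). specialize (H2 n).
  simpl. unfold Rminus in *. replace (4 * D / 2 ^ n) with (2 * D / 2 ^ n + 2 * D / 2 ^ n) by (field; apply pow_nonzero; lra). lra.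
Qed.

Fixpoint vseq (A B v0 : C -> C) (n : nat) : C -> C :=
  match n with O => v0 | S m => fun z => Copp (Rop A B (vseq A B v0 m) z) end.

Fixpoint Fseq (A B f v0 : C -> C) (n : nat) : C -> C :=
  match n with O => f | S m => fun z => Cminus (Fseq A B f v0 m z) (Sop A B (vseq A B v0 m) z) end.

Lemma half_pow_small (D eps : R) : 0 <= D -> 0 < eps -> exists n, D / 2 ^ n < eps.
Proof.
  intros HD He. destruct (pow2_small (D + 1) eps) as (n & Hn); [lra|auto|]. exists n.
  eapply Rle_lt_trans; [|exact Hn]. unfold Rdiv. apply Rmult_le_compat_r; [|lra].
  left. apply Rinv_0_lt_compat, pow_lt; lra.
Qed.

(* Neumann series: [vseq n = (-Rop)^n (dbar bump)] halves at each step in the norm weighted by [exp phi], and the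
   partial sums [Fseq n = bump - sum_(i < n) Sop (vseq i)] satisfy [dbar (Fseq n) = vseq n]. *)
Lemma entire_peak (A B : C -> C) (dA dB : C -> C -> C) (phi : C -> R) (K : R) :
  C11s A dA -> C11s B dB -> 1000 <= K ->
  (forall z w, Cmod w <= 1 -> fst (Cplus (Cmult (A z) w) (Cmult (B z) (Cmult w w))) <= phi (Cplus z w) - phi z - K * (Cmod w * Cmod w)) ->
  (forall M, exists b, forall z, Cmod z <= M -> phi z <= b) ->
  forall a, exists F, (forall z, exists p, cdiff1 F z p) /\ (forall z, Cmod (F z) <= 2 * exp (phi z - phi a)) /\ 1 / 2 <= Cmod (F a).
Proof.
  intros HA HB HK Hphi Hloc a.
  set (f := bump A B a). set (v0 := dbump A B a).
  (* [K >= 1000] is used twice: [16 / K <= 1/2] halves [vseq] at each step, and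
     [4 * 8 * 6 / K = 192 / K <= 1/4] bounds the total correction [F - f] relative to
     [exp (phi z - phi a)]. *)
  assert (Hiv : 0 < / K <= / 1000).
  { split; [apply Rinv_0_lt_compat; lra|]. apply Rinv_le_contravar; lra. }
  set (V0 := 6 * / K * exp (- phi a)). pose proof (exp_pos (- phi a)) as HE.
  assert (HV0 : 0 < V0) by (unfold V0; apply Rmult_lt_0_compat; lra).
  assert (Hk : forall z, Cmod (Cminus z a) <= 1 -> Cmod (ker (fun _ => A a) (fun _ => B a) a (Cminus z a)) <= exp (phi z - phi a) * exp (- (K * (Cmod (Cminus z a) * Cmod (Cminus z a))))).
  { intros z Hz. rewrite <- exp_plus. unfold ker. rewrite Cmod_cexp. apply exp_mono.
    pose proof (Hphi a (Cminus z a) Hz). replace (Cplus a (Cminus z a)) with z in H by ring. lra. }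
  assert (Hsq : forall z, fst (sq a z) = Cmod (Cminus z a) * Cmod (Cminus z a)) by (intros; rewrite Cmod_sqr; unfold sq; simpl; ring).
  assert (Hsq2 : forall z, snd (sq a z) = 0) by (intros; unfold sq; simpl; ring).
  assert (Hcut : forall z, cut a z = RtoC (1 - (Cmod (Cminus z a) * Cmod (Cminus z a)) * (Cmod (Cminus z a) * Cmod (Cminus z a)))).
  { intros z. assert (Es : sq a z = RtoC (Cmod (Cminus z a) * Cmod (Cminus z a))) by (apply C_ext; [rewrite Hsq; reflexivity|apply Hsq2]).
    unfold cut. rewrite Es, <- !RtoC_mult, <- RtoC_minus. reflexivity. }
  (* The hypothesis on [phi] controls the kernel only for [|w| <= 1]. Outside that disc the cutoff
     vanishes and nothing has to be estimated. *)
  assert (Hout : forall z, 1 <= Cmod (Cminus z a) -> posq (cut a z) = RtoC 0).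
  { intros z Hz. unfold posq. rewrite Hcut. simpl. rewrite Rmax_left; [f_equal; ring|].
    assert (1 <= Cmod (Cminus z a) * Cmod (Cminus z a)) by nra. nra. }
  assert (Hin : forall z, Cmod (Cminus z a) <= 1 -> 0 <= Cmod (posq (cut a z)) <= 1 /\ 0 <= Cmod (cut a z) <= 1).
  { intros z Hz. unfold posq. rewrite Hcut. pose proof (Cmod_ge_0 (Cminus z a)). set (m := Cmod (Cminus z a)) in *. simpl.
    assert (0 <= m * m <= 1) by nra. assert (0 <= 1 - m * m * (m * m) <= 1) by nra.
    rewrite Rmax_right by lra. rewrite !Cmod_RtoC. rewrite !Rabs_pos_eq by nra. nra. }
  assert (Hf : forall z, Cmod (f z) <= exp (phi z - phi a)).
  { intros z. unfold f, bump. pose proof (exp_pos (phi z - phi a)).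
    destruct (Rle_dec 1 (Cmod (Cminus z a))) as [Hz|Hz].
    - rewrite Hout by auto. rewrite !Cmod_mult, Cmod_0. lra.
    - destruct (Hin z) as (P1 & P2); [lra|]. specialize (Hk z ltac:(lra)). rewrite !Cmod_mult.
      assert (exp (- (K * (Cmod (Cminus z a) * Cmod (Cminus z a)))) <= 1).
      { rewrite <- exp_0. apply exp_mono. pose proof (Cmod_ge_0 (Cminus z a)).
        assert (0 <= Cmod (Cminus z a) * Cmod (Cminus z a)) by nra. nra. }
      apply Rle_trans with (1 * 1 * exp (phi z - phi a)); [|lra].
      apply Rmult_le_compat; auto using Cmod_ge_0; [nra|nra|].
      eapply Rle_trans; [exact Hk|]. rewrite <- Rmult_1_r. apply Rmult_le_compat_l; lra. }
  assert (Hv0 : forall z, Cmod (v0 z) <= V0 * exp (phi z)).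
  { intros z. unfold v0, dbump, V0. pose proof (exp_pos (phi z)).
    destruct (Rle_dec 1 (Cmod (Cminus z a))) as [Hz|Hz].
    - rewrite Hout by auto. rewrite !Cmod_mult, Cmod_0. rewrite !Rmult_0_r, !Rmult_0_l.
      assert (0 <= 6 * / K * exp (- phi a) * exp (phi z)) by (apply Rmult_le_pos; nra). lra.
    - destruct (Hin z) as (P1 & P2); [lra|]. specialize (Hk z ltac:(lra)). rewrite !Cmod_mult.
      assert (Es : Cmod (sq a z) = Cmod (Cminus z a) * Cmod (Cminus z a)) by (unfold sq; now rewrite Cmod_mult, Cmod_conj).
      rewrite Es, Cmod_RtoC. replace (Rabs (-6)) with 6 by (unfold Rabs; destruct (Rcase_abs (-6)); lra).
      set (m := Cmod (Cminus z a)) in *. assert (0 <= m <= 1) by (unfold m in *; split; [apply Cmod_ge_0|lra]).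
      pose proof (xexp_le K (m * m) ltac:(lra)).
      set (pq := Cmod (posq (cut a z))) in *.
      apply Rle_trans with (6 * (m * m * 1) * 1 * (exp (phi z - phi a) * exp (- (K * (m * m))))).
      + apply Rmult_le_compat; auto using Cmod_ge_0.
        * repeat apply Rmult_le_pos; try lra.
        * apply Rmult_le_compat; try lra; [repeat apply Rmult_le_pos; lra|]. apply Rmult_le_compat_l; [lra|]. apply Rmult_le_compat_l; nra.
      + replace (phi z - phi a) with (- phi a + phi z) by ring. rewrite exp_plus.
        assert (0 <= exp (- phi a) * exp (phi z)) by nra.
        replace (6 * (m * m * 1) * 1 * (exp (- phi a) * exp (phi z) * exp (- (K * (m * m))))) with (6 * (m * m * exp (- (K * (m * m)))) * (exp (- phi a) * exp (phi z))) by ring.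
        replace (6 * / K * exp (- phi a) * exp (phi z)) with (6 * / K * (exp (- phi a) * exp (phi z))) by ring.
        apply Rmult_le_compat_r; lra. }
  assert (Hvd : forall n, exists d, C11s (vseq A B v0 n) d).
  { induction n as [|n (d & Hd)]; [apply C11s_dbump|].
    destruct (C11_gR A B _ dA dB d HA HB Hd) as (dR & HdR).
    pose proof (C11_opp _ _ (C11_mult _ _ _ _ (C11_const (RtoC (/ PI))) (C11_dint _ _ HdR))) as H.
    match type of H with C11 _ ?d => exists (fun z h => d z (RtoC 0) h (RtoC 0)) end.
    eapply C11_ext; [| |exact H]; reflexivity. }
  assert (Hvb : forall n z, Cmod (vseq A B v0 n z) <= V0 / 2 ^ n * exp (phi z)).
  { induction n as [|n IH]; intros z.
    - simpl. unfold Rdiv. rewrite Rinv_1, Rmult_1_r. apply Hv0.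
    - simpl. rewrite Cmod_opp. destruct (Hvd n) as (d & Hd).
      assert (P : 0 < 2 ^ n) by (apply pow_lt; lra).
      assert (HVn : 0 <= V0 / 2 ^ n) by (apply Rlt_le, Rdiv_lt_0_compat; auto).
      eapply Rle_trans; [apply (Rop_bound A B _ dA dB d phi K (V0 / 2 ^ n) z HA HB Hd); auto; lra|].
      apply Rmult_le_compat_r; [left; apply exp_pos|].
      replace (V0 / (2 * 2 ^ n)) with (/ 2 * (V0 / 2 ^ n)) by (field; lra). apply Rmult_le_compat_r; auto. unfold Rdiv. lra. }
  assert (HF : forall n, forall z, exists p, rdiff (Fseq A B f v0 n) z p (vseq A B v0 n z)).
  { assert (HF' : forall n, exists d, C11s (Fseq A B f v0 n) d /\ forall z, Cmult (RtoC (/ 2)) (Cplus (d z (RtoC 1)) (Cmult Ci (d z Ci))) = vseq A B v0 n z).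
    { induction n as [|n (d & Hd & Ed)]; [apply C11s_bump|].
      destruct (Hvd n) as (dv & Hdv). destruct (dbar_Sop A B _ dA dB dv HA HB Hdv) as (dS & HdS & EdS).
      exists (fun z h => Cplus (d z h) (Copp (dS z h))). split.
      - eapply C11_ext; [| |exact (C11_plus _ _ _ _ Hd (C11_opp _ _ HdS))]; reflexivity.
      - intros z. simpl.
        transitivity (Cminus (Cmult (RtoC (/ 2)) (Cplus (d z (RtoC 1)) (Cmult Ci (d z Ci)))) (Cmult (RtoC (/ 2)) (Cplus (dS z (RtoC 1)) (Cmult Ci (dS z Ci))))); [ring|].
        rewrite Ed, EdS. ring. }
    intros n z. destruct (HF' n) as (d & Hd & Ed). rewrite <- Ed. eexists. now apply C11s_rdiff. }
  set (D := fun z => 8 * V0 * exp (phi z)).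
  assert (HD : forall z, 0 < D z) by (intros; unfold D; apply Rmult_lt_0_compat; [lra|apply exp_pos]).
  assert (HS : forall z n, Cmod (Cminus (Fseq A B f v0 (S n) z) (Fseq A B f v0 n z)) <= D z / 2 ^ n).
  { intros z n. simpl. replace (Cminus (Cminus (Fseq A B f v0 n z) (Sop A B (vseq A B v0 n) z)) (Fseq A B f v0 n z)) with (Copp (Sop A B (vseq A B v0 n) z)) by ring.
    rewrite Cmod_opp. destruct (Hvd n) as (d & Hd).
    assert (P : 0 < 2 ^ n) by (apply pow_lt; lra).
    eapply Rle_trans; [apply (Sop_bound A B _ dA dB d phi K (V0 / 2 ^ n) z HA HB Hd); auto|].
    - lra.
    - apply Rlt_le, Rdiv_lt_0_compat; auto.
    - right. unfold D. field. lra. }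
  destruct (functional_choice (fun z l => forall n, Cmod (Cminus l (Fseq A B f v0 n z)) <= 4 * D z / 2 ^ n)) as (F & HFl).
  { intros z. apply geom_limit; auto. }
  assert (H0 : forall z, Cmod (Cminus (F z) (f z)) <= 1 / 4 * exp (phi z - phi a)).
  { intros z. pose proof (HFl z O). simpl in H. unfold Rdiv in H at 1. rewrite Rinv_1, Rmult_1_r in H.
    eapply Rle_trans; [exact H|]. unfold D, V0. replace (phi z - phi a) with (- phi a + phi z) by ring. rewrite exp_plus.
    pose proof (exp_pos (phi z)).
    replace (4 * (8 * (6 * / K * exp (- phi a)) * exp (phi z))) with (192 * / K * (exp (- phi a) * exp (phi z))) by ring.
    apply Rmult_le_compat_r; [nra|lra]. }
  assert (HFb : forall z, Cmod (F z) <= 2 * exp (phi z - phi a)).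
  { intros z. pose proof (Cmod_rev_tri (F z) (f z)). specialize (H0 z). specialize (Hf z). pose proof (exp_pos (phi z - phi a)). lra. }
  assert (Hfc : forall n z, ccontC (Fseq A B f v0 n) z).
  { intros n z. destruct (HF n z) as (p & Hp). eapply rdiff_cont; eauto. }
  assert (HDl : forall M, exists b, 0 <= b /\ forall z, Cmod z <= M -> D z <= b).
  { intros M. destruct (Hloc M) as (b & Hb). exists (8 * V0 * exp b). split; [pose proof (exp_pos b); nra|].
    intros z Hz. unfold D. apply Rmult_le_compat_l; [lra|]. apply exp_mono; auto. }
  assert (HFc : forall z, ccontC F z).
  { intros z eps He. destruct (HDl (Cmod z + 1)) as (b & Hb0 & Hb). destruct (half_pow_small (4 * b) (eps / 4)) as (n & Hn); [lra|lra|].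
    assert (P : 0 < / 2 ^ n) by (apply Rinv_0_lt_compat, pow_lt; lra).
    destruct (Hfc n z (eps / 4)) as (d & Hd & Kd); [lra|]. exists (Rmin 1 d). split; [apply Rmin_pos; lra|].
    intros w Hw. pose proof (Rlt_le_trans _ _ _ Hw (Rmin_l _ _)). pose proof (Rlt_le_trans _ _ _ Hw (Rmin_r _ _)).
    specialize (Kd w H1). pose proof (HFl w n). pose proof (HFl z n).
    assert (D w <= b). { apply Hb. pose proof (Cmod_rev_tri w z). lra. }
    assert (D z <= b) by (apply Hb; lra).
    assert (4 * D w / 2 ^ n <= 4 * b / 2 ^ n) by (unfold Rdiv; apply Rmult_le_compat_r; lra).
    assert (4 * D z / 2 ^ n <= 4 * b / 2 ^ n) by (unfold Rdiv; apply Rmult_le_compat_r; lra).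
    pose proof (Cmod_tri3 (F w) (Fseq A B f v0 n w) (F z)). pose proof (Cmod_tri3 (Fseq A B f v0 n w) (Fseq A B f v0 n z) (F z)).
    rewrite (Cmod_minus_sym (Fseq A B f v0 n z) (F z)) in H9. lra. }
  exists F. split; [|split; auto].
  - apply morera; auto.
    + intros M. destruct (Hloc M) as (b & Hb). exists (2 * exp (b - phi a)). intros z Hz.
      eapply Rle_trans; [apply HFb|]. apply Rmult_le_compat_l; [lra|]. apply exp_mono. specialize (Hb z Hz). lra.
    + intros x1 x2 y1 y2 Hx Hy.
      set (M := Rabs x1 + Rabs x2 + Rabs y1 + Rabs y2).
      assert (HM : forall x y, x1 <= x <= x2 -> y1 <= y <= y2 -> Cmod (x, y) <= M).
      { intros x y Hx' Hy'. eapply Rle_trans; [apply Cmod_le_abs|]. simpl. unfold M.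
        assert (Rabs x <= Rabs x1 + Rabs x2) by (unfold Rabs; destruct (Rcase_abs x), (Rcase_abs x1), (Rcase_abs x2); lra).
        assert (Rabs y <= Rabs y1 + Rabs y2) by (unfold Rabs; destruct (Rcase_abs y), (Rcase_abs y1), (Rcase_abs y2); lra). lra. }
      destruct (HDl M) as (b & Hb0 & Hb).
      (* No differentiability of the limit [F] is available. Its rectangle integral is that of
         [Fseq n], small by Goursat because the [zbar]-derivative [vseq n] is small, plus that of
         the uniformly small tail; both are of order [2^(-n)]. *)
      assert (Q : forall n, Cmod (rectint F x1 x2 y1 y2) <= (16 * b * ((x2 - x1) + (y2 - y1)) + 2 * b * ((x2 - x1) * (y2 - y1))) / 2 ^ n).
      { intros n. set (G := fun z => Cminus (F z) (Fseq A B f v0 n z)).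
        assert (P : 0 < / 2 ^ n) by (apply Rinv_0_lt_compat, pow_lt; lra).
        assert (HG : contrect G x1 x2 y1 y2).
        { intros x y _ _ eps He. destruct (HFc (x, y) (eps / 2)) as (d1 & Hd1 & K1); [lra|]. destruct (Hfc n (x, y) (eps / 2)) as (d2 & Hd2 & K2); [lra|].
          exists (Rmin d1 d2). split; [apply Rmin_pos; auto|]. intros w Hw.
          specialize (K1 w (Rlt_le_trans _ _ _ Hw (Rmin_l _ _))). specialize (K2 w (Rlt_le_trans _ _ _ Hw (Rmin_r _ _))).
          unfold G. replace (Cminus (Cminus (F w) (Fseq A B f v0 n w)) (Cminus (F (x, y)) (Fseq A B f v0 n (x, y)))) with
            (Cminus (Cminus (F w) (F (x, y))) (Cminus (Fseq A B f v0 n w) (Fseq A B f v0 n (x, y)))) by ring.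
          eapply Rle_lt_trans; [apply Cmod_sub_le|]. lra. }
        assert (E : rectint F x1 x2 y1 y2 = Cplus (rectint (Fseq A B f v0 n) x1 x2 y1 y2) (rectint G x1 x2 y1 y2)).
        { rewrite <- rectint_plus; try lra; auto; [|intros ? ? ? ?; apply Hfc].
          unfold rectint. f_equal; [|f_equal]; f_equal; apply CInt_ext; try lra; intros; unfold G; ring. }
        rewrite E. eapply Rle_trans; [apply Cmod_triangle|].
        assert (Cmod (rectint (Fseq A B f v0 n) x1 x2 y1 y2) <= 2 * (b / 2 ^ n) * ((x2 - x1) * (y2 - y1))).
        { apply goursat; auto. intros x y Hx' Hy'. destruct (HF n (x, y)) as (p & Hp). exists p, (vseq A B v0 n (x, y)). split; auto.
          eapply Rle_trans; [apply Hvb|]. specialize (Hb (x, y) (HM x y Hx' Hy')). unfold D in Hb. pose proof (exp_pos (phi (x, y))).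
          unfold Rdiv. rewrite (Rmult_comm V0), Rmult_assoc, (Rmult_comm b). apply Rmult_le_compat_l; [lra|]. nra. }
        assert (Cmod (rectint G x1 x2 y1 y2) <= 4 * (4 * b / 2 ^ n) * ((x2 - x1) + (y2 - y1))).
        { apply rectint_le; auto; try lra. intros x y Hx' Hy'. unfold G. eapply Rle_trans; [apply HFl|].
          unfold Rdiv. apply Rmult_le_compat_r; [lra|]. specialize (Hb (x, y) (HM x y Hx' Hy')). lra. }
        unfold Rdiv in *. lra. }
      apply Cmod_eq_0. apply Rle_antisym; [|apply Cmod_ge_0]. apply Rnot_lt_le. intros Hlt.
      destruct (half_pow_small (16 * b * ((x2 - x1) + (y2 - y1)) + 2 * b * ((x2 - x1) * (y2 - y1))) (Cmod (rectint F x1 x2 y1 y2))) as (n & Hn); auto.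
      { assert (0 <= b * ((x2 - x1) + (y2 - y1))) by (apply Rmult_le_pos; lra).
        assert (0 <= b * ((x2 - x1) * (y2 - y1))) by (apply Rmult_le_pos; nra). lra. }
      specialize (Q n). lra.
  - assert (Ea : f a = RtoC 1).
    { unfold f, bump. rewrite Hcut. replace (Cminus a a) with (RtoC 0) by ring. rewrite Cmod_0. unfold posq, ker. simpl.
      rewrite Rmax_right by lra. replace (Cplus (Cmult (A a) (RtoC 0)) (Cmult (B a) (Cmult (RtoC 0) (RtoC 0)))) with (RtoC 0) by ring.
      rewrite cexp_0. apply C_ext; simpl; ring. }
    specialize (H0 a). rewrite Ea, Rminus_diag, exp_0 in H0. rewrite Cmod_minus_sym in H0.
    pose proof (Cmod_rev_tri (RtoC 1) (F a)). rewrite Cmod_1 in H. lra.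
Qed.

(** * Second-order expansions of polynomials in [z] and [zbar] *)

(* Locally of class [C^{1,1}]. *)
Definition sm (f : C -> C) : Prop := exists d, C11s f d.

Lemma sm_ext (f g : C -> C) : (forall z, f z = g z) -> sm f -> sm g.
Proof. intros E (d & Hd). exists d. apply (C11_ext (fun z _ => f z) _ (fun z _ h _ => d z h) _); auto. Qed.

Lemma sm_const (c : C) : sm (fun _ => c).
Proof. exists (fun _ _ => RtoC 0). exact (C11_const c). Qed.

Lemma sm_id : sm (fun z => z).
Proof. exists (fun _ h => h). exact C11_fst. Qed.

Lemma sm_plus (f g : C -> C) : sm f -> sm g -> sm (fun z => Cplus (f z) (g z)).
Proof. intros (d & Hd) (e & He). exists (fun z h => Cplus (d z h) (e z h)). exact (C11_plus _ _ _ _ Hd He). Qed.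

Lemma sm_mult (f g : C -> C) : sm f -> sm g -> sm (fun z => Cmult (f z) (g z)).
Proof.
  intros (d & Hd) (e & He). exists (fun z h => Cplus (Cmult (d z h) (g z)) (Cmult (f z) (e z h))).
  exact (C11_mult _ _ _ _ Hd He).
Qed.

Lemma sm_conj (f : C -> C) : sm f -> sm (fun z => Cconj (f z)).
Proof. intros (d & Hd). exists (fun z h => Cconj (d z h)). exact (C11_conj _ _ Hd). Qed.

Lemma sm_re (f : C -> C) : sm f -> sm (fun z => RtoC (fst (f z))).
Proof. intros (d & Hd). exists (fun z h => RtoC (fst (d z h))). exact (C11_re _ _ Hd). Qed.

Lemma sm_dil (f : C -> C) (s : R) : sm f -> sm (fun z => f (Cmult (RtoC s) z)).
Proof.
  intros (d & Hd). exists (fun z h => d (Cmult (RtoC s) z) (Cmult (RtoC s) h)).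
  assert (H : C11 (fun z _ => Cmult (RtoC s) z) (fun _ _ h _ => Cmult (RtoC s) h)).
  { apply (C11_lin1 (Cmult (RtoC s)) (Rabs s)); intros; try ring; [apply Rabs_pos|]. rewrite Cmod_mult, Cmod_RtoC. lra. }
  exact (C11_comp1 f _ d _ Hd H).
Qed.

Lemma sm_bound (f : C -> C) : sm f -> forall M, exists L, 0 <= L /\ forall z, Cmod z <= M -> Cmod (f z) <= L.
Proof.
  intros (d & _ & _ & H) M. destruct (H (Rmax M 0)) as (L & HL & K). exists L; split; auto.
  intros z Hz. pose proof (Rmax_l M 0). pose proof (Rmax_r M 0).
  destruct (K z (RtoC 0) (RtoC 0) (RtoC 0)); rewrite ?Cmod_0; auto; lra.
Qed.

Lemma sm_cont (f : C -> C) (z : C) : sm f -> ccontC f z.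
Proof. intros (d & Hd). eapply rdiff_cont, C11s_rdiff, Hd. Qed.

(** Second-order Taylor expansion in Wirtinger form, the letter [b] standing for [zbar], with a
    cubic remainder uniform on balls. The coefficients are required to be [sm] because the twist of
    the kernel will be built from them. *)
Definition T3 (f fz fb fzz fbb fzb : C -> C) : Prop :=
  (sm f /\ sm fz /\ sm fb /\ sm fzz /\ sm fbb /\ sm fzb) /\
  forall M, exists L, 0 <= L /\ forall z h, Cmod z <= M -> Cmod h <= 1 ->
    Cmod (Cminus (f (Cplus z h)) (Cplus (f z) (Cplus (Cplus (Cmult (fz z) h) (Cmult (fb z) (Cconj h)))
      (Cplus (Cmult (RtoC (/2)) (Cplus (Cmult (fzz z) (Cmult h h)) (Cmult (fbb z) (Cmult (Cconj h) (Cconj h))))) (Cmult (fzb z) (Cmult h (Cconj h)))))))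
     <= L * (Cmod h * Cmod h * Cmod h).

Lemma T3_ext (f fz fb fzz fbb fzb f' fz' fb' fzz' fbb' fzb' : C -> C) :
  (forall z, f z = f' z) -> (forall z, fz z = fz' z) -> (forall z, fb z = fb' z) ->
  (forall z, fzz z = fzz' z) -> (forall z, fbb z = fbb' z) -> (forall z, fzb z = fzb' z) ->
  T3 f fz fb fzz fbb fzb -> T3 f' fz' fb' fzz' fbb' fzb'.
Proof.
  intros E1 E2 E3 E4 E5 E6 ((S1 & S2 & S3 & S4 & S5 & S6) & H). split.
  - repeat split; eapply sm_ext; try eassumption; eauto.
  - intros M. destruct (H M) as (L & HL & K). exists L; split; auto. intros z h Hz Hh.
    rewrite <- !E1, <- E2, <- E3, <- E4, <- E5, <- E6. auto.
Qed.

Lemma T3_exact (f fz fb fzz fbb fzb : C -> C) : (sm f /\ sm fz /\ sm fb /\ sm fzz /\ sm fbb /\ sm fzb) ->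
  (forall z h, f (Cplus z h) = (Cplus (f z) (Cplus (Cplus (Cmult (fz z) h) (Cmult (fb z) (Cconj h)))
      (Cplus (Cmult (RtoC (/2)) (Cplus (Cmult (fzz z) (Cmult h h)) (Cmult (fbb z) (Cmult (Cconj h) (Cconj h))))) (Cmult (fzb z) (Cmult h (Cconj h))))))) ->
  T3 f fz fb fzz fbb fzb.
Proof.
  intros S H. split; auto. intros M. exists 0; split; [lra|]. intros z h _ _. rewrite H.
  match goal with |- Cmod ?x <= _ => replace x with (RtoC 0) by ring end. rewrite Cmod_0. lra.
Qed.

Lemma T3_const (c : C) : T3 (fun _ => c) (fun _ => RtoC 0) (fun _ => RtoC 0) (fun _ => RtoC 0) (fun _ => RtoC 0) (fun _ => RtoC 0).
Proof. apply T3_exact; [repeat split; apply sm_const|]. intros; ring. Qed.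

Lemma T3_id : T3 (fun z => z) (fun _ => RtoC 1) (fun _ => RtoC 0) (fun _ => RtoC 0) (fun _ => RtoC 0) (fun _ => RtoC 0).
Proof. apply T3_exact; [repeat split; try apply sm_const; apply sm_id|]. intros; ring. Qed.

Lemma T3_plus (f fz fb fzz fbb fzb g gz gb gzz gbb gzb : C -> C) :
  T3 f fz fb fzz fbb fzb -> T3 g gz gb gzz gbb gzb ->
  T3 (fun z => Cplus (f z) (g z)) (fun z => Cplus (fz z) (gz z)) (fun z => Cplus (fb z) (gb z))
     (fun z => Cplus (fzz z) (gzz z)) (fun z => Cplus (fbb z) (gbb z)) (fun z => Cplus (fzb z) (gzb z)).
Proof.
  intros ((S1 & S2 & S3 & S4 & S5 & S6) & H) ((R1 & R2 & R3 & R4 & R5 & R6) & K). split.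
  - repeat split; apply sm_plus; auto.
  - intros M. destruct (H M) as (L1 & HL1 & K1). destruct (K M) as (L2 & HL2 & K2). exists (L1 + L2); split; [lra|].
    intros z h Hz Hh. specialize (K1 z h Hz Hh). specialize (K2 z h Hz Hh).
    match type of K1 with Cmod ?x <= _ => match type of K2 with Cmod ?y <= _ =>
     match goal with |- Cmod ?w <= _ => replace w with (Cplus x y) by ring end end end.
    eapply Rle_trans; [apply Cmod_triangle|]. lra.
Qed.

Lemma T3_mult (f fz fb fzz fbb fzb g gz gb gzz gbb gzb : C -> C) :
  T3 f fz fb fzz fbb fzb -> T3 g gz gb gzz gbb gzb ->
  T3 (fun z => Cmult (f z) (g z)) (fun z => Cplus (Cmult (fz z) (g z)) (Cmult (f z) (gz z)))
     (fun z => Cplus (Cmult (fb z) (g z)) (Cmult (f z) (gb z)))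
     (fun z => Cplus (Cplus (Cmult (fzz z) (g z)) (Cmult (f z) (gzz z))) (Cmult (RtoC 2) (Cmult (fz z) (gz z))))
     (fun z => Cplus (Cplus (Cmult (fbb z) (g z)) (Cmult (f z) (gbb z))) (Cmult (RtoC 2) (Cmult (fb z) (gb z))))
     (fun z => Cplus (Cplus (Cmult (fzb z) (g z)) (Cmult (f z) (gzb z))) (Cplus (Cmult (fz z) (gb z)) (Cmult (fb z) (gz z)))).
Proof.
  intros ((S1 & S2 & S3 & S4 & S5 & S6) & H) ((R1 & R2 & R3 & R4 & R5 & R6) & K). split.
  - repeat split; repeat (apply sm_plus || apply sm_mult || apply sm_const); auto.
  - intros M.
    assert (Q : forall (f fz fb fzz fbb fzb : C -> C), sm f -> sm fz -> sm fb -> sm fzz -> sm fbb -> sm fzb ->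
      exists N, 0 <= N /\ forall z h, Cmod z <= M -> Cmod h <= 1 -> Cmod (f z) <= N /\
        Cmod (Cplus (Cmult (fz z) h) (Cmult (fb z) (Cconj h))) <= N * Cmod h /\
        Cmod (Cplus (Cmult (RtoC (/2)) (Cplus (Cmult (fzz z) (Cmult h h)) (Cmult (fbb z) (Cmult (Cconj h) (Cconj h))))) (Cmult (fzb z) (Cmult h (Cconj h)))) <= N * (Cmod h * Cmod h)).
    { clear. intros f fz fb fzz fbb fzb S1 S2 S3 S4 S5 S6.
      destruct (sm_bound f S1 M) as (a1 & P1 & Q1). destruct (sm_bound fz S2 M) as (a2 & P2 & Q2). destruct (sm_bound fb S3 M) as (a3 & P3 & Q3).
      destruct (sm_bound fzz S4 M) as (a4 & P4 & Q4). destruct (sm_bound fbb S5 M) as (a5 & P5 & Q5). destruct (sm_bound fzb S6 M) as (a6 & P6 & Q6).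
      exists (a1 + a2 + a3 + a4 + a5 + a6). split; [lra|]. intros z h Hz Hh. pose proof (Cmod_ge_0 h).
      assert (0 <= Cmod h * Cmod h) by nra.
      split; [specialize (Q1 z Hz); lra|]. split.
      - eapply Rle_trans; [apply Cmod_triangle|]. rewrite !Cmod_mult, Cmod_conj. specialize (Q2 z Hz). specialize (Q3 z Hz). nra.
      - eapply Rle_trans; [apply Cmod_triangle|]. rewrite !Cmod_mult, Cmod_conj, Cmod_RtoC, Rabs_pos_eq by lra.
        specialize (Q4 z Hz). specialize (Q5 z Hz). specialize (Q6 z Hz).
        pose proof (Cmod_triangle (Cmult (fzz z) (Cmult h h)) (Cmult (fbb z) (Cmult (Cconj h) (Cconj h)))).
        rewrite !Cmod_mult, Cmod_conj in H1.
        assert (Cmod (fzz z) * (Cmod h * Cmod h) <= a4 * (Cmod h * Cmod h)) by (apply Rmult_le_compat_r; auto).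
        assert (Cmod (fbb z) * (Cmod h * Cmod h) <= a5 * (Cmod h * Cmod h)) by (apply Rmult_le_compat_r; auto).
        assert (Cmod (fzb z) * (Cmod h * Cmod h) <= a6 * (Cmod h * Cmod h)) by (apply Rmult_le_compat_r; auto).
        assert (0 <= (a1 + a2 + a3) * (Cmod h * Cmod h)) by (apply Rmult_le_pos; lra).
        pose proof (Cmod_ge_0 (fzz z)). pose proof (Cmod_ge_0 (fbb z)). nra. }
    destruct (Q f fz fb fzz fbb fzb) as (N1 & HN1 & B1); auto. destruct (Q g gz gb gzz gbb gzb) as (N2 & HN2 & B2); auto. clear Q.
    destruct (H M) as (L1 & HL1 & K1). destruct (K M) as (L2 & HL2 & K2). clear H K.
    exists (3 * N1 * L2 + L1 * (3 * N2 + L2) + 3 * (N1 * N2)).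
    assert (0 <= N1 * N2) by nra. assert (0 <= N1 * L2) by nra. assert (0 <= L1 * N2) by nra. assert (0 <= L1 * L2) by nra.
    split; [nra|].
    intros z h Hz Hh. specialize (K1 z h Hz Hh). specialize (K2 z h Hz Hh). specialize (B1 z h Hz Hh). specialize (B2 z h Hz Hh).
    destruct B1 as (B10 & B11 & B12). destruct B2 as (B20 & B21 & B22).
    set (a1 := Cplus (Cmult (fz z) h) (Cmult (fb z) (Cconj h))) in *.
    set (a2 := Cplus (Cmult (RtoC (/2)) (Cplus (Cmult (fzz z) (Cmult h h)) (Cmult (fbb z) (Cmult (Cconj h) (Cconj h))))) (Cmult (fzb z) (Cmult h (Cconj h)))) in *.
    set (b1 := Cplus (Cmult (gz z) h) (Cmult (gb z) (Cconj h))) in *.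
    set (b2 := Cplus (Cmult (RtoC (/2)) (Cplus (Cmult (gzz z) (Cmult h h)) (Cmult (gbb z) (Cmult (Cconj h) (Cconj h))))) (Cmult (gzb z) (Cmult h (Cconj h)))) in *.
    set (e := Cminus (f (Cplus z h)) (Cplus (f z) (Cplus a1 a2))) in *. set (e' := Cminus (g (Cplus z h)) (Cplus (g z) (Cplus b1 b2))) in *.
    set (p := Cplus (f z) (Cplus a1 a2)) in *. set (q := Cplus (g z) (Cplus b1 b2)) in *.
    (* With [p], [q] the quadratic Taylor polynomials and [e], [e'] the remainders, the error of the
       product consists of the terms containing a remainder and of those products of homogeneous
       parts whose total order is at least [3]. *)
    match goal with |- Cmod ?x <= _ => replace x with
      (Cplus (Cplus (Cmult p e') (Cmult e (Cplus q e'))) (Cplus (Cplus (Cmult a1 b2) (Cmult a2 b1)) (Cmult a2 b2))) end.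
    2:{ unfold e, e', p, q, a1, a2, b1, b2.
        assert (E2 : Cmult (RtoC (/ 2)) (RtoC 2) = RtoC 1) by (rewrite <- RtoC_mult; f_equal; field).
        set (fh := f (Cplus z h)). set (gh := g (Cplus z h)). set (hf := RtoC (/ 2)) in *.
        match goal with |- ?l = Cminus _ (Cplus _ (Cplus _ (Cplus (Cmult _ (Cplus (Cmult (Cplus ?u1 (Cmult (RtoC 2) ?u2)) ?u3) (Cmult (Cplus ?v1 (Cmult (RtoC 2) ?v2)) ?v3))) ?w))) =>
          replace (Cmult hf (Cplus (Cmult (Cplus u1 (Cmult (RtoC 2) u2)) u3) (Cmult (Cplus v1 (Cmult (RtoC 2) v2)) v3))) with
           (Cplus (Cmult hf (Cplus (Cmult u1 u3) (Cmult v1 v3))) (Cmult (Cmult hf (RtoC 2)) (Cplus (Cmult u2 u3) (Cmult v2 v3)))) by ring end.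
        rewrite E2. ring. }
    pose proof (Cmod_ge_0 h). set (m := Cmod h) in *.
    assert (Hm2 : 0 <= m * m <= 1) by nra. assert (Hm3 : 0 <= m * m * m) by nra. assert (Hm3' : m * m * m <= 1) by nra.
    assert (Hm32 : m * m * (m * m) <= m * m * m) by nra.
    assert (Bp : Cmod p <= 3 * N1).
    { unfold p. eapply Rle_trans; [apply Cmod_triangle|]. pose proof (Cmod_triangle a1 a2). nra. }
    assert (Bq : Cmod (Cplus q e') <= 3 * N2 + L2).
    { eapply Rle_trans; [apply Cmod_triangle|]. assert (Cmod q <= 3 * N2).
      { unfold q. eapply Rle_trans; [apply Cmod_triangle|]. pose proof (Cmod_triangle b1 b2). nra. }
      assert (L2 * (m * m * m) <= L2 * 1) by (apply Rmult_le_compat_l; auto). lra. }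
    eapply Rle_trans; [apply Cmod_triangle|].
    pose proof (Cmod_triangle (Cmult p e') (Cmult e (Cplus q e'))). pose proof (Cmod_triangle (Cplus (Cmult a1 b2) (Cmult a2 b1)) (Cmult a2 b2)).
    pose proof (Cmod_triangle (Cmult a1 b2) (Cmult a2 b1)). rewrite !Cmod_mult in *.
    assert (Cmod p * Cmod e' <= 3 * N1 * (L2 * (m * m * m))) by (apply Rmult_le_compat; auto using Cmod_ge_0).
    assert (Cmod e * Cmod (Cplus q e') <= L1 * (m * m * m) * (3 * N2 + L2)) by (apply Rmult_le_compat; auto using Cmod_ge_0).
    assert (Cmod a1 * Cmod b2 <= N1 * m * (N2 * (m * m))) by (apply Rmult_le_compat; auto using Cmod_ge_0).
    assert (Cmod a2 * Cmod b1 <= N1 * (m * m) * (N2 * m)) by (apply Rmult_le_compat; auto using Cmod_ge_0).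
    assert (Cmod a2 * Cmod b2 <= N1 * (m * m) * (N2 * (m * m))) by (apply Rmult_le_compat; auto using Cmod_ge_0).
    assert (N1 * (m * m) * (N2 * (m * m)) <= N1 * N2 * (m * m * m)).
    { replace (N1 * (m * m) * (N2 * (m * m))) with (N1 * N2 * (m * m * (m * m))) by ring. apply Rmult_le_compat_l; auto. }
    nra.
Qed.

Lemma T3_conj_holo (f fz fzz : C -> C) :
  T3 f fz (fun _ => RtoC 0) fzz (fun _ => RtoC 0) (fun _ => RtoC 0) ->
  T3 (fun z => Cconj (f z)) (fun _ => RtoC 0) (fun z => Cconj (fz z)) (fun _ => RtoC 0) (fun z => Cconj (fzz z)) (fun _ => RtoC 0).
Proof.
  intros ((S1 & S2 & S3 & S4 & S5 & S6) & H). split.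
  - repeat split; try apply sm_conj; auto.
  - intros M. destruct (H M) as (L & HL & K). exists L; split; auto. intros z h Hz Hh. specialize (K z h Hz Hh).
    eapply Rle_trans; [|exact K]. right. rewrite <- Cmod_conj. f_equal. apply C_ext; simpl; ring.
Qed.

Lemma T3_pow (n : nat) : exists fzz,
  T3 (fun z => Cpow z n) (fun z => Cmult (RtoC (INR n)) (Cpow z (n - 1))) (fun _ => RtoC 0) fzz (fun _ => RtoC 0) (fun _ => RtoC 0).
Proof.
  induction n as [|n (fzz & IH)].
  - exists (fun _ => RtoC 0). eapply T3_ext; [| | | | | |apply (T3_const (RtoC 1))]; intros; simpl; try reflexivity. ring.
  - eexists. eapply T3_ext; [| | | | | |apply (T3_mult _ _ _ _ _ _ _ _ _ _ _ _ T3_id IH)]; intros; cbv beta; try reflexivity; try ring.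
    (* The exponent [n - 1] is truncated at [n = 0], where the coefficient [INR 0] makes its value
       irrelevant. *)
    replace (S n - 1)%nat with n by lia. destruct n.
    + simpl. ring.
    + replace (S n - 1)%nat with n by lia. rewrite (S_INR (S n)), RtoC_plus. simpl Cpow. ring.
Qed.

Lemma T3_Csum (N : nat) (f fzb : nat -> C -> C) :
  (forall j, exists fz fb fzz fbb, T3 (f j) fz fb fzz fbb (fzb j)) ->
  exists fz fb fzz fbb, T3 (fun z => Csum (fun j => f j z) N) fz fb fzz fbb (fun z => Csum (fun j => fzb j z) N).
Proof.
  intros H. induction N as [|N (a & b & cc & d & IH)]; simpl.
  - destruct (H O) as (a & b & cc & d & Hj). exists a, b, cc, d. exact Hj.
  - destruct (H (S N)) as (a' & b' & c' & d' & Hj). do 4 eexists. apply (T3_plus _ _ _ _ _ _ _ _ _ _ _ _ IH Hj).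
Qed.

Lemma T3_monomial (c : C) (j l : nat) : exists fz fb fzz fbb,
  T3 (fun z => Cmult c (Cmult (Cpow z j) (Cpow (Cconj z) l))) fz fb fzz fbb
     (fun z => Cmult (RtoC (INR j * INR l)) (Cmult c (Cmult (Cpow z (j - 1)) (Cpow (Cconj z) (l - 1))))).
Proof.
  destruct (T3_pow j) as (fzz & H1). destruct (T3_pow l) as (gzz & H2). apply T3_conj_holo in H2.
  pose proof (T3_mult _ _ _ _ _ _ _ _ _ _ _ _ (T3_const c) (T3_mult _ _ _ _ _ _ _ _ _ _ _ _ H1 H2)) as H.
  do 4 eexists. eapply T3_ext; [| | | | | |exact H]; intros; cbv beta; try reflexivity.
  - now rewrite Cpow_conj.
  - rewrite RtoC_mult, <- !Cpow_conj.
    replace (Cconj (Cmult (RtoC (INR l)) (Cpow z (l - 1)))) with (Cmult (RtoC (INR l)) (Cconj (Cpow z (l - 1)))) by (apply C_ext; simpl; ring). ring.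
Qed.

Lemma T3_poly (c : nat -> nat -> C) (N : nat) : exists fz fb fzz fbb, T3 (polyzzb c N) fz fb fzz fbb (polyzzb_ddbar c N).
Proof.
  apply (T3_Csum N (fun j z => Csum (fun l => Cmult (c j l) (Cmult (Cpow z j) (Cpow (Cconj z) l))) N)
    (fun j z => Csum (fun l => Cmult (RtoC (INR j * INR l)) (Cmult (c j l) (Cmult (Cpow z (j - 1)) (Cpow (Cconj z) (l - 1))))) N)).
  intros j. apply (T3_Csum N (fun l z => Cmult (c j l) (Cmult (Cpow z j) (Cpow (Cconj z) l)))
    (fun l z => Cmult (RtoC (INR j * INR l)) (Cmult (c j l) (Cmult (Cpow z (j - 1)) (Cpow (Cconj z) (l - 1)))))).
  intros l. apply T3_monomial.
Qed.

(** * Peak functions for homogeneous strictly subharmonic potentials *)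

(** A second-order expansion sorted for the kernel: [Re (A h + B h^2)] is its harmonic part, the
    real part of the exponent used in [ker], and [D] is the mixed derivative, a quarter of the
    Laplacian. A positive [D] is what produces the Gaussian gain. *)
Definition Pot (P : C -> R) (A B : C -> C) (D : C -> R) : Prop :=
  sm A /\ sm B /\ sm (fun z => RtoC (D z)) /\ sm (fun z => RtoC (P z)) /\
  forall M, exists L, 0 <= L /\ forall z h, Cmod z <= M -> Cmod h <= 1 ->
    Rabs (P (Cplus z h) - (P z + fst (Cplus (Cmult (A z) h) (Cmult (B z) (Cmult h h))) + D z * (Cmod h * Cmod h)))
     <= L * (Cmod h * Cmod h * Cmod h).

(** Under the real part a term in [conj h] equals its conjugate, so the [zbar]-coefficients can be
    folded into the holomorphic ones. *)
Lemma Pot_T3 (f fz fb fzz fbb fzb : C -> C) : T3 f fz fb fzz fbb fzb ->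
  Pot (fun z => fst (f z)) (fun z => Cplus (fz z) (Cconj (fb z)))
    (fun z => Cmult (RtoC (/ 2)) (Cplus (fzz z) (Cconj (fbb z)))) (fun z => fst (fzb z)).
Proof.
  intros ((S1 & S2 & S3 & S4 & S5 & S6) & H). split; [|split; [|split; [|split]]].
  - apply sm_plus; auto. now apply sm_conj.
  - apply (sm_mult (fun _ => RtoC (/2))); [apply sm_const|]. apply sm_plus; auto. now apply sm_conj.
  - now apply sm_re.
  - now apply sm_re.
  - intros M. destruct (H M) as (L & HL & K). exists L; split; auto. intros z h Hz Hh. specialize (K z h Hz Hh).
    eapply Rle_trans; [|exact K]. eapply Rle_trans; [|apply abs_fst_le]. right. f_equal.
    rewrite Cmod_sqr. destruct (fz z), (fb z), (fzz z), (fbb z), (fzb z), h. simpl. field.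
Qed.

Lemma Pot_sub (P P' : C -> R) (A B A' B' : C -> C) (D D' : C -> R) (e : R) : Pot P A B D -> Pot P' A' B' D' ->
  Pot (fun z => P z - e * P' z) (fun z => Cplus (A z) (Cmult (RtoC (- e)) (A' z))) (fun z => Cplus (B z) (Cmult (RtoC (- e)) (B' z)))
    (fun z => D z - e * D' z).
Proof.
  intros (S1 & S2 & S3 & S4 & H) (S1' & S2' & S3' & S4' & H').
  assert (Hsub : forall f g : C -> R, sm (fun z => RtoC (f z)) -> sm (fun z => RtoC (g z)) -> sm (fun z => RtoC (f z - e * g z))).
  { intros f g Hf Hg. apply sm_ext with (fun z => Cplus (RtoC (f z)) (Cmult (RtoC (- e)) (RtoC (g z)))).
    - intros. rewrite <- RtoC_mult, <- RtoC_plus. f_equal. ring.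
    - apply sm_plus; auto. apply (sm_mult (fun _ => RtoC (- e))); auto. apply sm_const. }
  split; [|split; [|split; [|split]]]; auto.
  - apply sm_plus; auto. apply (sm_mult (fun _ => RtoC (- e))); auto. apply sm_const.
  - apply sm_plus; auto. apply (sm_mult (fun _ => RtoC (- e))); auto. apply sm_const.
  - intros M. destruct (H M) as (L & HL & K). destruct (H' M) as (L' & HL' & K').
    exists (L + Rabs e * L'). pose proof (Rabs_pos e). split; [nra|]. intros z h Hz Hh.
    specialize (K z h Hz Hh). specialize (K' z h Hz Hh).
    match type of K with Rabs ?x <= _ => match type of K' with Rabs ?y <= _ =>
     match goal with |- Rabs ?w <= _ => replace w with (x + (- e) * y) by (simpl; ring) end end end.
    eapply Rle_trans; [apply Rabs_triang|]. rewrite Rabs_mult, Rabs_Ropp.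
    replace ((L + Rabs e * L') * (Cmod h * Cmod h * Cmod h)) with (L * (Cmod h * Cmod h * Cmod h) + Rabs e * (L' * (Cmod h * Cmod h * Cmod h))) by ring. apply Rplus_le_compat; auto. apply Rmult_le_compat_l; auto.
Qed.

(** Uniqueness of Taylor coefficients: divide by [t] and let [t] tend to [0], first for [al], then
    for [be]. *)
Lemma quad_small_zero (al be C0 : R) : (forall t, 0 < t <= 1 -> Rabs (al * t + be * (t * t)) <= C0 * (t * t * t)) -> al = 0 /\ be = 0.
Proof.
  intros H.
  assert (HC : 0 <= C0). { specialize (H 1 ltac:(lra)). pose proof (Rabs_pos (al * 1 + be * (1 * 1))). lra. }
  assert (K : forall x y, (forall t, 0 < t <= 1 -> Rabs (x + y * t) <= C0 * t) -> x = 0).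
  { intros x y Hx. destruct (Req_dec x 0); auto. exfalso. pose proof (Rabs_pos_lt x H0).
    set (s := C0 + Rabs y + Rabs x + 1). pose proof (Rabs_pos y). assert (0 < s) by (unfold s; lra).
    set (t := Rabs x / (2 * s)). assert (0 < t) by (apply Rdiv_lt_0_compat; lra).
    assert (E : t * (2 * s) = Rabs x) by (unfold t; field; lra).
    assert (t <= 1) by (unfold s in *; nra). specialize (Hx t ltac:(lra)).
    assert (Rabs x <= Rabs (x + y * t) + Rabs y * t).
    { replace x with ((x + y * t) - y * t) at 1 by ring. eapply Rle_trans; [apply Rabs_triang|]. rewrite Rabs_Ropp, Rabs_mult, (Rabs_pos_eq t); lra. }
    unfold s in *. nra. }
  assert (Ha : al = 0).
  { apply (K al be). intros t Ht. specialize (H t Ht).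
    replace (al * t + be * (t * t)) with ((al + be * t) * t) in H by ring. rewrite Rabs_mult, (Rabs_pos_eq t) in H by lra.
    assert (Rabs (al + be * t) * t <= C0 * t * t * t) by lra. apply Rmult_le_reg_r in H0; [|lra].
    assert (C0 * t * t <= C0 * t * 1) by (apply Rmult_le_compat_l; nra). lra. }
  split; auto. subst al. apply (K be 0). intros t Ht. specialize (H t Ht).
  replace (0 * t + be * (t * t)) with ((be + 0 * t) * (t * t)) in H by ring. rewrite Rabs_mult, (Rabs_pos_eq (t * t)) in H by nra.
  apply Rmult_le_reg_r with (t * t); nra.
Qed.

(** [P (r (y + k))] can be expanded at [r y], or as [r^m P (y + k)] at [y]; the two expansions must
    have the same coefficients. Thus [A], [B], [D] inherit the homogeneity of [P] without being
    computed. *)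
Lemma Pot_homog (P : C -> R) (A B : C -> C) (D : C -> R) (m : nat) : Pot P A B D ->
  (forall r z, P (Cmult (RtoC r) z) = r ^ m * P z) -> forall r y, 0 < r ->
  (forall h, fst (Cmult (A (Cmult (RtoC r) y)) (Cmult (RtoC r) h)) = r ^ m * fst (Cmult (A y) h)) /\
  (forall h, fst (Cmult (B (Cmult (RtoC r) y)) (Cmult (Cmult (RtoC r) h) (Cmult (RtoC r) h))) = r ^ m * fst (Cmult (B y) (Cmult h h))) /\
  D (Cmult (RtoC r) y) * (r * r) = r ^ m * D y.
Proof.
  intros (_ & _ & _ & _ & H) Hh r y Hr.
  set (ry := Cmult (RtoC r) y) in *.
  assert (Q : forall h, Cmod h <= 1 ->
     r * fst (Cmult (A ry) h) - r ^ m * fst (Cmult (A y) h) = 0 /\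
     (r * r * (fst (Cmult (B ry) (Cmult h h)) + D ry * (Cmod h * Cmod h)) - r ^ m * (fst (Cmult (B y) (Cmult h h)) + D y * (Cmod h * Cmod h))) = 0).
  { intros h Hh1. pose proof (Cmod_ge_0 h).
    (* Shrinks [h] so that both [s t h] and its dilate by [r] are displacements of modulus at most
       [1]. *)
    set (s := / (1 + r)). assert (Hs : 0 < s <= 1 /\ s * r <= 1).
    { unfold s. split; [split; [apply Rinv_0_lt_compat; lra|]|].
      - rewrite <- Rinv_1. apply Rinv_le_contravar; lra.
      - apply Rmult_le_reg_r with (1 + r); [lra|]. replace (/ (1 + r) * r * (1 + r)) with r by (field; lra). lra. }
    destruct (H (Cmod y)) as (L1 & HL1 & K1). destruct (H (Cmod ry)) as (L2 & HL2 & K2).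
    assert (0 < r ^ m) by (now apply pow_lt).
    destruct (quad_small_zero (s * (r * fst (Cmult (A ry) h) - r ^ m * fst (Cmult (A y) h)))
      (s * s * (r * r * (fst (Cmult (B ry) (Cmult h h)) + D ry * (Cmod h * Cmod h)) - r ^ m * (fst (Cmult (B y) (Cmult h h)) + D y * (Cmod h * Cmod h))))
      (L2 + r ^ m * L1)) as (E1 & E2).
    - intros t Ht. set (k := Cmult (RtoC (s * t)) h). set (k' := Cmult (RtoC r) k).
      assert (Hk : Cmod k = s * t * Cmod h) by (unfold k; rewrite Cmod_mult, Cmod_RtoC, Rabs_pos_eq by nra; ring).
      assert (Hk' : Cmod k' = r * (s * t * Cmod h)) by (unfold k'; rewrite Cmod_mult, Cmod_RtoC, Rabs_pos_eq, Hk by lra; ring).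
      assert (0 <= t * Cmod h <= t) by nra.
      assert (B1 : Cmod k <= t) by (rewrite Hk; nra). assert (B2 : Cmod k' <= t) by (rewrite Hk'; nra).
      specialize (K1 y k ltac:(lra) ltac:(lra)). specialize (K2 ry k' ltac:(lra) ltac:(lra)).
      assert (Ep : P (Cplus ry k') = r ^ m * P (Cplus y k)) by (rewrite <- Hh; f_equal; unfold ry, k'; ring).
      assert (Ep' : P ry = r ^ m * P y) by (apply Hh).
      rewrite Ep, Ep' in K2. rewrite Hk' in K2. rewrite Hk in K1.
      match type of K1 with Rabs ?x <= _ => match type of K2 with Rabs ?w <= _ =>
        match goal with |- Rabs ?v <= _ => replace v with (r ^ m * x - w) by (unfold k', k; simpl; ring) end end end.
      eapply Rle_trans; [apply Rabs_triang|]. rewrite Rabs_Ropp, Rabs_mult, (Rabs_pos_eq (r ^ m)) by lra.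
      rewrite <- Hk in K1. rewrite <- Hk' in K2. pose proof (Cmod_ge_0 k). pose proof (Cmod_ge_0 k').
      assert (T1 : Cmod k * Cmod k * Cmod k <= t * t * t) by (repeat apply Rmult_le_compat; nra).
      assert (T2 : Cmod k' * Cmod k' * Cmod k' <= t * t * t) by (repeat apply Rmult_le_compat; nra).
      apply (Rmult_le_compat_l (r ^ m)) in K1; [|lra].
      apply (Rmult_le_compat_l L1) in T1; auto. apply (Rmult_le_compat_l L2) in T2; auto.
      apply (Rmult_le_compat_l (r ^ m)) in T1; [|lra]. rewrite Hk, Hk' in *. nra.
    - assert (0 < s * s) by nra. split; [apply Rmult_integral in E1|apply Rmult_integral in E2]; lra. }
  assert (Q1 : forall h, r * fst (Cmult (A ry) h) = r ^ m * fst (Cmult (A y) h)).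
  { intros h. destruct (Q (RtoC 1)) as (Qa & _); [rewrite Cmod_1; lra|]. destruct (Q Ci) as (Qb & _); [rewrite Cmod_Ci; lra|].
    simpl in Qa, Qb. simpl. destruct h as [h1 h2]; simpl.
    replace (r * (fst (A ry) * h1 - snd (A ry) * h2)) with (h1 * (r * fst (A ry)) - h2 * (r * snd (A ry))) by ring.
    replace (r ^ m * (fst (A y) * h1 - snd (A y) * h2)) with (h1 * (r ^ m * fst (A y)) - h2 * (r ^ m * snd (A y))) by ring.
    replace (r * fst (A ry)) with (r ^ m * fst (A y)) by lra. replace (r * snd (A ry)) with (r ^ m * snd (A y)) by lra. ring. }
  (* Passing from [h = 1] to [h = Ci] changes the sign of [h^2] but not [|h|^2]; adding the two
     identities isolates [D]. *)
  assert (QD : D ry * (r * r) = r ^ m * D y).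
  { destruct (Q (RtoC 1)) as (_ & Qa); [rewrite Cmod_1; lra|]. destruct (Q Ci) as (_ & Qb); [rewrite Cmod_Ci; lra|].
    rewrite Cmod_1 in Qa. rewrite Cmod_Ci in Qb. simpl in Qa, Qb. lra. }
  split; [|split]; auto.
  - intros h. rewrite <- Q1. simpl. ring.
  - intros h.
    destruct (Q (RtoC 1)) as (_ & Qa); [rewrite Cmod_1; lra|].
    (* [h = 1] yields the real part of [B]; [h = (1 + i) / 2], with [h^2 = i / 2], yields its
       imaginary part. *)
    assert (Hhalf : Cmod (/ 2, / 2) <= 1).
    { eapply Rle_trans; [apply Cmod_le_abs|]. simpl. rewrite Rabs_pos_eq; lra. }
    destruct (Q (/ 2, / 2) Hhalf) as (_ & Qb).
    rewrite Cmod_1 in Qa. rewrite Cmod_sqr in Qb. simpl in Qa, Qb.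
    assert (X1 : r * r * fst (B ry) = r ^ m * fst (B y)) by nra.
    assert (X2 : r * r * snd (B ry) = r ^ m * snd (B y)) by nra.
    destruct h as [h1 h2]; simpl.
    match goal with |- ?l = ?rr =>
      replace l with ((h1 * h1 - h2 * h2) * (r * r * fst (B ry)) - (2 * h1 * h2) * (r * r * snd (B ry))) by ring;
      replace rr with ((h1 * h1 - h2 * h2) * (r ^ m * fst (B y)) - (2 * h1 * h2) * (r ^ m * snd (B y))) by ring end.
    rewrite X1, X2. ring.
Qed.

Lemma circle_cis (e : C) : Cmod e = 1 -> exists t, - PI <= t <= PI /\ e = cis t.
Proof.
  intros He. pose proof (Cmod_sqr e) as Hs. rewrite He in Hs. destruct e as [x y]; simpl in Hs.
  assert (Hx : -1 <= x <= 1) by nra. pose proof (acos_bound x) as Ha.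
  assert (Hsin : sin (acos x) = sqrt (1 - x²)) by (apply sin_acos; auto).
  assert (Hy : y * y = 1 - x²) by (unfold Rsqr; lra).
  destruct (Rle_dec 0 y).
  - exists (acos x). split; [lra|]. unfold cis. rewrite cos_acos, Hsin by auto. f_equal. rewrite <- Hy. symmetry. now apply sqrt_square.
  - exists (- acos x). split; [lra|]. unfold cis. rewrite cos_neg, sin_neg, cos_acos, Hsin by auto. f_equal.
    rewrite <- Hy. replace (y * y) with ((- y) * (- y)) by ring. rewrite sqrt_square by lra. ring.
Qed.

Lemma circle_min (D : C -> R) : sm (fun z => RtoC (D z)) -> (forall z, z <> RtoC 0 -> 0 < D z) ->
  exists d0, 0 < d0 /\ forall e, Cmod e = 1 -> d0 <= D e.
Proof.
  intros Hs Hp. pose proof PI_RGT_0.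
  destruct (continuity_ab_min (fun t => D (cis t)) (- PI) PI) as (t0 & Hmin & Ht0); [lra| |].
  - intros t _. apply continuity_pt_filterlim.
    assert (ccont (fun t => RtoC (D (cis t))) t).
    { apply (ccont_comp (fun z => RtoC (D z)) cis); [now apply (sm_cont (fun z => RtoC (D z)))|apply ccont_cis]. }
    apply ccont_re_im in H0. apply H0.
  - exists (D (cis t0)). split.
    + apply Hp. intros E. pose proof (Cmod_cis t0). rewrite E, Cmod_0 in H0. lra.
    + intros e He. destruct (circle_cis e He) as (t & Ht & ->). now apply Hmin.
Qed.

(** * A bounded correction of the potential at the origin *)

(** The mixed derivative of [- recip] is [(1 - |z|^2) / (1 + |z|^2)^3]: positive near [0], where
    that of [P] degenerates, and bounded everywhere. *)
Definition recip (z : C) : R := / (1 + Cmod z * Cmod z).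

Lemma recip_pos (z : C) : 0 < recip z <= 1.
Proof.
  unfold recip. pose proof (Cmod_ge_0 z). assert (0 <= Cmod z * Cmod z) by nra. split.
  - apply Rinv_0_lt_compat. lra.
  - rewrite <- Rinv_1. apply Rinv_le_contravar; lra.
Qed.

Lemma recip_expand (z h : C) : let d := 2 * fst (Cmult (Cconj z) h) + Cmod h * Cmod h in
  recip (Cplus z h) - recip z = - d * (recip z * recip z) + d * d * (recip z * recip z * recip (Cplus z h)) /\
  recip (Cplus z h) - recip z = - d * (recip z * recip (Cplus z h)).
Proof.
  intros d. assert (E : 1 + Cmod (Cplus z h) * Cmod (Cplus z h) = 1 + Cmod z * Cmod z + d).
  { unfold d. rewrite !Cmod_sqr. simpl. ring. }
  pose proof (Cmod_ge_0 z). pose proof (Cmod_ge_0 (Cplus z h)).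
  assert (0 <= Cmod z * Cmod z) by nra. assert (0 <= Cmod (Cplus z h) * Cmod (Cplus z h)) by nra.
  unfold recip. rewrite E in *. split; field; lra.
Qed.

Lemma re_conj_le (z h : C) : Rabs (fst (Cmult (Cconj z) h)) <= Cmod z * Cmod h.
Proof. eapply Rle_trans; [apply abs_fst_le|]. rewrite Cmod_mult, Cmod_conj. lra. Qed.

Lemma sm_recip : sm (fun z => RtoC (recip z)).
Proof.
  exists (fun z h => RtoC (- 2 * fst (Cmult (Cconj z) h) * (recip z * recip z))). apply C11_intro.
  - intros. apply C_ext; simpl; ring.
  - intros. apply C_ext; simpl; ring.
  - intros M HM. exists (1 + 9 * (M * M) + 2 + 2 * M + 12 * (M * M) + 1). split; [nra|].
    intros z _ h k Hz _ Hh _. pose proof (Cmod_ge_0 z). pose proof (Cmod_ge_0 h). pose proof (Cmod_ge_0 k).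
    destruct (recip_expand z h) as (E1 & E2). cbv zeta in E1, E2.
    pose proof (recip_pos z) as Hr. pose proof (recip_pos (Cplus z h)) as Hr'. pose proof (re_conj_le z h) as Hre.
    set (r := recip z) in *. set (r' := recip (Cplus z h)) in *. set (x := fst (Cmult (Cconj z) h)) in *.
    set (d := 2 * x + Cmod h * Cmod h) in *.
    assert (Hd : Rabs d <= 3 * M * Cmod h).
    { unfold d. eapply Rle_trans; [apply Rabs_triang|]. rewrite Rabs_mult, (Rabs_pos_eq 2), (Rabs_pos_eq (Cmod h * Cmod h)) by nra. nra. }
    assert (Hrr : 0 <= r * r <= 1) by nra. assert (Hrr' : 0 <= r * r' <= 1) by nra.
    assert (Hrrr : 0 <= r * r * r' <= 1) by nra. assert (HMM : 0 <= M * M) by nra.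
    assert (Hhh : Cmod h * Cmod h <= (Cmod h + Cmod k) * (Cmod h + Cmod k)) by nra.
    assert (Hh0 : 0 <= Cmod h * Cmod h) by nra.
    split; [|split].
    + rewrite Cmod_RtoC, Rabs_pos_eq; lra.
    + rewrite <- RtoC_plus, <- RtoC_minus, Cmod_RtoC.
      replace (r' - (r + -2 * x * (r * r))) with (d * d * (r * r * r') - Cmod h * Cmod h * (r * r)) by (unfold d in *; lra).
      eapply Rle_trans; [apply Rabs_triang|]. rewrite Rabs_Ropp, !Rabs_mult.
      assert (Rabs d * Rabs d <= 9 * (M * M) * (Cmod h * Cmod h)).
      { apply Rle_trans with (3 * M * Cmod h * (3 * M * Cmod h)); [|right; ring]. apply Rmult_le_compat; auto using Rabs_pos. }
      rewrite <- !Rabs_mult. rewrite (Rabs_mult (d * d)), (Rabs_mult (Cmod h * Cmod h)), (Rabs_mult d).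
      rewrite (Rabs_pos_eq (r * r * r')), (Rabs_pos_eq (r * r)), (Rabs_pos_eq (Cmod h * Cmod h)) by lra.
      assert (Rabs d * Rabs d * (r * r * r') <= 9 * (M * M) * (Cmod h * Cmod h) * 1).
      { apply Rmult_le_compat; try lra. pose proof (Rabs_pos d). nra. }
      assert (Cmod h * Cmod h * (r * r) <= Cmod h * Cmod h * 1) by (apply Rmult_le_compat_l; lra).
      apply Rle_trans with ((1 + 9 * (M * M)) * (Cmod h * Cmod h)); [lra|].
      apply Rmult_le_compat; lra.
    + intros a b. pose proof (Cmod_ge_0 a). pose proof (Cmod_ge_0 b). pose proof (re_conj_le z a) as Ha. pose proof (re_conj_le h a) as Hha.
      split.
      * rewrite Cmod_RtoC, !Rabs_mult. replace (Rabs (-2)) with 2 by (unfold Rabs; destruct (Rcase_abs (-2)); lra).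
        rewrite <- Rabs_mult, (Rabs_pos_eq (r * r)) by lra. pose proof (Rabs_pos (fst (Cmult (Cconj z) a))).
        assert (Rabs (fst (Cmult (Cconj z) a)) * (r * r) <= M * Cmod a) by nra.
        assert (0 <= (1 + 21 * (M * M) + 3) * (Cmod a + Cmod b)) by (apply Rmult_le_pos; lra).
        assert (0 <= M * Cmod b) by nra. nra.
      * rewrite <- RtoC_minus, Cmod_RtoC.
        replace (fst (Cmult (Cconj (Cplus z h)) a)) with (fst (Cmult (Cconj z) a) + fst (Cmult (Cconj h) a)) by (simpl; ring).
        set (u := fst (Cmult (Cconj z) a)) in *. set (w := fst (Cmult (Cconj h) a)) in *.
        replace (-2 * (u + w) * (r' * r') - -2 * u * (r * r)) with (-2 * (w * (r' * r') + u * ((r' - r) * (r' + r)))) by ring.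
        rewrite Rabs_mult. replace (Rabs (-2)) with 2 by (unfold Rabs; destruct (Rcase_abs (-2)); lra).
        assert (T1 : Rabs (w * (r' * r')) <= Cmod h * Cmod a).
        { rewrite Rabs_mult, (Rabs_pos_eq (r' * r')) by nra. pose proof (Rabs_pos w). assert (r' * r' <= 1) by nra. nra. }
        assert (T2 : Rabs (r' - r) <= 3 * M * Cmod h).
        { rewrite E2, Rabs_mult, Rabs_Ropp, (Rabs_pos_eq (r * r')) by lra. pose proof (Rabs_pos d). nra. }
        assert (T3' : Rabs (u * ((r' - r) * (r' + r))) <= M * Cmod a * (3 * M * Cmod h * 2)).
        { rewrite !Rabs_mult, (Rabs_pos_eq (r' + r)) by lra. apply Rmult_le_compat; auto using Rabs_pos.
          - apply Rmult_le_pos; [apply Rabs_pos|lra].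
          - apply Rle_trans with (Cmod z * Cmod a); auto. apply Rmult_le_compat_r; auto.
          - apply Rmult_le_compat; try apply Rabs_pos; lra. }
        pose proof (Rabs_triang (w * (r' * r')) (u * ((r' - r) * (r' + r)))).
        assert (Hha0 : 0 <= Cmod h * Cmod a) by nra.
        assert (Hprod : Cmod h * Cmod a <= (Cmod h + Cmod k) * (Cmod a + Cmod b)) by nra.
        assert (2 * (Rabs (w * (r' * r') + u * ((r' - r) * (r' + r)))) <= (2 + 12 * (M * M)) * (Cmod h * Cmod a)) by lra.
        eapply Rle_trans; [exact H5|]. rewrite Rmult_assoc. apply Rmult_le_compat; try lra.
Qed.

(** [q] is the increment of [- recip] after removal of its complex linear part. By [recip_expand] it
    equals [|h|^2 r^2 - d^2 r^2 r'], with [r], [r'] the values of [recip] at [y] and [y + h] and [d]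
    the increment of the squared modulus. Since [|d| <= (2 |y| + |h|) |h|], the second term costs at
    most [5 |h|^2] in general, and at most [9/16] of the first one when [|y|, |h| <= 1/4]. *)
Lemma recip_lower (y h : C) : Cmod h <= 1 ->
  let q := - recip (Cplus y h) + recip y - fst (Cmult (Cmult (RtoC (2 * (recip y * recip y))) (Cconj y)) h) in
  - 5 * (Cmod h * Cmod h) <= q /\ (Cmod y <= 1 / 4 -> Cmod h <= 1 / 4 -> Cmod h * Cmod h / 4 <= q).
Proof.
  intros Hh q. pose proof (Cmod_ge_0 y). pose proof (Cmod_ge_0 h).
  destruct (recip_expand y h) as (E1 & _). cbv zeta in E1.
  pose proof (recip_pos y) as Hr. pose proof (recip_pos (Cplus y h)) as Hr'. pose proof (re_conj_le y h) as Hre.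
  assert (Eq : q = Cmod h * Cmod h * (recip y * recip y) - (2 * fst (Cmult (Cconj y) h) + Cmod h * Cmod h) * (2 * fst (Cmult (Cconj y) h) + Cmod h * Cmod h) * (recip y * recip y * recip (Cplus y h))).
  { unfold q. replace (fst (Cmult (Cmult (RtoC (2 * (recip y * recip y))) (Cconj y)) h)) with (2 * (recip y * recip y) * fst (Cmult (Cconj y) h)) by (simpl; ring). lra. }
  rewrite Eq. clear Eq q E1. set (x := fst (Cmult (Cconj y) h)) in *. set (r' := recip (Cplus y h)) in *.
  assert (Er : recip y * (1 + Cmod y * Cmod y) = 1) by (unfold recip; field; nra).
  set (r := recip y) in *. set (a := Cmod y) in *. set (b := Cmod h) in *. apply Rabs_le_between in Hre.
  assert (Hd : (2 * x + b * b) * (2 * x + b * b) <= (2 * a + b) * (2 * a + b) * (b * b)).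
  { assert (- ((2 * a + b) * b) <= 2 * x + b * b <= (2 * a + b) * b) by nra.
    replace ((2 * a + b) * (2 * a + b) * (b * b)) with ((2 * a + b) * b * ((2 * a + b) * b)) by ring. nra. }
  set (dd := (2 * x + b * b) * (2 * x + b * b)) in *. assert (0 <= dd) by exact (Rle_0_sqr (2 * x + b * b)).
  assert (Hbb : 0 <= b * b) by nra.
  assert (Hrr : 0 < r * r <= 1) by nra.
  assert (Hdd : dd * (r * r * r') <= dd * (r * r)).
  { apply Rmult_le_compat_l; auto. nra. }
  split.
  - assert ((2 * a + b) * (2 * a + b) <= 5 * (1 + a * a)).
    { assert ((2 * a + b) * (2 * a + b) <= (2 * a + 1) * (2 * a + 1)) by (apply Rmult_le_compat; lra).
      pose proof (Rle_0_sqr (a - 2)) as Hs. unfold Rsqr in Hs. lra. }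
    assert (dd * (r * r) <= 5 * (b * b)).
    { apply Rle_trans with (5 * (1 + a * a) * (b * b) * (r * r)).
      - apply Rmult_le_compat_r; [lra|]. eapply Rle_trans; [exact Hd|]. apply Rmult_le_compat_r; auto.
      - replace (5 * (1 + a * a) * (b * b) * (r * r)) with (5 * (b * b) * r * (r * (1 + a * a))) by ring. rewrite Er. nra. }
    assert (0 <= b * b * (r * r)) by nra. lra.
  - intros Ha Hb.
    assert ((2 * a + b) * (2 * a + b) <= 9 / 16) by nra.
    assert (dd <= 9 / 16 * (b * b)) by nra.
    assert (Hr2 : 16 / 17 <= r) by nra.
    assert (16 / 17 * (16 / 17) <= r * r) by nra.
    assert (dd * (r * r) <= 9 / 16 * (b * b) * (r * r)) by (apply Rmult_le_compat_r; lra).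
    assert (7 / 16 * (b * b) * (16 / 17 * (16 / 17)) <= 7 / 16 * (b * b) * (r * r)) by (apply Rmult_le_compat_l; nra).
    lra.
Qed.

Definition good_pot (P : C -> R) (k : nat) : Prop :=
  exists A B D, Pot P A B D /\ (forall r z, P (Cmult (RtoC r) z) = r ^ (2 * k) * P z) /\
    forall z, z <> RtoC 0 -> 0 < D z.

(** Away from the origin homogeneity reduces everything to the compact unit circle, so [d1] does not
    depend on [y]. Near the origin only the nonnegativity of [D] is available, which leaves the
    cubic loss of the last clause. *)
Lemma Pot_strict_large (P : C -> R) (A B : C -> C) (D : C -> R) (k : nat) : (1 < k)%nat ->
  Pot P A B D -> (forall r z, P (Cmult (RtoC r) z) = r ^ (2 * k) * P z) -> (forall z, z <> RtoC 0 -> 0 < D z) ->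
  exists d1 L, 0 < d1 /\ 0 <= L /\
   (forall y h b, 1 / 4 <= Cmod y -> Cmod h <= b -> b <= 1 -> L * b <= d1 / 2 ->
     d1 / 2 * (Cmod h * Cmod h) <= P (Cplus y h) - P y - fst (Cplus (Cmult (A y) h) (Cmult (B y) (Cmult h h)))) /\
   (forall y h, Cmod y <= 1 -> Cmod h <= 1 ->
     - L * (Cmod h * Cmod h * Cmod h) <= P (Cplus y h) - P y - fst (Cplus (Cmult (A y) h) (Cmult (B y) (Cmult h h)))).
Proof.
  intros Hk HP Hh HD. pose proof (Pot_homog P A B D (2 * k) HP Hh) as Hom.
  destruct HP as (S1 & S2 & S3 & S4 & HT). destruct (HT 1) as (L & HL & K).
  destruct (circle_min D S3 HD) as (d0 & Hd0 & Hmin).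
  assert (Hpol : forall y, y <> RtoC 0 -> exists r e, 0 < r /\ Cmod y = r /\ Cmod e = 1 /\ y = Cmult (RtoC r) e).
  { intros y Hy. pose proof (Cmod_gt_0 y) as Hm. assert (0 < Cmod y) by (now apply Hm).
    exists (Cmod y), (Cmult (RtoC (/ Cmod y)) y). repeat split; auto.
    - rewrite Cmod_mult, Cmod_RtoC, Rabs_pos_eq by (left; now apply Rinv_0_lt_compat). field. lra.
    - rewrite Cmult_assoc, <- RtoC_mult, Rinv_r by lra. ring. }
  (* At [0] the dilation by [2] gives [4 D 0 = 2^(2 k) D 0], hence [D 0 = 0] as [k > 1]. *)
  assert (HD0 : forall y, 0 <= D y).
  { intros y. destruct (classic (y = RtoC 0)) as [->|Hy]; [|left; auto].
    destruct (Hom 2 (RtoC 0) ltac:(lra)) as (_ & _ & E). replace (Cmult (RtoC 2) (RtoC 0)) with (RtoC 0) in E by ring.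
    replace (2 * k)%nat with (2 + (2 * k - 2))%nat in E by lia. rewrite pow_add in E.
    assert (1 < 2 ^ (2 * k - 2)) by (apply Rlt_pow_R1; [lra|lia]). simpl (2 ^ 2) in E.
    assert (E0 : D (RtoC 0) * (1 - 2 ^ (2 * k - 2)) = 0) by lra. apply Rmult_integral in E0. lra. }
  set (q := (1 / 4) ^ (2 * k)).
  assert (Hq : 0 < q <= 1). { unfold q. split; [apply pow_lt; lra|]. apply Rle_trans with (1 ^ (2 * k)); [apply pow_incr; lra|rewrite pow1; lra]. }
  exists (q * d0), L. split; [nra|]. split; auto. split.
  - intros y h b Hy Hhb Hb HLb. pose proof (Cmod_ge_0 h).
    assert (Hy0 : y <> RtoC 0) by (intros E; rewrite E, Cmod_0 in Hy; lra).
    destruct (Hpol y Hy0) as (r & e & Hr & Er & He & Ey).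
    destruct (Hom r e Hr) as (HA & HB & HDD). rewrite <- Ey in HA, HB, HDD. specialize (Hmin e He).
    (* For [r >= 1] the displacement only shrinks when pulled back to the circle, and
       [r^(2 k) >= r^2] compensates. For [1/4 <= r < 1] one expands at [y] itself, where
       [D y >= (1/4)^(2 k) d0]. *)
    destruct (Rle_dec 1 r) as [H1|H1].
    + set (h' := Cmult (RtoC (/ r)) h).
      assert (Hri : 0 < / r <= 1) by (split; [now apply Rinv_0_lt_compat|rewrite <- Rinv_1; apply Rinv_le_contravar; lra]).
      assert (Eh : h = Cmult (RtoC r) h') by (unfold h'; rewrite Cmult_assoc, <- RtoC_mult, Rinv_r by lra; ring).
      assert (Hh' : Cmod h' = / r * Cmod h) by (unfold h'; rewrite Cmod_mult, Cmod_RtoC, Rabs_pos_eq; lra).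
      assert (Hh1 : Cmod h' <= b) by (rewrite Hh'; nra).
      pose proof (Cmod_ge_0 h').
      specialize (K e h' ltac:(lra) ltac:(lra)). apply Rabs_le_between in K.
      assert (E : P (Cplus y h) - P y - fst (Cplus (Cmult (A y) h) (Cmult (B y) (Cmult h h))) =
        r ^ (2 * k) * (P (Cplus e h') - P e - fst (Cplus (Cmult (A e) h') (Cmult (B e) (Cmult h' h'))))).
      { change (fst (Cplus (Cmult (A y) h) (Cmult (B y) (Cmult h h)))) with (fst (Cmult (A y) h) + fst (Cmult (B y) (Cmult h h))).
        change (fst (Cplus (Cmult (A e) h') (Cmult (B e) (Cmult h' h')))) with (fst (Cmult (A e) h') + fst (Cmult (B e) (Cmult h' h'))).
        rewrite Eh, HA, HB. rewrite Ey at 1 2. replace (Cplus (Cmult (RtoC r) e) (Cmult (RtoC r) h')) with (Cmult (RtoC r) (Cplus e h')) by ring.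
        rewrite !Hh. ring. }
      rewrite E.
      assert (Hlow : d0 / 2 * (Cmod h' * Cmod h') <= P (Cplus e h') - P e - fst (Cplus (Cmult (A e) h') (Cmult (B e) (Cmult h' h')))).
      { assert (L * Cmod h' <= d0 / 2) by nra. assert (0 <= Cmod h' * Cmod h') by nra. nra. }
      assert (Hr2 : r * r <= r ^ (2 * k)).
      { replace (r * r) with (r ^ 2) by ring. apply Rle_pow; [lra|lia]. }
      assert (Ehh : Cmod h * Cmod h = r * r * (Cmod h' * Cmod h')) by (rewrite Hh'; field; lra).
      rewrite Ehh. assert (0 <= Cmod h' * Cmod h') by nra.
      assert (0 <= d0 / 2 * (Cmod h' * Cmod h')) by nra.
      apply Rle_trans with (r ^ (2 * k) * (d0 / 2 * (Cmod h' * Cmod h'))); [|apply Rmult_le_compat_l; nra].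
      apply Rle_trans with (r * r * (d0 / 2 * (Cmod h' * Cmod h'))); [|apply Rmult_le_compat_r; auto].
      assert (0 <= r * r * (Cmod h' * Cmod h')) by (apply Rmult_le_pos; nra).
      replace (r * r * (d0 / 2 * (Cmod h' * Cmod h'))) with (d0 / 2 * (r * r * (Cmod h' * Cmod h'))) by ring.
      apply Rmult_le_compat_r; nra.
    + specialize (K y h ltac:(lra) ltac:(lra)). apply Rabs_le_between in K.
      assert (HDy : q * d0 <= D y).
      { assert (q <= r ^ (2 * k)) by (unfold q; apply pow_incr; lra).
        assert (D y * (r * r) <= D y * 1) by (apply Rmult_le_compat_l; [apply HD0|nra]).
        assert (q * d0 <= r ^ (2 * k) * D e) by (apply Rmult_le_compat; lra). lra. }
      assert (L * Cmod h <= q * d0 / 2) by nra. assert (0 <= Cmod h * Cmod h) by nra. nra.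
  - intros y h Hy Hh1. pose proof (Cmod_ge_0 h). specialize (K y h Hy Hh1). apply Rabs_le_between in K. specialize (HD0 y).
    assert (0 <= D y * (Cmod h * Cmod h)) by (apply Rmult_le_pos; nra). lra.
Qed.

(* The bounded correction [- eps / (1 + |y|^2)] restores strict subharmonicity at the origin. *)
Lemma Pot_strict (P : C -> R) (A B : C -> C) (D : C -> R) (k : nat) : (1 < k)%nat ->
  Pot P A B D -> (forall r z, P (Cmult (RtoC r) z) = r ^ (2 * k) * P z) -> (forall z, z <> RtoC 0 -> 0 < D z) ->
  exists eps b c0, 0 < eps /\ 0 < b /\ 0 < c0 /\ forall y h, Cmod h <= b ->
     c0 * (Cmod h * Cmod h) <= (P (Cplus y h) - eps * recip (Cplus y h)) - (P y - eps * recip y) -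
       fst (Cplus (Cmult (Cplus (A y) (Cmult (RtoC (eps * (2 * (recip y * recip y)))) (Cconj y))) h) (Cmult (B y) (Cmult h h))).
Proof.
  intros Hk HP Hh HD. destruct (Pot_strict_large P A B D k Hk HP Hh HD) as (d1 & L & Hd1 & HL & H1 & H2).
  (* Away from [0] the correction loses at most [5 eps], half of the available [d1 / 2 = 10 eps].
     Near [0] it gains [eps / 4], and [b] is chosen so that the cubic remainder takes at most
     [eps / 8] of this. *)
  set (eps := d1 / 20). assert (He : 0 < eps) by (unfold eps; lra).
  set (b := Rmin (1 / 4) (eps / (8 * (L + 1)))).
  assert (Hb : 0 < b) by (unfold b; apply Rmin_pos; [lra|apply Rdiv_lt_0_compat; lra]).
  assert (Hb4 : b <= 1 / 4) by apply Rmin_l.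
  assert (HLb : L * b <= eps / 8).
  { assert (b <= eps / (8 * (L + 1))) by apply Rmin_r.
    apply Rle_trans with ((L + 1) * (eps / (8 * (L + 1)))); [|right; field; lra]. apply Rmult_le_compat; lra. }
  exists eps, b, (eps / 8). split; [auto|split; [auto|split; [lra|]]]. intros y h Hhb. pose proof (Cmod_ge_0 h).
  assert (0 <= Cmod h * Cmod h) by nra.
  destruct (recip_lower y h ltac:(lra)) as (Q1 & Q2).
  set (X := P (Cplus y h) - P y - fst (Cplus (Cmult (A y) h) (Cmult (B y) (Cmult h h)))) in *.
  set (q := - recip (Cplus y h) + recip y - fst (Cmult (Cmult (RtoC (2 * (recip y * recip y))) (Cconj y)) h)) in *.
  match goal with |- _ <= ?g => replace g with (X + eps * q) by (unfold X, q; simpl; ring) end.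
  destruct (Rle_dec (1 / 4) (Cmod y)).
  - specialize (H1 y h b ltac:(lra) Hhb ltac:(lra) ltac:(unfold eps in *; lra)). fold X in H1.
    assert (eps * (-5 * (Cmod h * Cmod h)) <= eps * q) by (apply Rmult_le_compat_l; lra). unfold eps in *. nra.
  - specialize (H2 y h ltac:(lra) ltac:(lra)). fold X in H2. specialize (Q2 ltac:(lra) ltac:(lra)).
    assert (eps * (Cmod h * Cmod h / 4) <= eps * q) by (apply Rmult_le_compat_l; lra).
    assert (L * (Cmod h * Cmod h * Cmod h) <= eps / 8 * (Cmod h * Cmod h)).
    { replace (L * (Cmod h * Cmod h * Cmod h)) with (L * Cmod h * (Cmod h * Cmod h)) by ring. apply Rmult_le_compat_r; nra. }
    lra.
Qed.

(** * Peak functions at every scale *)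

(** [M] is independent of [t] because only the fixed weight [phi] goes through the kernel
    construction. A dilation turns [T P] into [t P], while the correction, being bounded by [eps] at
    every scale, costs at most [exp (T eps)]. *)
Lemma peak_family (P : C -> R) (k : nat) : (1 < k)%nat -> good_pot P k ->
  exists M, 1 <= M /\ forall t b, 0 < t -> exists F, (forall z, exists p, cdiff1 F z p) /\
    (forall z, Cmod (F z) <= M * exp (t * (P z - P b))) /\ 1 / 2 <= Cmod (F b).
Proof.
  intros Hk (A & B & D & HP & Hh & HD).
  destruct (Pot_strict P A B D k Hk HP Hh HD) as (eps & s & c0 & He & Hs & Hc0 & Hst).
  destruct HP as (S1 & S2 & S3 & S4 & _).
  (* The dilation by [s] makes all displacements up to [1] admissible, at the price of [s^2] in the
     Gaussian constant; [T] restores it to [K = 1000]. *)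
  set (T := 1000 / (c0 * (s * s))). assert (Hss : 0 < s * s) by nra. assert (HT : 0 < T) by (unfold T; apply Rdiv_lt_0_compat; nra).
  set (A1 := fun y => Cplus (A y) (Cmult (RtoC (eps * (2 * (recip y * recip y)))) (Cconj y))).
  assert (SA : sm A1).
  { apply sm_plus; auto. apply (sm_mult (fun y => RtoC (eps * (2 * (recip y * recip y))))); [|apply sm_conj, sm_id].
    apply sm_ext with (fun y => Cmult (RtoC (eps * 2)) (Cmult (RtoC (recip y)) (RtoC (recip y)))).
    - intros. rewrite <- !RtoC_mult. f_equal. ring.
    - apply (sm_mult (fun _ => RtoC (eps * 2))); [apply sm_const|]. apply sm_mult; apply sm_recip. }
  set (A' := fun z => Cmult (RtoC (T * s)) (A1 (Cmult (RtoC s) z))). set (B' := fun z => Cmult (RtoC (T * (s * s))) (B (Cmult (RtoC s) z))).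
  assert (SA' : sm A') by (apply (sm_mult (fun _ => RtoC (T * s))); [apply sm_const|now apply sm_dil]).
  assert (SB' : sm B') by (apply (sm_mult (fun _ => RtoC (T * (s * s)))); [apply sm_const|now apply sm_dil]).
  destruct SA' as (dA & HdA). destruct SB' as (dB & HdB).
  set (phi := fun z => T * (P (Cmult (RtoC s) z) - eps * recip (Cmult (RtoC s) z))).
  assert (Hpeak : forall a, exists F, (forall z, exists p, cdiff1 F z p) /\ (forall z, Cmod (F z) <= 2 * exp (phi z - phi a)) /\ 1 / 2 <= Cmod (F a)).
  { apply (entire_peak A' B' dA dB phi 1000 HdA HdB); [lra| |].
    - intros z w Hw.
      assert (Hsw : Cmod (Cmult (RtoC s) w) = s * Cmod w) by (rewrite Cmod_mult, Cmod_RtoC, Rabs_pos_eq; lra).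
      pose proof (Cmod_ge_0 w).
      specialize (Hst (Cmult (RtoC s) z) (Cmult (RtoC s) w) ltac:(rewrite Hsw; nra)). rewrite Hsw in Hst. fold (A1 (Cmult (RtoC s) z)) in Hst.
      apply (Rmult_le_compat_l T) in Hst; [|lra].
      replace (T * (c0 * (s * Cmod w * (s * Cmod w)))) with (1000 * (Cmod w * Cmod w)) in Hst by (unfold T; field; lra).
      replace (Cplus (Cmult (RtoC s) z) (Cmult (RtoC s) w)) with (Cmult (RtoC s) (Cplus z w)) in Hst by ring.
      assert (E : fst (Cplus (Cmult (A' z) w) (Cmult (B' z) (Cmult w w))) = T * fst (Cplus (Cmult (A1 (Cmult (RtoC s) z)) (Cmult (RtoC s) w)) (Cmult (B (Cmult (RtoC s) z)) (Cmult (Cmult (RtoC s) w) (Cmult (RtoC s) w))))).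
      { unfold A', B'. generalize (A1 (Cmult (RtoC s) z)) (B (Cmult (RtoC s) z)). intros u v. simpl. ring. }
      rewrite E. unfold phi. lra.
    - intros M. destruct (sm_bound _ S4 (s * Rabs M)) as (L & HL & K). exists (T * L). intros z Hz. unfold phi.
      apply Rmult_le_compat_l; [lra|]. pose proof (recip_pos (Cmult (RtoC s) z)).
      assert (Cmod (Cmult (RtoC s) z) <= s * Rabs M).
      { rewrite Cmod_mult, Cmod_RtoC, Rabs_pos_eq by lra. apply Rmult_le_compat_l; [lra|]. pose proof (Rle_abs M). lra. }
      specialize (K _ H0). rewrite Cmod_RtoC in K. pose proof (Rle_abs (P (Cmult (RtoC s) z))). nra. }
  exists (2 * exp (T * eps)). assert (1 <= exp (T * eps)) by (rewrite <- exp_0; apply exp_mono; nra).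
  split; [lra|]. intros t b Ht.
  (* Chosen so that [(s kap)^(2 k) = t / T], that is, [T P (s kap z) = t P z]. *)
  set (kap := Rpower (t / T) (/ INR (2 * k)) / s).
  assert (Hkap : 0 < kap) by (unfold kap; apply Rdiv_lt_0_compat; auto; unfold Rpower; apply exp_pos).
  assert (Ek : (s * kap) ^ (2 * k) = t / T).
  { assert (0 < t / T) by (apply Rdiv_lt_0_compat; auto).
    replace (s * kap) with (Rpower (t / T) (/ INR (2 * k))) by (unfold kap; field; lra).
    rewrite <- Rpower_pow by (unfold Rpower; apply exp_pos). rewrite Rpower_mult, Rinv_l; [now apply Rpower_1|]. apply not_0_INR. lia. }
  destruct (Hpeak (Cmult (RtoC kap) b)) as (F & F1 & F2 & F3).
  exists (fun z => F (Cmult (RtoC kap) z)). split; [|split; auto].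
  - intros z. destruct (F1 (Cmult (RtoC kap) z)) as (p & Hp). eexists.
    apply (cdiff1_comp (fun z => Cmult (RtoC kap) z) F); [|exact Hp].
    apply cdiff1_ext with (fun w => Cplus (Cmult (RtoC kap) w) (RtoC 0)); [intros; ring|apply cdiff1_affine].
  - intros z. eapply Rle_trans; [apply F2|]. rewrite Rmult_assoc. apply Rmult_le_compat_l; [lra|].
    rewrite <- exp_plus. apply exp_mono. unfold phi.
    replace (Cmult (RtoC s) (Cmult (RtoC kap) z)) with (Cmult (RtoC (s * kap)) z) by (rewrite RtoC_mult; ring).
    replace (Cmult (RtoC s) (Cmult (RtoC kap) b)) with (Cmult (RtoC (s * kap)) b) by (rewrite RtoC_mult; ring).
    rewrite !Hh, Ek. pose proof (recip_pos (Cmult (RtoC (s * kap)) z)). pose proof (recip_pos (Cmult (RtoC (s * kap)) b)).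
    assert (E : forall u, T * (t / T * u) = t * u) by (intros; field; lra).
    rewrite !Rmult_minus_distr_l, !E.
    assert (T * (eps * recip (Cmult (RtoC (s * kap)) b)) <= T * eps) by (apply Rmult_le_compat_l; nra).
    assert (0 <= T * (eps * recip (Cmult (RtoC (s * kap)) z))) by (apply Rmult_le_pos; nra). lra.
Qed.

(** The mixed derivative of [|z|^(2 k)] is [k^2 |z|^(2 k - 2)], homogeneous of the same degree as
    that of [P]. Comparing them on the unit circle is enough, and [e = d0 / (2 k^2)] uses up half of
    the minimum [d0]. The small loss is what gives test functions extra decay in [z1]. *)
Lemma good_pot_bump (c : nat -> nat -> C) (N k : nat) : (1 < k)%nat ->
  (forall (r : R) (z : C), polyzzb c N (Cmult (RtoC r) z) = Cmult (RtoC (r ^ (2 * k))) (polyzzb c N z)) ->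
  (forall z : C, z <> RtoC 0 -> Im (polyzzb_ddbar c N z) = 0 /\ 0 < Re (polyzzb_ddbar c N z)) ->
  good_pot (fun z => fst (polyzzb c N z)) k /\
  exists e, 0 < e /\ good_pot (fun z => fst (polyzzb c N z) - e * Cmod z ^ (2 * k)) k.
Proof.
  intros Hk Hh HD.
  destruct (T3_poly c N) as (fz & fb & fzz & fbb & HT). apply Pot_T3 in HT.
  destruct (T3_monomial (RtoC 1) k k) as (gz & gb & gzz & gbb & HG). apply Pot_T3 in HG.
  assert (Hh' : forall r z, fst (polyzzb c N (Cmult (RtoC r) z)) = r ^ (2 * k) * fst (polyzzb c N z)).
  { intros. rewrite Hh. simpl. ring. }
  assert (HD' : forall z, z <> RtoC 0 -> 0 < fst (polyzzb_ddbar c N z)) by (intros; now apply HD).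
  split.
  - do 3 eexists. split; [exact HT|]. split; auto.
  - assert (Eg : forall z n, Cmult (Cpow z n) (Cpow (Cconj z) n) = RtoC (Cmod z ^ (2 * n))).
    { intros z n. rewrite <- Cpow_mult_l. replace (Cmult z (Cconj z)) with (RtoC (Cmod z * Cmod z)) by (rewrite Cmod_sqr; apply C_ext; simpl; ring).
      rewrite <- RtoC_pow. f_equal. rewrite pow_mult. f_equal. ring. }
    assert (S3 := HT). destruct S3 as (_ & _ & S3 & _).
    destruct (circle_min _ S3 HD') as (d0 & Hd0 & Hmin).
    set (e := d0 / (2 * (INR k * INR k))).
    assert (Hkk : 0 < INR k * INR k) by (assert (0 < INR k) by (apply lt_0_INR; lia); nra).
    assert (He : 0 < e) by (unfold e; apply Rdiv_lt_0_compat; lra).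
    exists e. split; auto.
    pose proof (Pot_sub _ _ _ _ _ _ _ _ e HT HG) as H.
    assert (Hhom := Pot_homog _ _ _ _ (2 * k) HT Hh').
    match type of H with Pot _ ?A0 ?B0 ?D0 => exists A0, B0, D0 end. split; [|split].
    + destruct H as (Q1 & Q2 & Q3 & Q4 & Q5).
      assert (Ep : forall z, fst (polyzzb c N z) - e * fst (Cmult (RtoC 1) (Cmult (Cpow z k) (Cpow (Cconj z) k))) = fst (polyzzb c N z) - e * Cmod z ^ (2 * k)).
      { intros. rewrite Eg. simpl. ring. }
      split; [exact Q1|split; [exact Q2|split; [exact Q3|split]]].
      * eapply sm_ext; [|exact Q4]. intros. cbv beta. now rewrite Ep.
      * intros M. destruct (Q5 M) as (L & HL & K). exists L. split; auto. intros z h Hz Hh1. specialize (K z h Hz Hh1). rewrite !Ep in K. exact K.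
    + intros r z. cbv beta. rewrite Hh', Cmod_mult, Cmod_RtoC, Rpow_mult_distr.
      replace (Rabs r ^ (2 * k)) with (r ^ (2 * k)). 1: ring.
      rewrite !pow_mult. f_equal. simpl. rewrite !Rmult_1_r. unfold Rabs; destruct (Rcase_abs r); ring.
    + intros z Hz. cbv beta. rewrite Eg.
      assert (Hm : 0 < Cmod z) by (now apply Cmod_gt_0). set (r := Cmod z) in *.
      set (u := Cmult (RtoC (/ r)) z).
      assert (Hu : Cmod u = 1) by (unfold u; rewrite Cmod_mult, Cmod_RtoC, Rabs_pos_eq by (left; now apply Rinv_0_lt_compat); fold r; field; lra).
      assert (Ez : z = Cmult (RtoC r) u) by (unfold u; rewrite Cmult_assoc, <- RtoC_mult, Rinv_r by lra; ring).
      destruct (Hhom r u Hm) as (_ & _ & E). rewrite <- Ez in E. specialize (Hmin u Hu).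
      replace (2 * k)%nat with (2 * (k - 1) + 2)%nat in E by lia. rewrite pow_add in E.
      assert (E' : fst (polyzzb_ddbar c N z) = r ^ (2 * (k - 1)) * fst (polyzzb_ddbar c N u)).
      { apply Rmult_eq_reg_r with (r * r); [|nra]. rewrite E. ring. }
      rewrite E'. assert (0 < r ^ (2 * (k - 1))) by (now apply pow_lt).
      replace (fst (Cmult (RtoC (INR k * INR k)) (Cmult (RtoC 1) (RtoC (r ^ (2 * (k - 1))))))) with (INR k * INR k * r ^ (2 * (k - 1))) by (simpl; ring).
      replace (e * (INR k * INR k * r ^ (2 * (k - 1)))) with (d0 / 2 * r ^ (2 * (k - 1))) by (unfold e; field; assert (0 < INR k) by (apply lt_0_INR; lia); lra).
      assert (d0 * r ^ (2 * (k - 1)) <= r ^ (2 * (k - 1)) * fst (polyzzb_ddbar c N u)) by nra. nra.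
Qed.

(** * The Caratheodory metric of an open set *)

Definition polydisc (p : C2) (r : R) (q : C2) : Prop :=
  Cmod (Cminus (fst q) (fst p)) <= r /\ Cmod (Cminus (snd q) (snd p)) <= r.

Definition open2 (U : C2 -> Prop) : Prop := forall p, U p -> exists r, 0 < r /\ forall q, polydisc p r q -> U q.

Definition dot (a v : C2) : C := Cplus (Cmult (fst a) (fst v)) (Cmult (snd a) (snd v)).

Definition size2 (v : C2) : R := Cmod (fst v) + Cmod (snd v).

Definition diff2 (p q : C2) : C2 := (Cminus (fst p) (fst q), Cminus (snd p) (snd q)).

Lemma size2_pos (v : C2) : 0 <= size2 v.
Proof. unfold size2. pose proof (Cmod_ge_0 (fst v)). pose proof (Cmod_ge_0 (snd v)). lra. Qed.

Lemma cdiff_at_fst (f : C2 -> C) (p a : C2) : cdiff_at f p a -> cdiff1 (fun w => f (w, snd p)) (fst p) (fst a).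
Proof.
  intros H eps He. destruct (H eps He) as (d & Hd & K). exists d; split; auto. intros h Hh.
  specialize (K h (RtoC 0) Hh). rewrite Cmod_0 in K. specialize (K Hd).
  replace (Cplus (snd p) (RtoC 0)) with (snd p) in K by ring.
  replace (Cplus (Cmult (fst a) h) (Cmult (snd a) (RtoC 0))) with (Cmult (fst a) h) in K by ring.
  rewrite Rplus_0_r in K. destruct p; exact K.
Qed.

Lemma cdiff_at_snd (f : C2 -> C) (p a : C2) : cdiff_at f p a -> cdiff1 (fun w => f (fst p, w)) (snd p) (snd a).
Proof.
  intros H eps He. destruct (H eps He) as (d & Hd & K). exists d; split; auto. intros h Hh.
  specialize (K (RtoC 0) h). rewrite Cmod_0 in K. specialize (K Hd Hh).
  replace (Cplus (fst p) (RtoC 0)) with (fst p) in K by ring.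
  replace (Cplus (Cmult (fst a) (RtoC 0)) (Cmult (snd a) h)) with (Cmult (snd a) h) in K by ring.
  rewrite Rplus_0_l in K. destruct p; exact K.
Qed.

Lemma cdiff_at_affine (f : C2 -> C) (p a : C2) (c d : C) : cdiff_at f p a ->
  cdiff_at (fun q => Cplus (Cmult c (f q)) d) p (Cmult c (fst a), Cmult c (snd a)).
Proof.
  intros H eps He. pose proof (Cmod_ge_0 c).
  destruct (H (eps / (Cmod c + 1))) as (dl & Hd & K); [apply Rdiv_lt_0_compat; lra|].
  exists dl; split; auto. intros h1 h2 H1 H2. specialize (K h1 h2 H1 H2). simpl fst. simpl snd.
  match type of K with Cmod ?x <= _ => match goal with |- Cmod ?w <= _ => replace w with (Cmult c x) by ring end end.
  rewrite Cmod_mult. apply Rle_trans with (Cmod c * (eps / (Cmod c + 1) * (Cmod h1 + Cmod h2))).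
  - apply Rmult_le_compat_l; auto.
  - pose proof (Cmod_ge_0 h1). pose proof (Cmod_ge_0 h2).
    replace (Cmod c * (eps / (Cmod c + 1) * (Cmod h1 + Cmod h2))) with (Cmod c / (Cmod c + 1) * (eps * (Cmod h1 + Cmod h2))) by (field; lra).
    rewrite <- (Rmult_1_l (eps * (Cmod h1 + Cmod h2))) at 2. apply Rmult_le_compat_r; [nra|].
    apply Rle_div_l; lra.
Qed.

Lemma cdiff_at_const (c : C) (p : C2) : cdiff_at (fun _ => c) p (RtoC 0, RtoC 0).
Proof.
  intros eps He. exists 1; split; [lra|]. intros. simpl.
  match goal with |- Cmod ?x <= _ => replace x with (RtoC 0) by ring end. rewrite Cmod_0.
  pose proof (Cmod_ge_0 h1). pose proof (Cmod_ge_0 h2). nra.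
Qed.

Lemma polydisc_mono (p q : C2) (r r' : R) : r <= r' -> polydisc p r q -> polydisc p r' q.
Proof. unfold polydisc. intros. lra. Qed.

Lemma polydisc_tri (p q x : C2) (r r' : R) : polydisc p r q -> polydisc q r' x -> polydisc p (r + r') x.
Proof.
  unfold polydisc. intros (H1 & H2) (H3 & H4).
  pose proof (Cmod_tri3 (fst x) (fst q) (fst p)). pose proof (Cmod_tri3 (snd x) (snd q) (snd p)). lra.
Qed.

Lemma polydisc_refl (p : C2) (r : R) : 0 <= r -> polydisc p r p.
Proof. unfold polydisc. intros. replace (Cminus (fst p) (fst p)) with (RtoC 0) by ring. replace (Cminus (snd p) (snd p)) with (RtoC 0) by ring. rewrite Cmod_0. lra. Qed.

Lemma holo_slices (U : C2 -> Prop) (f : C2 -> C) (p : C2) (r : R) : holo_to_disc U f -> (forall q, polydisc p r q -> U q) -> 0 <= r ->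
  (forall w, Cmod (Cminus w (fst p)) <= r -> exists a, cdiff1 (fun w => f (w, snd p)) w a) /\
  (forall w, Cmod (Cminus w (snd p)) <= r -> exists a, cdiff1 (fun w => f (fst p, w)) w a).
Proof.
  intros Hf HU Hr. split; intros w Hw.
  - destruct (Hf (w, snd p)) as (_ & a & Ha).
    + apply HU. split; simpl; auto. replace (Cminus (snd p) (snd p)) with (RtoC 0) by ring. now rewrite Cmod_0.
    + exists (fst a). apply (cdiff_at_fst f (w, snd p) a Ha).
  - destruct (Hf (fst p, w)) as (_ & a & Ha).
    + apply HU. split; simpl; auto. replace (Cminus (fst p) (fst p)) with (RtoC 0) by ring. now rewrite Cmod_0.
    + exists (snd a). apply (cdiff_at_snd f (fst p, w) a Ha).
Qed.

Lemma holo_gradient (U : C2 -> Prop) (f : C2 -> C) (p a : C2) (r : R) : 0 < r -> holo_to_disc U f -> (forall q, polydisc p r q -> U q) ->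
  cdiff_at f p a -> Cmod (fst a) <= 2 / r /\ Cmod (snd a) <= 2 / r.
Proof.
  intros Hr Hf HU Ha. destruct (holo_slices U f p r Hf HU) as (S1 & S2); [lra|].
  replace (2 / r) with (2 * 1 / r) by (unfold Rdiv; ring).
  split.
  - apply (cauchy_est (fun w => f (w, snd p)) (fst p) (fst a) r 1 Hr S1).
    + now apply cdiff_at_fst.
    + intros w Hw. left. apply Hf, HU. split; simpl; auto. replace (Cminus (snd p) (snd p)) with (RtoC 0) by ring. rewrite Cmod_0. lra.
  - apply (cauchy_est (fun w => f (fst p, w)) (snd p) (snd a) r 1 Hr S2).
    + now apply cdiff_at_snd.
    + intros w Hw. left. apply Hf, HU. split; simpl; auto. replace (Cminus (fst p) (fst p)) with (RtoC 0) by ring. rewrite Cmod_0. lra.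
Qed.

Lemma segment_close (z w c : C) (r t : R) : 0 <= t <= 1 -> Cmod (Cminus z c) <= r -> Cmod (Cminus w c) <= r ->
  Cmod (Cminus (Cplus z (Cmult (RtoC t) (Cminus w z))) c) <= r.
Proof.
  intros Ht Hz Hw. replace (Cminus (Cplus z (Cmult (RtoC t) (Cminus w z))) c) with
    (Cplus (Cmult (RtoC (1 - t)) (Cminus z c)) (Cmult (RtoC t) (Cminus w c))) by (rewrite RtoC_minus; ring).
  eapply Rle_trans; [apply Cmod_triangle|]. rewrite !Cmod_mult, !Cmod_RtoC, !Rabs_pos_eq by lra. nra.
Qed.

(** The two points are joined by a path parallel to the axes, which stays in the polydisc. On it the
    partial derivatives are at most [2 / r], and the mean value theorem doubles this. *)
Lemma holo_lipschitz (U : C2 -> Prop) (f : C2 -> C) (p q q' : C2) (r s : R) : 0 < r -> holo_to_disc U f ->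
  (forall x, polydisc p (s + r) x -> U x) -> polydisc p s q -> polydisc p s q' ->
  Cmod (Cminus (f q') (f q)) <= 4 / r * size2 (diff2 q' q).
Proof.
  intros Hr Hf HU (Hq1 & Hq2) (Hq1' & Hq2').
  assert (HG : forall x, polydisc p s x -> exists a, cdiff_at f x a /\ Cmod (fst a) <= 2 / r /\ Cmod (snd a) <= 2 / r).
  { intros x Hx. destruct (Hf x) as (_ & a & Ha).
    - apply HU. eapply polydisc_mono; [|exact Hx]. lra.
    - exists a. split; auto. apply (holo_gradient U f x a r); auto. intros y Hy. apply HU. eapply polydisc_tri; [|eassumption]; eassumption. }
  destruct q as [x y], q' as [x' y']. simpl in *.
  assert (E1 : Cmod (Cminus (f (x', y)) (f (x, y))) <= 2 * (2 / r) * Cmod (Cminus x' x)).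
  { pose proof (cdiff1_mvt (fun w => f (w, y)) x (Cminus x' x) (2 / r)) as K. cbv beta in K.
    replace (Cplus x (Cminus x' x)) with x' in K by ring. apply K. intros t Ht.
    destruct (HG (Cplus x (Cmult (RtoC t) (Cminus x' x)), y)) as (a & Ha & B1 & _).
    - split; simpl; auto. now apply segment_close.
    - exists (fst a). split; auto. now apply (cdiff_at_fst f (Cplus x (Cmult (RtoC t) (Cminus x' x)), y)). }
  assert (E2 : Cmod (Cminus (f (x', y')) (f (x', y))) <= 2 * (2 / r) * Cmod (Cminus y' y)).
  { pose proof (cdiff1_mvt (fun w => f (x', w)) y (Cminus y' y) (2 / r)) as K. cbv beta in K.
    replace (Cplus y (Cminus y' y)) with y' in K by ring. apply K. intros t Ht.
    destruct (HG (x', Cplus y (Cmult (RtoC t) (Cminus y' y)))) as (a & Ha & _ & B2).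
    - split; simpl; auto. now apply segment_close.
    - exists (snd a). split; auto. now apply (cdiff_at_snd f (x', Cplus y (Cmult (RtoC t) (Cminus y' y)))). }
  pose proof (Cmod_tri3 (f (x', y')) (f (x', y)) (f (x, y))). unfold size2, diff2; simpl.
  replace (4 / r) with (2 * (2 / r)) by (field; lra). lra.
Qed.

(** Subtracting the two Cauchy formulas compares derivatives at different points, even of different
    slices, through values alone; second derivatives never appear. *)
Lemma cauchy_diff (f g : C -> C) (z w a b : C) (r M : R) : 0 < r ->
  (forall x, Cmod (Cminus x z) <= r -> exists p, cdiff1 f x p) -> (forall x, Cmod (Cminus x w) <= r -> exists p, cdiff1 g x p) ->
  cdiff1 f z a -> cdiff1 g w b ->
  (forall h, Cmod h <= r -> Cmod (Cminus (f (Cplus z h)) (g (Cplus w h))) <= M) -> Cmod (Cminus a b) <= 2 * M / r.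
Proof.
  intros Hr Hf Hg Ha Hb HM. pose proof two_PI_pos.
  pose proof (cauchy_deriv f z a r Hr Hf Ha) as E1. pose proof (cauchy_deriv g w b r Hr Hg Hb) as E2.
  assert (Cmod (Cmult (RtoC (2 * PI * r)) (Cminus a b)) <= 2 * ((2 * PI - 0) * M)).
  { replace (Cmult (RtoC (2 * PI * r)) (Cminus a b)) with (Cminus (Cmult (RtoC (2 * PI * r)) a) (Cmult (RtoC (2 * PI * r)) b)) by ring.
    rewrite <- E1, <- E2, <- CInt_minus by (now apply ex_cauchy). apply CInt_le; [lra|apply exCInt_minus; now apply ex_cauchy|].
    intros t _. set (h := Cmult (RtoC r) (cis t)).
    replace (Cminus (Cmult (f (Cplus z h)) (cis (- t))) (Cmult (g (Cplus w h)) (cis (- t)))) with (Cmult (Cminus (f (Cplus z h)) (g (Cplus w h))) (cis (- t))) by ring.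
    rewrite Cmod_mult, Cmod_cis, Rmult_1_r. apply HM. unfold h. rewrite Cmod_rcis; lra. }
  rewrite Cmod_mult, Cmod_RtoC, Rabs_pos_eq in H0 by nra.
  apply Rle_div_r; auto. apply Rmult_le_reg_l with (2 * PI); [lra|]. nra.
Qed.

(** The radius [3 r] has room for the position of [q] and [q'], for the Cauchy circles around them,
    and for the Lipschitz estimate on these circles, [r] each. *)
Lemma holo_gradient_lipschitz (U : C2 -> Prop) (f : C2 -> C) (p q q' a a' : C2) (r : R) : 0 < r -> holo_to_disc U f ->
  (forall x, polydisc p (3 * r) x -> U x) -> polydisc p r q -> polydisc p r q' -> cdiff_at f q a -> cdiff_at f q' a' ->
  Cmod (Cminus (fst a) (fst a')) <= 8 / (r * r) * size2 (diff2 q q') /\ Cmod (Cminus (snd a) (snd a')) <= 8 / (r * r) * size2 (diff2 q q').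
Proof.
  intros Hr Hf HU Hq Hq' Ha Ha'.
  assert (HUq : forall x, polydisc q r x -> U x).
  { intros x Hx. apply HU. apply (polydisc_mono p x (r + r)); [lra|]. eapply polydisc_tri; [|eassumption]; eassumption. }
  assert (HUq' : forall x, polydisc q' r x -> U x).
  { intros x Hx. apply HU. apply (polydisc_mono p x (r + r)); [lra|]. eapply polydisc_tri; [|eassumption]; eassumption. }
  destruct (holo_slices U f q r Hf HUq) as (S1 & S2); [lra|]. destruct (holo_slices U f q' r Hf HUq') as (S1' & S2'); [lra|].
  assert (HL : forall x x', polydisc q r x -> polydisc q' r x' -> Cmod (Cminus (f x) (f x')) <= 4 / r * size2 (diff2 x x')).
  { intros x x' Hx Hx'. apply (holo_lipschitz U f p x' x r (2 * r)); auto.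
    - intros y Hy. apply HU. eapply polydisc_mono; [|exact Hy]. lra.
    - apply (polydisc_mono p x' (r + r)); [lra|]. eapply polydisc_tri; [|eassumption]; eassumption.
    - apply (polydisc_mono p x (r + r)); [lra|]. eapply polydisc_tri; [|eassumption]; eassumption. }
  assert (Z : forall u : C, Cmod (Cminus u u) = 0) by (intros; replace (Cminus u u) with (RtoC 0) by ring; apply Cmod_0).
  assert (Zh : forall u h : C, Cminus (Cplus u h) u = h) by (intros; ring).
  assert (E : 8 / (r * r) * size2 (diff2 q q') = 2 * (4 / r * size2 (diff2 q q')) / r) by (field; lra).
  rewrite E. split.
  - apply (cauchy_diff (fun w => f (w, snd q)) (fun w => f (w, snd q')) (fst q) (fst q') _ _ r); auto.
    + now apply cdiff_at_fst.
    + now apply cdiff_at_fst.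
    + intros h Hh. eapply Rle_trans; [apply HL; split; simpl; rewrite ?Z, ?Zh; lra|].
      right. unfold size2, diff2; simpl. do 3 f_equal. ring.
  - apply (cauchy_diff (fun w => f (fst q, w)) (fun w => f (fst q', w)) (snd q) (snd q') _ _ r); auto.
    + now apply cdiff_at_snd.
    + now apply cdiff_at_snd.
    + intros h Hh. eapply Rle_trans; [apply HL; split; simpl; rewrite ?Z, ?Zh; lra|].
      right. unfold size2, diff2; simpl. do 3 f_equal. ring.
Qed.

(** [real] sends infinite values to [0], so this is meaningful only together with finiteness, which
    [caratheodory_finite] supplies on open sets. *)
Definition cm (U : C2 -> Prop) (p v : C2) : R := real (caratheodory_metric U p v).

Lemma Cmod_dot_le (a v : C2) (M : R) : Cmod (fst a) <= M -> Cmod (snd a) <= M -> Cmod (dot a v) <= M * size2 v.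
Proof.
  intros H1 H2. unfold dot, size2. eapply Rle_trans; [apply Cmod_triangle|]. rewrite !Cmod_mult.
  pose proof (Cmod_ge_0 (fst v)). pose proof (Cmod_ge_0 (snd v)). nra.
Qed.

(** The set of competitors contains the constant [0], and Cauchy's estimates on a polydisc bound it.
    The other two clauses are the least upper bound property, restated for the real number [cm]. *)
Lemma caratheodory_finite (U : C2 -> Prop) (p v : C2) : open2 U -> U p ->
  is_finite (caratheodory_metric U p v) /\
  (forall f a, holo_to_disc U f -> f p = RtoC 0 -> cdiff_at f p a -> Cmod (dot a v) <= cm U p v) /\
  (forall b, (forall f a, holo_to_disc U f -> f p = RtoC 0 -> cdiff_at f p a -> Cmod (dot a v) <= b) -> cm U p v <= b).
Proof.
  intros HU Hp. destruct (HU p Hp) as (r & Hr & Hpd). unfold cm, caratheodory_metric.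
  set (E := fun x => exists f a, holo_to_disc U f /\ f p = RtoC 0 /\ cdiff_at f p a /\ x = Cmod (Cplus (Cmult (fst a) (fst v)) (Cmult (snd a) (snd v)))).
  destruct (Lub_Rbar_correct E) as (Hub & Hlub).
  assert (H0 : E 0).
  { exists (fun _ => RtoC 0), (RtoC 0, RtoC 0). split; [|split; [auto|split; [apply cdiff_at_const|]]].
    - intros q _. rewrite Cmod_0. split; [lra|]. eexists. apply cdiff_at_const.
    - simpl. replace (Cplus (Cmult (RtoC 0) (fst v)) (Cmult (RtoC 0) (snd v))) with (RtoC 0) by ring. now rewrite Cmod_0. }
  assert (Hb : Rbar_le (Lub_Rbar E) (Finite (2 / r * size2 v))).
  { apply Hlub. intros x (f & a & Hf & _ & Ha & ->). simpl. destruct (holo_gradient U f p a r Hr Hf Hpd Ha). now apply (Cmod_dot_le a v). }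
  pose proof (Hub 0 H0) as H0'.
  destruct (Lub_Rbar E) as [l| |] eqn:El; simpl in *; try contradiction.
  split; [reflexivity|]. split.
  - intros f a Hf Hfp Ha. apply (Hub (Cmod (dot a v))). exists f, a. auto.
  - intros b Hbb. apply (Hlub (Finite b)). intros x (f & a & Hf & Hfp & Ha & ->). apply (Hbb f a); auto.
Qed.

Lemma cm_pos (U : C2 -> Prop) (p v : C2) : open2 U -> U p -> 0 <= cm U p v.
Proof.
  intros HU Hp. destruct (caratheodory_finite U p v HU Hp) as (_ & H & _).
  eapply Rle_trans; [apply Cmod_ge_0|apply (H (fun _ => RtoC 0) (RtoC 0, RtoC 0)); auto].
  - intros q _. rewrite Cmod_0. split; [lra|]. eexists. apply cdiff_at_const.
  - apply cdiff_at_const.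
Qed.

(* Recentering [f] as [(f - f p) / (1 + |f p|)] costs a factor at most [2] and avoids Moebius maps. *)
Lemma cm_lower (U : C2 -> Prop) (f : C2 -> C) (p v a : C2) : open2 U -> U p -> holo_to_disc U f -> cdiff_at f p a ->
  Cmod (dot a v) <= cm U p v * (1 + Cmod (f p)).
Proof.
  intros HU Hp Hf Ha. destruct (caratheodory_finite U p v HU Hp) as (_ & H & _).
  set (m := 1 + Cmod (f p)). pose proof (Cmod_ge_0 (f p)). assert (Hm : 0 < m) by (unfold m; lra).
  set (g := fun q => Cplus (Cmult (RtoC (/ m)) (f q)) (Copp (Cmult (RtoC (/ m)) (f p)))).
  assert (Hg : holo_to_disc U g).
  { intros q Hq. destruct (Hf q Hq) as (B & b & Hb). split; [|eexists; apply cdiff_at_affine, Hb].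
    unfold g. replace (Cplus (Cmult (RtoC (/ m)) (f q)) (Copp (Cmult (RtoC (/ m)) (f p)))) with (Cmult (RtoC (/ m)) (Cminus (f q) (f p))) by ring.
    rewrite Cmod_mult, Cmod_RtoC, Rabs_pos_eq by (left; now apply Rinv_0_lt_compat).
    apply Rmult_lt_reg_l with m; auto. rewrite <- Rmult_assoc, Rinv_r, Rmult_1_l, Rmult_1_r by lra.
    pose proof (Cmod_sub_le (f q) (f p)). unfold m. lra. }
  specialize (H g _ Hg ltac:(unfold g; ring) (cdiff_at_affine f p a _ _ Ha)).
  replace (dot (Cmult (RtoC (/ m)) (fst a), Cmult (RtoC (/ m)) (snd a)) v) with (Cmult (RtoC (/ m)) (dot a v)) in H by (unfold dot; simpl; ring).
  rewrite Cmod_mult, Cmod_RtoC, Rabs_pos_eq in H by (left; now apply Rinv_0_lt_compat).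
  apply Rmult_le_reg_l with (/ m); [now apply Rinv_0_lt_compat|]. replace (/ m * (cm U p v * m)) with (cm U p v) by (field; lra). exact H.
Qed.

Lemma cm_upper (U : C2 -> Prop) (p v : C2) (r : R) : open2 U -> 0 < r -> (forall x, polydisc p r x -> U x) -> cm U p v <= 2 / r * size2 v.
Proof.
  intros HU Hr Hp. assert (U p) by (apply Hp, polydisc_refl; lra).
  apply (caratheodory_finite U p v HU H). intros f a Hf _ Ha. destruct (holo_gradient U f p a r Hr Hf Hp Ha). now apply Cmod_dot_le.
Qed.

Lemma dot_sub (a b v : C2) : dot (diff2 a b) v = Cminus (dot a v) (dot b v).
Proof. unfold dot, diff2; simpl. ring. Qed.

(** A competitor at [q] is reused at [q']: its gradient changes little, and since it vanishes at [q]
    its value at [q'] is small, so recentering by [cm_lower] costs little. The resulting continuity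
    in the base point makes the metric integrable along segments. *)
Lemma cm_lipschitz (U : C2 -> Prop) (p v : C2) (r : R) : open2 U -> 0 < r -> (forall x, polydisc p (3 * r) x -> U x) ->
  exists L, 0 <= L /\ forall q q', polydisc p r q -> polydisc p r q' -> cm U q v <= cm U q' v + L * size2 (diff2 q q').
Proof.
  intros HU Hr Hp. pose proof (size2_pos v) as Hv.
  set (L := 8 / (r * r) * size2 v + 2 / r * size2 v * (4 / r)).
  assert (0 < 8 / (r * r)) by (apply Rdiv_lt_0_compat; nra). assert (0 < 2 / r) by (apply Rdiv_lt_0_compat; lra).
  assert (0 < 4 / r) by (apply Rdiv_lt_0_compat; lra).
  exists L. split; [unfold L; apply Rplus_le_le_0_compat; [nra|apply Rmult_le_pos; nra]|]. intros q q' Hq Hq'.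
  assert (Uq : U q) by (apply Hp; eapply polydisc_mono; [|exact Hq]; lra).
  assert (Uq' : U q') by (apply Hp; eapply polydisc_mono; [|exact Hq']; lra).
  apply (caratheodory_finite U q v HU Uq). intros f a Hf Hfq Ha. destruct (Hf q' Uq') as (_ & a' & Ha').
  destruct (holo_gradient_lipschitz U f p q q' a a' r Hr Hf Hp Hq Hq' Ha Ha') as (D1 & D2).
  set (s := size2 (diff2 q q')) in *. pose proof (size2_pos (diff2 q q')) as Hs. fold s in Hs.
  assert (B1 : Cmod (Cminus (dot a v) (dot a' v)) <= 8 / (r * r) * s * size2 v) by (rewrite <- dot_sub; apply Cmod_dot_le; auto).
  pose proof (cm_lower U f q' v a' HU Uq' Hf Ha') as B2.
  assert (B3 : Cmod (f q') <= 4 / r * s).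
  { rewrite <- Cmod_opp. replace (Copp (f q')) with (Cminus (f q) (f q')) by (rewrite Hfq; ring).
    apply (holo_lipschitz U f p q' q r r); auto. intros x Hx. apply Hp. eapply polydisc_mono; [|exact Hx]. lra. }
  assert (B4 : cm U q' v <= 2 / r * size2 v).
  { apply cm_upper; auto. intros x Hx. apply Hp. apply (polydisc_mono p x (r + r)); [lra|]. eapply polydisc_tri; [|eassumption]; eassumption. }
  pose proof (cm_pos U q' v HU Uq').
  pose proof (Cmod_rev_tri (dot a v) (dot a' v)).
  assert (cm U q' v * Cmod (f q') <= 2 / r * size2 v * (4 / r * s)) by (apply Rmult_le_compat; auto using Cmod_ge_0).
  unfold L. nra.
Qed.

Definition rscal (c : R) (v : C2) : C2 := (Cmult (RtoC c) (fst v), Cmult (RtoC c) (snd v)).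

(** One inequality, applied both to [c] and to [/ c]. *)
Lemma cm_scal (U : C2 -> Prop) (p v : C2) (c : R) : open2 U -> U p -> c <> 0 -> cm U p (rscal c v) = Rabs c * cm U p v.
Proof.
  intros HU Hp Hc.
  assert (K : forall c v, c <> 0 -> cm U p (rscal c v) <= Rabs c * cm U p v).
  { clear c v Hc. intros c v Hc. apply (caratheodory_finite U p (rscal c v) HU Hp). intros f a Hf Hfp Ha.
    replace (dot a (rscal c v)) with (Cmult (RtoC c) (dot a v)) by (unfold dot, rscal; simpl; ring).
    rewrite Cmod_mult, Cmod_RtoC. apply Rmult_le_compat_l; [apply Rabs_pos|].
    apply (proj1 (proj2 (caratheodory_finite U p v HU Hp)) f); auto. }
  apply Rle_antisym; auto.
  pose proof (K (/ c) (rscal c v) ltac:(now apply Rinv_neq_0_compat)) as K1.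
  replace (rscal (/ c) (rscal c v)) with v in K1.
  2:{ unfold rscal; simpl. destruct v as [v1 v2]; simpl. f_equal; rewrite Cmult_assoc, <- RtoC_mult, Rinv_l by auto; ring. }
  rewrite Rabs_inv in K1. pose proof (Rabs_pos_lt c Hc).
  apply Rmult_le_reg_l with (/ Rabs c); [now apply Rinv_0_lt_compat|].
  replace (/ Rabs c * (Rabs c * cm U p v)) with (cm U p v) by (field; lra). exact K1.
Qed.

(** * Lengths of piecewise smooth curves *)

Definition arc (U : C2 -> Prop) (g : R -> C2) (a b : R) (l : R) : Prop :=
  C1_on g a b /\ (forall s, a <= s <= b -> U (g s)) /\ is_RInt (fun s => cm U (g s) (vel g s)) a b l.

(** The parameter interval is left free: lengths are invariant under affine reparametrisation, so
    pieces can be concatenated and reversed without keeping track of a subdivision of [[0, 1]]. *)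
Definition piece (U : C2 -> Prop) (p q : C2) (l : R) : Prop :=
  exists g a b, a < b /\ g a = p /\ g b = q /\ arc U g a b l.

Definition coord (c : C2 -> R) : Prop :=
  c = (fun q => fst (fst q)) \/ c = (fun q => snd (fst q)) \/ c = (fun q => fst (snd q)) \/ c = (fun q => snd (snd q)).

Lemma Derive_affine (f : R -> R) (al be s : R) : (forall s, ex_derive f s) ->
  is_derive (fun u => f (al * u + be)) s (al * Derive f (al * s + be)).
Proof.
  intros Hf. apply (is_derive_comp f (fun u => al * u + be) s).
  - apply Derive_correct, Hf.
  - auto_derive; auto; ring.
Qed.

Lemma C1_on_affine (g : R -> C2) (a b c d al be : R) : C1_on g a b -> (forall s, c <= s <= d -> a <= al * s + be <= b) ->
  C1_on (fun s => g (al * s + be)) c d.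
Proof.
  intros Hg Hab comp Hc. destruct (Hg comp Hc) as (H1 & H2). split.
  - intros s. eexists. apply (Derive_affine (fun u => comp (g u))). exact H1.
  - intros s Hs. apply continuous_ext with (fun s => al * Derive (fun u => comp (g u)) (al * s + be)).
    + intros x. symmetry. apply is_derive_unique. apply (Derive_affine (fun u => comp (g u)) al be x H1).
    + apply (@continuous_scal_r R_UniformSpace R_AbsRing R_NormedModule al (fun s => Derive (fun u => comp (g u)) (al * s + be))).
      apply (continuous_comp (fun s => al * s + be) (Derive (fun u => comp (g u)))); [|apply H2; auto].
      apply (ex_derive_continuous (fun s => al * s + be)). auto_derive; auto.
Qed.

Lemma vel_affine (g : R -> C2) (a b al be s : R) : C1_on g a b ->
  vel (fun s => g (al * s + be)) s = rscal al (vel g (al * s + be)).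
Proof.
  intros Hg.
  assert (E : forall comp, coord comp -> Derive (fun u => comp (g (al * u + be))) s = al * Derive (fun u => comp (g u)) (al * s + be)).
  { intros comp Hc. apply is_derive_unique. destruct (Hg comp Hc) as (H1 & _). apply (Derive_affine (fun u => comp (g u)) al be s H1). }
  unfold vel, rscal. simpl.
  rewrite (E (fun q => fst (fst q))), (E (fun q => snd (fst q))), (E (fun q => fst (snd q))), (E (fun q => snd (snd q))) by (unfold coord; auto).
  f_equal; apply C_ext; simpl; ring.
Qed.

(** The metric is homogeneous in the velocity, so the slope [al] factors out and becomes the
    Jacobian of the substitution. *)
Lemma piece_reparam (U : C2 -> Prop) (p q : C2) (l : R) : open2 U -> piece U p q l -> forall c d, c < d ->
  exists g, g c = p /\ g d = q /\ arc U g c d l.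
Proof.
  intros HU (g & a & b & Hab & Ha & Hb & Hg & HUg & HI) c d Hcd.
  set (al := (b - a) / (d - c)). set (be := a - al * c).
  assert (Hal : 0 < al) by (apply Rdiv_lt_0_compat; lra).
  assert (Ec : al * c + be = a) by (unfold be; ring). assert (Ed : al * d + be = b) by (unfold be, al; field; lra).
  assert (Hin : forall s, c <= s <= d -> a <= al * s + be <= b) by (intros s Hs; rewrite <- Ec, <- Ed; nra).
  exists (fun s => g (al * s + be)). rewrite Ec, Ed. split; [auto|split; [auto|split; [|split]]].
  - eapply C1_on_affine; eauto.
  - intros s Hs. auto.
  - apply is_RInt_ext with (fun s => scal al (cm U (g (al * s + be)) (vel g (al * s + be)))).
    + rewrite Rmin_left, Rmax_right by lra. intros s Hs. rewrite (vel_affine g a b) by auto.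
      rewrite cm_scal; auto; [|apply HUg, Hin; lra|lra]. rewrite Rabs_pos_eq by lra. reflexivity.
    + apply (is_RInt_comp_lin (fun s => cm U (g s) (vel g s)) al be c d l). now rewrite Ec, Ed.
Qed.

Lemma piece_rev (U : C2 -> Prop) (p q : C2) (l : R) : open2 U -> piece U p q l -> piece U q p l.
Proof.
  intros HU (g & a & b & Hab & Ha & Hb & Hg & HUg & HI).
  assert (Hin : forall s, a <= s <= b -> a <= (-1) * s + (a + b) <= b) by (intros; lra).
  exists (fun s => g ((-1) * s + (a + b))), a, b. split; auto.
  replace (-1 * a + (a + b)) with b by ring. replace (-1 * b + (a + b)) with a by ring.
  split; [auto|split; [auto|split; [|split]]].
  - eapply C1_on_affine; eauto.
  - intros s Hs. auto.
  - replace l with (opp (opp l)) by apply opp_opp.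
    apply is_RInt_ext with (fun s => opp (scal (-1) (cm U (g ((-1) * s + (a + b))) (vel g ((-1) * s + (a + b)))))).
    + rewrite Rmin_left, Rmax_right by lra. intros s Hs. rewrite (vel_affine g a b) by auto.
      rewrite cm_scal; auto; [|apply HUg, Hin; lra|lra]. replace (Rabs (-1)) with 1 by (unfold Rabs; destruct (Rcase_abs (-1)); lra).
      unfold opp, scal; simpl; unfold mult; simpl. ring.
    + apply (is_RInt_opp (V := R_NormedModule)). apply (is_RInt_comp_lin (fun s => cm U (g s) (vel g s)) (-1) (a + b) a b).
      replace (-1 * a + (a + b)) with b by ring. replace (-1 * b + (a + b)) with a by ring. now apply (is_RInt_swap (V := R_NormedModule)).
Qed.

(** An inductive substitute for [carath_length], equivalent to it on open sets by [length_chain] and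
    [chain_length]. Symmetry, the triangle inequality and estimates of functions along curves become
    inductions. *)
Inductive chain (U : C2 -> Prop) : C2 -> C2 -> R -> Prop :=
| chain_one p q l : piece U p q l -> chain U p q l
| chain_cons p q r l L : piece U p q l -> chain U q r L -> chain U p r (l + L).

Lemma chain_app (U : C2 -> Prop) (p q r : C2) (L M : R) : chain U p q L -> chain U q r M -> chain U p r (L + M).
Proof.
  intros H. revert r M. induction H as [p q l Hl|p q s l L Hl HL IH]; intros r M HM.
  - eapply chain_cons; eauto.
  - rewrite Rplus_assoc. eapply chain_cons; eauto.
Qed.

Lemma chain_rev (U : C2 -> Prop) (p q : C2) (L : R) : open2 U -> chain U p q L -> chain U q p L.
Proof.
  intros HU H. induction H as [p q l Hl|p q s l L Hl HL IH].
  - apply chain_one, piece_rev; auto.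
  - rewrite Rplus_comm. eapply chain_app; eauto. apply chain_one, piece_rev; auto.
Qed.

Lemma piece_pos (U : C2 -> Prop) (p q : C2) (l : R) : open2 U -> piece U p q l -> 0 <= l.
Proof.
  intros HU (g & a & b & Hab & Ha & Hb & Hg & HUg & HI).
  apply (is_RInt_ge_0 (fun s => cm U (g s) (vel g s)) a b l); auto; [lra|]. intros. apply cm_pos; auto. apply HUg. lra.
Qed.

Lemma chain_pos (U : C2 -> Prop) (p q : C2) (l : R) : open2 U -> chain U p q l -> 0 <= l.
Proof.
  intros HU H. induction H as [p q l Hl|p q s l L Hl HL IH]; [eapply piece_pos; eauto|].
  pose proof (piece_pos U p q l HU Hl). lra.
Qed.

Lemma length_chain (U : C2 -> Prop) (p q : C2) (L : R) : carath_length U p q L -> chain U p q L.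
Proof.
  intros (ga & n & t & g & l & Hn & t0 & tn & Ht & g0 & g1 & HUg & Hp & ->).
  assert (T0 : forall i, (i <= n)%nat -> 0 <= t i).
  { induction i as [|i IH]; intros Hi; [lra|]. pose proof (Ht i ltac:(lia)). specialize (IH ltac:(lia)). lra. }
  (* A descending induction from [t n = 1], written with [j = n - i]. *)
  assert (T1 : forall j, (j <= n)%nat -> t (n - j)%nat <= 1).
  { induction j as [|j IH]; intros Hj; [rewrite Nat.sub_0_r; lra|]. specialize (IH ltac:(lia)).
    pose proof (Ht (n - S j)%nat ltac:(lia)). replace (S (n - S j)) with (n - j)%nat in H by lia. lra. }
  assert (T1' : forall i, (i <= n)%nat -> t i <= 1).
  { intros i Hi. replace i with (n - (n - i))%nat by lia. apply T1. lia. }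
  assert (Hpc : forall m, (m < n)%nat -> piece U (ga (t m)) (ga (t (S m))) (l m)).
  { intros m Hm. destruct (Hp m Hm) as (Q1 & Q2 & _ & Q4). pose proof (Ht m Hm). pose proof (T0 m ltac:(lia)). pose proof (T1' (S m) ltac:(lia)).
    exists (g m), (t m), (t (S m)). split; auto. split; [apply Q2; lra|split; [apply Q2; lra|split; [|split]]]; auto.
    intros s Hs. rewrite Q2 by auto. apply HUg. lra. }
  assert (K : forall m, (m < n)%nat -> chain U (ga (t O)) (ga (t (S m))) (sum_f_R0 l m)).
  { induction m as [|m IH]; intros Hm; simpl.
    - apply chain_one. auto.
    - eapply chain_app; [apply IH; lia|]. apply chain_one. auto. }
  specialize (K (n - 1)%nat ltac:(lia)). replace (S (n - 1)) with n in K by lia. rewrite t0, tn, g0, g1 in K. exact K.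
Qed.

Lemma chain_list (U : C2 -> Prop) (p q : C2) (L : R) : chain U p q L -> exists n (pt : nat -> C2) (l : nat -> R),
  (0 < n)%nat /\ pt O = p /\ pt n = q /\ (forall i, (i < n)%nat -> piece U (pt i) (pt (S i)) (l i)) /\ L = sum_f_R0 l (n - 1).
Proof.
  intros H. induction H as [p q l Hl|p q r l L Hl HL (n & pt & ll & Hn & E0 & En & Hpc & ->)].
  - exists 1%nat, (fun i => match i with O => p | _ => q end), (fun _ => l). repeat split; auto.
    intros i Hi. replace i with O by lia. exact Hl.
  - exists (S n), (fun i => match i with O => p | S j => pt j end), (fun i => match i with O => l | S j => ll j end).
    split; [lia|split; [auto|split; [auto|split]]].
    + intros [|i] Hi; [rewrite E0; exact Hl|apply Hpc; lia].
    + replace (S n - 1)%nat with n by lia. rewrite (decomp_sum (fun i => match i with O => l | S j => ll j end) n Hn). f_equal. rewrite <- Nat.sub_1_r. reflexivity.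
Qed.

(** The pieces are spread over the intervals [[i / n, (i + 1) / n]], and one curve [ga] is glued
    from them by choice. A relation defines it rather than a case distinction, so only agreement on
    overlaps has to be checked. *)
Lemma chain_length (U : C2 -> Prop) (p q : C2) (L : R) : open2 U -> chain U p q L -> carath_length U p q L.
Proof.
  intros HU H. destruct (chain_list U p q L H) as (n & pt & l & Hn & E0 & En & Hpc & ->).
  set (t := fun i => INR i / INR n).
  assert (Hin : 0 < INR n) by (now apply lt_0_INR).
  assert (Ht : forall i, t i < t (S i)).
  { intros i. unfold t. rewrite S_INR. apply Rmult_lt_compat_r; [now apply Rinv_0_lt_compat|lra]. }
  destruct (functional_choice (fun i g => (i < n)%nat -> g (t i) = pt i /\ g (t (S i)) = pt (S i) /\ arc U g (t i) (t (S i)) (l i))) as (g & Hg).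
  { intros i. destruct (Compare_dec.lt_dec i n) as [Hi|Hi].
    - destruct (piece_reparam U _ _ _ HU (Hpc i Hi) (t i) (t (S i)) (Ht i)) as (g & Hg). exists g. auto.
    - exists (fun _ => p). lia. }
  assert (Hts : forall i s, t i <= s <= t (S i) -> INR i <= INR n * s <= INR i + 1).
  { intros i s [H1 H2]. unfold t in *. rewrite S_INR in H2.
    apply (Rmult_le_compat_l (INR n)) in H1; [|lra]. apply (Rmult_le_compat_l (INR n)) in H2; [|lra].
    replace (INR n * (INR i / INR n)) with (INR i) in H1 by (field; lra). replace (INR n * ((INR i + 1) / INR n)) with (INR i + 1) in H2 by (field; lra). lra. }
  (* Two different intervals can share a point only if they are neighbours; the point is then the
     common endpoint, where both pieces take the value [pt (S i)]. *)
  assert (Hadj : forall i j s, (i < n)%nat -> (j < n)%nat -> (i < j)%nat -> t i <= s <= t (S i) -> t j <= s <= t (S j) -> g i s = g j s).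
  { intros i j s Hi Hj Hij Hsi Hsj. pose proof (Hts i s Hsi). pose proof (Hts j s Hsj).
    assert (INR (S i) <= INR j) by (apply le_INR; lia). rewrite S_INR in H2.
    assert (E : INR j = INR (S i)) by (rewrite S_INR; lra). apply INR_eq in E. subst j.
    destruct (Hg i Hi) as (_ & G1 & _). destruct (Hg (S i) Hj) as (G2 & _ & _).
    assert (s = t (S i)) by lra. subst s. congruence. }
  destruct (functional_choice (fun s z => forall i, (i < n)%nat -> t i <= s <= t (S i) -> z = g i s)) as (ga & Hga).
  { intros s. destruct (classic (exists i, (i < n)%nat /\ t i <= s <= t (S i))) as [(i & Hi & Hs)|HN].
    - exists (g i s). intros j Hj Hsj. destruct (Nat.lt_trichotomy i j) as [Hij|[->|Hij]]; auto.
      symmetry. apply Hadj; auto.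
    - exists p. intros i Hi Hs. exfalso. apply HN. eauto. }
  assert (t0 : t O = 0) by (unfold t; simpl; unfold Rdiv; ring).
  assert (tn : t n = 1) by (unfold t; field; lra).
  assert (Hcover : forall m, (m <= n)%nat -> forall s, 0 <= s <= t m -> s = 0 \/ exists i, (i < m)%nat /\ t i <= s <= t (S i)).
  { induction m as [|m IH]; intros Hm s Hs; [left; lra|]. destruct (Rle_dec s (t m)) as [Hle|Hle].
    - destruct (IH ltac:(lia) s ltac:(lra)) as [?|(i & Hi & Hsi)]; auto. right. exists i. split; auto.
    - right. exists m. split; [lia|lra]. }
  exists ga, n, t, g, l. repeat split; auto.
  - rewrite (Hga 0 O) by (auto; pose proof (Ht O); lra). rewrite <- t0. rewrite <- E0. now apply Hg.
  - destruct (Hg (n - 1)%nat ltac:(lia)) as (_ & G & _). replace (S (n - 1)) with n in G by lia. rewrite tn in G. rewrite <- En, <- G.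
    apply Hga; [lia|]. pose proof (Ht (n - 1)%nat). replace (S (n - 1)) with n in * by lia. lra.
  - intros s Hs. assert (Hi : exists i, (i < n)%nat /\ t i <= s <= t (S i)).
    { destruct (Hcover n (le_n n) s ltac:(lra)) as [->|Hi]; auto. exists O. split; auto. pose proof (Ht O). lra. }
    destruct Hi as (i & Hi & Hsi). rewrite (Hga s i Hi Hsi). now apply (Hg i Hi).
  - now apply (Hg i H0).
  - now apply (Hg i H0).
  - intros s Hs. symmetry. now apply Hga.
  - intros s Hs. apply caratheodory_finite; auto. now apply (Hg i H0).
  - now apply (Hg i H0).
Qed.

Lemma derive_eps (u : R -> R) (s l : R) : is_derive u s l -> forall eps, 0 < eps -> exists d, 0 < d /\ forall h, Rabs h < d ->
  Rabs (u (s + h) - u s - h * l) <= eps * Rabs h.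
Proof.
  intros H eps He. apply is_derive_Reals in H. destruct (H eps He) as (d & Hd). exists d. split; [apply cond_pos|].
  intros h Hh. destruct (Req_dec h 0) as [->|Hn].
  - rewrite Rplus_0_r, Rabs_R0. replace (u s - u s - 0 * l) with 0 by ring. rewrite Rabs_R0. lra.
  - specialize (Hd h Hn Hh). replace (u (s + h) - u s - h * l) with (((u (s + h) - u s) / h - l) * h) by (field; auto).
    rewrite Rabs_mult. apply Rmult_le_compat_r; [apply Rabs_pos|lra].
Qed.

Lemma derive_eps_C (u : R -> C) (s : R) (l : C) : is_derive (fun t => fst (u t)) s (fst l) -> is_derive (fun t => snd (u t)) s (snd l) ->
  forall eps, 0 < eps -> exists d, 0 < d /\ forall h, Rabs h < d ->
  Cmod (Cminus (u (s + h)) (Cplus (u s) (Cmult (RtoC h) l))) <= eps * Rabs h.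
Proof.
  intros H1 H2 eps He. destruct (derive_eps _ _ _ H1 (eps / 2)) as (d1 & Hd1 & K1); [lra|].
  destruct (derive_eps _ _ _ H2 (eps / 2)) as (d2 & Hd2 & K2); [lra|].
  exists (Rmin d1 d2). split; [apply Rmin_pos; auto|]. intros h Hh.
  specialize (K1 h (Rlt_le_trans _ _ _ Hh (Rmin_l _ _))). specialize (K2 h (Rlt_le_trans _ _ _ Hh (Rmin_r _ _))).
  eapply Rle_trans; [apply Cmod_le_abs|]. simpl.
  replace (fst (u (s + h)) + - (fst (u s) + (h * fst l - 0 * snd l))) with (fst (u (s + h)) - fst (u s) - h * fst l) by ring.
  replace (snd (u (s + h)) + - (snd (u s) + (h * snd l + 0 * fst l))) with (snd (u (s + h)) - snd (u s) - h * snd l) by ring. lra.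
Qed.

Lemma ccont_pair (u : R -> C) (t : R) : continuous (fun t => fst (u t)) t -> continuous (fun t => snd (u t)) t -> ccont u t.
Proof.
  assert (K : forall f : R -> R, continuous f t -> forall eps, 0 < eps -> exists d, 0 < d /\ forall s, Rabs (s - t) < d -> Rabs (f s - f t) < eps).
  { intros f Hf eps He. apply continuity_pt_filterlim in Hf. destruct (Hf eps He) as (d & Hd & K). exists d. split; auto.
    intros s Hs. destruct (Req_dec s t) as [->|Hn]; [rewrite Rminus_diag, Rabs_R0; lra|].
    apply K. split; [split; [exact I|auto]|exact Hs]. }
  intros H1 H2 eps He. destruct (K _ H1 (eps / 2)) as (d1 & Hd1 & K1); [lra|]. destruct (K _ H2 (eps / 2)) as (d2 & Hd2 & K2); [lra|].
  exists (Rmin d1 d2). split; [apply Rmin_pos; auto|]. intros s Hs.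
  specialize (K1 s (Rlt_le_trans _ _ _ Hs (Rmin_l _ _))). specialize (K2 s (Rlt_le_trans _ _ _ Hs (Rmin_r _ _))).
  eapply Rle_lt_trans; [apply Cmod_le_abs|]. simpl. unfold Rminus in *. lra.
Qed.

Lemma C1_on_facts (g : R -> C2) (a b s : R) : C1_on g a b -> a <= s <= b ->
  ccont (fun s => fst (g s)) s /\ ccont (fun s => snd (g s)) s /\ ccont (fun s => fst (vel g s)) s /\ ccont (fun s => snd (vel g s)) s /\
  (forall eps, 0 < eps -> exists d, 0 < d /\ forall h, Rabs h < d ->
     Cmod (Cminus (fst (g (s + h))) (Cplus (fst (g s)) (Cmult (RtoC h) (fst (vel g s))))) <= eps * Rabs h /\
     Cmod (Cminus (snd (g (s + h))) (Cplus (snd (g s)) (Cmult (RtoC h) (snd (vel g s))))) <= eps * Rabs h).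
Proof.
  intros Hg Hs.
  destruct (Hg _ (or_introl eq_refl)) as (D1 & V1).
  destruct (Hg _ (or_intror (or_introl eq_refl))) as (D2 & V2).
  destruct (Hg _ (or_intror (or_intror (or_introl eq_refl)))) as (D3 & V3).
  destruct (Hg _ (or_intror (or_intror (or_intror eq_refl)))) as (D4 & V4).
  assert (C0 : forall f : R -> R, (forall s, ex_derive f s) -> continuous f s) by (intros f Hf; apply (ex_derive_continuous f), Hf).
  split; [|split; [|split; [|split]]].
  - apply ccont_pair; apply C0; auto.
  - apply ccont_pair; apply C0; auto.
  - apply ccont_pair; [apply V1; auto|apply V2; auto].
  - apply ccont_pair; [apply V3; auto|apply V4; auto].
  - intros eps He.
    destruct (derive_eps_C (fun t => fst (g t)) s (fst (vel g s))) with (eps := eps) as (d1 & Hd1 & K1); auto; try (apply Derive_correct; auto).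
    destruct (derive_eps_C (fun t => snd (g t)) s (snd (vel g s))) with (eps := eps) as (d2 & Hd2 & K2); auto; try (apply Derive_correct; auto).
    exists (Rmin d1 d2). split; [apply Rmin_pos; auto|]. intros h Hh. split.
    + apply K1. exact (Rlt_le_trans _ _ _ Hh (Rmin_l _ _)).
    + apply K2. exact (Rlt_le_trans _ _ _ Hh (Rmin_r _ _)).
Qed.

Lemma holo_curve_derive (f : C2 -> C) (g : R -> C2) (a b s : R) (A : C2) : C1_on g a b -> a <= s <= b -> cdiff_at f (g s) A ->
  is_derive (fun t => fst (f (g t))) s (fst (dot A (vel g s))) /\ is_derive (fun t => snd (f (g t))) s (snd (dot A (vel g s))).
Proof.
  intros Hg Hs HA. destruct (C1_on_facts g a b s Hg Hs) as (_ & _ & _ & _ & HD).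
  apply (curve_derive (fun t => f (g t))). intros eps He.
  set (V := vel g s) in *. set (m := size2 V + 2). pose proof (size2_pos V) as HV. unfold size2 in HV.
  set (k := Cmod (fst A) + Cmod (snd A) + 1). pose proof (Cmod_ge_0 (fst A)). pose proof (Cmod_ge_0 (snd A)).
  assert (Hm : 0 < m) by (unfold m, size2; lra). assert (Hk : 0 < k) by (unfold k; lra).
  destruct (HA (eps / (2 * m))) as (d & Hd & K); [apply Rdiv_lt_0_compat; lra|].
  destruct (HD (Rmin 1 (eps / (2 * k)))) as (d' & Hd' & K'); [apply Rmin_pos; [lra|apply Rdiv_lt_0_compat; lra]|].
  exists (Rmin d' (d / m)). split; [apply Rmin_pos; auto; apply Rdiv_lt_0_compat; auto|]. intros h Hh.
  specialize (K' h (Rlt_le_trans _ _ _ Hh (Rmin_l _ _))). pose proof (Rlt_le_trans _ _ _ Hh (Rmin_r _ _)) as Hh2.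
  apply Rlt_div_r in Hh2; auto. destruct K' as (K1 & K2). pose proof (Rabs_pos h).
  set (h1 := Cminus (fst (g (s + h))) (fst (g s))). set (h2 := Cminus (snd (g (s + h))) (snd (g s))).
  set (e1 := Cminus (fst (g (s + h))) (Cplus (fst (g s)) (Cmult (RtoC h) (fst V)))) in *.
  set (e2 := Cminus (snd (g (s + h))) (Cplus (snd (g s)) (Cmult (RtoC h) (snd V)))) in *.
  assert (E1 : h1 = Cplus (Cmult (RtoC h) (fst V)) e1) by (unfold h1, e1; ring).
  assert (E2 : h2 = Cplus (Cmult (RtoC h) (snd V)) e2) by (unfold h2, e2; ring).
  assert (L1 : Rmin 1 (eps / (2 * k)) <= 1) by apply Rmin_l. assert (L2 : Rmin 1 (eps / (2 * k)) <= eps / (2 * k)) by apply Rmin_r.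
  assert (B1 : Cmod e1 <= Rabs h) by (eapply Rle_trans; [exact K1|]; nra). assert (B2 : Cmod e2 <= Rabs h) by (eapply Rle_trans; [exact K2|]; nra).
  assert (B1' : Cmod e1 <= eps / (2 * k) * Rabs h) by (eapply Rle_trans; [exact K1|]; apply Rmult_le_compat_r; auto).
  assert (B2' : Cmod e2 <= eps / (2 * k) * Rabs h) by (eapply Rle_trans; [exact K2|]; apply Rmult_le_compat_r; auto).
  assert (Hh12 : Cmod h1 + Cmod h2 <= m * Rabs h).
  { rewrite E1, E2. pose proof (Cmod_triangle (Cmult (RtoC h) (fst V)) e1). pose proof (Cmod_triangle (Cmult (RtoC h) (snd V)) e2).
    rewrite !Cmod_mult, Cmod_RtoC in *. unfold m, size2. lra. }
  pose proof (Cmod_ge_0 h1). pose proof (Cmod_ge_0 h2).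
  specialize (K h1 h2 ltac:(lra) ltac:(lra)).
  replace (Cplus (fst (g s)) h1, Cplus (snd (g s)) h2) with (g (s + h)) in K.
  2:{ unfold h1, h2. rewrite (surjective_pairing (g (s + h))) at 1. f_equal; ring. }
  replace (Cminus (f (g (s + h))) (Cplus (f (g s)) (Cmult (RtoC h) (dot A V)))) with
    (Cplus (Cminus (f (g (s + h))) (Cplus (f (g s)) (Cplus (Cmult (fst A) h1) (Cmult (snd A) h2)))) (Cplus (Cmult (fst A) e1) (Cmult (snd A) e2))).
  2:{ rewrite E1, E2. unfold dot. ring. }
  eapply Rle_trans; [apply Cmod_triangle|].
  pose proof (Cmod_triangle (Cmult (fst A) e1) (Cmult (snd A) e2)). rewrite !Cmod_mult in H4.
  assert (eps / (2 * m) * (Cmod h1 + Cmod h2) <= eps / (2 * m) * (m * Rabs h)) by (apply Rmult_le_compat_l; auto; left; apply Rdiv_lt_0_compat; lra).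
  replace (eps / (2 * m) * (m * Rabs h)) with (eps / 2 * Rabs h) in H5 by (field; lra).
  assert (Cmod (fst A) * Cmod e1 <= Cmod (fst A) * (eps / (2 * k) * Rabs h)) by (apply Rmult_le_compat_l; auto).
  assert (Cmod (snd A) * Cmod e2 <= Cmod (snd A) * (eps / (2 * k) * Rabs h)) by (apply Rmult_le_compat_l; auto).
  assert (0 <= eps / (2 * k) * Rabs h) by (apply Rmult_le_pos; auto; left; apply Rdiv_lt_0_compat; lra).
  assert (k * (eps / (2 * k) * Rabs h) = eps / 2 * Rabs h) by (field; lra).
  unfold k in H9 at 1. lra.
Qed.

(** The derivative of [f] along the curve is at most twice the metric by [cm_lower], since
    [|f| < 1]. Integrating real and imaginary parts separately doubles this, whence the constant
    [4]. *)
Lemma piece_fun (U : C2 -> Prop) (f : C2 -> C) (p q : C2) (l : R) : open2 U -> holo_to_disc U f -> piece U p q l ->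
  Cmod (Cminus (f q) (f p)) <= 4 * l.
Proof.
  intros HU Hf (g & a & b & Hab & <- & <- & Hg & HUg & HI).
  destruct (functional_choice (fun x A => U x -> cdiff_at f x A)) as (A & HA).
  { intros x. destruct (classic (U x)) as [Hx|Hx].
    - destruct (Hf x Hx) as (_ & A & HA). exists A; auto.
    - exists (RtoC 0, RtoC 0). contradiction. }
  set (D := fun s => dot (A (g s)) (vel g s)).
  assert (HD : forall s, a <= s <= b -> is_derive (fun t => fst (f (g t))) s (fst (D s)) /\ is_derive (fun t => snd (f (g t))) s (snd (D s))).
  { intros s Hs. apply (holo_curve_derive f g a b s (A (g s)) Hg Hs). apply HA; auto. }
  (* The fundamental theorem of calculus needs a continuous derivative. The gradient was picked
     pointwise by choice, but any such selection is Lipschitz by [holo_gradient_lipschitz]. *)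
  assert (HDc : forall s, a <= s <= b -> ccont D s).
  { intros s Hs. destruct (C1_on_facts g a b s Hg Hs) as (G1 & G2 & V1 & V2 & _).
    destruct (HU (g s) (HUg s Hs)) as (r3 & Hr3 & Hp). set (r := r3 / 3).
    assert (Hr : 0 < r) by (unfold r; lra). assert (Hp' : forall x, polydisc (g s) (3 * r) x -> U x) by (intros x Hx; apply Hp; replace r3 with (3 * r) by (unfold r; field); auto).
    assert (HAc : forall eps, 0 < eps -> exists d, 0 < d /\ forall s', Rabs (s' - s) < d ->
      Cmod (Cminus (fst (A (g s'))) (fst (A (g s)))) < eps /\ Cmod (Cminus (snd (A (g s'))) (snd (A (g s)))) < eps).
    { intros eps He. set (K := 8 / (r * r)). assert (HK : 0 < K) by (apply Rdiv_lt_0_compat; nra).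
      set (e := Rmin r (eps / (4 * K))). assert (He' : 0 < e) by (apply Rmin_pos; auto; apply Rdiv_lt_0_compat; lra).
      destruct (G1 e He') as (d1 & Hd1 & K1). destruct (G2 e He') as (d2 & Hd2 & K2).
      exists (Rmin d1 d2). split; [apply Rmin_pos; auto|]. intros s' Hs'.
      specialize (K1 s' (Rlt_le_trans _ _ _ Hs' (Rmin_l _ _))). specialize (K2 s' (Rlt_le_trans _ _ _ Hs' (Rmin_r _ _))).
      assert (e <= r) by apply Rmin_l. assert (e <= eps / (4 * K)) by apply Rmin_r.
      assert (Hq : polydisc (g s) r (g s')) by (split; lra).
      destruct (holo_gradient_lipschitz U f (g s) (g s') (g s) (A (g s')) (A (g s)) r Hr Hf Hp' Hq (polydisc_refl _ _ (Rlt_le _ _ Hr))) as (B1 & B2).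
      - apply HA, Hp'. eapply polydisc_mono; [|exact Hq]. lra.
      - apply HA, HUg, Hs.
      - fold K in B1, B2. assert (size2 (diff2 (g s') (g s)) < 2 * e) by (unfold size2, diff2; simpl; lra).
        assert (K * size2 (diff2 (g s') (g s)) < K * (2 * e)) by (apply Rmult_lt_compat_l; auto).
        assert (K * (2 * e) <= K * (2 * (eps / (4 * K)))) by (apply Rmult_le_compat_l; lra).
        replace (K * (2 * (eps / (4 * K)))) with (eps / 2) in H3 by (field; lra). lra. }
    unfold D, dot. apply ccont_plus; apply ccont_mult; auto.
    - intros eps He. destruct (HAc eps He) as (d & Hd & K). exists d. split; auto. intros; now apply K.
    - intros eps He. destruct (HAc eps He) as (d & Hd & K). exists d. split; auto. intros; now apply K. }
  assert (HDb : forall s, a <= s <= b -> Cmod (D s) <= 2 * cm U (g s) (vel g s)).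
  { intros s Hs. pose proof (cm_lower U f (g s) (vel g s) (A (g s)) HU (HUg s Hs) Hf (HA _ (HUg s Hs))).
    destruct (Hf (g s) (HUg s Hs)) as (B & _). pose proof (cm_pos U (g s) (vel g s) HU (HUg s Hs)). unfold D. nra. }
  assert (HI2 : is_RInt (fun s => 2 * cm U (g s) (vel g s)) a b (2 * l)) by (apply (is_RInt_scal (V := R_NormedModule)); auto).
  assert (F1 : Rabs (fst (f (g b)) - fst (f (g a))) <= 2 * l).
  { apply (norm_RInt_le (fun s => fst (D s)) (fun s => 2 * cm U (g s) (vel g s)) a b (minus (fst (f (g b))) (fst (f (g a)))) (2 * l)); auto; [lra| |].
    - intros s Hs. eapply Rle_trans; [apply abs_fst_le|auto].
    - apply (is_RInt_derive (fun t => fst (f (g t)))); rewrite Rmin_left, Rmax_right by lra; intros s Hs; [apply HD; auto|].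
      now apply (ccont_re_im D s (HDc s Hs)). }
  assert (F2 : Rabs (snd (f (g b)) - snd (f (g a))) <= 2 * l).
  { apply (norm_RInt_le (fun s => snd (D s)) (fun s => 2 * cm U (g s) (vel g s)) a b (minus (snd (f (g b))) (snd (f (g a)))) (2 * l)); auto; [lra| |].
    - intros s Hs. eapply Rle_trans; [apply abs_snd_le|auto].
    - apply (is_RInt_derive (fun t => snd (f (g t)))); rewrite Rmin_left, Rmax_right by lra; intros s Hs; [apply HD; auto|].
      now apply (ccont_re_im D s (HDc s Hs)). }
  eapply Rle_trans; [apply Cmod_le_abs|]. simpl. unfold Rminus in *. lra.
Qed.

Lemma chain_fun (U : C2 -> Prop) (f : C2 -> C) (p q : C2) (L : R) : open2 U -> holo_to_disc U f -> chain U p q L ->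
  Cmod (Cminus (f q) (f p)) <= 4 * L.
Proof.
  intros HU Hf H. induction H as [p q l Hl|p q s l L Hl HL IH]; [now apply (piece_fun U)|].
  pose proof (piece_fun U f p q l HU Hf Hl). pose proof (Cmod_tri3 (f s) (f q) (f p)). lra.
Qed.

Definition seg (p q : C2) (s : R) : C2 :=
  (Cplus (fst p) (Cmult (RtoC s) (Cminus (fst q) (fst p))), Cplus (snd p) (Cmult (RtoC s) (Cminus (snd q) (snd p)))).

Lemma seg_0 (p q : C2) : seg p q 0 = p.
Proof. destruct p, q; unfold seg; simpl. f_equal; ring. Qed.

Lemma seg_1 (p q : C2) : seg p q 1 = q.
Proof. destruct p, q; unfold seg; simpl. f_equal; ring. Qed.

(** The only curves ever constructed are segments, pieces and hence chains of them. Their velocity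
    is constant, so integrability needs only the continuity of the metric in the base point. *)
Lemma seg_piece (U : C2 -> Prop) (p q : C2) : open2 U -> (forall s, 0 <= s <= 1 -> U (seg p q s)) ->
  exists l, piece U p q l /\ forall M, (forall s, 0 <= s <= 1 -> cm U (seg p q s) (diff2 q p) <= M) -> l <= M.
Proof.
  intros HU Hs. set (v := diff2 q p).
  assert (Hd : forall comp, coord comp -> forall s, is_derive (fun u => comp (seg p q u)) s (comp v)).
  { intros comp [->|[->|[->| ->]]] s; unfold seg, v, diff2; simpl; auto_derive; auto; ring. }
  assert (Hv : forall s, vel (seg p q) s = v).
  { intros s. unfold vel. pose proof (Hd _ (or_introl eq_refl) s) as D1. pose proof (Hd _ (or_intror (or_introl eq_refl)) s) as D2.
    pose proof (Hd _ (or_intror (or_intror (or_introl eq_refl))) s) as D3. pose proof (Hd _ (or_intror (or_intror (or_intror eq_refl))) s) as D4.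
    transitivity ((fst (fst v), snd (fst v)), (fst (snd v), snd (snd v))); [|now rewrite <- !surjective_pairing].
    f_equal; f_equal; apply is_derive_unique; assumption. }
  assert (Hc : forall s, 0 <= s <= 1 -> continuous (fun s => cm U (seg p q s) v) s).
  { intros s Hs1. apply continuity_pt_filterlim.
    destruct (HU _ (Hs s Hs1)) as (r3 & Hr3 & Hp). set (r := r3 / 3). assert (Hr : 0 < r) by (unfold r; lra).
    destruct (cm_lipschitz U (seg p q s) v r HU Hr) as (L & HL & K).
    { intros x Hx. apply Hp. replace r3 with (3 * r) by (unfold r; field). auto. }
    pose proof (size2_pos v) as Hv0. pose proof (Cmod_ge_0 (fst v)). pose proof (Cmod_ge_0 (snd v)). set (m := size2 v + 1).
    assert (Hsd : forall s s', Cminus (fst (seg p q s')) (fst (seg p q s)) = Cmult (RtoC (s' - s)) (fst v) /\ Cminus (snd (seg p q s')) (snd (seg p q s)) = Cmult (RtoC (s' - s)) (snd v)).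
    { intros. unfold seg, v, diff2; simpl fst; simpl snd. rewrite RtoC_minus. split; ring. }
    assert (Hsz : forall s s', size2 (diff2 (seg p q s') (seg p q s)) = Rabs (s' - s) * size2 v).
    { intros x y.
      change (size2 (diff2 (seg p q y) (seg p q x))) with (Cmod (Cminus (fst (seg p q y)) (fst (seg p q x))) + Cmod (Cminus (snd (seg p q y)) (snd (seg p q x)))).
      destruct (Hsd x y) as (E1 & E2). rewrite E1, E2, !Cmod_mult, Cmod_RtoC. unfold size2. ring. }
    intros eps He. exists (Rmin (r / m) (eps / (L * m + 1))).
    assert (Hm : 1 <= m) by (unfold m; lra). assert (0 <= L * m) by nra.
    split; [apply Rmin_pos; apply Rdiv_lt_0_compat; lra|]. intros s' (_ & Hs'). simpl in Hs'. unfold Rdist in *.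
    pose proof (Rlt_le_trans _ _ _ Hs' (Rmin_l _ _)) as B1. pose proof (Rlt_le_trans _ _ _ Hs' (Rmin_r _ _)) as B2.
    apply Rlt_div_r in B1; [|lra]. apply Rlt_div_r in B2; [|lra]. pose proof (Rabs_pos (s' - s)).
    assert (Hq : polydisc (seg p q s) r (seg p q s')).
    { destruct (Hsd s s') as (E1 & E2). unfold size2 in m. split; rewrite ?E1, ?E2, Cmod_mult, Cmod_RtoC; unfold m in B1; nra. }
    pose proof (polydisc_refl (seg p q s) r (Rlt_le _ _ Hr)) as Hq0.
    pose proof (K _ _ Hq Hq0) as K1. pose proof (K _ _ Hq0 Hq) as K2. rewrite Hsz in K1, K2. rewrite (Rabs_minus_sym s s') in K2.
    assert (L * (Rabs (s' - s) * size2 v) < eps).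
    { apply Rle_lt_trans with (L * (Rabs (s' - s) * m)); [apply Rmult_le_compat_l; auto; apply Rmult_le_compat_l; unfold m; lra|]. nra. }
    simpl. unfold Rdist. apply Rabs_def1; lra. }
  assert (HI : ex_RInt (fun s => cm U (seg p q s) v) 0 1).
  { apply (@ex_RInt_continuous R_CompleteNormedModule). rewrite Rmin_left, Rmax_right by lra. exact Hc. }
  exists (RInt (fun s => cm U (seg p q s) v) 0 1). split.
  - exists (seg p q), 0, 1. split; [lra|]. split; [apply seg_0|]. split; [apply seg_1|]. split; [|split; auto].
    + intros comp Hcomp. split; [intros s; eexists; apply Hd; exact Hcomp|].
      intros s _. apply continuous_ext with (fun _ => comp v); [|apply continuous_const].
      intros x. symmetry. apply is_derive_unique. apply Hd. exact Hcomp.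
    + apply is_RInt_ext with (fun s => cm U (seg p q s) v); [intros; now rewrite Hv|]. apply (@RInt_correct R_CompleteNormedModule); auto.
  - intros M HM. replace M with (RInt (fun _ => M) 0 1) by (rewrite RInt_const; unfold scal; simpl; unfold mult; simpl; ring).
    apply RInt_le; auto; [lra|apply ex_RInt_const|]. intros s Hs1. apply HM. lra.
Qed.

(** * The distance as an infimum over chains *)

Definition cdist (U : C2 -> Prop) (p q : C2) : R := real (carath_dist U p q).

Definition chained (U : C2 -> Prop) : Prop := forall p q, U p -> U q -> exists L, chain U p q L.

Lemma cdist_facts (U : C2 -> Prop) (p q : C2) : open2 U -> chained U -> U p -> U q ->
  is_finite (carath_dist U p q) /\ 0 <= cdist U p q /\ (forall L, chain U p q L -> cdist U p q <= L) /\
  (forall eps, 0 < eps -> exists L, chain U p q L /\ L < cdist U p q + eps).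
Proof.
  intros HU Hc Hp Hq. destruct (Hc p q Hp Hq) as (L0 & HL0).
  unfold cdist, carath_dist. destruct (Glb_Rbar_correct (carath_length U p q)) as (Hlb & Hglb).
  assert (H0 : Rbar_le 0 (Glb_Rbar (carath_length U p q))).
  { apply Hglb. intros x Hx. simpl. apply length_chain in Hx. eapply chain_pos; eauto. }
  pose proof (Hlb L0 (chain_length U p q L0 HU HL0)) as H1.
  destruct (Glb_Rbar (carath_length U p q)) as [d| |]; simpl in *; try contradiction.
  split; [reflexivity|]. split; [exact H0|]. split.
  - intros L HL. apply (Hlb L). now apply chain_length.
  - intros eps He. apply NNPP. intros HN.
    assert (Rbar_le (Finite (d + eps)) (Finite d)).
    { apply Hglb. intros x Hx. simpl. apply Rnot_lt_le. intros Hlt. apply HN. exists x. split; auto. now apply length_chain. }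
    simpl in H. lra.
Qed.

Lemma carath_dist_sym (U : C2 -> Prop) (p q : C2) : open2 U -> carath_dist U p q = carath_dist U q p.
Proof.
  intros HU. apply Glb_Rbar_eqset. intros x.
  split; intros H; apply chain_length; auto; apply chain_rev; auto; now apply length_chain.
Qed.

Lemma cdist_triangle (U : C2 -> Prop) (p q r : C2) : open2 U -> chained U -> U p -> U q -> U r ->
  cdist U p r <= cdist U p q + cdist U q r.
Proof.
  intros HU Hc Hp Hq Hr. apply Rnot_lt_le. intros Hlt.
  set (eps := (cdist U p r - (cdist U p q + cdist U q r)) / 2).
  destruct (cdist_facts U p q HU Hc Hp Hq) as (_ & _ & _ & K1). destruct (cdist_facts U q r HU Hc Hq Hr) as (_ & _ & _ & K2).
  destruct (cdist_facts U p r HU Hc Hp Hr) as (_ & _ & K3 & _).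
  assert (He : 0 < eps) by (unfold eps; lra).
  destruct (K1 eps He) as (L1 & C1 & B1). destruct (K2 eps He) as (L2 & C2' & B2).
  pose proof (K3 _ (chain_app U p q r L1 L2 C1 C2')). unfold eps in *. lra.
Qed.

Lemma cdist_fun (U : C2 -> Prop) (f : C2 -> C) (p q : C2) : open2 U -> chained U -> U p -> U q -> holo_to_disc U f ->
  Cmod (Cminus (f q) (f p)) <= 4 * cdist U p q.
Proof.
  intros HU Hc Hp Hq Hf. apply Rnot_lt_le. intros Hlt.
  destruct (cdist_facts U p q HU Hc Hp Hq) as (_ & _ & _ & K).
  destruct (K ((Cmod (Cminus (f q) (f p)) - 4 * cdist U p q) / 4)) as (L & HL & B); [lra|].
  pose proof (chain_fun U f p q L HU Hf HL). lra.
Qed.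

(** The distance is locally dominated by the Euclidean one: on half of an admissible polydisc the
    metric is at most [2 / r] times the Euclidean size, and the segment from [x] is a competitor. *)
Lemma cdist_local (U : C2 -> Prop) (x : C2) : open2 U -> chained U -> U x -> exists r B, 0 < r /\ 0 < B /\
  forall q, polydisc x r q -> U q /\ cdist U x q <= B * size2 (diff2 q x).
Proof.
  intros HU Hc Hx. destruct (HU x Hx) as (r2 & Hr2 & Hp). set (r := r2 / 2).
  exists r, (2 / r). assert (Hr : 0 < r) by (unfold r; lra). split; auto. split; [apply Rdiv_lt_0_compat; lra|].
  intros q Hq.
  assert (Hp' : forall y, polydisc x (r + r) y -> U y) by (intros y Hy; apply Hp; replace r2 with (r + r) by (unfold r; field); auto).
  assert (HUq : U q) by (apply Hp'; eapply polydisc_mono; [|exact Hq]; lra). split; auto.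
  assert (Hs : forall s, 0 <= s <= 1 -> polydisc x r (seg x q s)).
  { intros s Hs. destruct Hq as (Q1 & Q2). assert (Z : forall u : C, Cmod (Cminus u u) <= r) by (intros; replace (Cminus u u) with (RtoC 0) by ring; rewrite Cmod_0; lra).
    split; apply segment_close; auto. }
  destruct (seg_piece U x q HU) as (l & Hl & Hb).
  { intros s Hs1. apply Hp'. eapply polydisc_mono; [|apply Hs, Hs1]. lra. }
  eapply Rle_trans; [apply (cdist_facts U x q HU Hc Hx HUq); apply chain_one, Hl|].
  apply Hb. intros s Hs1. apply cm_upper; auto. intros y Hy. apply Hp'. eapply polydisc_tri; [apply Hs, Hs1|exact Hy].
Qed.

Lemma cdist_refl (U : C2 -> Prop) (x : C2) : open2 U -> chained U -> U x -> carath_dist U x x = Finite 0.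
Proof.
  intros HU Hc Hx. destruct (cdist_facts U x x HU Hc Hx Hx) as (Hf & H0 & _ & _).
  destruct (cdist_local U x HU Hc Hx) as (r & B & Hr & HB & K). destruct (K x) as (_ & K1); [apply polydisc_refl; lra|].
  unfold size2, diff2 in K1. simpl in K1.
  replace (Cminus (fst x) (fst x)) with (RtoC 0) in K1 by ring. replace (Cminus (snd x) (snd x)) with (RtoC 0) in K1 by ring.
  rewrite Cmod_0 in K1. rewrite <- Hf. f_equal. unfold cdist in *. lra.
Qed.

(** A single [s] would determine [om] only modulo the period [2 PI i / s]. Having the whole interval
    [[0, tau]] prevents [s Im om] from reaching another period, because it would have to cross
    values at which the sine is not small. *)
Lemma cexp_near_one (om : C) (tau th : R) : 0 < tau -> th <= 1 / 4 ->
  (forall s, 0 <= s <= tau -> Cmod (Cminus (cexp (Cmult (RtoC s) om)) (RtoC 1)) <= th) -> Cmod om <= 5 * th / tau.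
Proof.
  intros Ht Hth H. destruct om as [x y].
  assert (E : forall s, cexp (Cmult (RtoC s) (x, y)) = (exp (s * x) * cos (s * y), exp (s * x) * sin (s * y))).
  { intros s. unfold cexp. simpl. replace (s * x - 0 * y) with (s * x) by ring. replace (s * y + 0 * x) with (s * y) by ring. reflexivity. }
  assert (Hsin : forall v, Rabs v <= 1 / 2 -> 3 / 4 * Rabs v <= Rabs (sin v)).
  { intros v Hv. pose proof (sin_rem v). pose proof (Rabs_pos v).
    assert (v * v <= 1 / 4). { rewrite <- (Rabs_pos_eq (v * v)) by nra. rewrite Rabs_mult. nra. }
    assert (Rabs v - Rabs (sin v) <= Rabs (sin v - v)). { pose proof (Rabs_triang_inv v (sin v)). rewrite (Rabs_minus_sym (sin v) v). lra. }
    nra. }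
  assert (Hmod : forall s, 0 <= s <= tau -> Rabs (exp (s * x) - 1) <= th /\ Rabs (exp (s * x) * sin (s * y)) <= th).
  { intros s Hs. specialize (H s Hs). rewrite E in H. split.
    - eapply Rle_trans; [|exact H]. rewrite <- E.
      pose proof (Cmod_rev_tri (cexp (Cmult (RtoC s) (x, y))) (RtoC 1)) as A1. pose proof (Cmod_rev_tri (RtoC 1) (cexp (Cmult (RtoC s) (x, y)))) as A2.
      rewrite (Cmod_minus_sym (RtoC 1)) in A2. rewrite Cmod_1, Cmod_cexp in A1, A2.
      replace (fst (Cmult (RtoC s) (x, y))) with (s * x) in A1, A2 by (simpl; ring). apply Rabs_le. lra.
    - eapply Rle_trans; [|exact H]. eapply Rle_trans; [|apply abs_snd_le]. right. f_equal. simpl. ring. }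
  assert (Hsmall : forall s, 0 <= s <= tau -> Rabs (sin (s * y)) <= 4 / 3 * th).
  { intros s Hs. destruct (Hmod s Hs) as (M1 & M2). apply Rabs_le_between in M1.
    rewrite Rabs_mult, (Rabs_pos_eq (exp (s * x))) in M2 by (left; apply exp_pos). pose proof (Rabs_pos (sin (s * y))). nra. }
  assert (Hth0 : 0 <= th) by (eapply Rle_trans; [apply Cmod_ge_0|apply (H 0); lra]).
  (* Otherwise some [s <= tau] has [|s y| = 1/2]. There the sine would be at least [3/8] by [Hsin],
     but it is at most [(4/3) (1/4) = 1/3]. *)
  assert (Hy : tau * Rabs y < 1 / 2).
  { apply Rnot_le_lt. intros Hle. assert (0 < Rabs y) by (pose proof (Rabs_pos y); nra).
    set (s := 1 / (2 * Rabs y)).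
    assert (Hsy : s * Rabs y = 1 / 2) by (unfold s; field; lra).
    assert (Hs : 0 <= s <= tau). { assert (0 < s) by (unfold s; apply Rdiv_lt_0_compat; lra). nra. }
    assert (Ha : Rabs (s * y) = 1 / 2) by (rewrite Rabs_mult, (Rabs_pos_eq s) by lra; auto).
    pose proof (Hsin (s * y) ltac:(lra)). pose proof (Hsmall s Hs). lra. }
  assert (Hty : Rabs (tau * y) = tau * Rabs y) by (rewrite Rabs_mult, (Rabs_pos_eq tau); lra).
  pose proof (Hsin (tau * y) ltac:(lra)) as S1. pose proof (Hsmall tau ltac:(lra)) as S2.
  destruct (Hmod tau ltac:(lra)) as (M1 & _). apply Rabs_le_between in M1.
  assert (Hx : Rabs (tau * x) <= 2 * th).
  { pose proof (exp_ineq1_le (tau * x)). pose proof (exp_ineq1_le (- (tau * x))).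
    assert (exp (tau * x) * exp (- (tau * x)) = 1) by (rewrite <- exp_plus, Rplus_opp_r; apply exp_0).
    pose proof (exp_pos (- (tau * x))).
    apply Rabs_le. split; [|lra]. assert ((1 - th) * exp (- (tau * x)) <= 1) by nra. nra. }
  rewrite Rabs_mult, (Rabs_pos_eq tau) in Hx by lra.
  apply Rle_div_r; auto. pose proof (Cmod_le_abs (x, y)). simpl in H0. nra.
Qed.

(** * The domain [Omega] *)

Definition defect (P : C -> C) (q : C2) : R := - (fst (snd q) + fst (P (fst q))).

Lemma Omega_defect (P : C -> C) (q : C2) : Omega P q <-> 0 < defect P q.
Proof. unfold Omega, defect, Re. split; intros; lra. Qed.

Lemma defect_cont (P : C -> C) (x : C2) (eps : R) : sm (fun z => RtoC (fst (P z))) -> 0 < eps ->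
  exists r, 0 < r /\ forall q, polydisc x r q -> Rabs (defect P q - defect P x) < eps.
Proof.
  intros HP He. destruct (sm_cont _ (fst x) HP (eps / 2)) as (d & Hd & K); [lra|].
  exists (Rmin (d / 2) (eps / 4)). split; [apply Rmin_pos; lra|]. intros q (Q1 & Q2).
  pose proof (Rmin_l (d / 2) (eps / 4)). pose proof (Rmin_r (d / 2) (eps / 4)).
  specialize (K (fst q) ltac:(lra)). rewrite <- RtoC_minus, Cmod_RtoC in K.
  pose proof (abs_fst_le (Cminus (snd q) (snd x))). simpl in H1.
  unfold defect. replace (- (fst (snd q) + fst (P (fst q))) - - (fst (snd x) + fst (P (fst x)))) with
    (- (fst (snd q) + - fst (snd x)) + - (fst (P (fst q)) - fst (P (fst x)))) by ring.
  eapply Rle_lt_trans; [apply Rabs_triang|]. rewrite !Rabs_Ropp. lra.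
Qed.

Lemma Omega_open (P : C -> C) : sm (fun z => RtoC (fst (P z))) -> open2 (Omega P).
Proof.
  intros HP p Hp. apply Omega_defect in Hp. destruct (defect_cont P p (defect P p) HP Hp) as (r & Hr & K).
  exists r. split; auto. intros q Hq. apply Omega_defect. specialize (K q Hq). apply Rabs_def2 in K. lra.
Qed.

(** Lowering [Re z2] never leaves the domain. Both points are pushed down by the same large [T], so
    deep that the segment between the lowered points stays below the graph of [- P] over the
    relevant ball. *)
Lemma Omega_chained (P : C -> C) : sm (fun z => RtoC (fst (P z))) -> chained (Omega P).
Proof.
  intros HP p q Hp Hq. pose proof (Omega_open P HP) as HU.
  apply Omega_defect in Hp, Hq. unfold defect in Hp, Hq.
  destruct (sm_bound _ HP (Cmod (fst p) + Cmod (fst q))) as (B & HB & K).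
  set (T := Cmod (snd p) + Cmod (snd q) + B + 1).
  pose proof (Cmod_ge_0 (snd p)). pose proof (Cmod_ge_0 (snd q)). pose proof (Cmod_ge_0 (fst p)). pose proof (Cmod_ge_0 (fst q)).
  pose proof (fst_le_Cmod (snd p)). pose proof (fst_le_Cmod (snd q)).
  assert (HT : 0 < T) by (unfold T; lra).
  set (p' := (fst p, Cminus (snd p) (RtoC T)) : C2). set (q' := (fst q, Cminus (snd q) (RtoC T)) : C2).
  assert (S1 : exists l, piece (Omega P) p p' l).
  { destruct (seg_piece (Omega P) p p' HU) as (l & Hl & _); [|eauto]. intros s Hs. apply Omega_defect.
    assert (E : seg p p' s = (fst p, Cminus (snd p) (RtoC (s * T)))).
    { unfold seg, p'; simpl fst; simpl snd. rewrite RtoC_mult. apply injective_projections; simpl fst; simpl snd; apply C_ext; simpl; ring. }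
    rewrite E. unfold defect; simpl. assert (0 <= s * T) by nra. lra. }
  assert (S2 : exists l, piece (Omega P) p' q' l).
  { destruct (seg_piece (Omega P) p' q' HU) as (l & Hl & _); [|eauto]. intros s Hs. apply Omega_defect. unfold defect, seg, p', q'.
    assert (Hz : Cmod (Cplus (fst p) (Cmult (RtoC s) (Cminus (fst q) (fst p)))) <= Cmod (fst p) + Cmod (fst q)).
    { replace (Cplus (fst p) (Cmult (RtoC s) (Cminus (fst q) (fst p)))) with (Cplus (Cmult (RtoC (1 - s)) (fst p)) (Cmult (RtoC s) (fst q))) by (rewrite RtoC_minus; ring).
      eapply Rle_trans; [apply Cmod_triangle|]. rewrite !Cmod_mult, !Cmod_RtoC, !Rabs_pos_eq by lra. nra. }
    specialize (K _ Hz). rewrite Cmod_RtoC in K. apply Rabs_le_between in K.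
    change (fst (fst p, Cminus (snd p) (RtoC T))) with (fst p). change (fst (fst q, Cminus (snd q) (RtoC T))) with (fst q).
    set (zz := Cplus (fst p) (Cmult (RtoC s) (Cminus (fst q) (fst p)))) in *.
    change (fst (zz, Cplus (snd (fst p, Cminus (snd p) (RtoC T))) (Cmult (RtoC s) (Cminus (snd (fst q, Cminus (snd q) (RtoC T))) (snd (fst p, Cminus (snd p) (RtoC T))))))) with zz.
    simpl. replace (fst (snd p) + - T + (s * (fst (snd q) + - T + - (fst (snd p) + - T)) - 0 * (snd (snd q) + - 0 + - (snd (snd p) + - 0)))) with
      ((1 - s) * fst (snd p) + s * fst (snd q) - T) by ring.
    assert ((1 - s) * fst (snd p) <= (1 - s) * Cmod (snd p)) by (apply Rmult_le_compat_l; lra).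
    assert (s * fst (snd q) <= s * Cmod (snd q)) by (apply Rmult_le_compat_l; lra).
    unfold T. nra. }
  assert (S3 : exists l, piece (Omega P) q q' l).
  { destruct (seg_piece (Omega P) q q' HU) as (l & Hl & _); [|eauto]. intros s Hs. apply Omega_defect.
    assert (E : seg q q' s = (fst q, Cminus (snd q) (RtoC (s * T)))).
    { unfold seg, q'; simpl fst; simpl snd. rewrite RtoC_mult. apply injective_projections; simpl fst; simpl snd; apply C_ext; simpl; ring. }
    rewrite E. unfold defect; simpl. assert (0 <= s * T) by nra. lra. }
  destruct S1 as (l1 & S1), S2 as (l2 & S2), S3 as (l3 & S3).
  eexists. eapply chain_cons; [exact S1|]. eapply chain_cons; [exact S2|]. apply chain_one, piece_rev; eauto.
Qed.

Lemma cdiff_at_prod (G H : C -> C) (p : C2) (a b : C) : cdiff1 G (fst p) a -> cdiff1 H (snd p) b ->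
  cdiff_at (fun q => Cmult (G (fst q)) (H (snd q))) p (Cmult a (H (snd p)), Cmult (G (fst p)) b).
Proof.
  intros HG HH eps He. destruct p as [z w]; simpl in *.
  set (M := 1 + Cmod (G z) + Cmod (H w) + Cmod a).
  pose proof (Cmod_ge_0 (G z)). pose proof (Cmod_ge_0 (H w)). pose proof (Cmod_ge_0 a).
  assert (HM : 0 < M) by (unfold M; lra).
  set (e := Rmin 1 (eps / (4 * M))).
  assert (He0 : 0 < e) by (apply Rmin_pos; [lra|apply Rdiv_lt_0_compat; lra]). assert (He1 : e <= 1) by apply Rmin_l.
  assert (HeM : e * M <= eps / 4).
  { apply Rle_trans with (eps / (4 * M) * M); [apply Rmult_le_compat_r; [lra|apply Rmin_r]|]. right; field; lra. }
  destruct (HG e He0) as (d1 & Hd1 & K1). destruct (HH e He0) as (d2 & Hd2 & K2).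
  destruct (cdiff1_cont H w b HH e He0) as (d3 & Hd3 & K3).
  exists (Rmin d1 (Rmin d2 d3)); split; [repeat apply Rmin_pos; auto|]. intros h1 h2 Hh1 Hh2.
  specialize (K1 h1 (Rlt_le_trans _ _ _ Hh1 (Rmin_l _ _))).
  pose proof (Rlt_le_trans _ _ _ Hh2 (Rmin_r _ _)) as Hh2'.
  specialize (K2 h2 (Rlt_le_trans _ _ _ Hh2' (Rmin_l _ _))).
  specialize (K3 (Cplus w h2)). replace (Cminus (Cplus w h2) w) with h2 in K3 by ring.
  specialize (K3 (Rlt_le_trans _ _ _ Hh2' (Rmin_r _ _))).
  set (G' := G (Cplus z h1)) in *. set (H' := H (Cplus w h2)) in *.
  replace (Cminus (Cmult G' H') (Cplus (Cmult (G z) (H w)) (Cplus (Cmult (Cmult a (H w)) h1) (Cmult (Cmult (G z) b) h2))))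
   with (Cplus (Cmult (Cminus G' (Cplus (G z) (Cmult a h1))) H')
     (Cplus (Cmult (Cmult a h1) (Cminus H' (H w))) (Cmult (G z) (Cminus H' (Cplus (H w) (Cmult b h2)))))) by ring.
  assert (HB : Cmod H' <= M). { pose proof (Cmod_rev_tri H' (H w)). unfold M. lra. }
  eapply Rle_trans; [apply Cmod_triangle|].
  eapply Rle_trans; [apply Rplus_le_compat_l, Cmod_triangle|].
  rewrite !Cmod_mult. pose proof (Cmod_ge_0 h1). pose proof (Cmod_ge_0 h2).
  assert (Cmod (Cminus G' (Cplus (G z) (Cmult a h1))) * Cmod H' <= e * Cmod h1 * M) by (apply Rmult_le_compat; auto using Cmod_ge_0).
  assert (Cmod a * Cmod h1 * Cmod (Cminus H' (H w)) <= M * Cmod h1 * e).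
  { apply Rmult_le_compat; auto using Cmod_ge_0; [nra| |lra]. apply Rmult_le_compat_r; unfold M; lra. }
  assert (Cmod (G z) * Cmod (Cminus H' (Cplus (H w) (Cmult b h2))) <= M * (e * Cmod h2)).
  { apply Rmult_le_compat; auto using Cmod_ge_0. unfold M; lra. }
  assert (e * M * Cmod h1 <= eps / 4 * Cmod h1) by (apply Rmult_le_compat_r; auto).
  assert (e * M * Cmod h2 <= eps / 4 * Cmod h2) by (apply Rmult_le_compat_r; auto).
  nra.
Qed.

(** * Test functions on the domain and the estimates they give *)

Definition entire (F : C -> C) : Prop := forall z, exists p, cdiff1 F z p.

Definition tfun (F : C -> C) (t : R) (q : C2) : C := Cmult (F (fst q)) (cexp (Cmult (RtoC t) (snd q))).

Lemma tfun_mod (F : C -> C) (t : R) (q : C2) : Cmod (tfun F t q) = Cmod (F (fst q)) * exp (t * fst (snd q)).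
Proof. unfold tfun. rewrite Cmod_mult, Cmod_cexp. do 2 f_equal. simpl. ring. Qed.

Lemma tfun_holo (P : C -> C) (F : C -> C) (t : R) : entire F ->
  (forall q, Omega P q -> Cmod (tfun F t q) < 1) -> holo_to_disc (Omega P) (tfun F t).
Proof.
  intros HF Hb q Hq. split; auto. destruct (HF (fst q)) as (a & Ha).
  eexists. apply (cdiff_at_prod F (fun w => cexp (Cmult (RtoC t) w)) q a); auto.
  apply (cdiff1_comp (fun w => Cmult (RtoC t) w) cexp); [|apply cdiff1_cexp].
  apply cdiff1_ext with (fun w => Cplus (Cmult (RtoC t) w) (RtoC 0)); [intros; ring|apply cdiff1_affine].
Qed.

Lemma entire_scal (F : C -> C) (c : C) : entire F -> entire (fun z => Cmult c (F z)).
Proof. intros HF z. destruct (HF z) as (a & Ha). eexists. apply (cdiff1_mult (fun _ => c) F); [apply cdiff1_const|exact Ha]. Qed.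

Lemma entire_mulz (F : C -> C) (c : C) : entire F -> entire (fun z => Cmult (Cmult c z) (F z)).
Proof.
  intros HF z. destruct (HF z) as (a & Ha). eexists. apply (cdiff1_mult (fun z => Cmult c z) F); [|exact Ha].
  apply cdiff1_ext with (fun w => Cplus (Cmult c w) (RtoC 0)); [intros; ring|apply cdiff1_affine].
Qed.

(** Normalised so that the bound refers to [exp (t Q)] itself rather than to its value relative to
    [b]. The spare factor [1/2] makes the resulting test functions strictly smaller than [1] in
    modulus. *)
Lemma peak_norm (Q : C -> R) (k : nat) : (1 < k)%nat -> good_pot Q k -> exists c0, 0 < c0 <= 1 /\
  forall t b, 0 < t -> exists F, entire F /\ (forall z, Cmod (F z) <= / 2 * exp (t * Q z)) /\ c0 * exp (t * Q b) <= Cmod (F b).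
Proof.
  intros Hk HQ. destruct (peak_family Q k Hk HQ) as (M & HM & H).
  assert (HMi : 0 < / M <= 1) by (split; [apply Rinv_0_lt_compat; lra|rewrite <- Rinv_1; apply Rinv_le_contravar; lra]).
  exists (/ M / 4). split; [lra|]. intros t b Ht. destruct (H t b Ht) as (F & F1 & F2 & F3).
  set (c := / (2 * M) * exp (t * Q b)). pose proof (exp_pos (t * Q b)).
  assert (Hc : 0 < c) by (unfold c; apply Rmult_lt_0_compat; auto; apply Rinv_0_lt_compat; lra).
  exists (fun z => Cmult (RtoC c) (F z)). split; [now apply entire_scal|]. split.
  - intros z. rewrite Cmod_mult, Cmod_RtoC, Rabs_pos_eq by lra.
    apply Rle_trans with (c * (M * exp (t * (Q z - Q b)))); [apply Rmult_le_compat_l; auto; lra|].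
    right. replace (t * Q z) with (t * Q b + t * (Q z - Q b)) by ring. rewrite exp_plus. unfold c. field. lra.
  - rewrite Cmod_mult, Cmod_RtoC, Rabs_pos_eq by lra.
    apply Rle_trans with (c * (1 / 2)); [|apply Rmult_le_compat_l; lra]. right. unfold c. field. lra.
Qed.

Lemma exp_neg_lower (x c : R) : 0 < c -> c <= exp (- x) -> x <= / c.
Proof.
  intros Hc H. pose proof (exp_ineq1_le x). pose proof (exp_pos x).
  assert (exp x * exp (- x) = 1) by (rewrite <- exp_plus, Rplus_opp_r; apply exp_0).
  assert (exp x * c <= 1) by nra. apply Rmult_le_reg_r with c; auto. rewrite Rinv_l by lra. nra.
Qed.

(* With [t = 1 / defect v], the test function is bounded below at [v], while [|f u| <= exp (- defect u / defect v)];
   [cdist_hnorm] plays the same game with the peak at [u]. *)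
Lemma cdist_defect (P : C -> C) (k : nat) : (1 < k)%nat -> sm (fun z => RtoC (fst (P z))) -> good_pot (fun z => fst (P z)) k ->
  exists eta c, 0 < eta /\ 0 < c /\ forall u v, Omega P u -> Omega P v -> cdist (Omega P) u v <= eta -> c * defect P u <= defect P v.
Proof.
  intros Hk HP HQ. pose proof (Omega_open P HP) as HU. pose proof (Omega_chained P HP) as HC.
  destruct (peak_norm _ k Hk HQ) as (c0 & Hc0 & H). set (c1 := c0 * exp (- 1)). pose proof (exp_pos (- 1)).
  assert (Hc1 : 0 < c1) by (unfold c1; nra).
  exists (c1 / 8), (c1 / 2). split; [lra|split; [lra|]]. intros u v Hu Hv Hd.
  assert (Du := proj1 (Omega_defect P u) Hu). assert (Dv := proj1 (Omega_defect P v) Hv).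
  set (t := / defect P v). assert (Ht : 0 < t) by (now apply Rinv_0_lt_compat).
  destruct (H t (fst v) Ht) as (F & F1 & F2 & F3).
  assert (Hb : forall q, Cmod (tfun F t q) <= / 2 * exp (- (t * defect P q))).
  { intros q. rewrite tfun_mod. apply Rle_trans with (/ 2 * exp (t * fst (P (fst q))) * exp (t * fst (snd q))).
    - apply Rmult_le_compat_r; [left; apply exp_pos|auto].
    - right. rewrite Rmult_assoc, <- exp_plus. do 2 f_equal. unfold defect. ring. }
  assert (Hf : holo_to_disc (Omega P) (tfun F t)).
  { apply tfun_holo; auto. intros q Hq. apply Omega_defect in Hq. eapply Rle_lt_trans; [apply Hb|].
    assert (exp (- (t * defect P q)) <= 1) by (rewrite <- exp_0; apply exp_mono; nra). lra. }
  pose proof (cdist_fun _ _ u v HU HC Hu Hv Hf) as K.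
  assert (Hlow : c1 <= Cmod (tfun F t v)).
  { rewrite tfun_mod. apply Rle_trans with (c0 * exp (t * fst (P (fst v))) * exp (t * fst (snd v))).
    - right. rewrite Rmult_assoc, <- exp_plus. unfold c1. f_equal. f_equal.
      replace (t * fst (P (fst v)) + t * fst (snd v)) with (- (t * defect P v)) by (unfold defect; ring). unfold t. rewrite Rinv_l by lra. ring.
    - apply Rmult_le_compat_r; [left; apply exp_pos|auto]. }
  pose proof (Cmod_rev_tri (tfun F t v) (tfun F t u)). specialize (Hb u).
  pose proof (exp_pos (- (t * defect P u))).
  assert (E : t * defect P u <= / (c1 / 2)) by (apply exp_neg_lower; lra).
  apply (Rmult_le_compat_l (defect P v)) in E; [|lra].
  replace (defect P v * (t * defect P u)) with (defect P u) in E by (unfold t; field; lra).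
  apply (Rmult_le_compat_l (c1 / 2)) in E; [|lra].
  replace (c1 / 2 * (defect P v * / (c1 / 2))) with (defect P v) in E by (field; lra). exact E.
Qed.

(** Both terms scale with weight one under the dilations [(r z1, r^(2 k) z2)] that preserve the
    domain. It controls [z1] and [Re z2] but not [Im z2]. *)
Definition hnorm (P : C -> C) (k : nat) (q : C2) : R := defect P q + Cmod (fst q) ^ (2 * k).

Lemma cdist_hnorm (P : C -> C) (k : nat) (e : R) : (1 < k)%nat -> sm (fun z => RtoC (fst (P z))) -> 0 < e ->
  good_pot (fun z => fst (P z) - e * Cmod z ^ (2 * k)) k ->
  exists eta K, 0 < eta /\ 0 < K /\ forall u v, Omega P u -> Omega P v -> cdist (Omega P) u v <= eta -> hnorm P k v <= K * hnorm P k u.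
Proof.
  intros Hk HP He HQ. pose proof (Omega_open P HP) as HU. pose proof (Omega_chained P HP) as HC.
  destruct (peak_norm _ k Hk HQ) as (c0 & Hc0 & H). set (c1 := c0 * exp (- (1 + e))). pose proof (exp_pos (- (1 + e))).
  assert (Hc1 : 0 < c1) by (unfold c1; nra).
  (* The exponent [defect + e |z1|^(2 k)] of the test function lies between [e1 * hnorm] and
     [(1 + e) * hnorm]. *)
  set (e1 := Rmin 1 e). assert (He1 : 0 < e1) by (apply Rmin_pos; lra). assert (e1 <= 1) by apply Rmin_l. assert (e1 <= e) by apply Rmin_r.
  exists (c1 / 8), (/ (c1 / 2) / e1). split; [lra|]. split; [apply Rdiv_lt_0_compat; auto; apply Rinv_0_lt_compat; lra|]. intros u v Hu Hv Hd.
  assert (Du := proj1 (Omega_defect P u) Hu). assert (Dv := proj1 (Omega_defect P v) Hv).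
  assert (Hpow : forall q : C2, 0 <= Cmod (fst q) ^ (2 * k)) by (intros; apply pow_le, Cmod_ge_0).
  pose proof (Hpow u) as Pu. pose proof (Hpow v) as Pv.
  assert (Nu : 0 < hnorm P k u) by (unfold hnorm; lra).
  set (t := / hnorm P k u). assert (Ht : 0 < t) by (now apply Rinv_0_lt_compat).
  destruct (H t (fst u) Ht) as (F & F1 & F2 & F3). cbv beta in F2, F3.
  assert (Hb : forall q, Cmod (tfun F t q) <= / 2 * exp (- (t * (defect P q + e * Cmod (fst q) ^ (2 * k))))).
  { intros q. rewrite tfun_mod. apply Rle_trans with (/ 2 * exp (t * (fst (P (fst q)) - e * Cmod (fst q) ^ (2 * k))) * exp (t * fst (snd q))).
    - apply Rmult_le_compat_r; [left; apply exp_pos|auto].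
    - right. rewrite Rmult_assoc, <- exp_plus. do 2 f_equal. unfold defect. ring. }
  assert (Hf : holo_to_disc (Omega P) (tfun F t)).
  { apply tfun_holo; auto. intros q Hq. apply Omega_defect in Hq. eapply Rle_lt_trans; [apply Hb|].
    assert (exp (- (t * (defect P q + e * Cmod (fst q) ^ (2 * k)))) <= 1).
    { rewrite <- exp_0. apply exp_mono. pose proof (Hpow q).
      assert (0 <= t * (defect P q + e * Cmod (fst q) ^ (2 * k))) by (apply Rmult_le_pos; nra). lra. }
    lra. }
  pose proof (cdist_fun _ _ u v HU HC Hu Hv Hf) as K.
  assert (Hlow : c1 <= Cmod (tfun F t u)).
  { rewrite tfun_mod. apply Rle_trans with (c0 * exp (t * (fst (P (fst u)) - e * Cmod (fst u) ^ (2 * k))) * exp (t * fst (snd u))).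
    - rewrite Rmult_assoc, <- exp_plus. unfold c1. apply Rmult_le_compat_l; [lra|]. apply exp_mono.
      replace (t * (fst (P (fst u)) - e * Cmod (fst u) ^ (2 * k)) + t * fst (snd u)) with (- (t * (defect P u + e * Cmod (fst u) ^ (2 * k)))) by (unfold defect; ring).
      assert (t * (defect P u + e * Cmod (fst u) ^ (2 * k)) <= t * ((1 + e) * hnorm P k u)).
      { apply Rmult_le_compat_l; [lra|]. unfold hnorm. nra. }
      replace (t * ((1 + e) * hnorm P k u)) with (1 + e) in H3 by (unfold t; field; lra). lra.
    - apply Rmult_le_compat_r; [left; apply exp_pos|auto]. }
  pose proof (Cmod_rev_tri (tfun F t u) (tfun F t v)). rewrite Cmod_minus_sym in H3. specialize (Hb v).
  pose proof (exp_pos (- (t * (defect P v + e * Cmod (fst v) ^ (2 * k))))).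
  assert (E : t * (defect P v + e * Cmod (fst v) ^ (2 * k)) <= / (c1 / 2)) by (apply exp_neg_lower; lra).
  assert (E2 : t * (e1 * hnorm P k v) <= / (c1 / 2)).
  { eapply Rle_trans; [|exact E]. apply Rmult_le_compat_l; [lra|]. unfold hnorm. nra. }
  apply (Rmult_le_compat_l (hnorm P k u / e1)) in E2; [|left; apply Rdiv_lt_0_compat; auto].
  replace (hnorm P k u / e1 * (t * (e1 * hnorm P k v))) with (hnorm P k v) in E2 by (unfold t; field; lra).
  eapply Rle_trans; [exact E2|]. right. field. lra.
Qed.

Lemma Cmod_le_one_pow (z : C) (n : nat) : (0 < n)%nat -> Cmod z <= 1 + Cmod z ^ n.
Proof.
  intros Hn. pose proof (Cmod_ge_0 z). destruct (Rle_lt_dec (Cmod z) 1) as [Hl|Hl].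
  - pose proof (pow_le (Cmod z) n H). lra.
  - pose proof (Rle_pow (Cmod z) 1 n ltac:(lra) Hn). lra.
Qed.

Lemma tfun_shift (F : C -> C) (t tau : R) (q : C2) :
  tfun F (t + tau) q = Cmult (tfun F t q) (cexp (Cmult (RtoC tau) (snd q))).
Proof.
  unfold tfun. rewrite RtoC_plus.
  replace (Cmult (Cplus (RtoC t) (RtoC tau)) (snd q)) with (Cplus (Cmult (RtoC t) (snd q)) (Cmult (RtoC tau) (snd q))) by ring.
  rewrite cexp_plus. ring.
Qed.

(* A peak function [f] at the height of [v] recovers both coordinates: [z1 f] is bounded because [f] decays like
   [exp (- e |z1|^2k)], and so is [f exp (tau z2)] for small [tau]. *)
Lemma cdist_euclid (P : C -> C) (k : nat) (e p K0 : R) : (1 < k)%nat -> sm (fun z => RtoC (fst (P z))) -> 0 < e ->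
  good_pot (fun z => fst (P z) - e * Cmod z ^ (2 * k)) k -> 1 <= p -> (forall z, Rabs (fst (P z)) <= p * Cmod z ^ (2 * k)) ->
  exists eta M, 0 < eta /\ 0 < M /\ forall u v, Omega P u -> Omega P v -> hnorm P k u <= K0 -> hnorm P k v <= K0 ->
    cdist (Omega P) u v <= eta -> size2 (diff2 u v) <= M * cdist (Omega P) u v.
Proof.
  intros Hk HP He HQ Hp HPp. pose proof (Omega_open P HP) as HU. pose proof (Omega_chained P HP) as HC.
  destruct (peak_norm _ k Hk HQ) as (c0 & Hc0 & H).
  (* Lower bound for the test function at its peak [v]: there [defect] and [|z1|^(2 k)] are both at
     most [K0]. The constant [E] likewise bounds [exp (s Re z2)] at [u] from above and its inverse
     at [v]. *)
  set (c2 := c0 * exp (- ((1 + e) * K0))). assert (Hc2 : 0 < c2) by (apply Rmult_lt_0_compat; [lra|apply exp_pos]).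
  set (E := exp (e * K0)). assert (HE : 0 < E) by apply exp_pos.
  (* Normalises the product of [z1] with the test function: [|z1| <= 1 + X <= ik exp (e X)] for
     [X = |z1|^(2 k)], and the last exponential is absorbed by the decay of the test function. *)
  set (ik := 1 + / e). assert (Hik : 0 < ik) by (unfold ik; pose proof (Rinv_0_lt_compat e He); lra).
  set (M2 := 4 * (E + 1) / c2 * E).
  assert (HM2 : 0 < M2) by (unfold M2; apply Rmult_lt_0_compat; auto; apply Rdiv_lt_0_compat; lra).
  set (M1 := 4 * (1 + Rabs K0 + ik) / c2).
  assert (HM1 : 0 < M1) by (unfold M1; apply Rdiv_lt_0_compat; auto; pose proof (Rabs_pos K0); lra).
  (* [e / p] is the range of extra exponents [tau]: on the domain [Re z2 < - P z1 <= p |z1|^(2 k)],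
     so [exp (tau z2)] grows at most like [exp (e |z1|^(2 k))]. *)
  assert (Hep : 0 < e / p) by (apply Rdiv_lt_0_compat; lra).
  (* The first witness guarantees [M2 d <= 1/4], the threshold required by [cexp_near_one]. *)
  exists (1 / 4 / M2), (M1 + 5 * M2 / (e / p)). split; [apply Rdiv_lt_0_compat; lra|].
  split; [apply Rplus_lt_0_compat; auto; apply Rdiv_lt_0_compat; lra|].
  intros u v Hu Hv Nu Nv Hd. set (d := cdist (Omega P) u v) in *.
  destruct (H 1 (fst v) Rlt_0_1) as (F & F1 & F2 & F3). cbv beta in F2, F3.
  assert (Hpow : forall q : C2, 0 <= Cmod (fst q) ^ (2 * k)) by (intros; apply pow_le, Cmod_ge_0).
  assert (Hz : forall q : C2, Cmod (fst q) <= 1 + Cmod (fst q) ^ (2 * k)) by (intros; apply Cmod_le_one_pow; lia).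
  assert (Dq : forall q, Omega P q -> 0 < defect P q) by (intros q; apply Omega_defect).
  assert (Hb : forall q, Omega P q -> Cmod (tfun F 1 q) <= / 2 * exp (- (e * Cmod (fst q) ^ (2 * k)))).
  { intros q Hq. specialize (Dq q Hq). rewrite tfun_mod.
    apply Rle_trans with (/ 2 * exp (1 * (fst (P (fst q)) - e * Cmod (fst q) ^ (2 * k))) * exp (1 * fst (snd q))).
    - apply Rmult_le_compat_r; [left; apply exp_pos|auto].
    - rewrite Rmult_assoc, <- exp_plus. apply Rmult_le_compat_l; [lra|]. apply exp_mono. unfold defect in Dq. lra. }
  assert (Hre : forall q, Omega P q -> fst (snd q) <= p * Cmod (fst q) ^ (2 * k)).
  { intros q Hq. specialize (Dq q Hq). pose proof (HPp (fst q)) as B. apply Rabs_le_between in B. unfold defect in Dq. lra. }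
  assert (Htau : forall tau q, 0 <= tau <= e / p -> Omega P q -> tau * fst (snd q) <= e * Cmod (fst q) ^ (2 * k)).
  { intros tau q Ht Hq. apply Rle_trans with (tau * (p * Cmod (fst q) ^ (2 * k))); [apply Rmult_le_compat_l; auto; lra|].
    apply Rle_trans with (e / p * (p * Cmod (fst q) ^ (2 * k))).
    - apply Rmult_le_compat_r; [apply Rmult_le_pos; auto; lra|lra].
    - right. field. lra. }
  assert (Hsh : forall tau, 0 <= tau <= e / p -> holo_to_disc (Omega P) (tfun F (1 + tau))).
  { intros tau Ht. apply tfun_holo; auto. intros q Hq. rewrite tfun_shift, Cmod_mult, Cmod_cexp.
    replace (fst (Cmult (RtoC tau) (snd q))) with (tau * fst (snd q)) by (simpl; ring).
    apply Rle_lt_trans with (/ 2 * exp (- (e * Cmod (fst q) ^ (2 * k))) * exp (e * Cmod (fst q) ^ (2 * k))).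
    - apply Rmult_le_compat; auto using Cmod_ge_0; [left; apply exp_pos|]. apply exp_mono; auto.
    - rewrite Rmult_assoc, <- exp_plus, Rplus_opp_l, exp_0. lra. }
  assert (Hf : holo_to_disc (Omega P) (tfun F 1)).
  { replace 1 with (1 + 0) by ring. apply Hsh. lra. }
  pose proof (cdist_fun _ _ u v HU HC Hu Hv Hf) as Kf. fold d in Kf.
  assert (Hlow : c2 <= Cmod (tfun F 1 v)).
  { rewrite tfun_mod. apply Rle_trans with (c0 * exp (1 * (fst (P (fst v)) - e * Cmod (fst v) ^ (2 * k))) * exp (1 * fst (snd v))).
    - rewrite Rmult_assoc, <- exp_plus. unfold c2. apply Rmult_le_compat_l; [lra|]. apply exp_mono.
      pose proof (Dq v Hv). pose proof (Hpow v). unfold hnorm in Nv. unfold defect in Nv, H0. nra.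
    - apply Rmult_le_compat_r; [left; apply exp_pos|auto]. }
  assert (Xu : Cmod (fst u) ^ (2 * k) <= K0) by (pose proof (Dq u Hu); unfold hnorm in Nu; lra).
  assert (Xv : Cmod (fst v) ^ (2 * k) <= K0) by (pose proof (Dq v Hv); unfold hnorm in Nv; lra).
  assert (HK0 : 0 <= K0) by (pose proof (Hpow u); lra).
  assert (A1 : Cmod (Cminus (fst u) (fst v)) <= M1 * d).
  { set (G := fun z => Cmult (Cmult (RtoC (/ ik)) z) (F z)).
    assert (Gt : forall q, tfun G 1 q = Cmult (Cmult (RtoC (/ ik)) (fst q)) (tfun F 1 q)) by (intros; unfold tfun, G; ring).
    assert (Hiki : 0 < / ik) by (now apply Rinv_0_lt_compat).
    assert (HG : holo_to_disc (Omega P) (tfun G 1)).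
    { apply tfun_holo; [now apply entire_mulz|]. intros q Hq. rewrite Gt, !Cmod_mult, Cmod_RtoC, Rabs_pos_eq by lra.
      set (X := Cmod (fst q) ^ (2 * k)) in *. pose proof (Hpow q) as HX. fold X in HX.
      apply Rle_lt_trans with (/ ik * (1 + X) * (/ 2 * exp (- (e * X)))).
      - apply Rmult_le_compat; auto using Cmod_ge_0; [apply Rmult_le_pos; [lra|apply Cmod_ge_0]|].
        apply Rmult_le_compat_l; [lra|apply Hz].
      - assert (1 + X <= ik * exp (e * X)).
        { apply Rle_trans with (ik * (1 + e * X)); [|apply Rmult_le_compat_l; [lra|apply exp_ineq1_le]].
          unfold ik. replace ((1 + / e) * (1 + e * X)) with (1 + X + e * X + / e) by (field; lra).
          pose proof (Rinv_0_lt_compat e He). nra. }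
        assert (E1 : exp (e * X) * exp (- (e * X)) = 1) by (rewrite <- exp_plus, Rplus_opp_r; apply exp_0).
        apply Rle_lt_trans with (/ ik * (ik * exp (e * X)) * (/ 2 * exp (- (e * X)))).
        + apply Rmult_le_compat_r; [pose proof (exp_pos (- (e * X))); lra|]. apply Rmult_le_compat_l; lra.
        + replace (/ ik * (ik * exp (e * X)) * (/ 2 * exp (- (e * X)))) with (/ 2 * (exp (e * X) * exp (- (e * X)))) by (field; lra). rewrite E1. lra. }
    pose proof (cdist_fun _ _ u v HU HC Hu Hv HG) as KG. fold d in KG. rewrite !Gt in KG.
    replace (Cminus (Cmult (Cmult (RtoC (/ ik)) (fst v)) (tfun F 1 v)) (Cmult (Cmult (RtoC (/ ik)) (fst u)) (tfun F 1 u)))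
      with (Cmult (RtoC (/ ik)) (Cminus (Cmult (fst v) (tfun F 1 v)) (Cmult (fst u) (tfun F 1 u)))) in KG by ring.
    rewrite Cmod_mult, Cmod_RtoC, Rabs_pos_eq in KG by lra.
    assert (KG' : Cmod (Cminus (Cmult (fst v) (tfun F 1 v)) (Cmult (fst u) (tfun F 1 u))) <= 4 * d * ik).
    { apply Rmult_le_reg_l with (/ ik); auto. replace (/ ik * (4 * d * ik)) with (4 * d) by (field; lra). exact KG. }
    (* With [f = tfun F 1], the product [(u1 - v1) f v] is [u1 (f v - f u)] minus [v1 f v - u1 f u].
       Both differences are controlled by the distance, and [|f v| >= c2] can then be divided
       out. *)
    assert (Q : Cmod (Cminus (fst u) (fst v)) * Cmod (tfun F 1 v) <= 4 * (1 + Rabs K0 + ik) * d).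
    { rewrite <- Cmod_mult. replace (Cmult (Cminus (fst u) (fst v)) (tfun F 1 v)) with
       (Cminus (Cmult (fst u) (Cminus (tfun F 1 v) (tfun F 1 u))) (Cminus (Cmult (fst v) (tfun F 1 v)) (Cmult (fst u) (tfun F 1 u)))) by ring.
      eapply Rle_trans; [apply Cmod_sub_le|]. rewrite Cmod_mult.
      assert (Cmod (fst u) * Cmod (Cminus (tfun F 1 v) (tfun F 1 u)) <= (1 + Rabs K0) * (4 * d)).
      { apply Rmult_le_compat; auto using Cmod_ge_0. rewrite Rabs_pos_eq by auto. specialize (Hz u). lra. }
      nra. }
    unfold M1. apply Rmult_le_reg_r with c2; auto.
    replace (4 * (1 + Rabs K0 + ik) / c2 * d * c2) with (4 * (1 + Rabs K0 + ik) * d) by (field; lra).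
    eapply Rle_trans; [|exact Q]. apply Rmult_le_compat_l; auto using Cmod_ge_0. }
  assert (A2 : Cmod (Cminus (snd u) (snd v)) <= 5 * (M2 * d) / (e / p)).
  { apply cexp_near_one; auto.
    { apply (Rmult_le_compat_l M2) in Hd; [|lra]. replace (M2 * (1 / 4 / M2)) with (1 / 4) in Hd by (field; lra). exact Hd. }
    intros s Hs. pose proof (cdist_fun _ _ u v HU HC Hu Hv (Hsh s Hs)) as Ks. fold d in Ks. rewrite !tfun_shift in Ks.
    set (wu := cexp (Cmult (RtoC s) (snd u))) in *. set (wv := cexp (Cmult (RtoC s) (snd v))) in *.
    set (x := cexp (Cmult (RtoC s) (Cminus (snd u) (snd v)))).
    assert (Ex : wu = Cmult x wv).
    { unfold wu, x, wv. rewrite <- cexp_plus. f_equal. ring. }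
    assert (Bu : Cmod wu <= E).
    { unfold wu, E. rewrite Cmod_cexp. replace (fst (Cmult (RtoC s) (snd u))) with (s * fst (snd u)) by (simpl; ring).
      apply exp_mono. specialize (Htau s u Hs Hu). nra. }
    assert (Bv : / E <= Cmod wv).
    { unfold wv, E. rewrite <- exp_Ropp, Cmod_cexp. replace (fst (Cmult (RtoC s) (snd v))) with (s * fst (snd v)) by (simpl; ring).
      apply exp_mono.
      assert (- (p * K0) <= fst (snd v)).
      { pose proof (HPp (fst v)) as B. apply Rabs_le_between in B. pose proof (Dq v Hv). pose proof (Hpow v).
        unfold hnorm in Nv. unfold defect in Nv, H0. nra. }
      assert (s * - fst (snd v) <= s * (p * K0)) by (apply Rmult_le_compat_l; lra).
      assert (s * (p * K0) <= e / p * (p * K0)) by (apply Rmult_le_compat_r; [nra|lra]).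
      replace (e / p * (p * K0)) with (e * K0) in H2 by (field; lra). lra. }
    (* The same device with [exp (s z2)] in place of [z1]; here [x] is the ratio [wu / wv], which is
       to be shown close to [1] for every [s] in the range. *)
    assert (Q : Cmod (tfun F 1 v) * (Cmod (Cminus x (RtoC 1)) * Cmod wv) <= 4 * (E + 1) * d).
    { rewrite <- !Cmod_mult. replace (Cmult (tfun F 1 v) (Cmult (Cminus x (RtoC 1)) wv)) with
       (Cminus (Cmult (Cminus (tfun F 1 v) (tfun F 1 u)) wu) (Cminus (Cmult (tfun F 1 v) wv) (Cmult (tfun F 1 u) wu))) by (rewrite Ex; ring).
      eapply Rle_trans; [apply Cmod_sub_le|]. rewrite Cmod_mult.
      assert (Cmod (Cminus (tfun F 1 v) (tfun F 1 u)) * Cmod wu <= 4 * d * E) by (apply Rmult_le_compat; auto using Cmod_ge_0).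
      lra. }
    assert (Q2 : c2 * (Cmod (Cminus x (RtoC 1)) * / E) <= 4 * (E + 1) * d).
    { eapply Rle_trans; [|exact Q]. pose proof (Cmod_ge_0 (Cminus x (RtoC 1))). pose proof (Rinv_0_lt_compat E HE).
      apply Rmult_le_compat; auto; [lra|apply Rmult_le_pos; lra|]. apply Rmult_le_compat_l; auto. }
    apply (Rmult_le_compat_l (E / c2)) in Q2; [|left; apply Rdiv_lt_0_compat; auto].
    replace (E / c2 * (c2 * (Cmod (Cminus x (RtoC 1)) * / E))) with (Cmod (Cminus x (RtoC 1))) in Q2 by (field; lra).
    eapply Rle_trans; [exact Q2|]. right. unfold M2. field. lra. }
  unfold size2, diff2; simpl fst; simpl snd.
  replace ((M1 + 5 * M2 / (e / p)) * d) with (M1 * d + 5 * (M2 * d) / (e / p)) by (field; lra). lra.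
Qed.

(** * Completeness *)

Lemma homog_bound (Q : C -> R) (n : nat) : (0 < n)%nat -> sm (fun z => RtoC (Q z)) ->
  (forall r z, Q (Cmult (RtoC r) z) = r ^ n * Q z) -> exists p, 1 <= p /\ forall z, Rabs (Q z) <= p * Cmod z ^ n.
Proof.
  intros Hn HQ Hh. destruct (sm_bound _ HQ 1) as (L & HL & K). exists (1 + L). split; [lra|]. intros z.
  pose proof (Cmod_ge_0 z) as Hz. pose proof (pow_le (Cmod z) n Hz) as Hp.
  destruct (Req_dec (Cmod z) 0) as [E|E].
  - apply Cmod_eq_0 in E. subst z. assert (E0 : Q (RtoC 0) = 0).
    { replace (RtoC 0) with (Cmult (RtoC 0) (RtoC 0)) at 1 by ring. rewrite Hh, pow_i by auto. ring. }
    rewrite E0, Rabs_R0. apply Rmult_le_pos; lra.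
  - replace z with (Cmult (RtoC (Cmod z)) (Cmult (RtoC (/ Cmod z)) z)) at 1 by (rewrite Cmult_assoc, <- RtoC_mult, Rinv_r by auto; ring).
    rewrite Hh, Rabs_mult, (Rabs_pos_eq (Cmod z ^ n)), Rmult_comm by auto. apply Rmult_le_compat_r; auto.
    assert (0 < / Cmod z) by (apply Rinv_0_lt_compat; lra).
    specialize (K (Cmult (RtoC (/ Cmod z)) z)). rewrite Cmod_mult, !Cmod_RtoC, (Rabs_pos_eq (/ Cmod z)), Rinv_l in K by lra.
    specialize (K ltac:(lra)). lra.
Qed.

Lemma Cauchy_seq_C (u : nat -> C) :
  (forall eps, 0 < eps -> exists N, forall m n, (N <= m)%nat -> (N <= n)%nat -> Cmod (Cminus (u m) (u n)) < eps) ->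
  exists l, forall eps, 0 < eps -> exists N, forall m, (N <= m)%nat -> Cmod (Cminus (u m) l) < eps.
Proof.
  intros H.
  assert (K : forall c : C -> R, (forall z w, Rabs (c z - c w) <= Cmod (Cminus z w)) -> exists l, Un_cv (fun n => c (u n)) l).
  { intros c Hc. destruct (Rcomplete.R_complete (fun n => c (u n))) as (l & Hl); [|eauto].
    intros eps He. destruct (H eps He) as (N & HN). exists N. intros m n Hm Hn. unfold Rdist.
    eapply Rle_lt_trans; [apply Hc|auto]. }
  destruct (K fst) as (a & Ha); [intros z w; apply (abs_fst_le (Cminus z w))|].
  destruct (K snd) as (b & Hb); [intros z w; apply (abs_snd_le (Cminus z w))|].
  exists (a, b). intros eps He. destruct (Ha (eps / 2)) as (N1 & H1); [lra|]. destruct (Hb (eps / 2)) as (N2 & H2); [lra|].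
  exists (Nat.max N1 N2). intros m Hm. specialize (H1 m ltac:(lia)). specialize (H2 m ltac:(lia)). unfold Rdist in *.
  pose proof (Cmod_le_abs (Cminus (u m) (a, b))) as B. simpl in B. unfold Rminus in *. lra.
Qed.

Lemma complete_from_estimates (P : C -> C) (k : nat) : sm (fun z => RtoC (fst (P z))) ->
  (exists eta c, 0 < eta /\ 0 < c /\ forall u v, Omega P u -> Omega P v -> cdist (Omega P) u v <= eta -> c * defect P u <= defect P v) ->
  (exists eta K, 0 < eta /\ 0 < K /\ forall u v, Omega P u -> Omega P v -> cdist (Omega P) u v <= eta -> hnorm P k v <= K * hnorm P k u) ->
  (forall K0, exists eta M, 0 < eta /\ 0 < M /\ forall u v, Omega P u -> Omega P v -> hnorm P k u <= K0 -> hnorm P k v <= K0 ->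
    cdist (Omega P) u v <= eta -> size2 (diff2 u v) <= M * cdist (Omega P) u v) ->
  complete_metric_space (Omega P) (carath_dist (Omega P)).
Proof.
  intros HP (ed & cd & Hed & Hcd & HD) (eh & Kh & Heh & HKh & HH) HE.
  pose proof (Omega_open P HP) as HU. pose proof (Omega_chained P HP) as HC.
  split; [|split; [|split; [|split]]].
  - intros p q Hp Hq. now apply cdist_facts.
  - intros p q Hp Hq. split; [|intros ->; now apply cdist_refl]. intros E.
    assert (E' : cdist (Omega P) p q = 0) by (unfold cdist; now rewrite E).
    (* Definiteness needs no limit: two points always have a common bound on [hnorm], and at
       distance [0] the Euclidean estimate applies to them. *)
    destruct (HE (Rmax (hnorm P k p) (hnorm P k q))) as (eta & M & He & HM & K).
    specialize (K p q Hp Hq (Rmax_l _ _) (Rmax_r _ _) ltac:(lra)). rewrite E', Rmult_0_r in K.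
    unfold size2, diff2 in K. simpl in K.
    pose proof (Cmod_ge_0 (Cminus (fst p) (fst q))). pose proof (Cmod_ge_0 (Cminus (snd p) (snd q))).
    apply injective_projections; apply Ceq_minus, Cmod_eq_0; lra.
  - intros p q _ _. now apply carath_dist_sym.
  - intros p q r Hp Hq Hr. now apply cdist_triangle.
  - intros u Hu Hc. change (forall eps, 0 < eps -> exists N, forall m n, (N <= m)%nat -> (N <= n)%nat -> cdist (Omega P) (u m) (u n) < eps) in Hc.
    (* The estimates hold only for points at small distance. They suffice because every later term
       is compared directly with the one term [u N0], so the constants do not accumulate. *)
    destruct (Hc (Rmin ed eh)) as (N0 & HN0); [now apply Rmin_pos|].
    pose proof (Rmin_l ed eh). pose proof (Rmin_r ed eh).
    assert (Bd : forall m, (N0 <= m)%nat -> cd * defect P (u N0) <= defect P (u m)).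
    { intros m Hm. apply HD; auto. specialize (HN0 N0 m ltac:(lia) Hm). lra. }
    assert (Bh : forall m, (N0 <= m)%nat -> hnorm P k (u m) <= Kh * hnorm P k (u N0)).
    { intros m Hm. apply HH; auto. specialize (HN0 N0 m ltac:(lia) Hm). lra. }
    destruct (HE (Kh * hnorm P k (u N0))) as (eta & M & He & HM & KE).
    assert (EC : forall eps, 0 < eps -> exists N, forall m n, (N <= m)%nat -> (N <= n)%nat -> size2 (diff2 (u m) (u n)) < eps).
    { intros eps Heps. destruct (Hc (Rmin eta (eps / M))) as (N1 & HN1); [apply Rmin_pos; auto; now apply Rdiv_lt_0_compat|].
      pose proof (Rmin_l eta (eps / M)). pose proof (Rmin_r eta (eps / M)).
      exists (Nat.max N0 N1). intros m n Hm Hn. specialize (HN1 m n ltac:(lia) ltac:(lia)).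
      eapply Rle_lt_trans; [apply KE; auto; [apply Bh; lia|apply Bh; lia|lra]|].
      rewrite Rmult_comm. apply Rlt_div_r; auto. lra. }
    destruct (Cauchy_seq_C (fun m => fst (u m))) as (x1 & L1).
    { intros eps Heps. destruct (EC eps Heps) as (N & HN). exists N. intros m n Hm Hn. specialize (HN m n Hm Hn).
      unfold size2, diff2 in HN; simpl in HN. pose proof (Cmod_ge_0 (Cminus (snd (u m)) (snd (u n)))). lra. }
    destruct (Cauchy_seq_C (fun m => snd (u m))) as (x2 & L2).
    { intros eps Heps. destruct (EC eps Heps) as (N & HN). exists N. intros m n Hm Hn. specialize (HN m n Hm Hn).
      unfold size2, diff2 in HN; simpl in HN. pose proof (Cmod_ge_0 (Cminus (fst (u m)) (fst (u n)))). lra. }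
    set (x := (x1, x2) : C2).
    assert (Lx : forall r, 0 < r -> exists N, forall m, (N <= m)%nat -> polydisc x r (u m) /\ size2 (diff2 (u m) x) < r).
    { intros r Hr. destruct (L1 (r / 2)) as (N1 & K1); [lra|]. destruct (L2 (r / 2)) as (N2 & K2); [lra|].
      exists (Nat.max N1 N2). intros m Hm. specialize (K1 m ltac:(lia)). specialize (K2 m ltac:(lia)).
      unfold polydisc, size2, diff2; simpl. lra. }
    (* The lower bound on [defect] along the tail passes to the Euclidean limit by continuity; this
       is where escape to a finite boundary point is excluded. *)
    assert (Hx : Omega P x).
    { apply Omega_defect. set (d0 := cd * defect P (u N0)).
      assert (Hd0 : 0 < d0) by (apply Rmult_lt_0_compat; auto; apply Omega_defect, Hu).
      destruct (defect_cont P x d0 HP Hd0) as (r & Hr & K). destruct (Lx r Hr) as (N1 & K1).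
      destruct (K1 (Nat.max N0 N1) ltac:(lia)) as (K2 & _). specialize (K _ K2). apply Rabs_def2 in K.
      specialize (Bd (Nat.max N0 N1) ltac:(lia)). fold d0 in Bd. lra. }
    exists x. split; auto. intros eps Heps. destruct (cdist_local (Omega P) x HU HC Hx) as (r & B & Hr & HB & K).
    destruct (Lx (Rmin r (eps / B))) as (N1 & K1); [apply Rmin_pos; auto; now apply Rdiv_lt_0_compat|].
    pose proof (Rmin_l r (eps / B)). pose proof (Rmin_r r (eps / B)).
    exists N1. intros m Hm. destruct (K1 m Hm) as (P1 & P2). rewrite carath_dist_sym by auto. fold (cdist (Omega P) x (u m)).
    destruct (K (u m)) as (_ & K2); [eapply polydisc_mono; [|exact P1]; lra|].
    eapply Rle_lt_trans; [exact K2|]. rewrite Rmult_comm. apply Rlt_div_r; auto. lra.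
Qed.

Theorem theorem3p3 (c : nat -> nat -> C) (N k : nat) :
  (1 < k)%nat ->
  (* P_{2k} is real-valued *)
  (forall z : C, Im (polyzzb c N z) = 0) ->
  (* homogeneity of degree 2k under real dilations *)
  (forall (r : R) (z : C),
     polyzzb c N (Cmult (RtoC r) z) = Cmult (RtoC (r ^ (2 * k))) (polyzzb c N z)) ->
  (* d^2 P / dz dzbar > 0 away from 0 *)
  (forall z : C, z <> RtoC 0 ->
     Im (polyzzb_ddbar c N z) = 0 /\ 0 < Re (polyzzb_ddbar c N z)) ->
  complete_metric_space (Omega (polyzzb c N)) (carath_dist (Omega (polyzzb c N))).
Proof.
  intros Hk _ Hh HD.
  assert (HS : sm (fun z => RtoC (fst (polyzzb c N z)))).
  { destruct (T3_poly c N) as (fz & fb & fzz & fbb & (S & _) & _). now apply sm_re. }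
  destruct (good_pot_bump c N k Hk Hh HD) as (G0 & e & He & G1).
  destruct (homog_bound (fun z => fst (polyzzb c N z)) (2 * k)) as (p & Hp & Hb); auto; [lia| |].
  { intros r z. rewrite Hh. simpl. ring. }
  apply (complete_from_estimates _ k); auto.
  - now apply cdist_defect with k.
  - now apply cdist_hnorm with e.
  - intros K0. now apply cdist_euclid with e p.
Qed.
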